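(* Let $n\ge2$, $R>0$, and let $a=a_+-a_-\in L^1(0,R)$, where $a_+\in L^\infty(0,R)$, $a_-\ge0$, $a_-$ is bounded near $r=0$ and outside neighborhoods of finitely many points of $(0,R]$, and $a_-$ is integrable near each of these points (one-sidedly if the point is $R$). Let $\mathcal L$ be the self-adjoint operator in $L^2((0,R),r^{n-1}\,dr)$ associated with the closed, lower-bounded form $$\phi\mapsto\int_0^R\bigl(|\phi'|^2-a\phi^2\bigr)r^{n-1}\,dr,\qquad \phi\in H^1_{0,{\rm rad}}(B_R),$$ with differential expression $$\tau y:=-y''-\frac{n-1}{r}y'-a(r)y,\qquad y'(0)=0,\qquad y(R)=0 .$$ Let $y_0$ be the unique regular integral solution of $\tau y_0=0$, $y_0(0)=1$, $y_0'(0)=0$. Assume that $y_0(R)\ne0$ and that $y_0$ has exactly $N$ zeros in $(0,R)$. Then $\mathcal L$ has exactly $N$ negative eigenvalues, counted with multiplicity, and $\ker\mathcal L=\{0\}$.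
   Context: $B_R\subset\mathbb R^n$ is the open ball of radius $R$ centered at $0$; $H^1_{0,{\rm rad}}(B_R)$ is the space of radial functions in $H^1_0(B_R)$, viewed as functions of $r\in(0,R)$. Under the stated hypotheses on $a$ the form is densely defined, closed and bounded below with compact resolvent. A regular integral solution of $\tau y=0$ is $y\in C^1([0,R])$ with $r^{n-1}y'$ absolutely continuous on $[0,R]$, $y'(0)=0$, and $(r^{n-1}y')'+r^{n-1}a(r)y=0$ for a.e. $r\in(0,R)$. *)

(* Defs.v *)
From HB Require Import structures.
From mathcomp Require Import all_boot all_order all_algebra.
From mathcomp Require Import all_classical all_reals all_analysis.

Set Implicit Arguments.
Unset Strict Implicit.
Unset Printing Implicit Defensive.
Import Order.TTheory GRing.Theory Num.Theory.
Import numFieldNormedType.Exports.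

Local Open Scope classical_set_scope.
Local Open Scope ring_scope.

(* The sigma-algebra on row vectors generated by the coordinates; over the   *)
(* Borel sigma-algebra of R it is the Borel sigma-algebra of R^n.             *)
Section measurable_row.
Context {d} {T : measurableType d} (n : nat).

Let coors : 'I_n -> 'rV[T]_n -> T := fun i x => x ord0 i.

Let row_set0 : g_sigma_preimage coors set0.
Proof. exact: sigma_algebra0. Qed.

Let row_setC A : g_sigma_preimage coors A -> g_sigma_preimage coors (~` A).
Proof. exact: sigma_algebraC. Qed.

Let row_bigcup (F : _^nat) : (forall i, g_sigma_preimage coors (F i)) ->
  g_sigma_preimage coors (\bigcup_i (F i)).
Proof. exact: sigma_algebra_bigcup. Qed.

HB.instance Definition _ := @isMeasurable.Build (measure_tuple_display d)
  'rV[T]_n (g_sigma_preimage coors) row_set0 row_setC row_bigcup.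

Lemma measurable_row_coor (i : 'I_n) :
  measurable_fun [set: 'rV[T]_n] (fun x => x ord0 i).
Proof.
move=> _ Y mY; rewrite setTI; apply: sub_sigma_algebra => /=.
rewrite -bigcup_seq/=; exists i => /=; first by rewrite mem_index_enum.
by exists Y => //; rewrite setTI.
Qed.

Lemma measurable_fun_row d1 (T1 : measurableType d1) (f : T1 -> 'rV[T]_n) :
  (forall i, measurable_fun setT (fun x => f x ord0 i)) -> measurable_fun setT f.
Proof.
move=> mf _ A mA; rewrite setTI.
suff : preimage_set_system setT f (g_sigma_preimage coors) `<=` measurable.
  by move=> H; apply: H; exists A => //; rewrite setTI.
rewrite -[X in X `<=` _]g_sigma_preimageE.
apply: smallest_sub; first exact: sigma_algebra_measurable.
move=> _ [B + <-]; rewrite setTI -bigcup_seq => -[i _ [C mC <-]].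
by rewrite setTI -comp_preimage -[X in measurable X]setTI; exact: mf.
Qed.

End measurable_row.

(* Restated because the canonical sigma-finite structure of a product measure *)
(* is shadowed in the library by the one for subprobabilities.                *)
Lemma sigma_finite_product d1 d2 (T1 : measurableType d1)
    (T2 : measurableType d2) (R : realType)
    (m1 : {sigma_finite_measure set T1 -> \bar R})
    (m2 : {sigma_finite_measure set T2 -> \bar R}) :
  sigma_finite setT (m1 \x m2)%E.
Proof.
have /sigma_finiteP[F [TF ndF Foo]] := sigma_finiteT m1.
have /sigma_finiteP[G [TG ndG Goo]] := sigma_finiteT m2.
exists (fun n => F n `*` G n).
  rewrite -setXTT TF TG predeqE => -[x y]; split.
    move=> [/= [n _ Fnx] [k _ Gky]]; exists (maxn n k) => //; split.
    - by move: x Fnx; exact/subsetPset/ndF/leq_maxl.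
    - by move: y Gky; exact/subsetPset/ndG/leq_maxr.
  by move=> [n _ []/= ? ?]; split; exists n.
move=> k; have [? ?] := Foo k; have [? ?] := Goo k.
split; first exact: measurableX.
by rewrite product_measure1E// lte_mul_pinfty// ge0_fin_numE.
Qed.

Section lebesgue_Rn.
Context {R : realType}.
Local Notation mu := (@lebesgue_measure R).

Definition row_cons n (p : R * 'rV[R]_n) : 'rV[R]_n.+1 :=
  \row_i oapp (p.2 ord0) p.1 (unlift ord0 i).

Lemma measurable_row_cons n : measurable_fun setT (@row_cons n).
Proof.
apply: measurable_fun_row => i; rewrite /row_cons.
case: (unliftP ord0 i) => [j ->|->].
  under eq_fun do rewrite mxE liftK /=.
  exact: (measurableT_comp (measurable_row_coor j)).
under eq_fun do rewrite mxE unlift_none /=.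
exact: measurable_fst.
Qed.

Section step.
Variables (n : nat) (nu : {sigma_finite_measure set 'rV[R]_n -> \bar R}).

Definition lebesgue_step : set 'rV[R]_n.+1 -> \bar R :=
  pushforward (mu \x nu)%E (@row_cons n).

Let lebesgue_step0 : lebesgue_step set0 = 0%E.
Proof. by rewrite /lebesgue_step /pushforward preimage_set0 measure0. Qed.

Let lebesgue_step_ge0 A : (0 <= lebesgue_step A)%E.
Proof.
rewrite /lebesgue_step /pushforward.
apply: measure_ge0; rewrite -[X in measurable X]setTI; exact: measurable_row_cons.
Qed.

Let lebesgue_step_sigma_additive : semi_sigma_additive lebesgue_step.
Proof.
move=> F mF tF mUF; rewrite /lebesgue_step /pushforward preimage_bigcup.
have mp B : measurable B -> measurable (@row_cons n @^-1` B).
  by move=> mB; rewrite -[X in measurable X]setTI; exact: measurable_row_cons.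
apply: measure_semi_sigma_additive.
- by move=> k; exact: mp.
- apply/trivIsetP => /= i j _ _ ij; rewrite -preimage_setI.
  by move/trivIsetP : tF => /(_ _ _ _ _ ij) ->//; rewrite preimage_set0.
- by rewrite -preimage_bigcup; exact: mp.
Qed.

HB.instance Definition _ := isMeasure.Build _ _ _ lebesgue_step
  lebesgue_step0 lebesgue_step_ge0 lebesgue_step_sigma_additive.

Let lebesgue_step_sigma_finite : sigma_finite setT lebesgue_step.
Proof.
have [F FT Foo] := sigma_finite_product mu nu.
pose g (v : 'rV[R]_n.+1) : R * 'rV[R]_n :=
  (v ord0 ord0, \row_j v ord0 (lift ord0 j)).
have gK (p : R * 'rV[R]_n) : g (row_cons p) = p.
  case: p => x w; congr pair; rewrite /= ?mxE ?unlift_none//.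
  by apply/rowP => j; rewrite !mxE liftK.
have mg : measurable_fun setT g.
  apply/measurable_fun_pairP; split; first exact: (measurable_row_coor ord0).
  apply: measurable_fun_row => j; under eq_fun do rewrite /= mxE.
  exact: measurable_row_coor.
exists (fun i => g @^-1` F i).
  by rewrite -preimage_bigcup -FT preimage_setT.
move=> i; have [mFi Fioo] := Foo i; split.
  by rewrite -[X in measurable X]setTI; exact: mg.
rewrite /lebesgue_step /pushforward -comp_preimage.
by rewrite (_ : _ \o _ = id)//; apply/funext => p /=; exact: gK.
Qed.

HB.instance Definition _ := Measure_isSigmaFinite.Build _ _ _ lebesgue_step
  lebesgue_step_sigma_finite.

End step.

Definition lebesgue_row0 : set 'rV[R]_0 -> \bar R := dirac (0 : 'rV[R]_0).
HB.instance Definition _ := Measure.on lebesgue_row0.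
Let lebesgue_row0_sigma_finite : sigma_finite setT lebesgue_row0.
Proof.
exists (fun=> setT); first by rewrite bigcup_const.
by move=> _; split => //; rewrite /lebesgue_row0 diracT ltry.
Qed.
HB.instance Definition _ := Measure_isSigmaFinite.Build _ _ _ lebesgue_row0
  lebesgue_row0_sigma_finite.

(* n-dimensional Lebesgue measure, as the n-fold product measure. *)
Fixpoint lebesgue_row n : {sigma_finite_measure set 'rV[R]_n -> \bar R} :=
  match n with
  | 0 => lebesgue_row0
  | m.+1 => lebesgue_step (lebesgue_row m)
  end.

End lebesgue_Rn.

Section sobolev_Rn.
Context {R : realType}.

(* All iterated directional derivatives of order at most k exist everywhere   *)
(* and are continuous; for V finite-dimensional this is the usual C^k.        *)
Fixpoint Ck (k : nat) (V : normedModType R) (f : V -> R^o) : Prop :=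
  continuous f /\
  match k with
  | 0 => True
  | m.+1 => forall v, (forall x, derivable f x v) /\ Ck m ('D_v f)
  end.

Definition test_function (V : normedModType R) (Om : set V) (phi : V -> R^o) :=
  [/\ forall k, Ck k phi,
      compact (closure [set x | phi x != 0]) &
      closure [set x | phi x != 0] `<=` Om].

Variable n : nat.
Local Notation leb := (lebesgue_row n).
Implicit Types (Om : set 'rV[R]_n) (u phi : 'rV[R]_n -> R)
  (G : 'I_n -> 'rV[R]_n -> R).

Definition partial (i : 'I_n) (phi : 'rV[R]_n -> R^o) : 'rV[R]_n -> R :=
  'D_(delta_mx ord0 i) phi.

Definition L2 Om u :=
  measurable_fun Om u /\ leb.-integrable Om (fun x => (u x ^+ 2)%:E).

Definition weak_gradient Om u G :=
  forall phi, test_function Om phi -> forall i,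
    \int[leb]_(x in Om) (u x * partial i phi x) =
    - \int[leb]_(x in Om) (G i x * phi x).

Definition H1 Om u G :=
  [/\ L2 Om u, forall i, L2 Om (G i) & weak_gradient Om u G].

(* H^1_0(Om): the closure of the test functions in H^1(Om). *)
Definition H1_0 Om u :=
  exists2 G, H1 Om u G &
    forall e : R, 0 < e -> exists2 phi, test_function Om phi &
      (\int[leb]_(x in Om) ((u x - phi x) ^+ 2 +
         \sum_(i < n) (G i x - partial i phi x) ^+ 2)%:E < e%:E)%E.

Definition enorm (x : 'rV[R]_n) : R := Num.sqrt (\sum_(i < n) x ord0 i ^+ 2).

Definition eball (rho : R) : set 'rV[R]_n := [set x | enorm x < rho].

(* Profiles f : (0, rho) -> R of the radial elements of H^1_0(B_rho); f is a  *)
(* function on R of which only the values on (0, rho) matter, up to a null    *)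
(* set.                                                                       *)
Definition H1_0rad (rho : R) (f : R -> R) :=
  H1_0 (eball rho) (fun x => f (enorm x)).

End sobolev_Rn.

Section radial_operator.
Context {R : realType}.
Local Notation mu := (@lebesgue_measure R).
Variables (n : nat) (rho : R).
Local Notation I := (`]0, rho[%classic : set R).
Implicit Types (f g u v y a : R -> R).

(* L^2((0, rho), r^(n-1) dr). *)
Definition L2rad f :=
  measurable_fun I f /\
  mu.-integrable I (fun r => (f r ^+ 2 * r ^+ n.-1)%:E).

Definition is_weak_deriv f g :=
  locally_integrable I g /\
  forall psi : R -> R, test_function (I : set R^o) psi ->
    \int[mu]_(r in I) (f r * derive1 psi r) = - \int[mu]_(r in I) (g r * psi r).

(* The weak derivative on (0, rho), unique up to a null set (and 0 if there   *)
(* is none).                                                                  *)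
Definition weak_deriv f : R -> R := xget (cst 0) [set g | is_weak_deriv f g].

(* The symmetric bilinear form whose diagonal is the quadratic form. *)
Definition form a u v : R :=
  \int[mu]_(r in I)
    ((weak_deriv u r * weak_deriv v r - a r * u r * v r) * r ^+ n.-1).

(* Graph of the operator L associated with the form (first representation     *)
(* theorem): u is in the domain of L and L u = f.                             *)
Definition form_operator a u f :=
  [/\ H1_0rad n rho u, L2rad f &
      forall v, H1_0rad n rho v ->
        form a u v = \int[mu]_(r in I) (f r * v r * r ^+ n.-1)].

Definition trivial_kernel a :=
  forall u, form_operator a u (cst 0) -> ae_eq mu I u (cst 0).

Definition eigenspace a (lam : R) : set (R -> R) :=
  [set u | form_operator a u (fun r => lam * u r)].

Definition is_eigenvalue a (lam : R) :=
  exists2 u, eigenspace a lam u & ~ ae_eq mu I u (cst 0).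

(* The eigenspace has dimension k, as a space of classes modulo a.e. equality. *)
Definition eigen_multiplicity a (lam : R) (k : nat) :=
  exists e : 'I_k -> R -> R,
    [/\ forall i, eigenspace a lam (e i),
        forall c : 'I_k -> R,
          ae_eq mu I (fun r => \sum_(i < k) c i * e i r) (cst 0) ->
          forall i, c i = 0 &
        forall u, eigenspace a lam u ->
          exists c : 'I_k -> R, ae_eq mu I u (fun r => \sum_(i < k) c i * e i r)].

(* There are exactly N negative eigenvalues, counted with multiplicity. *)
Definition negative_eigenvalue_count a (N : nat) :=
  exists (s : seq R) (m : R -> nat),
    [/\ uniq s,
        forall lam, lam \in s <-> lam < 0 /\ is_eigenvalue a lam,
        forall lam, lam \in s -> eigen_multiplicity a lam (m lam) &
        (\sum_(lam <- s) m lam)%N = N].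

(* a = ap - am, where ps lists the points of (0, rho] near which am may be    *)
(* unbounded; intersecting with I makes neighborhoods of rho one-sided.       *)
Definition admissible_potential a ap am (ps : seq R) :=
  [/\ mu.-integrable I (EFin \o a),
      {ae mu, forall r, I r -> a r = ap r - am r},
      measurable_fun I ap /\ exists M : R, {ae mu, forall r, I r -> `|ap r| <= M},
      measurable_fun I am /\ {ae mu, forall r, I r -> 0 <= am r} &
      [/\ forall p, p \in ps -> 0 < p <= rho,
          exists d M : R,
            0 < d /\ {ae mu, forall r, I r -> r < d -> am r <= M},
          forall d : R, 0 < d -> exists M : R,
            {ae mu, forall r, I r ->
               (forall p, p \in ps -> d <= `|r - p|) -> am r <= M} &
          forall p, p \in ps -> exists2 d : R, 0 < d &
            mu.-integrable (I `&` ball p d) (EFin \o am)]].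

Definition abs_continuous (b c : R) f :=
  forall e : R, 0 < e -> exists2 d : R, 0 < d &
    forall J : seq (R * R),
      all (fun p : R * R => [&& b <= p.1, p.1 <= p.2 & p.2 <= c]) J ->
      pairwise (fun p q : R * R => p.2 <= q.1) J ->
      \sum_(p <- J) (p.2 - p.1) < d ->
      \sum_(p <- J) `|f p.2 - f p.1| < e.

(* g is the derivative of f on [0, rho], one-sided at the end points, and is  *)
(* continuous there.                                                          *)
Definition C1_with_deriv f g :=
  {within `[0, rho], continuous g} /\
  forall r, r \in `[0, rho] ->
    (f x - f r) / (x - r) @[x --> within `[0, rho] r^'] --> g r.

Definition regular_solution a y :=
  exists y' : R -> R,
    [/\ C1_with_deriv y y', y' 0 = 0,
        abs_continuous 0 rho (fun r => r ^+ n.-1 * y' r) &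
        {ae mu, forall r, I r ->
           is_derive r (1 : R) (fun s => s ^+ n.-1 * y' s)
             (- (r ^+ n.-1 * a r * y r))}].

End radial_operator.

(* Main.v *)
(* Let y_lam be the regular solution of tau y = lam y normalised by           *)
(* y_lam(0) = 1. A weak eigenfunction u has the form u(r) = - int_r^R g with  *)
(* r^(n-1) g integrable, and testing the form against radial functions gives  *)
(* r^(n-1) g = - int_0^r t^(n-1) (a + lam) u. The Wronskian of u and y_lam is *)
(* then constant, and it is 0 because both fluxes vanish at the origin, so u  *)
(* is a multiple of y_lam. Conversely y_lam is in the form domain as soon as  *)
(* y_lam(R) = 0. Hence the eigenvalues are simple, and they are the zeros of  *)
(* lam |-> y_lam(R).                                                          *)
(*                                                                            *)
(* The zeros of y_lam in (0, R) are simple, depend continuously on lam, are   *)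
(* more and more numerous as lam grows (Sturm), and disappear for lam <= - M  *)
(* if a <= M. For k < N, the supremum of the lam <= 0 for which y_lam has at  *)
(* most k zeros in (0, R) is therefore a zero of lam |-> y_lam(R), and every  *)
(* negative zero arises in this way for exactly one k.                        *)

Require Import Defs.
From HB Require Import structures.
From mathcomp Require Import all_boot all_order all_algebra.
From mathcomp Require Import all_classical all_reals all_analysis.
From mathcomp Require Import measurable_realfun.
From mathcomp Require Import ring lra.

Set Implicit Arguments.
Unset Strict Implicit.
Unset Printing Implicit Defensive.
Import Order.TTheory GRing.Theory Num.Theory.
Import numFieldNormedType.Exports.

Local Open Scope classical_set_scope.
Local Open Scope ring_scope.

(** * Derivatives and interval integrals *)

(** Write d = n - 1 and let q be a + lam cut off to ]0, rho[ ([pot]). As a is merely integrable, the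
    equation is used in integrated form: y_lam is the solution of y + [volt] d q y = 1, where - r^d
    y' is the primitive of r^d q y ([regsol]). Existence, uniqueness and Lipschitz dependence on lam
    come from a contraction in an exponentially weighted sup norm. The given y0 is y_0 on [0, rho]
    ([regular_solution_regsol]): a covering argument integrates the almost everywhere equation of
    its absolutely continuous flux.

    The operator meets the equation in two ways. A radial element u of H^1_0 is almost everywhere -
    int_r^rho g with r^d g integrable ([H1_0rad_primitive]): approximation by test functions allows
    integration by parts against the fields k(|x|^2) x without boundary term, and Fubini brings the
    result to one dimension. If u is an eigenfunction, testing the form with radial bumps gives r^d
    g = - flux ([weak_form_flux]), and the Wronskian of u and y_lam, constant and null at the
    origin, makes u a multiple of y_lam ([weak_solution_multiple]). Conversely, when y_lam(rho) = 0,
    y_lam lies in the form domain ([C1_H1_0rad]) and satisfies the weak equation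
    ([eigenspace_regsol]). So the eigenspace at lam is the line of y_lam if y_lam(rho) = 0 and is
    trivial otherwise; at lam = 0 this is the statement on the kernel.

    It remains to count the lam < 0 with y_lam(rho) = 0 ([eigenvalue_count]). The inputs are simple
    zeros ([regsol_simple]), Lipschitz dependence in C^1 ([regsol_locally_lipschitz]), interlacing
    ([sturm_comparison]), and positivity of y_lam at lam = - M, where M bounds the positive part of
    a ([regsol_pos]). For k < N let m be the supremum of the lam <= 0 for which y_lam has at most k
    zeros in ]0, rho[. Having k + 1 interior zeros is an open condition on lam, so it fails at m;
    but zeros taken at larger lam converge to k + 1 zeros of y_m in ]0, rho], distinct by
    simplicity. Hence one of them is rho. Conversely, at a negative root with exactly j interior
    zeros, Sturm gives j + 1 interior zeros for every larger lam; so j < N, and no two roots share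
    the same j. *)

Section derivative_rules.
Context {R : realType}.
Implicit Types (f g : R -> R) (x : R).

Lemma is_derive_exprn n x :
  is_derive x (1 : R) (fun r : R => r ^+ n) (n%:R * x ^+ n.-1).
Proof.
have := @is_deriveX R R^o id n x 1 1 (is_derive_id x (1 : R)).
rewrite /GRing.scale/= mulr1; suff -> : (id : R -> R) ^+ n = (fun r => r ^+ n) by [].
by apply/funext => r; elim: n => [|n IH]; rewrite ?expr0// !exprS -IH.
Qed.

Lemma is_derive_cmul k f x df : is_derive x (1 : R) f df ->
  is_derive x (1 : R) (fun r => k * f r) (k * df).
Proof. by move=> fd; have := @is_deriveZ _ _ _ f k x 1 df fd. Qed.

Lemma is_deriveD_fun f g x df dg : is_derive x (1 : R) f df ->
  is_derive x (1 : R) g dg -> is_derive x (1 : R) (fun r => f r + g r) (df + dg).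
Proof. by move=> fd gd; exact: is_deriveD. Qed.

Lemma is_deriveB_fun f g x df dg : is_derive x (1 : R) f df ->
  is_derive x (1 : R) g dg -> is_derive x (1 : R) (fun r => f r - g r) (df - dg).
Proof. by move=> fd gd; exact: is_deriveB. Qed.

Lemma is_deriveN_fun f x df : is_derive x (1 : R) f df ->
  is_derive x (1 : R) (fun r => - f r) (- df).
Proof. by move=> fd; exact: is_deriveN. Qed.

Lemma is_deriveM_fun f g x df dg : is_derive x (1 : R) f df ->
  is_derive x (1 : R) g dg ->
  is_derive x (1 : R) (fun r => f r * g r) (df * g x + f x * dg).
Proof.
move=> fd gd; have := @is_deriveM _ _ f g x 1 df dg fd gd.
by rewrite /GRing.scale/= addrC (mulrC (g x)).
Qed.

Lemma is_derive_comp f g x df dg : is_derive x (1 : R) g dg ->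
  is_derive (g x) (1 : R) f df -> is_derive x (1 : R) (fun r => f (g r)) (df * dg).
Proof. by move=> gd fd; exact: is_derive1_comp. Qed.

Lemma is_derive_continuous f x df : is_derive x (1 : R) f df ->
  {for x, continuous f}.
Proof. by case=> fd _; apply: differentiable_continuous; apply/derivable1_diffP. Qed.

End derivative_rules.

Section real_integrable.
Context d (T : measurableType d) (R : realType).
Variables (mu : {measure set T -> \bar R}) (D : set T).
Hypothesis mD : measurable D.
Implicit Types f g h : T -> R.

Lemma integrable_measurableR f :
  mu.-integrable D (EFin \o f) -> measurable_fun D f.
Proof. by move=> /measurable_int /measurable_EFinP. Qed.

Lemma le_integrableR f g : measurable_fun D g ->
  (forall x, D x -> `|g x| <= `|f x|) -> mu.-integrable D (EFin \o f) ->
  mu.-integrable D (EFin \o g).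
Proof.
move=> mg gf; apply: le_integrable => //; first exact/measurable_EFinP.

Qed.

Lemma integrableD_real f g : mu.-integrable D (EFin \o f) ->
  mu.-integrable D (EFin \o g) ->
  mu.-integrable D (EFin \o (fun x => f x + g x)).
Proof. by move=> fi gi; exact: (integrableD mD fi gi). Qed.

Lemma integrableB_real f g : mu.-integrable D (EFin \o f) ->
  mu.-integrable D (EFin \o g) ->
  mu.-integrable D (EFin \o (fun x => f x - g x)).
Proof. by move=> fi gi; exact: (integrableB mD fi gi). Qed.

Lemma integrableZ_real k f : mu.-integrable D (EFin \o f) ->
  mu.-integrable D (EFin \o (fun x => k * f x)).
Proof. by move=> fi; exact: (integrableZl mD k fi). Qed.

Lemma integrableN_real f : mu.-integrable D (EFin \o f) ->
  mu.-integrable D (EFin \o (fun x => - f x)).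
Proof. by move=> fi; rewrite (_ : _ \o _ = -%E \o (EFin \o f))//; exact: integrableN. Qed.

Lemma integrableM_bounded C f h : measurable_fun D h ->
  (forall x, D x -> `|h x| <= C) -> mu.-integrable D (EFin \o f) ->
  mu.-integrable D (EFin \o (fun x => h x * f x)).
Proof.
move=> mh hC fi; apply: (@le_integrableR (fun x => C * f x)); last 1 first.
- exact: integrableZ_real.
- by apply: measurable_funM => //; exact: integrable_measurableR.
- move=> x Dx; rewrite !normrM ler_wpM2r//.
  by rewrite (le_trans (hC x Dx))// ler_norm.
Qed.

Lemma RintegralN f : mu.-integrable D (EFin \o f) ->
  \int[mu]_(x in D) (- f x) = - \int[mu]_(x in D) f x.
Proof.
move=> fi; rewrite -mulN1r -RintegralZl//.
by apply: eq_Rintegral => x _; rewrite mulN1r.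
Qed.

Lemma eq_ae_Rintegral f g : measurable_fun D f -> measurable_fun D g ->
  {ae mu, forall x, D x -> f x = g x} ->
  \int[mu]_(x in D) f x = \int[mu]_(x in D) g x.
Proof.
move=> mf mg fg; rewrite /Rintegral; congr fine; apply: ae_eq_integral => //.
- exact/measurable_EFinP.
- exact/measurable_EFinP.
- by apply: filterS fg => x /[apply] ->.
Qed.

End real_integrable.

Section interval_integral.
Context {R : realType}.
Local Notation mu := (@lebesgue_measure R).
Implicit Types (f g : R -> R) (a b c : R).

(** Unsigned: the value is 0 when b < a. The primitive from 0 of a function that vanishes on the
    negative axis is then the right function on the whole line. *)
Definition itg f a b : R := \int[mu]_(x in `[a, b]) f x.

Definition int_itv f a b := mu.-integrable `[a, b] (EFin \o f).

Lemma int_itvS f a b a' b' : a <= a' -> b' <= b ->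
  int_itv f a b -> int_itv f a' b'.
Proof.
move=> aa bb; apply: integrableS => //.
by apply: subset_itv; rewrite bnd_simp.
Qed.

Lemma int_itvT f a b : mu.-integrable setT (EFin \o f) -> int_itv f a b.
Proof. exact: integrableS. Qed.

Lemma itg_split f a b c : a <= b -> b <= c -> int_itv f a c ->
  itg f a c = itg f a b + itg f b c.
Proof.
move=> ab bc fi; apply/eqP; rewrite addrC -subr_eq; apply/eqP.
rewrite /itg Rintegral_itvB//; apply: Rintegral_itv_obnd_cbnd.
apply: integrableS fi => //.
by apply: subset_itv; rewrite bnd_simp.
Qed.

Lemma itg_lt f a b : b < a -> itg f a b = 0.
Proof. by move=> ba; rewrite /itg set_itv_ge ?bnd_simp -?ltNge// Rintegral_set0. Qed.

Lemma itg_pt f a b : b <= a -> itg f a b = 0.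
Proof.
rewrite le_eqVlt => /predU1P[->|]; last exact: itg_lt.
by rewrite /itg set_itv1 Rintegral_set1.
Qed.

Lemma itg_ge0 f a b : (forall x, a <= x <= b -> 0 <= f x) -> 0 <= itg f a b.
Proof. by move=> f0; apply: Rintegral_ge0 => x /=; rewrite in_itv/=; exact: f0. Qed.

Lemma le_itg f g a b : int_itv f a b -> int_itv g a b ->
  (forall x, a <= x <= b -> f x <= g x) -> itg f a b <= itg g a b.
Proof.
by move=> fi gi fg; apply: le_Rintegral.
Qed.

Lemma eq_itg f g a b : (forall x, a <= x <= b -> f x = g x) ->
  itg f a b = itg g a b.
Proof.
by move=> fg; apply: eq_Rintegral => x; rewrite inE/= in_itv/=; exact: fg.
Qed.

Lemma norm_itg f a b : int_itv f a b ->
  `|itg f a b| <= itg (fun x => `|f x|) a b.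
Proof. by move=> fi; apply: le_normr_Rintegral. Qed.

Lemma itgD f g a b : int_itv f a b -> int_itv g a b ->
  itg (fun x => f x + g x) a b = itg f a b + itg g a b.
Proof. by move=> fi gi; apply: RintegralD. Qed.

Lemma itgB f g a b : int_itv f a b -> int_itv g a b ->
  itg (fun x => f x - g x) a b = itg f a b - itg g a b.
Proof. by move=> fi gi; apply: RintegralB. Qed.

Lemma itgZ k f a b : int_itv f a b ->
  itg (fun x => k * f x) a b = k * itg f a b.
Proof. by move=> fi; apply: RintegralZl. Qed.

Lemma itgN f a b : int_itv f a b ->
  itg (fun x => - f x) a b = - itg f a b.
Proof. by move=> fi; apply: RintegralN. Qed.

Lemma itg_cst k a b : a <= b -> itg (fun=> k) a b = k * (b - a).
Proof.
move=> ab; rewrite /itg Rintegral_cst//=.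
by rewrite lebesgue_measure_itv/= lte_fin; case: ltgtP ab => //= -> _; rewrite subrr.
Qed.

Lemma int_itv_norm f a b : int_itv f a b -> int_itv (fun x => `|f x|) a b.
Proof. exact: integrable_norm. Qed.

Lemma int_itv_continuous f a b : (forall x, a <= x <= b -> {for x, continuous f}) ->
  int_itv f a b.
Proof.
move=> cf; apply: continuous_compact_integrable; first exact: segment_compact.
apply: continuous_in_subspaceT => x; rewrite inE/= in_itv/=; exact: cf.
Qed.

Lemma int_itv_cst k a b : int_itv (fun=> k) a b.
Proof. by apply: int_itv_continuous => x _; exact: cst_continuous. Qed.

Lemma le_itg_sub f a b a' b' : a <= a' -> b' <= b ->
  int_itv f a b -> (forall x, a <= x <= b -> 0 <= f x) ->
  itg f a' b' <= itg f a b.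
Proof.
move=> aa bb fi f0; have [ab|ba] := leP a' b'; last first.
  by rewrite itg_lt// itg_ge0.
rewrite (@itg_split f a a' b)//; last exact: le_trans bb.
rewrite (@itg_split f a' b' b)//; last exact: int_itvS fi.
rewrite [leRHS]addrCA lerDl addr_ge0// itg_ge0// => x /andP[x1 x2]; apply: f0.
  by rewrite x1 (le_trans x2)// (le_trans ab).
by rewrite x2 (le_trans _ x1)// (le_trans aa).
Qed.

Lemma itg_derive F f a b : a <= b ->
  (forall x, a <= x <= b -> {for x, continuous f}) ->
  (forall x, a <= x <= b -> is_derive x (1 : R) F (f x)) ->
  itg f a b = F b - F a.
Proof.
rewrite le_eqVlt => /predU1P[<-|ab] cf dF; first by rewrite itg_pt// subrr.
rewrite /itg /Rintegral (@continuous_FTC2 _ f F)//.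
- apply: continuous_in_subspaceT => x; rewrite inE/= in_itv/=; exact: cf.
- have cF x : a <= x <= b -> {for x, continuous F}.
    by move=> /dF [dFx _]; apply: differentiable_continuous; apply/derivable1_diffP.
  split.
  + move=> x; rewrite in_itv/= => /andP[ax xb].
    by have [] := dF x; rewrite ?(ltW ax) ?(ltW xb).
  + by apply: cvg_at_right_filter; apply: cF; rewrite lexx ltW.
  + by apply: cvg_at_left_filter; apply: cF; rewrite lexx ltW.
- move=> x; rewrite in_itv/= => /andP[ax xb]; rewrite derive1E.
  by have /dF[_ ->] : a <= x <= b by rewrite (ltW ax) ltW.
Qed.


Lemma itg_continuous_at f a x : (forall b, int_itv f a b) -> a < x ->
  {for x, continuous (itg f a)}.
Proof.
move=> fi ax; have a1 : a < x + 1 by rewrite (lt_trans ax)// ltrDl.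
have := parameterized_integral_continuous (ltW a1) (fi (x + 1)).
move=> /(continuous_within_itvP _ a1)[cF _ _]; apply: cF.
by rewrite in_itv/= ax ltrDl/=.
Qed.

Lemma itg_oo f a b : measurable_fun `]a, b[ f ->
  \int[mu]_(x in `]a, b[) f x = itg f a b.
Proof.
move=> mf; rewrite /itg /Rintegral; congr fine.
by rewrite [RHS]integral_itv_bndoo//; exact/measurable_EFinP.
Qed.

Lemma int_itv_oo f a b : mu.-integrable `]a, b[ (EFin \o f) <-> int_itv f a b.
Proof.
split=> [fi|]; last by apply: integrableS => //; exact: subset_itv_oo_cc.
have mf := integrable_measurableR fi.
apply/integrableP; split.
  by apply/measurable_EFinP; exact: (@measurable_fun_itv_cc _ a b false true).
rewrite integral_itv_bndoo//; first by move/integrableP : fi => [].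
by apply: measurableT_comp => //; exact/measurable_EFinP.
Qed.

Lemma integrable_patch_oo f a b : int_itv f a b ->
  mu.-integrable setT (EFin \o (f \_ `]a, b[)).
Proof.
by move=> /int_itv_oo fi; rewrite -restrict_EFin; apply/(integrable_mkcond _ _).1.
Qed.

Lemma integral_patch_oo f a b : int_itv f a b ->
  (\int[mu]_x ((f \_ `]a, b[) x)%:E)%E = (itg f a b)%:E.
Proof.
move=> fi; have /int_itv_oo fi' := fi.
rewrite -itg_oo; last exact: integrable_measurableR fi'.
rewrite /Rintegral fineK; last exact: (integrable_fin_num _ fi').
rewrite [RHS]integral_mkcond; apply: eq_integral => x _.
by rewrite /= !patchE; case: ifP.
Qed.

Lemma itg_0l f a b : a <= 0 -> 0 <= b -> (forall b, int_itv f a b) ->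
  (forall x, x <= 0 -> f x = 0) -> itg f a b = itg f 0 b.
Proof.
move=> a0 b0 fi f0; rewrite (@itg_split f a 0)//.
rewrite (@eq_itg _ (fun=> 0) a 0) ?itg_cst// ?mul0r ?add0r//.
by move=> x /andP[_ ?]; exact: f0.
Qed.

(** The base point is moved to the left of both 0 and r, where f vanishes, so that r becomes an
    interior point of the interval of integration. *)
Lemma itg_continuous f : (forall a b, int_itv f a b) ->
  (forall x, x <= 0 -> f x = 0) -> continuous (itg f 0).
Proof.
move=> fi f0 r; pose a := - `|r| - 1.
have a0 : a <= 0 by rewrite /a; have := normr_ge0 r; lra.
have ar : a < r by rewrite /a; have := ler_norm (- r); rewrite normrN; lra.
have -> : itg f 0 = itg f a; last exact: itg_continuous_at.
apply/funext => b; have [b0|b0] := leP 0 b; first by rewrite -(@itg_0l _ a).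
rewrite itg_lt// (@eq_itg _ (fun=> 0) a b).
  have [ab|ba] := leP a b; last by rewrite itg_lt.
  by rewrite itg_cst// mul0r.
by move=> x /andP[_ xb]; rewrite f0// (le_trans xb)// ltW.
Qed.

Lemma is_derive_itg f a x : (forall b, int_itv f a b) -> a < x ->
  {for x, continuous f} -> is_derive x (1 : R) (itg f a) (f x).
Proof.
move=> fi ax cf; have x1 : x < x + 1 by rewrite ltrDl.
have [dF] := continuous_FTC1_closed x1 (fi (x + 1)) ax cf.
by rewrite derive1E => FE; apply: DeriveDef.
Qed.

Lemma measurable_continuous f : continuous f -> measurable_fun setT f.
Proof. exact: continuous_measurable_fun. Qed.

End interval_integral.

(** * Fubini's theorem on the triangle s < r *)

Section fubini.
Context {R : realType}.
Local Notation mu := (@lebesgue_measure R).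
Variables (b : R) (F G : R -> R).
Local Notation I := (`]0, b[%classic : set R).
Hypothesis b0 : 0 < b.
Hypothesis mF : measurable_fun I F.
Hypothesis Gi : mu.-integrable I (EFin \o G).
Hypothesis FGi :
  mu.-integrable I (EFin \o (fun r => F r * itg (fun t => `|G t|) 0 r)).
Hypothesis Fi : forall s, 0 < s -> int_itv F s b.

Let Fp : R -> R := F \_ I.
Let Gp : R -> R := G \_ I.
Let h (z : R * R) : R := Fp z.1 * Gp z.2 * (z.2 < z.1)%R%:R.

Let mFp : measurable_fun setT Fp.
Proof. by apply/(measurable_restrictT _ _).1. Qed.

Let mGp : measurable_fun setT Gp.
Proof. by apply/(measurable_restrictT _ _).1 => //; exact: integrable_measurableR Gi. Qed.

Let mh : measurable_fun setT h.
Proof.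
apply: measurable_funM; first apply: measurable_funM.
- exact: measurableT_comp.
- exact: measurableT_comp.
- apply: (@measurableT_comp _ _ _ _ _ _ (fun c : bool => c%:R : R)) => //.
  by apply: measurable_fun_ltr => //.
Qed.

Let Gi0 r : r < b -> int_itv G 0 r.
Proof.
by move=> rb; move/int_itv_oo : Gi; apply: int_itvS => //; exact: ltW.
Qed.


Let I_itv r : I r -> 0 < r /\ r < b.
Proof. by rewrite /= in_itv/= => /andP. Qed.

Let hE1 r s : I r -> h (r, s) = F r * (G \_ `]0, r[) s.
Proof.
move=> Ir; have [r0 rb] := I_itv Ir; rewrite /h /= /Fp /Gp !patchE mem_set//.
rewrite -mulrA !mem_setE !in_itv/=; congr (_ * _).
have [sr|rs] := ltP s r; rewrite ?andbF ?mulr0// ?mulr1 ?andbT.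
by rewrite (lt_trans sr rb) andbT.
Qed.

Let hE2 r s : I s -> h (r, s) = G s * (F \_ `]s, b[) r.
Proof.
move=> Is; have [s0 sb] := I_itv Is; rewrite /h /= /Fp /Gp !patchE.
rewrite (mem_set (_ : I s))// mulrAC mulrC !mem_setE !in_itv/=; congr (_ * _).
have [sr|rs] := ltP s r; rewrite ?mulr0// ?mulr1.
by rewrite (lt_trans s0 sr).
Qed.

Let h01 r s : ~ I r -> h (r, s) = 0.
Proof. by move=> Ir; rewrite /h /= /Fp !patchE memNset// 2!mul0r. Qed.

Let h02 r s : ~ I s -> h (r, s) = 0.
Proof. by move=> Ir; rewrite /h /= /Gp !patchE (@memNset _ I s)// mulr0 mul0r. Qed.

Let hF : fubini_F mu (EFin \o h) = EFin \o ((fun r => F r * itg G 0 r) \_ I).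
Proof.
apply/funext => r; rewrite /fubini_F /= patchE.
have [/set_mem Ir|/negP nIr] := boolP (r \in I); last first.
  by rewrite integral0_eq// => s _; rewrite h01// => /mem_set.
have [r0 rb] := I_itv Ir.
under eq_integral do rewrite hE1// EFinM.
rewrite integralZl//; last exact/integrable_patch_oo/Gi0.
by rewrite integral_patch_oo//; exact: Gi0.
Qed.

Let hG : fubini_G mu (EFin \o h) = EFin \o ((fun s => G s * itg F s b) \_ I).
Proof.
apply/funext => s; rewrite /fubini_G /= patchE.
have [/set_mem Is|/negP nIs] := boolP (s \in I); last first.
  by rewrite integral0_eq// => r _; rewrite h02// => /mem_set.
have [s0 sb] := I_itv Is.
under eq_integral do rewrite hE2// EFinM.
rewrite integralZl//; last exact/integrable_patch_oo/Fi.
by rewrite integral_patch_oo//; exact: Fi.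
Qed.

Let hi : (mu \x mu)%E.-integrable setT (EFin \o h).
Proof.
apply/integrable12ltyP; first exact/measurable_EFinP.
have /integrableP[_] := FGi; rewrite integral_mkcond.
apply: le_lt_trans; rewrite le_eqVlt; apply/orP; left; apply/eqP.
apply: eq_integral => r _; rewrite patchE.
have [/set_mem Ir|/negP nIr] := boolP (r \in I); last first.
  by rewrite integral0_eq// => s _ /=; rewrite h01 ?normr0// => /mem_set.
have [r0 rb] := I_itv Ir.
under eq_integral => s _.
  rewrite [X in (`|X|)%E]/= hE1// /= normrM EFinM.
  rewrite (_ : `|(G \_ `]0, r[) s| = ((fun t => `|G t|) \_ `]0, r[) s); last first.
    by rewrite !patchE; case: ifPn => // _; rewrite normr0.
  over.
rewrite integralZl//; last exact/integrable_patch_oo/int_itv_norm/Gi0.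
rewrite integral_patch_oo /=; last exact/int_itv_norm/Gi0.
by rewrite normrM (ger0_norm (itg_ge0 _)).
Qed.

(** Both sides are the integral over the plane of [h], the product F(r) G(s) on the triangle.
    Absolute convergence is checked with s as inner variable, where |F r| is multiplied by the
    primitive of |G|; so F need not be integrable at 0 if that primitive compensates. *)
Lemma fubini_triangle :
  mu.-integrable I (EFin \o (fun s => G s * itg F s b)) /\
  \int[mu]_(r in I) (F r * itg G 0 r) = \int[mu]_(s in I) (G s * itg F s b).
Proof.
split.
  apply/(integrable_mkcond _ _).2 => //; rewrite restrict_EFin -hG.
  apply/integrableP; split; first exact: (measurable_fubini_G hi).
  have := (integrable21ltyP mu mu (measurable_int _ hi)).1 hi.
  apply: le_lt_trans; apply: ge0_le_integral => //.
  - by apply: measurableT_comp => //; exact: (measurable_fubini_G hi).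
  - apply: (@measurable_fun_fubini_tonelli_G _ _ _ _ _ mu (abse \o (EFin \o h))) => //.
      by apply: measurableT_comp => //; exact: measurable_int hi.
    by move=> z; exact: abse_ge0.
  - move=> s _; apply: le_abse_integral => //; apply/measurable_EFinP.
    exact: (@measurable_fun_pair1 _ _ _ _ _ _ h s mh).
rewrite [LHS]Rintegral_mkcond [RHS]Rintegral_mkcond /Rintegral; congr fine.
transitivity (\int[mu]_r (fubini_F mu (EFin \o h) r))%E; first by rewrite hF.
transitivity (\int[mu]_r (fubini_G mu (EFin \o h) r))%E; last by rewrite hG.
by rewrite integral12_prod_meas1// integral21_prod_meas1.
Qed.

Lemma fubini_triangle_integrable :
  mu.-integrable I (EFin \o (fun r => F r * itg G 0 r)).
Proof.
apply/(integrable_mkcond _ _).2 => //; rewrite restrict_EFin -hF.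
exact: integrable_fubini_F.
Qed.

End fubini.

(** * Radial integrals on the Euclidean ball *)

Section affine_lebesgue.
Context {R : realType}.
Local Notation mu := (@lebesgue_measure R).

Lemma measurable_affine (c v : R) : measurable_fun setT (fun t : R => c * t + v).
Proof. by apply: measurable_funD => //; exact: measurable_funM. Qed.

(** Multiplied by c, the image measure agrees with length on half-open intervals, which
    characterises Lebesgue measure. *)
Lemma lebesgue_measure_affine (c v : R) (A : set R) : 0 < c -> measurable A ->
  pushforward mu (fun t : measurableTypeR R => (c * t + v : measurableTypeR R)) A
    = (c^-1%:E * mu A)%E.
Proof.
move=> c0 mA; pose k : {nonneg R} := NngNum (ltW c0).
have mf : measurable_fun setT
  (fun t : measurableTypeR R => (c * t + v : measurableTypeR R)).
  exact: measurable_affine.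
pose m := pushforward mu (fun t : measurableTypeR R => (c * t + v : measurableTypeR R)).
have : mu A = mscale k m A.
  move=> m0; apply: lebesgue_measure_unique => // _ [[a b]] _ <-.
  transitivity (c%:E * mu ((fun t : R => (c * t + v)%R) @^-1` `]a, b]))%E => //.
  rewrite (_ : _ @^-1` _ =
      `](a - v) / c, (b - v) / c]%classic); last first.
    apply/seteqP; split => x /=; rewrite !in_itv/= ltr_pdivrMr// ler_pdivlMr//.
      by rewrite ltrBlDr lerBrDr (mulrC x).
    by rewrite ltrBlDr lerBrDr (mulrC x).
  rewrite !lebesgue_measure_itv/= !lte_fin ltr_pM2r ?invr_gt0// ltrD2r.
  case: ifPn => _; last by rewrite mule0.
  by rewrite -EFinM; congr EFin; field; rewrite gt_eqF.
move=> /(_ mf) ->; by rewrite /mscale/= muleA -EFinM mulVf ?gt_eqF// mul1e.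
Qed.

Lemma integral_affine (c v : R) (f : R -> \bar R) : 0 < c ->
  measurable_fun setT f -> (forall x, 0 <= f x)%E ->
  (\int[mu]_t f (c * t + v)%R = c^-1%:E * \int[mu]_t f t)%E.
Proof.
move=> c0 mf f0; pose phi (t : measurableTypeR R) := (c * t + v : measurableTypeR R).
have mphi : measurable_fun setT phi by exact: measurable_affine.
have c1 : 0 < c^-1 by rewrite invr_gt0.
pose k : {nonneg R} := NngNum (ltW c1).
have := ge0_integral_pushforward mphi mu measurableT mf.
rewrite preimage_setT => <-; last by move=> ? _; exact: f0.
rewrite -(@ge0_integral_mscale _ _ _ mu setT measurableT k)//.
by apply: eq_measure_integral => A mA _; exact: (lebesgue_measure_affine v c0 mA).
Qed.

End affine_lebesgue.

(** * Lebesgue measure on R^n under dilations and translations *)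

Section leb_n.
Context {R : realType}.
Local Notation mu := (@lebesgue_measure R).
Local Notation leb := (@lebesgue_row R).

Lemma integral_leb0 (f : 'rV[R]_0 -> \bar R) : measurable_fun setT f ->
  (\int[leb 0%N]_x f x = f 0%R)%E.
Proof.
move=> mf.
have := @integral_dirac _ _ (0 : 'rV[R]_0) R setT measurableT f mf.
by rewrite diracT mul1e.
Qed.

Lemma integral_lebS n (f : 'rV[R]_n.+1 -> \bar R) : measurable_fun setT f ->
  (forall x, 0 <= f x)%E ->
  (\int[leb n.+1]_x f x = \int[mu]_t \int[leb n]_w f (row_cons (t, w)))%E.
Proof.
move=> mf f0; have mc : measurable_fun setT (@row_cons R n).
  exact: measurable_row_cons.
transitivity (\int[pushforward (mu \x leb n)%E (@row_cons R n)]_x f x)%E.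
  by apply: eq_measure_integral.
rewrite ge0_integral_pushforward//.
rewrite preimage_setT.
have mfc : measurable_fun setT (f \o @row_cons R n) by exact: measurableT_comp.
rewrite -(@fubini_tonelli1 _ _ _ _ _ mu (leb n) (f \o @row_cons R n))//.
by move=> z; exact: f0.
Qed.


Lemma measurable_row_cons_r n (t : R) :
  measurable_fun setT (fun w : 'rV[R]_n => row_cons (t, w)).
Proof.
apply: measurable_fun_row => i; rewrite /row_cons.
case: (unliftP ord0 i) => [j|] ->.
  by under eq_fun do rewrite mxE liftK /=; exact: measurable_row_coor.
by under eq_fun do rewrite mxE unlift_none /=; exact: measurable_cst.
Qed.

Lemma measurable_affine_row n (c : R) (v : 'rV[R]_n) :
  measurable_fun setT (fun x : 'rV[R]_n => c *: x + v).
Proof.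
apply: measurable_fun_row => i; under eq_fun do rewrite !mxE.
apply: measurable_funD => //; apply: measurable_funM => //.
exact: measurable_row_coor.
Qed.

(** Induction on n: Tonelli peels off the first coordinate, and each coordinate contributes one
    factor 1/c. *)
Lemma integral_leb_affine n (c : R) (v : 'rV[R]_n) (f : 'rV[R]_n -> \bar R) :
  0 < c -> measurable_fun setT f -> (forall x, 0 <= f x)%E ->
  (\int[leb n]_x f (c *: x + v)%R = (c^-1 ^+ n)%:E * \int[leb n]_x f x)%E.
Proof.
move=> c0; elim: n v f => [|n IH] v f mf f0.
  rewrite !integral_leb0 ?expr0 ?mul1e//.
    by congr f; apply/rowP; case.
  by apply: (measurableT_comp mf); exact: measurable_affine_row.
rewrite !integral_lebS//; last first.
  by apply: (measurableT_comp mf); exact: measurable_affine_row.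
pose v' : 'rV[R]_n := \row_j v ord0 (lift ord0 j).
have E t w : c *: row_cons (t, w) + v =
    row_cons (c * t + v ord0 ord0, c *: w + v').
  apply/rowP => i; rewrite !mxE /=; case: (unliftP ord0 i) => [j|] -> //=.
  by rewrite !mxE.
under eq_integral => t _.
  under eq_integral do rewrite E.
  rewrite (IH v' (fun w => f (row_cons (c * t + v ord0 ord0, w))))//; last first.
    exact: (measurableT_comp mf (measurable_row_cons_r _)).
  over.
have mI : measurable_fun setT (fun t => \int[leb n]_w f (row_cons (t, w)))%E.
  apply: (@measurable_fun_fubini_tonelli_F _ _ _ _ _ _ (f \o @row_cons R n)) => //.
    by apply: measurableT_comp => //; exact: measurable_row_cons.
  by move=> z; exact: f0.
rewrite (@ge0_integralZl _ _ _ mu setT measurableT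
  (fun t : R => \int[leb n]_w f (row_cons (c * t + v ord0 ord0, w)%R))%E _ (c^-1 ^+ n)%:E); last 3 first.
- exact: (measurableT_comp mI (measurable_affine _ _)).
- by move=> t _; apply: integral_ge0.
- by rewrite lee_fin exprn_ge0// invr_ge0 ltW.
rewrite (integral_affine _ c0 mI); last by move=> t; exact: integral_ge0.
by rewrite muleA -EFinM -exprSr.
Qed.

End leb_n.

(** * Measures given by a density *)

Section density.
Context d (T : measurableType d) {R : realType}.
Variables (mu : {sigma_finite_measure set T -> \bar R}) (w : T -> R).
Hypothesis w0 : forall x, 0 <= w x.
Hypothesis wi : mu.-integrable setT (EFin \o w).

Definition dens (A : set T) := (\int[mu]_(x in A) (w x)%:E)%E.

Let dens0 : dens set0 = 0%E.
Proof. by rewrite /dens integral_set0. Qed.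

Let dens_ge0 A : (0 <= dens A)%E.
Proof. by apply: integral_ge0 => x _; rewrite lee_fin. Qed.

Let dens_sigma_additive : semi_sigma_additive dens.
Proof.
move=> /= A mA tA mUA.
rewrite /dens/= integral_bigcup//=; last first.
  by apply: (integrableS _ _ (subsetT _)) => //.
apply: is_cvg_ereal_nneg_natsum_cond => n _ _.
by apply: integral_ge0 => /= x ?; rewrite lee_fin.
Qed.

Let dens_fin : fin_num_fun dens.
Proof. by move=> A mA; apply: integrable_fin_num => //; exact: integrableS wi. Qed.

HB.instance Definition _ := isMeasure.Build _ _ _
  dens dens0 dens_ge0 dens_sigma_additive.

HB.instance Definition _ := @Measure_isFinite.Build _ _ _ dens dens_fin.

Definition dens_measure : {finite_measure set T -> \bar R} := dens.

Lemma dens_dominates : dens `<< mu.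
Proof.
apply/null_content_dominatesP => A mA muA0.
by rewrite /dens null_set_integral//; apply: measurable_funTS; exact: measurable_int wi.
Qed.

(** The measure is dominated by mu, and its Radon-Nikodym derivative equals w almost everywhere
    because both have the same integral over every measurable set. *)
Lemma integral_dens (f : T -> \bar R) : measurable_fun setT f ->
  (forall x, 0 <= f x)%E ->
  (\int[dens]_x f x = \int[mu]_x (f x * (w x)%:E))%E.
Proof.
move=> mf f0; rewrite -(Radon_Nikodym_SigmaFinite.change_of_variables dens_dominates)//.
apply: ae_eq_integral => //.
- apply: emeasurable_funM => //.
  exact: measurable_int (Radon_Nikodym_SigmaFinite.f_integrable dens_dominates).
- by apply: emeasurable_funM => //; exact: measurable_int wi.
- apply: ae_eqe_mul2l; apply: integral_ae_eq => //.
  + exact: Radon_Nikodym_SigmaFinite.f_integrable dens_dominates.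
  + exact: measurable_int wi.
  + move=> E _ mE; rewrite -Radon_Nikodym_SigmaFinite.f_integral//.
    exact: dens_dominates.
Qed.

End density.

(** Open rays are stable under intersection and generate the Borel sets, and the rays with natural
    end points exhaust the line by sets of finite measure. *)
Lemma measure_eq_ray {R : realType}
    (m1 m2 : {measure set (measurableTypeR R) -> \bar R}) :
  (forall b : R, m1 `]-oo, b[%classic = m2 `]-oo, b[%classic) ->
  (forall b : R, m1 `]-oo, b[%classic < +oo)%E ->
  forall A, measurable A -> m1 A = m2 A.
Proof.
move=> m12 m1fin A mA.
apply: (@measure_unique _ R (measurableTypeR R) (@RGenInftyO.G R)
  (fun k : nat => [set` `]-oo, (k%:R : R)[])) => //.
- exact: RGenInftyO.measurableE.
- move=> _ _ [x ->] [y ->]; exists (Num.min x y).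
  by apply/seteqP; split => z; rewrite /= !in_itv/= lt_min => /andP.
- by move=> k; exists k%:R.
- apply/seteqP; split => // x _; exists (Num.bound `|x : R|) => //=.
  by rewrite in_itv/= (le_lt_trans (ler_norm (x : R)))// archi_boundP.
- by move=> _ [b ->]; exact: m12.
Qed.

(** * Volume of balls and integration in polar coordinates *)

Section radial.
Context {R : realType}.
Local Notation mu := (@lebesgue_measure R).
Local Notation leb := (@lebesgue_row R).

Lemma enorm_ge0 n (x : 'rV[R]_n) : 0 <= enorm x.
Proof. exact: sqrtr_ge0. Qed.

Lemma sqr_enorm n (x : 'rV[R]_n) : enorm x ^+ 2 = \sum_(i < n) x ord0 i ^+ 2.
Proof. by rewrite sqr_sqrtr// sumr_ge0// => i _; rewrite sqr_ge0. Qed.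

Lemma enormZ n (c : R) (x : 'rV[R]_n) : enorm (c *: x) = `|c| * enorm x.
Proof.
rewrite /enorm -sqrtr_sqr -sqrtrM ?sqr_ge0// mulr_sumr.
by congr Num.sqrt; apply: eq_bigr => i _; rewrite mxE exprMn.
Qed.

Lemma le_coor_enorm n (x : 'rV[R]_n) i : `|x ord0 i| <= enorm x.
Proof.
rewrite -(@ler_pXn2r _ 2%N)// ?nnegrE ?enorm_ge0// sqr_enorm real_normK ?num_real//.
rewrite (bigD1 i)//= lerDl sumr_ge0// => j _; exact: sqr_ge0.
Qed.

Lemma measurable_enorm n : measurable_fun setT (@enorm R n).
Proof.
apply: (@measurableT_comp _ _ _ _ _ _ (@Num.sqrt R)) => //.
  by apply: measurable_continuous; exact: sqrt_continuous.
apply: measurable_sum => i; apply: measurable_funX; exact: measurable_row_coor.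
Qed.

Lemma measurable_eball n (r : R) : measurable (@eball R n r).
Proof.
rewrite /eball (_ : mkset _ = @enorm R n @^-1` `]-oo, r[); last first.
  by apply/seteqP; split => x /=; rewrite in_itv.
by rewrite -[X in measurable X]setTI; exact: measurable_enorm.
Qed.

Lemma leb_eball_scale n (r : R) : 0 < r ->
  (leb n (@eball R n r) = (r ^+ n)%:E * leb n (@eball R n 1))%E.
Proof.
move=> r0; have mr := @measurable_eball n r; have m1 := @measurable_eball n 1.
have E (A : set 'rV[R]_n) : measurable A ->
    (leb n A = \int[leb n]_x (\1_A x)%:E)%E.
  by move=> mA; rewrite integral_indic// setIT.
rewrite E// (E _ m1).
have -> : (\int[leb n]_x (\1_(@eball R n 1) x)%:E =
    \int[leb n]_x (\1_(@eball R n r) (r *: x + 0)%R)%:E)%E.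
  apply: eq_integral => x _; congr (_%:E); rewrite !indicE; congr ((nat_of_bool _)%:R).
  apply/idP/idP; rewrite !inE /eball/= addr0 enormZ gtr0_norm//.
    by rewrite -{2}(mulr1 r) ltr_pM2l.
  by rewrite -{2}(mulr1 r) ltr_pM2l.
rewrite (@integral_leb_affine _ n r 0 (fun x => (\1_(@eball R n r) x)%:E))//.
  by rewrite muleA -EFinM -exprMn mulfV ?gt_eqF// expr1n mul1e.
exact/measurable_EFinP.
Qed.

(** A body of explicit measure to compare with: it contains the unit ball and lies in the ball of
    radius n + 1, so the unit ball has finite positive volume. *)
Let cube n : set 'rV[R]_n := [set x : 'rV[R]_n | forall i, `|x ord0 i| <= 1].

Arguments cube : clear implicits.

Let mcube n : measurable (cube n).
Proof.
have -> : cube n =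
    \bigcap_(i in [set: 'I_n]) ((fun x : 'rV[R]_n => x ord0 i) @^-1` `[-1, 1]).
  apply/seteqP; split => x /= H i; first by rewrite /= in_itv/= -ler_norml.
  by have := H i I; rewrite /= in_itv/= -ler_norml.
apply: fin_bigcap_measurable => // i _; rewrite -[X in measurable X]setTI.
exact: (measurable_row_coor i).
Qed.

Let leb_cube n : leb n (cube n) = ((2:R) ^+ n)%:E.
Proof.
elim: n => [|n IH].
  by rewrite /= /lebesgue_row0 diracE expr0 mem_set// => -[].
transitivity (\int[leb n.+1]_x (\1_(cube n.+1) x)%:E)%E.
  by rewrite integral_indic ?setIT//; exact: mcube.
rewrite integral_lebS//; last first.
  by apply/measurable_EFinP; apply: measurable_indic; exact: mcube.
transitivity (\int[mu]_t ((\1_`[-1, 1] t)%:E * (2 ^+ n)%:E))%E.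
  apply: eq_integral => t _; rewrite -IH.
  transitivity (\int[leb n]_w ((\1_`[-1, 1] t)%:E * (\1_(cube n) w)%:E))%E.
    apply: eq_integral => w _; rewrite -EFinM; congr EFin.
    rewrite !indicE -natrM mulnb; congr ((nat_of_bool _)%:R).
    apply/idP/idP.
      rewrite inE/= => H; apply/andP; split; rewrite inE/=.
        by have := H ord0; rewrite mxE unlift_none/= in_itv/= -ler_norml.
      by move=> i; have := H (lift ord0 i); rewrite mxE liftK.
    case/andP; rewrite !inE/= in_itv/= -ler_norml => t1 w1 i.
    by rewrite mxE; case: (unliftP ord0 i) => [j|] _ /=.
  rewrite (@ge0_integralZl _ _ _ (leb n) setT measurableT
    (fun w => (\1_(cube n) w)%:E))//.
    by rewrite integral_indic ?setIT//; exact: mcube.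
  by apply/measurable_EFinP; apply: measurable_indic; exact: mcube.
rewrite (@ge0_integralZr _ _ _ mu setT measurableT (fun t => (\1_`[-1, 1] t)%:E))//.
  have -> : (\int[mu]_x (\1_(`[-1, 1] : set R) x)%:E = 2%:E)%E.
    rewrite integral_indic// setIT; apply: (etrans (lebesgue_measure_itv `[-1, 1])).
    rewrite /= lte_fin ifT; last by lra.
    by rewrite -EFinD opprK.
  by rewrite -EFinM exprS.
exact/measurable_EFinP.
Qed.

Lemma leb_eball_fin n : (leb n (@eball R n 1) < +oo)%E.
Proof.
apply: (@le_lt_trans _ _ ((2:R) ^+ n)%:E); last exact: ltry.
rewrite -leb_cube; apply: le_measure; rewrite ?inE.
- exact: measurable_eball.
- exact: mcube.
move=> x; rewrite /eball/= => x1 i; apply/ltW/(le_lt_trans _ x1).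
exact: le_coor_enorm.
Qed.

Lemma leb_eball_gt0 n : (0 < leb n (@eball R n 1))%E.
Proof.
rewrite lt0e measure_ge0 andbT; apply/eqP => l0.
(* If the unit ball were null, scaling would make the ball of radius n + 1 null, yet it contains the
   cube, of measure 2^n. *)
suff : (((2:R) ^+ n)%:E <= 0%:E)%E.
  by rewrite lee_fin leNgt exprn_gt0.
rewrite -leb_cube -[leRHS](mule0 (n.+1%:R ^+ n)%:E) -l0 -leb_eball_scale//.
apply: le_measure; rewrite ?inE.
- exact: mcube.
- exact: measurable_eball.
move=> x /= x1; rewrite /eball/= -(@ltr_pXn2r _ 2%N)// ?nnegrE ?enorm_ge0//.
rewrite sqr_enorm; apply: (@le_lt_trans _ _ (\sum_(i < n) 1)).
  apply: ler_sum => i _; rewrite -real_normK ?num_real// expr_le1//.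
rewrite sumr_const card_ord -natrX ltr_nat; apply: (@leq_trans n.+1) => //.
by rewrite -mulnn leq_pmulr.
Qed.

Definition ball_volume n : R := fine (leb n (@eball R n 1)).

Lemma ball_volume_gt0 n : 0 < ball_volume n.
Proof. by rewrite fine_gt0// leb_eball_gt0 leb_eball_fin. Qed.

Lemma leb_eball n (r : R) : 0 < r ->
  leb n (@eball R n r) = (ball_volume n * r ^+ n)%:E.
Proof.
move=> r0; rewrite leb_eball_scale// mulrC EFinM; congr (_ * _)%E.
by rewrite fineK// fin_real// (lt_le_trans _ (measure_ge0 _ _))//= leb_eball_fin.
Qed.

Variables (n : nat) (rho : R).
Hypotheses (n0 : (0 < n)%N) (rho0 : 0 < rho).
Local Notation I := (`]0, rho[%classic : set R).

(** The area of the unit sphere. *)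
Local Notation c := (ball_volume n * n%:R).
Let w : R -> R := (fun r => c * r ^+ n.-1) \_ I.

Let c_ge0 : 0 <= c.
Proof. by rewrite mulr_ge0// ltW// ball_volume_gt0. Qed.

Let w_ge0 r : 0 <= w r.
Proof.
rewrite /w patchE; case: ifPn => //; rewrite inE/= in_itv/= => /andP[r0 _].
by rewrite mulr_ge0// exprn_ge0// ltW.
Qed.

Let int_w a b : int_itv (fun r => c * r ^+ n.-1) a b.
Proof.
apply: int_itv_continuous => x _; apply: cvgM; first exact: cvg_cst.
exact: exprn_continuous.
Qed.

Let w_i : mu.-integrable setT (EFin \o w).
Proof. exact: integrable_patch_oo. Qed.

Let itg_w b : 0 <= b -> itg (fun r => c * r ^+ n.-1) 0 b = ball_volume n * b ^+ n.
Proof.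
move=> b0; have cf x : {for x, continuous (fun r : R => c * r ^+ n.-1)}.
  by apply: cvgM; [exact: cvg_cst|exact: exprn_continuous].
have dF x : is_derive x (1 : R) (fun r => ball_volume n * r ^+ n) (c * x ^+ n.-1).
  by rewrite -mulrA; apply: is_derive_cmul; exact: is_derive_exprn.
rewrite (@itg_derive _ _ _ 0 b b0 (fun x _ => cf x) (fun x _ => dF x)).
by rewrite expr0n (gtn_eqF n0) mulr0 subr0.
Qed.

Let dens_w b : dens mu w `]-oo, b[%classic = leb n (@eball R n (Num.min b rho)).
Proof.
pose m := Num.min b rho.
have E : dens mu w `]-oo, b[%classic =
    (\int[mu]_x (((fun r => c * r ^+ n.-1) \_ `]0%R, m[) x)%:E)%E.
  rewrite /dens integral_mkcond; apply: eq_integral => x _.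
  rewrite /w !patchE !mem_setE !in_itv/= /m lt_min.
  by case: (x < b); case: (x < rho); case: (0 < x).
rewrite {}E integral_patch_oo//.
have [m0|m0] := leP m 0.
  rewrite itg_pt// (_ : eball _ = set0) ?measure0//.
  apply/seteqP; split => x //; rewrite /eball/= => xm.
  by have := lt_le_trans xm m0; rewrite ltNge enorm_ge0.
by rewrite leb_eball// itg_w// ltW.
Qed.

(** The image under [enorm] of Lebesgue measure on the ball and the measure c r^(n-1) dr on ]0, rho[
    give the same mass to every ray, by the volume formula for balls; hence they coincide. *)
Lemma integral_radial (f : R -> \bar R) : measurable_fun setT f ->
  (forall x, 0 <= f x)%E ->
  (\int[leb n]_(x in @eball R n rho) f (enorm x) =
   \int[mu]_(r in I) (f r * (c * r ^+ n.-1)%:E))%E.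
Proof.
move=> mf f0.
have mphi : measurable_fun setT (@enorm R n : _ -> measurableTypeR R).
  exact: measurable_enorm.
pose J : set (measurableTypeR R) := [set` `]-oo, rho[].
have mJ : measurable J by exact: measurable_itv.
have -> : @eball R n rho = (@enorm R n) @^-1` J.
  by apply/seteqP; split => x; rewrite /J /eball/= in_itv.
pose m1f : {measure set (measurableTypeR R) -> \bar R} :=
  mrestr (pushforward (leb n) (@enorm R n : _ -> measurableTypeR R)) mJ.
pose m1 := m1f mphi.
pose m2 : {measure set (measurableTypeR R) -> \bar R} :=
  @dens_measure _ (measurableTypeR R) R mu w w_ge0 w_i.
have m1E b : m1 `]-oo, b[%classic = leb n (@eball R n (Num.min b rho)).
  rewrite /m1 /= /mrestr /pushforward; congr (leb n _).
  by apply/seteqP; split => x; rewrite /J /eball/= !in_itv/= lt_min => /andP.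
have m12 A : measurable A -> m1 A = m2 A.
  apply: measure_eq_ray; first by move=> b; rewrite m1E -dens_w.
  move=> b; rewrite m1E.
  have [m0|m0] := leP (Num.min b rho) 0; last by rewrite leb_eball// ltry.
  rewrite (_ : eball _ = set0) ?measure0//.
  apply/seteqP; split => x //; rewrite /eball/= => xm.
  by have := lt_le_trans xm m0; rewrite ltNge enorm_ge0.
transitivity (\int[m1]_(y in J) f y)%E.
  rewrite -(@ge0_integral_pushforward _ _ _ _ _ _ mphi (leb n) J f)//.
    apply: eq_measure_integral => A mA AJ.
    by rewrite /m1/= /mrestr setIidl.
  by apply: measurable_funS mf.
transitivity (\int[m2]_(y in J) f y)%E.
  by apply: eq_measure_integral => A mA _; exact: m12.
rewrite [LHS]integral_mkcond (@integral_dens _ _ _ mu w w_ge0 w_i (f \_ J)); last 2 first.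
- by apply/(measurable_restrictT _ _).1 => //; exact: measurable_funTS.
- by move=> x; rewrite patchE; case: ifP.
rewrite [RHS]integral_mkcond; apply: eq_integral => x _.
rewrite /w !patchE !mem_setE !in_itv/=.
by case: (x < rho); rewrite ?andbF ?andbT/= ?mul0e//; case: (0 < x); rewrite ?mule0.
Qed.

End radial.

(** * Continuous functions on R^n are measurable *)

Section continuous_measurable.
Context {R : realType}.
Local Notation leb := (@lebesgue_row R).

Lemma cvg_row n (u : nat -> 'rV[R]_n) (x : 'rV[R]_n) :
  (forall i, u k ord0 i @[k --> \oo] --> x ord0 i) -> u k @[k --> \oo] --> x.
Proof.
move=> ux; apply/cvg_ballP => e e0.
have : \forall k \near \oo, forall i, ball (x ord0 i) e (u k ord0 i).
  by apply: filter_forall => i; have /cvg_ballP := ux i; exact.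
by apply: filterS => k H; split => // i j; rewrite (ord1 i).
Qed.

(* Sampling on the grid of mesh 1/(k+1) approximates a continuous function by *)
(* functions that factor through a countable type.                            *)
Lemma measurable_continuous_row n (f : 'rV[R]_n -> R) : continuous f ->
  measurable_fun setT f.
Proof.
move=> cf.
pose z k (x : 'rV[R]_n) : {ffun 'I_n -> int} :=
  [ffun i => Num.floor (k.+1%:R * x ord0 i)].
pose F k (m : {ffun 'I_n -> int}) : 'rV[R]_n := \row_i ((m i)%:~R / k.+1%:R).
apply: (@measurable_fun_cvg _ _ _ _ (fun k => f \o (F k \o z k))).
  move=> k _ Y mY; rewrite setTI.
  rewrite (_ : _ @^-1` Y = \bigcup_(m in [set: {ffun 'I_n -> int}])
     (if `[< Y (f (F k m)) >] then z k @^-1` [set m] else set0)); last first.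
    apply/seteqP; split => [x Yx|x [m _]] /=.
      by exists (z k x) => //; rewrite asboolT.
    by case: asboolP => // Ym /= ->.
  apply: countable_bigcupT_measurable => [|m]; first exact: countableP.
  case: asboolP => // _.
  rewrite (_ : _ @^-1` _ = \bigcap_(i in [set: 'I_n])
    ((fun x : 'rV[R]_n => x ord0 i) @^-1`
     [set` `[(m i)%:~R / k.+1%:R, (m i + 1)%:~R / k.+1%:R[])); last first.
    have E x i : (Num.floor (k.+1%:R * x ord0 i) == m i) =
       (x ord0 i \in `[((m i)%:~R : R) / k.+1%:R, (m i + 1)%:~R / k.+1%:R[).
      by rewrite floor_eq in_itv/= ler_pdivrMr// ltr_pdivlMr// (mulrC (x _ _)).
    apply/seteqP; split => x /=.
      by move=> xm i _; rewrite /= -E -xm ffunE.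
    by move=> H; apply/ffunP => i; apply/eqP; rewrite ffunE E; exact: H.
  apply: fin_bigcap_measurable => // i _; rewrite -[X in measurable X]setTI.
  exact: (measurable_row_coor i).
move=> x _; apply: continuous_cvg; first exact: cf.
apply: cvg_row => i; apply/cvgrPdist_le => e e0.
near=> k; rewrite /= /F mxE /z ffunE.
have k0 : 0 < k.+1%:R :> R by [].
have /andP[f1 f2] := floor_itv (k.+1%:R * x ord0 i).
have f3 : (Num.floor (k.+1%:R * x ord0 i))%:~R / k.+1%:R <= x ord0 i.
  by rewrite ler_pdivrMr// (mulrC (x _ _)).
rewrite ger0_norm ?subr_ge0//; set y := Num.floor _ in f1 f2 f3 *.
have f4 : x ord0 i < y%:~R / k.+1%:R + k.+1%:R^-1.
  by rewrite -{2}(mul1r k.+1%:R^-1) -mulrDl ltr_pdivlMr// mulrC; move: f2; rewrite intrD.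
rewrite lerBlDl (le_trans (ltW f4))// lerD2l.
by rewrite ltW//; near: k; exact: (near_infty_natSinv_lt (PosNum e0)).
Unshelve. all: by end_near. Qed.

End continuous_measurable.

(** * Directional derivatives through restriction to lines *)

Section directional.
Context {R : realType} {V : normedModType R}.
Implicit Types (f : V -> R) (x v : V).

Lemma line_quotient f x v t (h : R) :
  h^-1 *: (f (h *: v + (x + t *: v)) - f (x + t *: v)) =
  h^-1 *: (f (x + (h *: (1 : R) + t) *: v) - f (x + t *: v)) :> R^o.
Proof. by rewrite [h *: (1 : R)]mulr1 scalerDl addrCA. Qed.

Lemma is_derive_line f x v t : derivable (f : V -> R^o) (x + t *: v) v ->
  is_derive t (1 : R) (fun s => f (x + s *: v)) ('D_v (f : V -> R^o) (x + t *: v)).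
Proof.
move=> df; apply: DeriveDef.
- rewrite /derivable; under eq_fun do rewrite -line_quotient; exact: df.
- by rewrite /derive; under eq_fun do rewrite -line_quotient.
Qed.

Lemma line_derivable f x v d :
  is_derive (0 : R) (1 : R) (fun s => f (x + s *: v)) d ->
  is_derive x v (f : V -> R^o) d.
Proof.
have E h : h^-1 *: (f (h *: v + x) - f x) =
    h^-1 *: (f (x + (h *: (1 : R) + 0) *: v) - f (x + 0 *: v)) :> R^o.
  by rewrite -line_quotient scale0r addr0.
case=> df dE; apply: DeriveDef.
- rewrite /derivable; under eq_fun do rewrite E; exact: df.
- by rewrite -dE /derive; under eq_fun do rewrite E.
Qed.

Lemma le_directional f x v (M h : R) : 0 <= h ->
  (forall y, derivable (f : V -> R^o) y v) ->
  (forall y, `|'D_v (f : V -> R^o) y| <= M) ->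
  `|f (x + h *: v) - f x| <= M * h.
Proof.
rewrite le_eqVlt => /predU1P[<- _ _|h0 df dM].
  by rewrite scale0r addr0 subrr normr0 mulr0.
have dg t := is_derive_line (df (x + t *: v)).
have cg : {within `[0, h], continuous (fun s : R => f (x + s *: v))}.
  by apply: continuous_subspaceT => t; exact: is_derive_continuous (dg t).
have [c _] := @MVT _ _ _ 0 h h0 (fun t _ => dg t) cg.
rewrite scale0r addr0 subr0 => ->; rewrite normrM (ger0_norm (ltW h0)).
by rewrite ler_wpM2r// ltW.
Qed.

Lemma derive_eq0_near f x v : (\forall y \near x, f y = 0) ->
  'D_v (f : V -> R^o) x = 0.
Proof.
move=> f0; have fx : f x = 0 by exact: nbhs_singleton f0.
have h0 : \forall h \near (0 : R)^', h^-1 *: (f (h *: v + x) - f x) = 0 :> R^o.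
  have : (fun h : R => h *: v + x) h @[h --> 0^'] --> x.
    rewrite -[X in _ --> X]add0r -[X in _ --> X + _](scale0r v).
    apply: cvgD; last exact: cvg_cst.
    by apply: cvgZl; exact: cvg_within.
  move=> /(_ _ f0) H; near=> h.
  have -> : f (h *: v + x) = 0 by near: h; exact: H.
  by rewrite fx subrr scaler0.
by rewrite /derive; apply/cvg_lim => //; apply: cvg_near_cst.
Unshelve. all: by end_near. Qed.

End directional.

(** * The integral of a partial derivative with compact support *)

Section integral_partial.
Context {R : realType}.
Variable n : nat.
Local Notation leb := (@lebesgue_row R n).
Implicit Types f : 'rV[R]_n -> R.

Lemma integral_shift (f : 'rV[R]_n -> \bar R) (v : 'rV[R]_n) :
  measurable_fun setT f -> (\int[leb]_x f (x + v)%R = \int[leb]_x f x)%E.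
Proof.
move=> mf; rewrite integralE [RHS]integralE.
have E (g : 'rV[R]_n -> \bar R) : measurable_fun setT g -> (forall x, 0 <= g x)%E ->
    (\int[leb]_x g (x + v)%R = \int[leb]_x g x)%E.
  move=> mg g0; have := @integral_leb_affine R n 1 v g ltr01 mg g0.
  rewrite invr1 expr1n mul1e => <-.
  by apply: eq_integral => x _; rewrite scale1r.
have mp : measurable_fun setT (f^\+)%E by exact: measurable_funepos.
have mn : measurable_fun setT (f^\-)%E by exact: measurable_funeneg.
have p0 x : (0 <= (f^\+)%E x)%E by exact: funepos_ge0.
have n0 x : (0 <= (f^\-)%E x)%E by exact: funeneg_ge0.
rewrite -(E _ mp p0) -(E _ mn n0).
by congr (_ - _)%E; apply: eq_integral => x _; rewrite ?funepos.unlock ?funeneg.unlock.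
Qed.

Lemma enorm_lt_box (c : R) (x : 'rV[R]_n) : 0 < c ->
  (forall i, `|x ord0 i| <= c) -> enorm x < n.+1%:R * c.
Proof.
move=> c0 xc; have nc : 0 <= n.+1%:R * c by rewrite mulr_ge0// ltW.
rewrite -(@ltr_pXn2r _ 2%N)// ?nnegrE ?enorm_ge0// sqr_enorm.
apply: (@le_lt_trans _ _ (\sum_(i < n) c ^+ 2)).
  apply: ler_sum => i _; rewrite -real_normK ?num_real// ler_pXn2r//.
  by rewrite nnegrE ltW.
rewrite sumr_const card_ord exprMn -[X in X < _]mulr_natl ltr_pM2r ?exprn_gt0//.
rewrite -natrX ltr_nat; apply: (@leq_trans n.+1) => //.
by rewrite -mulnn leq_pmulr.
Qed.

Lemma integrable_bounded_ball f (r M : R) : measurable_fun setT f ->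
  (forall x, `|f x| <= M) -> (forall x, r <= enorm x -> f x = 0) ->
  leb.-integrable setT (EFin \o f).
Proof.
move=> mf fM f0; have [r0|r0] := leP r 0.
  apply: (eq_integrable _ (EFin \o cst 0)) => //; last exact: integrable0.
  by move=> x _ /=; rewrite f0// (le_trans r0)// enorm_ge0.
have -> : (EFin \o f) = (EFin \o f) \_ (@eball R n r).
  apply/funext => x; rewrite patchE; case: ifPn => //.
  by rewrite notin_setE /eball/= => /negP; rewrite -leNgt => /f0 ->.
apply/(integrable_mkcond _ _).1; first exact: measurable_eball.
apply: measurable_bounded_integrable.
- exact: measurable_eball.
- apply: (@le_lt_trans _ _ (ball_volume n * r ^+ n)%:E); last exact: ltry.
  by rewrite le_eqVlt; apply/orP; left; apply/eqP; exact: leb_eball.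
- exact: measurable_funTS.
- exists M; split; first exact: num_real.
  by move=> y My x _ /=; rewrite (le_trans (fM x))// ltW.
Qed.

Variables (i : 'I_n) (rho : R) (K : set 'rV[R]_n) (f : 'rV[R]_n -> R).
Hypotheses (Kc : compact K) (KB : K `<=` @eball R n rho).
Hypothesis f0 : forall x, ~ K x -> f x = 0.
Hypothesis cf : continuous f.
Let v : 'rV[R]_n := delta_mx ord0 i.
Hypothesis df : forall x, derivable (f : _ -> R^o) x v.
Hypothesis cdf : continuous (partial i f).

Lemma partial_eq0 x : ~ K x -> partial i f x = 0.
Proof.
move=> Kx; apply: derive_eq0_near.
have Kcl : closed K by exact: compact_closed.
have : nbhs x (~` K) by apply: open_nbhs_nbhs; split => //; exact: closed_openC.
by apply: filterS => y; exact: f0.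
Qed.

Lemma partial_bounded : exists M : R, 0 < M /\ forall x, `|partial i f x| <= M.
Proof.
have : compact (partial i f @` K).
  by apply: continuous_compact => //; exact: continuous_subspaceT.
move=> /compact_bounded /ex_strict_bound_gt0 [M M0 HM].
exists M; split => // x; have [Kx|Kx] := pselect (K x).
  by apply/ltW/HM; exists x.
by rewrite partial_eq0// normr0 ltW.
Qed.

Lemma support_bounded : exists M : R, 0 < M /\ forall x, `|f x| <= M.
Proof.
have : compact (f @` K).
  by apply: continuous_compact => //; exact: continuous_subspaceT.
move=> /compact_bounded /ex_strict_bound_gt0 [M M0 HM].
exists M; split => // x; have [Kx|Kx] := pselect (K x).
  by apply/ltW/HM; exists x.
by rewrite f0// normr0 ltW.
Qed.

Let off_ball x : rho <= enorm x -> ~ K x.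
Proof. by move=> xr /KB; rewrite /eball/= ltNge xr. Qed.

(** Difference quotients of f have integral 0 by translation invariance. They are bounded by M on
    one common ball and converge pointwise to the partial derivative, so dominated convergence
    applies. *)
Lemma integral_partial_eq0 : \int[leb]_(x in @eball R n rho) partial i f x = 0.
Proof.
have [M [M0 HM]] := partial_bounded.
have mf : measurable_fun setT f by exact: measurable_continuous_row.
have mp : measurable_fun setT (partial i f) by exact: measurable_continuous_row.
have [M' [M'0 HM']] := support_bounded.
have fi : leb.-integrable setT (EFin \o f).
  by apply: (@integrable_bounded_ball _ rho M') => // x /off_ball /f0.
pose h k : R := k.+1%:R^-1.
have h0 k : 0 < h k by rewrite invr_gt0.
pose g k (x : 'rV[R]_n) : R := (h k)^-1 * (f (x + h k *: v) - f x).
have mfs k : measurable_fun setT (fun x : 'rV[R]_n => f (x + h k *: v)).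
  apply: (measurableT_comp mf).
  have := @measurable_affine_row R n 1 (h k *: v).
  by under eq_fun do rewrite scale1r.
(* A crude radius obtained from coordinates bounded by rho + 1: outside it, f vanishes after any
   shift of at most one unit along v. *)
pose r' : R := n.+1%:R * (rho + 1).
have zs (x : 'rV[R]_n) (t : R) : r' <= enorm x -> 0 <= t <= 1 -> f (x + t *: v) = 0.
  move=> xr t01; apply: contrapT => /eqP fx.
  have Kx : K (x + t *: v).
    by apply: contrapT => /f0 /eqP; rewrite (negbTE fx).
  have xrho := KB Kx; rewrite /eball/= in xrho.
  have rho0 : 0 < rho by rewrite (le_lt_trans _ xrho)// enorm_ge0.
  have : enorm x < r'.
    apply: enorm_lt_box; first by rewrite addr_gt0.
    move=> j; have -> : x ord0 j = (x + t *: v) ord0 j - t * v ord0 j.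
      by rewrite 2!mxE addrK.
    rewrite (le_trans (ler_normB _ _))//; apply: lerD; first exact: (le_trans (le_coor_enorm _ _) (ltW xrho)).
    rewrite mxE/= normrM; case/andP: t01 => t0 t1.
    rewrite ger0_norm// (le_trans _ t1)// -[leRHS]mulr1 ler_wpM2l//.
    by case: (_ == _); rewrite ?normr1 ?normr0.
  by rewrite ltNge xr.
have h1 k : 0 <= h k <= 1.
  by rewrite ltW//= invf_le1// ler1n.
have gi k : leb.-integrable setT (EFin \o g k).
  apply: (@integrable_bounded_ball _ r' M).
  - by apply: measurable_funM => //; exact: measurable_funB.
  - move=> x; rewrite normrM ger0_norm ?invr_ge0 ?(ltW (h0 k))// ler_pdivrMl//.
    by rewrite mulrC; apply: le_directional => //; exact: ltW.
  - move=> x xr; rewrite /g zs// -[x]addr0 -[X in f (_ + X)](scale0r v) zs ?subrr ?mulr0//.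
    by rewrite lexx ler01.
have fsi k : leb.-integrable setT (EFin \o (fun x : 'rV[R]_n => f (x + h k *: v))).
  by apply: (@integrable_bounded_ball _ r' M') => // x xr; exact: zs.
have Ig0 k : (\int[leb]_x (g k x)%:E = 0)%E.
  under eq_integral do rewrite EFinM.
  rewrite integralZl//; last exact: (integrableB_real measurableT (fsi k) fi).
  under eq_integral do rewrite EFinB.
  rewrite (integralB measurableT (fsi k) fi).
  rewrite (integral_shift (h k *: v) (measurable_int _ fi)).
  by rewrite subee ?mule0//; exact: integrable_fin_num fi.
have di : leb.-integrable setT (EFin \o (fun x : 'rV[R]_n => M * \1_(@eball R n r') x)).
  apply: (@integrable_bounded_ball _ r' M).
  - by apply: measurable_funM => //; apply: measurable_indic; exact: measurable_eball.
  - move=> x; rewrite indicE; case: (_ \in _); rewrite ?mulr1 ?mulr0 ?normr0 ?(ltW M0)//.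
    by rewrite ger0_norm// ltW.
  - by move=> x xr; rewrite indicE memNset ?mulr0//= /eball/= ltNge xr.
have gd x : g ^~ x @ \oo --> partial i f x.
  have hk : h k @[k --> \oo] --> (0 : R) by exact: cvg_harmonic.
  have hk' : h k @[k --> \oo] --> (0 : R)^'.
    move=> A /hk [N _ HN]; exists N => // k /HN /=; apply.
    exact: lt0r_neq0.
  have dfx : (t^-1 *: (f (t *: v + x) - f x) : R^o) @[t --> (0 : R)^'] -->
      (partial i f x : R^o).
    exact: (@df x).
  have := cvg_comp _ _ hk' dfx; rewrite /comp.
  by under eq_fun do rewrite (addrC _ x).
have pz x : rho <= enorm x -> partial i f x = 0.
  by move=> /off_ball; exact: partial_eq0.
have [||||_ _ Icvg] := @dominated_convergence _ _ _ leb setT measurableT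
  (fun k => EFin \o g k) (EFin \o partial i f)
  (EFin \o (fun x : 'rV[R]_n => M * \1_(@eball R n r') x)) _ _ _ di.
- by move=> k; exact: measurable_int (gi k).
- exact/measurable_EFinP.
- by apply: aeW => x _; apply: cvg_EFin; [exact: nearW|exact: gd].
- apply: aeW => x k _ /=; rewrite lee_fin indicE.
  have [xr|xr] := ltP (enorm x) r'.
    rewrite mem_set// mulr1 normrM ger0_norm ?invr_ge0 ?(ltW (h0 k))//.
    by rewrite ler_pdivrMl// mulrC; apply: le_directional => //; exact: ltW.
  rewrite /g zs// -[x]addr0 -[X in f (_ + X)](scale0r v) zs ?subrr ?mulr0 ?normr0//.
    by rewrite mulr_ge0// ltW.
  by rewrite lexx ler01.
rewrite /Rintegral integral_mkcond.
rewrite (_ : (fun x => (partial i f x)%:E) \_ _ = EFin \o partial i f); last first.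
  apply/funext => x; rewrite patchE; case: ifPn => //.
  by rewrite notin_setE /eball/= => /negP; rewrite -leNgt => /pz ->.
have : (\int[leb]_x (g k x)%:E)%E @[k --> \oo] --> 0%:E.
  by under eq_fun do rewrite Ig0; exact: cvg_cst.
by move=> I0; have := cvg_unique _ Icvg I0; rewrite /= => ->.
Qed.

End integral_partial.

Section pushforward_finite.
Context d d' (T1 : measurableType d) (T2 : measurableType d') {R : realType}.
Variables (m : {finite_measure set T1 -> \bar R}) (f : T1 -> T2).
Hypothesis mf : measurable_fun setT f.

(** A named copy of the image measure, which carries the structure of a finite measure needed to
    apply the Radon-Nikodym theorem. *)
Definition finite_pushforward := pushforward m f.

Let mf_pre (A : set T2) : measurable A -> measurable (f @^-1` A).
Proof. by move=> mA; rewrite -[X in measurable X]setTI; exact: mf. Qed.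

Let push0 : finite_pushforward set0 = 0%E.
Proof. by rewrite /finite_pushforward /pushforward preimage_set0 measure0. Qed.

Let push_ge0 (A : set T2) : (0 <= finite_pushforward A)%E.
Proof. exact: measure_ge0. Qed.

Let push_sigma_additive : semi_sigma_additive finite_pushforward.
Proof.
move=> F mF tF mUF; rewrite /finite_pushforward /pushforward preimage_bigcup.
apply: measure_semi_sigma_additive.
- by move=> k; exact: mf_pre.
- apply/trivIsetP => /= i j _ _ ij; rewrite -preimage_setI.
  by move/trivIsetP : tF => /(_ _ _ _ _ ij) ->//; rewrite preimage_set0.
- by rewrite -preimage_bigcup; exact: mf_pre.
Qed.

HB.instance Definition _ := isMeasure.Build _ _ _
  finite_pushforward push0 push_ge0 push_sigma_additive.

Let push_fin : fin_num_fun finite_pushforward.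
Proof. by move=> A mA; apply: fin_num_measure; exact: mf_pre. Qed.

HB.instance Definition _ := @Measure_isFinite.Build _ _ _ finite_pushforward push_fin.

Definition finite_pushforward_measure : {finite_measure set T2 -> \bar R} :=
  finite_pushforward.

Lemma integral_finite_pushforward (h : T2 -> \bar R) : measurable_fun setT h ->
  (forall y, 0 <= h y)%E ->
  (\int[finite_pushforward_measure]_y h y = \int[m]_x h (f x))%E.
Proof.
move=> mh h0; transitivity (\int[pushforward m f]_y h y)%E.
  by apply: eq_measure_integral.
by rewrite ge0_integral_pushforward// => y _; exact: h0.
Qed.

End pushforward_finite.

(** * Projection of measures onto the radius *)

Section radial_projection.
Context {R : realType}.
Local Notation mu := (@lebesgue_measure R).
Variables (n : nat) (rho : R).
Hypotheses (n0 : (0 < n)%N) (rho0 : 0 < rho).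
Local Notation leb := (@lebesgue_row R n).
Local Notation B := (@eball R n rho).
Local Notation I := (`]0, rho[%classic : set R).

Lemma leb_enorm_null (A : set R) : measurable A -> mu A = 0%E ->
  leb (B `&` (@enorm R n) @^-1` A) = 0%E.
Proof.
move=> mA A0.
have mB := @measurable_eball R n rho.
have mE : measurable ((@enorm R n) @^-1` A).
  by rewrite -[X in measurable X]setTI; exact: measurable_enorm.
transitivity (\int[leb]_(x in B) (\1_A (enorm x))%:E)%E.
  by rewrite setIC; apply/esym; exact: (integral_indic leb mB mE).
rewrite (@integral_radial R n rho n0 (fun r => (\1_A r)%:E))//; last first.
  exact/measurable_EFinP.
transitivity (\int[mu]_(r in I `&` A) (ball_volume n * n%:R * r ^+ n.-1)%:E)%E.
  rewrite integral_mkcondr; apply: eq_integral => r _.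
  by rewrite patchE indicE; case: (r \in A); rewrite ?mul1e ?mul0e.
apply: null_set_integral.
- exact: measurableI.
- by apply: measurable_funTS; apply/measurable_EFinP; apply: measurable_funM.
- by apply: subset_measure0 A0 => //; exact: measurableI.
Qed.

(** By [leb_enorm_null] the image of F dx under [enorm] charges no null set of the line; f is its
    Radon-Nikodym derivative. *)
Let ge0_projection (F : 'rV[R]_n -> R) : (forall x, 0 <= F x) ->
  leb.-integrable setT (EFin \o F) -> (forall x, ~ B x -> F x = 0) ->
  exists f : R -> R, [/\ mu.-integrable setT (EFin \o f), forall r, 0 <= f r &
    forall h : R -> \bar R, measurable_fun setT h -> (forall r, 0 <= h r)%E ->
      (\int[leb]_x (h (enorm x) * (F x)%:E) = \int[mu]_r (h r * (f r)%:E))%E].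
Proof.
move=> F0 Fi FB.
have mphi : measurable_fun setT (@enorm R n : _ -> measurableTypeR R).
  exact: measurable_enorm.
pose D := @dens_measure _ _ R leb F F0 Fi.
pose m0 := finite_pushforward_measure D mphi.
have m0mu : m0 `<< mu.
  apply/null_content_dominatesP => A mA muA0.
  rewrite /m0 /= /finite_pushforward /pushforward /D /= /dens.
  have mB := @measurable_eball R n rho.
  have mE : measurable ((@enorm R n) @^-1` A).
    by rewrite -[X in measurable X]setTI; exact: measurable_enorm.
  transitivity (\int[leb]_(x in (@enorm R n) @^-1` A `&` B) (F x)%:E)%E.
    rewrite integral_mkcondr; apply: eq_integral => x _.
    by rewrite patchE; case: ifPn => //; rewrite notin_setE => /FB ->.
  apply: null_set_integral.
  - exact: measurableI.
  - by apply: measurable_funTS; exact: measurable_int Fi.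
  - by rewrite setIC; exact: leb_enorm_null.
have RNfin := Radon_Nikodym_SigmaFinite.f_fin_num m0mu.
have RN0 := Radon_Nikodym_SigmaFinite.f_ge0 m0mu.
pose f r := fine (Radon_Nikodym_SigmaFinite.f m0 mu r).
have fE : EFin \o f = Radon_Nikodym_SigmaFinite.f m0 mu.
  by apply/funext => r; rewrite /f /= fineK.
exists f; split.
- by rewrite fE; exact: Radon_Nikodym_SigmaFinite.f_integrable m0mu.
- by move=> r; rewrite /f fine_ge0.
- move=> h mh h0; transitivity (\int[D]_x h (enorm x))%E.
    rewrite (@integral_dens _ _ R leb F F0 Fi (fun x => h (enorm x)))//.
    exact: measurableT_comp.
  rewrite -(integral_finite_pushforward D mphi)//.
  rewrite -(Radon_Nikodym_SigmaFinite.change_of_variables m0mu)//.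
  by apply: eq_integral => r _; rewrite -fE.
Qed.

(* [g] is the density, against dr, of the image under enorm of the measure    *)
(* F dx.                                                                      *)
Lemma radial_projection (F : 'rV[R]_n -> R) :
  leb.-integrable B (EFin \o F) ->
  exists2 g : R -> R, mu.-integrable I (EFin \o g) &
    forall (h : R -> R) (C : R), measurable_fun setT h -> (forall r, `|h r| <= C) ->
      h 0 = 0 ->
      \int[leb]_(x in B) (h (enorm x) * F x) = \int[mu]_(r in I) (h r * g r).
Proof.
move=> Fi; have mB := @measurable_eball R n rho.
pose F' : 'rV[R]_n -> R := F \_ B.
have Fi' : leb.-integrable setT (EFin \o F').
  by rewrite -restrict_EFin; apply/(integrable_mkcond _ _).1.
have FB x : ~ B x -> F' x = 0 by move=> Bx; rewrite /F' patchE memNset.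
pose Fp (x : 'rV[R]_n) : R := Num.max (F' x) 0.
pose Fn (x : 'rV[R]_n) : R := Num.max (- F' x) 0.
have FE x : F' x = Fp x - Fn x.
  by rewrite /Fp /Fn /Num.max; case: (ltP (F' x) 0) => h1; case: (ltP (- F' x) 0) => h2; lra.
have mF' := integrable_measurableR Fi'.
have Fpi : leb.-integrable setT (EFin \o Fp).
  apply: (le_integrableR _ _ _ Fi') => //; first exact: measurable_maxr.
  by move=> x _; rewrite /Fp /Num.max; case: ltP => // ?; rewrite normr0.
have Fni : leb.-integrable setT (EFin \o Fn).
  apply: (le_integrableR _ _ _ Fi') => //.
    by apply: measurable_maxr => //; exact: measurableT_comp.
  by move=> x _; rewrite /Fn /Num.max; case: ltP => // ?; rewrite ?normrN// normr0.
have [||fp [fpi fp0 fpE]] := ge0_projection _ Fpi.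
- by move=> x; rewrite /Fp le_max lexx orbT.
- by move=> x /FB; rewrite /Fp => ->; rewrite maxxx.
have [||fn [fni fn0 fnE]] := ge0_projection _ Fni.
- by move=> x; rewrite /Fn le_max lexx orbT.
- by move=> x /FB; rewrite /Fn => ->; rewrite oppr0 maxxx.
(* For a bounded H of any sign, H + C and the constant C are both nonnegative, and the identity for
   C is subtracted from the one for H + C. *)
have Q (G : 'rV[R]_n -> R) (k H : R -> R) (C : R) :
    leb.-integrable setT (EFin \o G) -> mu.-integrable setT (EFin \o k) ->
    (forall h : R -> \bar R, measurable_fun setT h -> (forall r, 0 <= h r)%E ->
      (\int[leb]_x (h (enorm x) * (G x)%:E) = \int[mu]_r (h r * (k r)%:E))%E) ->
    measurable_fun setT H -> (forall r, `|H r| <= C) ->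
    \int[leb]_x (H (enorm x) * G x) = \int[mu]_r (H r * k r).
  move=> Gi ki GkE mH HC.
  have pos (h : R -> R) : measurable_fun setT h -> (forall r, 0 <= h r) ->
      \int[leb]_x (h (enorm x) * G x) = \int[mu]_r (h r * k r).
    move=> mh h0; rewrite /Rintegral; congr fine.
    by apply: (GkE (EFin \o h)) => //; exact/measurable_EFinP.
  have HCi : measurable_fun setT (fun r => H r + C) by exact: measurable_funD.
  have C0 : 0 <= C by exact: le_trans (normr_ge0 _) (HC 0).
  have HC0 r : 0 <= H r + C.
    by have := HC r; rewrite ler_norml => /andP[]; lra.
  have E1 := pos _ HCi HC0.
  have E2 := pos (fun=> C) (measurable_cst _) (fun=> C0).
  have mHe : measurable_fun setT (fun x : 'rV[R]_n => H (enorm x)).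
    by apply: measurableT_comp => //; exact: measurable_enorm.
  have i1 : leb.-integrable setT (EFin \o (fun x => H (enorm x) * G x)).
    exact: (integrableM_bounded _ mHe (fun x _ => HC (enorm x))).
  have i2 : mu.-integrable setT (EFin \o (fun r => H r * k r)).
    by apply: (@integrableM_bounded _ _ _ mu setT measurableT C k H).
  have i3 : leb.-integrable setT (EFin \o (fun x => C * G x)).
    exact: integrableZ_real.
  have i4 : mu.-integrable setT (EFin \o (fun r => C * k r)).
    exact: integrableZ_real.
  move: E1; under eq_Rintegral do rewrite mulrDl.
  under [in RHS]eq_Rintegral do rewrite mulrDl.
  by rewrite RintegralD// RintegralD// E2 => /addIr.
pose g r := fp r - fn r.
have gi : mu.-integrable setT (EFin \o g) by exact: integrableB_real.
exists g; first exact: integrableS gi.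
move=> h C mh hC h0.
pose H : R -> R := h \_ I.
have mH : measurable_fun setT H.
  by apply/(measurable_restrictT _ _).1 => //; exact: measurable_funTS.
have HC r : `|H r| <= C.
  rewrite /H patchE; case: ifPn => // _; rewrite normr0.
  exact: le_trans (normr_ge0 _) (hC 0).
have mHe : measurable_fun setT (fun x : 'rV[R]_n => H (enorm x)).
  by apply: measurableT_comp => //; exact: measurable_enorm.
have ip : leb.-integrable setT (EFin \o (fun x => H (enorm x) * Fp x)).
  exact: (integrableM_bounded _ mHe (fun x _ => HC (enorm x))).
have in_ : leb.-integrable setT (EFin \o (fun x => H (enorm x) * Fn x)).
  exact: (integrableM_bounded _ mHe (fun x _ => HC (enorm x))).
transitivity (\int[leb]_x (H (enorm x) * Fp x - H (enorm x) * Fn x)).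
  rewrite [LHS]Rintegral_mkcond; apply: eq_Rintegral => x _.
  rewrite -mulrBr -FE patchE; case: ifPn => [/set_mem Bx|/negP Bx]; last first.
    by rewrite FB ?mulr0// => /mem_set.
  rewrite /F' patchE mem_set//; congr (_ * _).
  (* The ball contains the origin but the interval does not contain 0; the condition h 0 = 0 settles
     this point. *)
  rewrite /H patchE; case: ifPn => //; rewrite notin_setE/= in_itv/= => /negP.
  move: Bx; rewrite /eball/= => ->; rewrite andbT -leNgt => xle0.
  by rewrite (_ : enorm x = 0) ?h0//; apply/le_anti; rewrite xle0 enorm_ge0.
rewrite RintegralB// (Q Fp fp H C)// (Q Fn fn H C)//.
rewrite -RintegralB//; last 2 first.
- by apply: (@integrableM_bounded _ _ _ mu setT measurableT C fp H).
- by apply: (@integrableM_bounded _ _ _ mu setT measurableT C fn H).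
rewrite [RHS]Rintegral_mkcond; apply: eq_Rintegral => r _.
rewrite -mulrBr patchE /H patchE; case: ifPn => // _; exact: mul0r.
Qed.

End radial_projection.

(** * Calculus rules for directional derivatives *)

Section chain_rule.
Context {R : realType} {V : normedModType R}.
Implicit Types (f g : V -> R) (x v : V).

Lemma is_derive_lineP f x v d : is_derive x v (f : V -> R^o) d ->
  is_derive (0 : R) (1 : R) (fun s => f (x + s *: v)) d.
Proof.
case=> df dE; have := @is_derive_line _ _ f x v 0.
by rewrite scale0r addr0 dE => /(_ df).
Qed.

Lemma is_derive_chain (k : R -> R) f x v d d' : is_derive x v (f : V -> R^o) d ->
  is_derive (f x) (1 : R) k d' -> is_derive x v ((fun y => k (f y)) : V -> R^o) (d' * d).
Proof.
move=> /is_derive_lineP fd kd; apply: line_derivable.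
apply: (@is_derive_comp _ k (fun s : R => f (x + s *: v))) => //.
by rewrite scale0r addr0.
Qed.

Lemma is_derive_mul f g x v d d' : is_derive x v (f : V -> R^o) d ->
  is_derive x v (g : V -> R^o) d' ->
  is_derive x v ((fun y => f y * g y) : V -> R^o) (d * g x + f x * d').
Proof.
move=> /is_derive_lineP fd /is_derive_lineP gd; apply: line_derivable.
have := is_deriveM_fun fd gd; by rewrite scale0r addr0.
Qed.

Lemma is_derive_add f g x v d d' : is_derive x v (f : V -> R^o) d ->
  is_derive x v (g : V -> R^o) d' ->
  is_derive x v ((fun y => f y + g y) : V -> R^o) (d + d').
Proof.
move=> /is_derive_lineP fd /is_derive_lineP gd; exact: (line_derivable (is_deriveD_fun fd gd)).
Qed.

Lemma is_derive_const (k : R) x v : is_derive x v ((fun=> k) : V -> R^o) 0.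
Proof. exact: is_derive_cst. Qed.

Lemma is_derive_sum_fun (J : Type) (s : seq J) (f : J -> V -> R) (d : J -> R) x v :
  (forall j, is_derive x v (f j : V -> R^o) (d j)) ->
  is_derive x v ((fun y => \sum_(j <- s) f j y) : V -> R^o) (\sum_(j <- s) d j).
Proof.
move=> fd; elim: s => [|j s IH].
  by rewrite big_nil; under eq_fun do rewrite big_nil; exact: is_derive_const.
by rewrite big_cons; under eq_fun do rewrite big_cons; exact: is_derive_add.
Qed.

End chain_rule.

Lemma continuousM_fun {R : realType} {T : topologicalType} (f g : T -> R) :
  continuous f -> continuous g -> continuous (fun x => f x * g x).
Proof. by move=> cf cg x; exact: (continuousM (cf x) (cg x)). Qed.

Lemma continuousD_fun {R : realType} {T : topologicalType} (f g : T -> R) :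
  continuous f -> continuous g -> continuous (fun x => f x + g x).
Proof. by move=> cf cg x; exact: (continuousD (cf x) (cg x)). Qed.

Lemma continuous_sum_fun {R : realType} {T : topologicalType} (J : Type) (s : seq J)
    (f : J -> T -> R) : (forall j, continuous (f j)) ->
  continuous (fun x => \sum_(j <- s) f j x).
Proof.
move=> fc; elim: s => [|j s IH] x.
  by under eq_fun do rewrite big_nil; exact: cvg_cst.
under eq_fun do rewrite big_cons.
by apply: cvgD; [exact: fc|exact: IH].
Qed.

Section coordinates.
Context {R : realType} {n : nat}.
Implicit Types x v : 'rV[R]_n.

Definition sqn x : R := \sum_(i < n) x ord0 i ^+ 2.
Definition dot x v : R := \sum_(i < n) x ord0 i * v ord0 i.

Lemma enorm_sqn x : enorm x ^+ 2 = sqn x.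
Proof. exact: sqr_enorm. Qed.

Lemma is_derive_coord (i : 'I_n) x v :
  is_derive x v ((fun y : 'rV[R]_n => y ord0 i) : _ -> R^o) (v ord0 i).
Proof.
apply: line_derivable.
rewrite (_ : (fun s : R => _) = (fun s : R => x ord0 i + v ord0 i * s)); last first.
  by apply/funext => s; rewrite !mxE mulrC.
rewrite -[X in is_derive _ _ _ X]add0r; apply: is_deriveD_fun.
by rewrite -[X in is_derive _ _ _ X]mulr1; apply: is_derive_cmul.
Qed.

Lemma is_derive_sqn x v : is_derive x v (sqn : 'rV[R]_n -> R^o) (2 * dot x v).
Proof.
rewrite /sqn /dot mulr_sumr; apply: is_derive_sum_fun => i.
rewrite (_ : 2 * _ = v ord0 i * x ord0 i + x ord0 i * v ord0 i); last by ring.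
apply: is_derive_mul; exact: is_derive_coord.
Qed.

Lemma continuous_coord (i : 'I_n) : continuous (fun x : 'rV[R]_n => x ord0 i).
Proof. exact: coord_continuous. Qed.

Lemma continuous_sqn : continuous (sqn : 'rV[R]_n -> R).
Proof.
apply: continuous_sum_fun => i x.
apply: (@continuous_comp _ _ _ (fun y : 'rV[R]_n => y ord0 i) (fun r : R => r ^+ 2)).
  exact: continuous_coord.
exact: exprn_continuous.
Qed.

Lemma dot_delta x (i : 'I_n) : dot x (delta_mx ord0 i) = x ord0 i.
Proof.
rewrite /dot (bigD1 i)//= mxE !eqxx mulr1 big1 ?addr0// => j ji.
by rewrite mxE (negbTE ji) andbF mulr0.
Qed.

End coordinates.

(** * Integration by parts against test functions *)

Section test_functions.
Context {R : realType} {n : nat}.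
Local Notation leb := (@lebesgue_row R n).
Implicit Types (phi psi : 'rV[R]_n -> R) (Om : set 'rV[R]_n).

Lemma test_function_facts Om phi : test_function Om phi ->
  exists K : set 'rV[R]_n, [/\ compact K, K `<=` Om, forall x, ~ K x -> phi x = 0,
    continuous phi & forall v, (forall x, derivable (phi : _ -> R^o) x v) /\
      continuous ('D_v (phi : _ -> R^o))].
Proof.
move=> [Ckphi cK KOm]; exists (closure [set x | phi x != 0]); split => //.
- move=> x Kx; apply: contrapT => /eqP px; apply: Kx; exact: subset_closure.
- by have [] := Ckphi 0%N.
- by move=> v; have [_ /(_ v)[dphi [cphi _]]] := Ckphi 1%N.
Qed.

Definition C1_dir (i : 'I_n) psi :=
  [/\ continuous psi, forall x, derivable (psi : _ -> R^o) x (delta_mx ord0 i) &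
      continuous (partial i psi)].

Lemma compact_support_integrable (rho : R) (K : set 'rV[R]_n) psi : compact K ->
  K `<=` @eball R n rho -> (forall x, ~ K x -> psi x = 0) -> continuous psi ->
  leb.-integrable (@eball R n rho) (EFin \o psi).
Proof.
move=> Kc KB K0 cpsi; have [M [M0 HM]] := support_bounded Kc K0 cpsi.
apply: (@integrableS _ _ _ _ setT) => //; first exact: measurable_eball.
apply: (@integrable_bounded_ball _ _ _ rho M) => //.
  exact: measurable_continuous_row.
by move=> x xr; apply: K0 => /KB; rewrite /eball/= ltNge xr.
Qed.

(** [integral_partial_eq0] applied to the product phi psi, whose support is that of phi. *)
Lemma test_function_ibp (rho : R) phi psi (i : 'I_n) :
  test_function (@eball R n rho) phi -> C1_dir i psi ->
  [/\ leb.-integrable (@eball R n rho) (EFin \o (fun x => phi x * partial i psi x)),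
      leb.-integrable (@eball R n rho) (EFin \o (fun x => partial i phi x * psi x)) &
      \int[leb]_(x in @eball R n rho) (phi x * partial i psi x) =
      - \int[leb]_(x in @eball R n rho) (partial i phi x * psi x)].
Proof.
move=> /test_function_facts[K [Kc KB K0 cphi /(_ (delta_mx ord0 i))[dphi cdphi]]].
move=> [cpsi dpsi cdpsi].
have pphi0 x : ~ K x -> partial i phi x = 0 by exact: (partial_eq0 i Kc K0).
have i1 : leb.-integrable (@eball R n rho)
    (EFin \o (fun x => phi x * partial i psi x)).
  apply: (compact_support_integrable Kc KB) => [x /K0 ->|]; first by rewrite mul0r.
  exact: continuousM_fun.
have i2 : leb.-integrable (@eball R n rho)
    (EFin \o (fun x => partial i phi x * psi x)).
  apply: (compact_support_integrable Kc KB) => [x /pphi0 ->|]; first by rewrite mul0r.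
  exact: continuousM_fun.
split => //; apply/eqP; rewrite -addr_eq0 addrC -RintegralD//; last exact: measurable_eball.
have dM x : is_derive x (delta_mx ord0 i) ((fun y => phi y * psi y) : _ -> R^o)
    (partial i phi x * psi x + phi x * partial i psi x).
  by apply: is_derive_mul; apply: DeriveDef.
have pM : partial i (fun y => phi y * psi y) =
    fun x => partial i phi x * psi x + phi x * partial i psi x.
  by apply/funext => x; have [_] := dM x.
rewrite -pM; apply/eqP; apply: (integral_partial_eq0 Kc KB).
- by move=> x /K0 ->; rewrite mul0r.
- exact: continuousM_fun.
- by move=> x; have [] := dM x.
- by rewrite pM; apply: continuousD_fun; exact: continuousM_fun.
Qed.

End test_functions.

Lemma Rintegral_sum_seq d (T : measurableType d) (R : realType)
    (mu : {measure set T -> \bar R}) (D : set T) (mD : measurable D)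
    (J : Type) (s : seq J) (f : J -> T -> R) :
  (forall j, mu.-integrable D (EFin \o f j)) ->
  mu.-integrable D (EFin \o (fun x => \sum_(j <- s) f j x)) /\
  \int[mu]_(x in D) (\sum_(j <- s) f j x) = \sum_(j <- s) \int[mu]_(x in D) f j x.
Proof.
move=> fi; elim: s => [|j s [IHi IHE]].
  have E x : \sum_(j <- [::]) f j x = 0 by rewrite big_nil.
  split.
    by rewrite (_ : _ \o _ = cst 0%E); [exact: integrable0|apply/funext => x /=; rewrite E].
  under eq_Rintegral do rewrite E; rewrite big_nil /Rintegral.
  by rewrite integral0.
have E x : \sum_(k <- j :: s) f k x = f j x + \sum_(k <- s) f k x by rewrite big_cons.
split.
  rewrite (_ : _ \o _ = EFin \o (fun x => f j x + \sum_(k <- s) f k x)).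
    exact: integrableD_real.
  by apply/funext => x /=; rewrite E.
under eq_Rintegral do rewrite E.
by rewrite RintegralD// IHE big_cons.
Qed.

(** Young's inequality with a free parameter. It does the work of the Cauchy-Schwarz inequality
    below: over a set of finite measure, an L^2 error of order e^2 gives an L^1 error of order e. *)
Lemma le_norm_amgm (R : realType) (e t : R) : 0 < e -> `|t| <= e + t ^+ 2 / e.
Proof.
move=> e0; have [te|et] := leP `|t| e.
  by rewrite (le_trans te)// lerDl divr_ge0 ?sqr_ge0// ltW.
rewrite -[leLHS]add0r lerD// ?(ltW e0)// ler_pdivlMr//.
by rewrite -[leRHS]real_normK ?num_real// expr2 ler_wpM2l// ltW.
Qed.

(** * Radial functions and their profiles *)

Section radial_functions.
Context {R : realType}.
Local Notation mu := (@lebesgue_measure R).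
Variables (n : nat) (rho : R).
Hypotheses (n0 : (0 < n)%N) (rho0 : 0 < rho).
Local Notation leb := (@lebesgue_row R n).
Local Notation B := (@eball R n rho).
Local Notation I := (`]0, rho[%classic : set R).
Local Notation c := (@ball_volume R n * n%:R).
Implicit Types f u : R -> R.

Lemma ball_const_gt0 : 0 < c.
Proof. by rewrite mulr_gt0 ?ball_volume_gt0// ltr0n. Qed.

Let mB := @measurable_eball R n rho.

(** The profile is recovered by composing with the half line r -> r e, where e is a coordinate
    vector. *)
Lemma measurable_profile f : measurable_fun B (fun x => f (enorm x)) ->
  measurable_fun I f.
Proof.
move=> mf; pose e : 'rV[R]_n := delta_mx ord0 (Ordinal n0).
pose s (r : R) := r *: e.
have en r : 0 < r -> enorm (s r) = r.
  move=> r0; rewrite enormZ gtr0_norm// (_ : enorm e = 1) ?mulr1//.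
  rewrite /enorm (bigD1 (Ordinal n0))//= mxE !eqxx expr1n big1 ?addr0 ?sqrtr1// => j ji.
  by rewrite mxE (negbTE ji) andbF expr0n.
have ms : measurable_fun setT s.
  apply: measurable_fun_row => i; under eq_fun do rewrite mxE.
  exact: measurable_funM.
apply: (@eq_measurable_fun _ _ _ _ _ ((fun x => f (enorm x)) \o s)).
  by move=> r; rewrite inE/= in_itv/= => /andP[r0 _]; rewrite en.
apply: (measurable_comp mB _ mf).
  by move=> _ [r + <-]; rewrite /= in_itv/= => /andP[r0 rr]; rewrite /eball/= en.
exact: measurable_funTS.
Qed.

Let pI f : measurable_fun I f -> measurable_fun setT (f \_ I).
Proof. by move=> mf; apply/(measurable_restrictT _ _).1. Qed.

(** Cutting the profile off to ]0, rho[ changes the radial function at most at the origin. *)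
Let pB f : {ae leb, forall x, B x -> f (enorm x) = (f \_ I) (enorm x)}.
Proof.
exists (B `&` (@enorm R n) @^-1` [set 0]); split.
- apply: measurableI => //; rewrite -[X in measurable X]setTI.
  exact: measurable_enorm.
- by apply: leb_enorm_null => //; rewrite lebesgue_measure_set1.
move=> x /= H; have [Bx|Bx] := pselect (B x); last by exfalso; apply: H.
split => //; apply: contrapT => /eqP x0; apply: H => _.
rewrite patchE mem_set//= in_itv/= lt_neqAle eq_sym x0 enorm_ge0.
exact: Bx.
Qed.

Lemma radial_integrable f : measurable_fun B (fun x => f (enorm x)) ->
  leb.-integrable B (EFin \o (fun x => f (enorm x))) <->
  mu.-integrable I (EFin \o (fun r => f r * r ^+ n.-1)).
Proof.
move=> mf; have mI := measurable_profile mf.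
have mp : measurable_fun I (fun r => f r * r ^+ n.-1) by exact: measurable_funM.
have E : (\int[leb]_(x in B) `|(EFin \o (fun x => f (enorm x))) x| =
   c%:E * \int[mu]_(x in I) `|(EFin \o (fun r => (f r * r ^+ n.-1)%R)) x|)%E.
  transitivity (\int[leb]_(x in B) (`|(f \_ I) (enorm x)|%:E))%E.
    apply: ae_eq_integral => //.
    - by apply: measurableT_comp => //; exact/measurable_EFinP.
    - apply/measurable_EFinP/measurable_funTS; apply: measurableT_comp => //.
      by apply: measurableT_comp; [exact: pI|exact: measurable_enorm].
    - by apply: filterS (pB f) => x H Bx /=; rewrite H.
  rewrite (@integral_radial R n rho n0 (fun r => `|(f \_ I) r|%:E))//; last first.
    by apply/measurable_EFinP; apply: measurableT_comp => //; exact: pI.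
  rewrite -ge0_integralZl//; last 2 first.
  - by apply: measurableT_comp => //; exact/measurable_EFinP.
  - by rewrite lee_fin ltW// ball_const_gt0.
  apply: eq_integral => r /set_mem rI; rewrite patchE mem_set//=.
  have r0 : 0 < r by move: rI; rewrite /= in_itv/= => /andP[].
  by rewrite -!EFinM normrM (ger0_norm (exprn_ge0 _ (ltW r0))); congr EFin; ring.
have X0 : (0 <= \int[mu]_(x in I) `|(EFin \o (fun r => (f r * r ^+ n.-1)%R)) x|)%E.
  exact: integral_ge0.
split=> /integrableP[_ foo]; apply/integrableP; split; try exact/measurable_EFinP.
  move: foo; rewrite E; move: X0.
  case: (\int[mu]_(x in I) _)%E => [r _ _|_|//]; first by rewrite ltry.
  by rewrite gt0_muley// lte_fin ball_const_gt0.
by rewrite E lte_mul_pinfty// lee_fin ltW// ball_const_gt0.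
Qed.

Lemma radial_Rintegral f : measurable_fun B (fun x => f (enorm x)) ->
  mu.-integrable I (EFin \o (fun r => f r * r ^+ n.-1)) ->
  \int[leb]_(x in B) f (enorm x) = c * \int[mu]_(r in I) (f r * r ^+ n.-1).
Proof.
move=> mf fi; have mI := measurable_profile mf.
pose g : R -> R := f \_ I; have mg : measurable_fun setT g by exact: pI.
pose gp r := Num.max (g r) 0; pose gn r := Num.max (- g r) 0.
have gE r : g r = gp r - gn r.
  by rewrite /gp /gn /Num.max; case: (ltP (g r) 0) => h1; case: (ltP (- g r) 0) => h2; lra.
have gp0 r : 0 <= gp r by rewrite /gp le_max lexx orbT.
have gn0 r : 0 <= gn r by rewrite /gn le_max lexx orbT.
have mgp : measurable_fun setT gp by exact: measurable_maxr.
have mgn : measurable_fun setT gn.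
  by apply: measurable_maxr => //; exact: measurableT_comp.
have gpg r : gp r <= `|g r|.
  by rewrite /gp ge_max ler_norm normr_ge0.
have gng r : gn r <= `|g r|.
  by rewrite /gn ge_max -normrN ler_norm normr_ge0.
have Rp (h : R -> R) : measurable_fun setT h -> (forall r, 0 <= h r) ->
    (forall r, h r <= `|g r|) ->
    [/\ mu.-integrable I (EFin \o (fun r => h r * r ^+ n.-1)),
     leb.-integrable B (EFin \o (fun x => h (enorm x))) &
     \int[leb]_(x in B) h (enorm x) = c * \int[mu]_(r in I) (h r * r ^+ n.-1)].
  move=> mh h0 hg.
  have mhB : measurable_fun B (fun x => h (enorm x)).
    by apply: measurable_funTS; apply: measurableT_comp => //; exact: measurable_enorm.
  have hi : mu.-integrable I (EFin \o (fun r => h r * r ^+ n.-1)).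
    apply: (le_integrableR _ _ _ fi) => //.
      by apply: measurable_funM => //; exact: measurable_funTS.
    move=> r rI; rewrite !normrM ler_wpM2r// (ger0_norm (h0 r)).
    by rewrite (le_trans (hg r))// /g patchE mem_set.
  split => //; first exact/radial_integrable.
  rewrite /Rintegral (@integral_radial R n rho n0 (EFin \o h))//; last first.
  exact/measurable_EFinP.
  rewrite -[c in RHS]/(fine c%:E) -fineM//; last exact: integrable_fin_num hi.
  rewrite -integralZl//; congr fine; apply: eq_integral => r _ /=.
  by rewrite -!EFinM; congr EFin; ring.
have [pi pB' pE] := Rp _ mgp gp0 gpg.
have [ni nB' nE] := Rp _ mgn gn0 gng.
transitivity (\int[leb]_(x in B) (gp (enorm x) - gn (enorm x))).
  apply: eq_ae_Rintegral => //.
  - by apply: measurable_funB; [exact: integrable_measurableR pB'|exact: integrable_measurableR nB'].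
  - by apply: filterS (pB f) => x H Bx; rewrite H// -gE.
rewrite RintegralB// pE nE -mulrBr; congr (_ * _).
rewrite -RintegralB//; apply: eq_Rintegral => r /set_mem rI.
by rewrite -mulrBl -gE /g patchE mem_set.
Qed.

Lemma eball_fin : (leb B < +oo)%E.
Proof.
apply: (@le_lt_trans _ _ (ball_volume n * rho ^+ n)%:E); last exact: ltry.
by rewrite le_eqVlt; apply/orP; left; apply/eqP; exact: leb_eball.
Qed.

Lemma integrable_ball_bounded (f : 'rV[R]_n -> R) (M : R) : measurable_fun B f ->
  (forall x, B x -> `|f x| <= M) -> leb.-integrable B (EFin \o f).
Proof.
move=> mf fM; apply: measurable_bounded_integrable => //; first exact: eball_fin.
exists M; split; first exact: num_real.
by move=> y My x Bx /=; rewrite (le_trans (fM x Bx))// ltW.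
Qed.

Lemma L2_integrable (f : 'rV[R]_n -> R) : L2 B f -> leb.-integrable B (EFin \o f).
Proof.
move=> [mf f2]; apply: (@le_integrableR _ _ _ _ _ mB (fun x => 1 + f x ^+ 2)) => //.
  move=> x _; have := le_norm_amgm (f x) ltr01; rewrite divr1 => H.
  by rewrite (le_trans H)// ler_norm.
by apply: integrableD_real => //; apply: (@integrable_ball_bounded _ 1) => // x _; rewrite normr1.
Qed.

End radial_functions.

(** * Divergence identity for radial vector fields *)

Section divergence_identity.
Context {R : realType}.
Local Notation mu := (@lebesgue_measure R).
Variables (n : nat) (rho : R).
Hypotheses (n0 : (0 < n)%N) (rho0 : 0 < rho).
Local Notation leb := (@lebesgue_row R n).
Local Notation B := (@eball R n rho).
Local Notation I := (`]0, rho[%classic : set R).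
Variables k k' : R -> R.
Hypothesis dk : forall s, is_derive s (1 : R) k (k' s).
Hypothesis ck' : continuous k'.

Let ck : continuous k.
Proof. by move=> s; exact: is_derive_continuous (dk s). Qed.

Let mB := @measurable_eball R n rho.

(** The radial field k(|x|^2) x. Writing it through |x|^2 makes it of class C^1 at the origin as
    soon as k is; [divPhi] is its divergence. *)
Let Phi (i : 'I_n) (x : 'rV[R]_n) : R := k (sqn x) * x ord0 i.
Let divPhi (x : 'rV[R]_n) : R := n%:R * k (sqn x) + 2 * sqn x * k' (sqn x).

Let continuous_comp_sqn (f : R -> R) : continuous f ->
  continuous (fun x : 'rV[R]_n => f (sqn x)).
Proof.
move=> cf x; apply: (@continuous_comp _ _ _ (@sqn R n) f).
  exact: continuous_sqn.
exact: cf.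
Qed.

Let dPhi i x : is_derive x (delta_mx ord0 i) (Phi i : 'rV[R]_n -> R^o)
  (k' (sqn x) * (2 * x ord0 i) * x ord0 i + k (sqn x) * 1).
Proof.
apply: is_derive_mul.
  rewrite -(dot_delta x i); apply: is_derive_chain; first exact: is_derive_sqn.
have := @is_derive_coord R n i x (delta_mx ord0 i).
by rewrite mxE !eqxx.
Qed.

Let partial_Phi i : partial i (Phi i) =
  fun x => k' (sqn x) * (2 * x ord0 i) * x ord0 i + k (sqn x) * 1.
Proof. by apply/funext => x; have [_] := dPhi i x. Qed.

Let Phi_C1 i : C1_dir i (Phi i).
Proof.
split.
- apply: continuousM_fun; first exact: continuous_comp_sqn.
  exact: continuous_coord.
- by move=> x; have [] := dPhi i x.
- rewrite partial_Phi; apply: continuousD_fun; apply: continuousM_fun.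
  + apply: continuousM_fun; first exact: continuous_comp_sqn.
    apply: continuousM_fun; first exact: cst_continuous.
    exact: continuous_coord.
  + exact: continuous_coord.
  + exact: continuous_comp_sqn.
  + exact: cst_continuous.
Qed.

Let sum_partial_Phi x : \sum_(i < n) partial i (Phi i) x = divPhi x.
Proof.
rewrite (eq_bigr (fun i => 2 * k' (sqn x) * x ord0 i ^+ 2 + k (sqn x))); last first.
  by move=> i _; rewrite partial_Phi; ring.
rewrite big_split/= -mulr_sumr sumr_const card_ord -/(sqn x) /divPhi.
by rewrite -mulr_natl; ring.
Qed.

Let sqn_ball x : B x -> 0 <= sqn x <= rho ^+ 2.
Proof.
rewrite /eball/= -enorm_sqn sqr_ge0/= => xr.
by rewrite ler_pXn2r ?nnegrE ?enorm_ge0 ?ltW.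
Qed.

Let bounded_ball (f : R -> R) : continuous f ->
  exists2 M : R, 0 < M & forall s, 0 <= s <= rho ^+ 2 -> `|f s| <= M.
Proof.
move=> cf; have : compact (f @` `[0, rho ^+ 2]).
  by apply: continuous_compact; [exact: continuous_subspaceT|exact: segment_compact].
move=> /compact_bounded /ex_strict_bound_gt0 [M M0 HM].
by exists M => // s s01; apply/ltW/HM; exists s => //=; rewrite in_itv.
Qed.

Let Phi_bound : exists2 M : R, 0 < M &
  forall x, B x -> `|divPhi x| <= M /\ forall i, `|Phi i x| <= M.
Proof.
have [M1 M10 H1] := bounded_ball ck; have [M2 M20 H2] := bounded_ball ck'.
have r20 : 0 <= rho ^+ 2 by exact: sqr_ge0.
exists (n%:R * M1 + 2 * rho ^+ 2 * M2 + M1 * rho).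
  rewrite ltr_wpDl ?mulr_gt0//.
  by rewrite addr_ge0 ?mulr_ge0// ltW.
move=> x Bx; have /andP[s0 s1] := sqn_ball Bx.
have k1 := H1 _ (sqn_ball Bx); have k2 := H2 _ (sqn_ball Bx); split.
  rewrite (le_trans (ler_normD _ _))// -[leLHS]addr0 lerD ?mulr_ge0 ?(ltW M10) ?(ltW rho0)//.
  rewrite !normrM ger0_norm ?ler0n// (ger0_norm s0) normr_nat; apply: lerD.
    by rewrite ler_wpM2l.
  by apply: ler_pM => //; rewrite ?mulr_ge0// ler_wpM2l.
move=> i; rewrite normrM -[leLHS]add0r lerD//.
  by rewrite addr_ge0 ?mulr_ge0// ltW.
apply: ler_pM => //; rewrite (le_trans (le_coor_enorm x i))//.
by apply: ltW; exact: Bx.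
Qed.

Let mdiv : measurable_fun B divPhi.
Proof.
apply: measurable_funTS; apply: measurable_continuous_row.
apply: continuousD_fun; apply: continuousM_fun.
- exact: cst_continuous.
- exact: continuous_comp_sqn.
- apply: continuousM_fun; first exact: cst_continuous.
  exact: continuous_sqn.
- exact: continuous_comp_sqn.
Qed.

Let mPhi i : measurable_fun B (Phi i).
Proof.
by apply: measurable_funTS; apply: measurable_continuous_row; have [] := Phi_C1 i.
Qed.

(** With a test function in place of U the identity is integration by parts. The hypothesis gives
    such functions arbitrarily close to U in H^1, and the field and its divergence are bounded on
    the ball. *)
Lemma divergence_identity (U : 'rV[R]_n -> R) (G : 'I_n -> 'rV[R]_n -> R) :
  L2 B U -> (forall i, L2 B (G i)) ->
  (forall e : R, 0 < e -> exists2 phi, test_function B phi &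
      (\int[leb]_(x in B) ((U x - phi x) ^+ 2 +
         \sum_(i < n) (G i x - partial i phi x) ^+ 2)%:E < e%:E)%E) ->
  \int[leb]_(x in B) (U x * (n%:R * k (sqn x) + 2 * sqn x * k' (sqn x))) =
  - \int[leb]_(x in B) (\sum_(i < n) G i x * x ord0 i * k (sqn x)).
Proof.
move=> LU LG app.
have [M M0 HM] := Phi_bound.
have UD : leb.-integrable B (EFin \o (fun x => divPhi x * U x)).
  apply: (@integrableM_bounded _ _ _ leb B mB M U divPhi) => //.
    by move=> x /HM[].
  exact: L2_integrable.
have GP i : leb.-integrable B (EFin \o (fun x => Phi i x * G i x)).
  apply: (@integrableM_bounded _ _ _ leb B mB M (G i) (Phi i)) => //.
    by move=> x /HM[].
  exact: L2_integrable.
have [GPi GPE] := Rintegral_sum_seq mB (index_enum 'I_n) GP.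
pose Z := \int[leb]_(x in B) (divPhi x * U x + \sum_(i < n) (Phi i x * G i x)).
suff Z0 : Z = 0.
  apply/eqP; rewrite -addr_eq0; apply/eqP; rewrite -[RHS]Z0 /Z RintegralD//.
  congr (_ + _).
    by apply: eq_Rintegral => x _; rewrite mulrC.
  apply: eq_Rintegral => x _; apply: eq_bigr => i _.
  by rewrite /Phi; ring.
have Zi : leb.-integrable B (EFin \o
    (fun x => divPhi x * U x + \sum_(i < n) (Phi i x * G i x))).
  exact: integrableD_real.
(* The test function is taken with squared error below d^2; [le_norm_amgm] with parameter d turns
   this into an L^1 bound, each of the n + 1 error terms contributing one constant d. *)
have key (d : R) : 0 < d ->
    `|Z| <= M * (n.+1%:R * d * fine (leb B) + d).
  move=> d0; have [phi tphi phie] := app _ (exprn_gt0 2 d0).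
  have ibp i := test_function_ibp tphi (Phi_C1 i).
  have [K [Kc KB K0 cphi dphi]] := test_function_facts tphi.
  have mphi : measurable_fun B phi.
    by apply: measurable_funTS; exact: measurable_continuous_row.
  have mdphi i : measurable_fun B (partial i phi).
    apply: measurable_funTS; apply: measurable_continuous_row.
    by have [_] := dphi (delta_mx ord0 i).
  have i1 i : leb.-integrable B (EFin \o (fun x => phi x * partial i (Phi i) x)).
    by have [] := ibp i.
  have i2 i : leb.-integrable B (EFin \o (fun x => partial i phi x * Phi i x)).
    by have [] := ibp i.
  have [s1i s1E] := Rintegral_sum_seq mB (index_enum 'I_n) i1.
  have [s2i s2E] := Rintegral_sum_seq mB (index_enum 'I_n) i2.
  have Z0 : \int[leb]_(x in B) (\sum_(i < n) phi x * partial i (Phi i) x +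
      \sum_(i < n) partial i phi x * Phi i x) = 0.
    rewrite RintegralD// s1E s2E -big_split/= big1// => i _.
    by have [_ _ ->] := ibp i; rewrite addNr.
  pose Q x := (U x - phi x) ^+ 2 + \sum_(i < n) (G i x - partial i phi x) ^+ 2.
  have Q0 x : 0 <= Q x.
    by rewrite addr_ge0 ?sqr_ge0// sumr_ge0// => i _; exact: sqr_ge0.
  have mQ : measurable_fun B Q.
    apply: measurable_funD.
      by apply: measurable_funX; apply: measurable_funB => //; case: LU.
    apply: measurable_sum => i; apply: measurable_funX; apply: measurable_funB => //.
    by case: (LG i).
  have Qi : leb.-integrable B (EFin \o Q).
    apply/integrableP; split; first exact/measurable_EFinP.
    rewrite (eq_integral (fun x => (Q x)%:E)); last first.
      by move=> x _ /=; rewrite ger0_norm.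
    exact: (lt_trans phie (ltry _)).
  have Qd : \int[leb]_(x in B) Q x < d ^+ 2.
    by rewrite -lte_fin /Rintegral fineK//; exact: (integrable_fin_num mB Qi).
  rewrite -[Z]subr0 -[X in _ - X]Z0 /Z -RintegralB//; last first.
    exact: integrableD_real.
  have c1 : leb.-integrable B (EFin \o (fun=> n.+1%:R * d)).
    by apply: (@integrable_ball_bounded _ _ _ rho0 _ `|n.+1%:R * d|) => //.
  have Di : leb.-integrable B (EFin \o (fun x => n.+1%:R * d + d^-1 * Q x)).
    by apply: integrableD_real => //; exact: integrableZ_real.
  have bnd := integrableZ_real mB M Di.
  apply: (@le_trans _ _ (\int[leb]_(x in B) (M * (n.+1%:R * d + d^-1 * Q x)))).
    apply: (le_trans (le_normr_Rintegral _ _)) => //.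
      by apply: integrableB_real => //; exact: integrableD_real.
    apply: le_Rintegral => //.
      by apply: integrable_norm; apply: integrableB_real => //; exact: integrableD_real.
    move=> x Bx; have [HM1 HM2] := HM x Bx.
    have -> : divPhi x * U x + \sum_(i < n) Phi i x * G i x -
        (\sum_(i < n) phi x * partial i (Phi i) x + \sum_(i < n) partial i phi x * Phi i x)
      = divPhi x * (U x - phi x) + \sum_(i < n) Phi i x * (G i x - partial i phi x).
      rewrite -mulr_sumr sum_partial_Phi opprD addrACA mulrBr (mulrC (phi x)).
      congr (_ + _); rewrite -sumrB; apply: eq_bigr => i _; ring.
    apply: (le_trans (ler_normD _ _)).
    have E : M * (n.+1%:R * d + d^-1 * Q x) = M * (d + (U x - phi x) ^+ 2 / d) +
        \sum_(i < n) M * (d + (G i x - partial i phi x) ^+ 2 / d).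
      rewrite -mulr_sumr big_split/= sumr_const card_ord -mulr_suml /Q -mulr_natl.
      by rewrite -natr1; ring.
    rewrite E; apply: lerD.
      by rewrite normrM ler_pM// le_norm_amgm.
    apply: (le_trans (ler_norm_sum _ _ _)); apply: ler_sum => i _.
    by rewrite normrM ler_pM// le_norm_amgm.
  rewrite RintegralZl// ler_wpM2l ?(ltW M0)// RintegralD//; last exact: integrableZ_real.
  rewrite Rintegral_cst// RintegralZl//; apply: lerD => //.
  by rewrite ler_pdivrMl// -expr2 ltW.
apply/eqP; rewrite -normr_le0; apply/ler_addgt0Pl => e e0; rewrite addr0.
have L0 : 0 <= fine (leb B) by rewrite fine_ge0.
(* The bound of [key] is A d, so d = e / A makes it equal to e. *)
pose A := M * (n.+1%:R * fine (leb B) + 1).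
have A0 : 0 < A by rewrite mulr_gt0// ltr_wpDl// mulr_ge0.
have := key (e / A) (divr_gt0 e0 A0); move=> /le_trans; apply.
rewrite (_ : M * _ = A * (e / A)); last by rewrite /A; ring.
by rewrite mulrC divfK// gt_eqF.
Qed.

End divergence_identity.

(** * Smooth cutoff functions *)

Section smooth.
Context {R : realType}.
Implicit Types f g : R -> R.

Definition deriv_closed (S : set (R -> R)) :=
  forall g, S g -> exists2 g', S g' & forall x, is_derive x (1 : R) g (g' x).

(** A coinductive form of smoothness: f lies in some class stable under differentiation. Each
    closure property is proved by exhibiting such a class, without derivatives of order k. *)
Definition smooth f := exists2 S, deriv_closed S & S f.

Lemma smooth_derive f : smooth f ->
  exists2 f', smooth f' & forall x, is_derive x (1 : R) f (f' x).
Proof. by move=> [S cS Sf]; have [f' Sf' df] := cS _ Sf; exists f' => //; exists S. Qed.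

Lemma smooth_continuous f : smooth f -> continuous f.
Proof. by move=> /smooth_derive[f' _ df] x; exact: is_derive_continuous (df x). Qed.

Lemma smoothZ c f : smooth f -> smooth (fun x => c * f x).
Proof.
move=> [S cS Sf]; exists [set h | exists2 g, S g & h = (fun x => c * g x)]; last by exists f.
move=> _ [g /cS[g' Sg' dg] ->]; exists (fun x => c * g' x); first by exists g'.
by move=> x; exact: is_derive_cmul.
Qed.

Lemma smoothD f g : smooth f -> smooth g -> smooth (fun x => f x + g x).
Proof.
move=> [S cS Sf] [T cT Tg].
exists [set h | exists2 u, S u & exists2 v, T v & h = (fun x => u x + v x)]; last first.
  by exists f => //; exists g.
move=> _ [u /cS[u' Su' du] [v /cT[v' Tv' dv] ->]].
exists (fun x => u' x + v' x); first by exists u' => //; exists v'.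
by move=> x; exact: is_deriveD_fun.
Qed.

(** Leibniz's rule leads out of the products u v but not out of their finite sums. *)
Inductive prod_sums (S T : set (R -> R)) : set (R -> R) :=
| prod_sums_mul u v : S u -> T v -> prod_sums S T (fun x => u x * v x)
| prod_sums_add u v : prod_sums S T u -> prod_sums S T v ->
    prod_sums S T (fun x => u x + v x).

Lemma smoothM f g : smooth f -> smooth g -> smooth (fun x => f x * g x).
Proof.
move=> [S cS Sf] [T cT Tg]; exists (prod_sums S T); last exact: prod_sums_mul.
move=> h; elim=> [u v /[dup] Su /cS[u' Su' du] /[dup] Tv /cT[v' Tv' dv]|].
  exists (fun x => u' x * v x + u x * v' x).
    by apply: prod_sums_add; exact: prod_sums_mul.
  by move=> x; exact: is_deriveM_fun.
move=> u v _ [u' Su' du] _ [v' Sv' dv].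
by exists (fun x => u' x + v' x); [exact: prod_sums_add|move=> x; exact: is_deriveD_fun].
Qed.

Lemma smooth_affine f (c d : R) : smooth f -> smooth (fun x => f (c * x + d)).
Proof.
move=> [S cS Sf].
exists [set h | exists2 g, S g & exists e : R, h = (fun x => e * g (c * x + d))]; last first.
  by exists f => //; exists 1; apply/funext => x; rewrite mul1r.
move=> _ [g /cS[g' Sg' dg] [e ->]].
exists (fun x => (e * c) * g' (c * x + d)); first by exists g' => //; exists (e * c).
move=> x; rewrite -mulrA; apply: is_derive_cmul; rewrite mulrC.
apply: (@is_derive_comp _ g (fun x => c * x + d)) => //.
rewrite -[X in is_derive _ _ _ X]addr0; apply: is_deriveD_fun.
by rewrite -[X in is_derive _ _ _ X]mulr1; apply: is_derive_cmul.
Qed.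

Lemma smooth_cst c : smooth (fun=> c).
Proof.
exists [set h | exists e : R, h = (fun=> e)]; last by exists c.
by move=> _ [e ->]; exists (fun=> 0); [exists 0|move=> x; exact: is_derive_cst].
Qed.

Lemma smooth_primitive f F : smooth f -> (forall x, is_derive x (1 : R) F (f x)) ->
  smooth F.
Proof.
move=> [S cS Sf] dF; exists [set h | S h \/ h = F]; last by right.
move=> g [/cS[g' Sg' dg]|->]; first by exists g' => //; left.
by exists f => //; left.
Qed.

Lemma is_derive_local f g x d : (\forall y \near x, f y = g y) ->
  is_derive x (1 : R) f d -> is_derive x (1 : R) g d.
Proof.
move=> fg [fd fdE]; have gf : \forall y \near x, g y = f y by apply: filterS fg.
by apply: DeriveDef; [exact: near_eq_derivable fd|rewrite -fdE; exact: near_eq_derive].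
Qed.

End smooth.

(** * Flat exponentials and bumps *)

Section exp_bump.
Context {R : realType}.
Variable d : R.
Hypothesis d0 : 0 < d.

(** Take the power k + 1 of exp(x / (k + 1)) >= x / (k + 1). *)
Lemma expR_ge_pow (k : nat) (x : R) : 0 <= x -> (x / k.+1%:R) ^+ k.+1 <= expR x.
Proof.
move=> x0; have -> : expR x = expR (x / k.+1%:R) ^+ k.+1.
  by rewrite -expRM_natl -mulr_natl mulrC divfK.
rewrite ler_pXn2r ?nnegrE ?divr_ge0 ?expR_ge0//.
by apply: le_trans (expR_ge1Dx _); rewrite lerDr.
Qed.

(** The polynomial in 1/t is there to make the family stable under differentiation
    ([is_derive_flat]), which is what [smooth] asks for. *)
Definition flat (p : {poly R}) (t : R) : R :=
  if 0 < t then p.[t^-1] * expR (- (d / t)) else 0.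

Lemma poly_bound (p : {poly R}) : exists C (m : nat), 0 <= C /\
  forall x, 1 <= x -> `|p.[x]| <= C * x ^+ m.
Proof.
elim/poly_ind: p => [|p c [C [m [C0 H]]]].
  by exists 0, 0%N; split => // x _; rewrite horner0 normr0 mul0r.
exists (C + `|c|), m.+1; split; first by rewrite addr_ge0.
move=> x x1; have x0 : 0 <= x by exact: le_trans x1.
rewrite hornerMXaddC (le_trans (ler_normD _ _))// mulrDl lerD//.
  by rewrite normrM (ger0_norm x0) exprSr mulrA ler_wpM2r// H.
by rewrite ler_peMr// exprn_ege1.
Qed.

(** A bound of order t^2 forces the derivative at 0 to exist and to be 0. *)
Lemma flat_small (p : {poly R}) : exists C : R, forall t, 0 < t <= 1 ->
  `|flat p t| <= C * t ^+ 2.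
Proof.
have [C [m [C0 H]]] := poly_bound p.
(* The exponential is at most a multiple of t^(m + 2): m powers absorb the growth of the polynomial
   in 1/t and two remain. *)
exists (C * (m.+2%:R / d) ^+ m.+2) => t /andP[t0 t1].
have ti : 1 <= t^-1 by rewrite invf_ge1.
rewrite /flat t0 normrM (ger0_norm (expR_ge0 _)).
have e1 : expR (- (d / t)) <= (m.+2%:R / d) ^+ m.+2 * t ^+ m.+2.
  rewrite expRN -exprMn; have := @expR_ge_pow m.+1 (d / t) (divr_ge0 (ltW d0) (ltW t0)).
  move=> H1; have p0 : 0 < (d / t / m.+2%:R) ^+ m.+2 by rewrite exprn_gt0// !divr_gt0.
  apply: (@le_trans _ _ ((d / t / m.+2%:R) ^+ m.+2)^-1).
    by rewrite lef_pV2 ?posrE ?expR_gt0.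
  by rewrite -exprVn; rewrite le_eqVlt; apply/orP; left; apply/eqP; congr (_ ^+ _); field; rewrite !gt_eqF.
apply: (le_trans (ler_pM (normr_ge0 _) (expR_ge0 _) (H _ ti) e1)).
rewrite mulrACA le_eqVlt; apply/orP; left; apply/eqP; congr (_ * _).
by rewrite exprVn -[m.+2]addn2 exprD mulrA mulVf ?mul1r// expf_neq0// gt_eqF.
Qed.

(** The polynomial of the derivative: with X = 1/t one has X' = - X^2, and exp(- d X) contributes
    the term d p. *)
Let flat_next (p : {poly R}) : {poly R} := 'X ^+ 2 * (d *: p - p^`()).

Lemma is_derive_horner (p : {poly R}) x :
  is_derive x (1 : R) (fun t => p.[t]) (p^`().[x]).
Proof.
elim/poly_ind: p => [|p c IH].
  rewrite linear0 horner0; under eq_fun do rewrite horner0; exact: is_derive_cst.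
under eq_fun do rewrite hornerMXaddC.
rewrite derivMXaddC hornerD hornerMX -[X in is_derive _ _ _ X]addr0.
apply: is_deriveD_fun.
have := is_deriveM_fun IH (is_derive_id x (1 : R)).
by rewrite mulr1 addrC.
Qed.

Let is_derive_quadratic (f : R -> R) (C : R) : f 0 = 0 ->
  (forall t, `|t| <= 1 -> `|f t| <= C * t ^+ 2) -> is_derive (0 : R) (1 : R) f 0.
Proof.
move=> f0 fC.
have Q : (h^-1 *: (f (h *: (1 : R) + 0) - f 0) : R^o) @[h --> (0 : R)^'] --> (0 : R^o).
  apply/cvgrPdist_le => e e0; near=> h.
  have h0 : h != 0 by near: h; exact: nbhs_dnbhs_neq.
  have h1 : `|h| <= 1 by near: h; exact: dnbhs0_le.
  have h2 : `|h| <= e / (`|C| + 1).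
    by near: h; apply: dnbhs0_le; rewrite divr_gt0// ltr_wpDl.
  rewrite sub0r normrN f0 subr0 addr0 [h *: _]mulr1 normrM normfV.
  rewrite ler_pdivrMl ?normr_gt0//.
  apply: (le_trans (fC h h1)); rewrite -real_normK ?num_real// expr2 mulrCA.
  rewrite ler_wpM2l//.
  move: h2; rewrite ler_pdivlMr ?ltr_wpDl// => h2.
  apply: le_trans h2; rewrite mulrDr mulr1 -[leLHS]addr0 lerD// mulrC.
  by rewrite ler_wpM2l// ler_norm.
apply: DeriveDef; first by apply: cvgP; exact: Q.
by rewrite /derive; apply/cvg_lim => //; exact: Q.
Unshelve. all: by end_near. Qed.

Lemma is_derive_flat p x : is_derive x (1 : R) (flat p) (flat (flat_next p) x).
Proof.
have [x0|x0|->] := ltgtP x 0.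
- rewrite {2}/flat ltNge (ltW x0)/=.
  apply: (@is_derive_local _ (fun=> 0)).
  near=> y; rewrite /flat ifF//; apply/negbTE; rewrite -leNgt ltW//.
  by near: y; exact: lt_nbhsl.
- rewrite {2}/flat x0.
  have nx : x != 0 by rewrite gt_eqF.
  have dV : is_derive x (1 : R) (fun t : R => t^-1) (- x ^- 2).
    have := is_deriveV nx (is_derive_id x (1 : R)).
    by rewrite /GRing.scale/= mulr1.
  have d1 := is_derive_comp dV (is_derive_horner p x^-1).
  have d2 : is_derive x (1 : R) (fun t => expR (- (d / t)))
      (expR (- (d / x)) * - (d * - x ^- 2)).
    exact: (is_derive_comp (is_deriveN_fun (is_derive_cmul d dV)) (is_derive_expR _)).
  have d3 := is_deriveM_fun d1 d2.
  apply: (@is_derive_local _ (fun t => p.[t^-1] * expR (- (d / t)))).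
    near=> y; rewrite /flat ifT//.
    by near: y; exact: lt_nbhsr.
  apply: is_derive_eq; rewrite /flat_next hornerM hornerXn hornerD hornerZ hornerN.
  by field.
- rewrite {2}/flat ltxx.
  have [C HC] := flat_small p.
  apply: (@is_derive_quadratic _ C); first by rewrite /flat ltxx.
  move=> t t1; have [t0|t0] := ltP 0 t.
    by apply: HC; rewrite t0 (le_trans (ler_norm t)).
  rewrite /flat ltNge t0/= normr0 mulr_ge0 ?sqr_ge0//.
  have := HC 1; rewrite ltr01 lexx expr1n mulr1 => /(_ isT).
  exact: le_trans.
Unshelve. all: by end_near. Qed.

Lemma smooth_flat p : smooth (flat p).
Proof.
exists [set h | exists p, h = flat p]; last by exists p.
move=> _ [q ->]; exists (flat (flat_next q)); first by exists (flat_next q).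
by move=> x; exact: is_derive_flat.
Qed.

End exp_bump.

Section bump.
Context {R : realType}.
Implicit Types d al be t : R.

(** The product of exp(- d / (t - al)) and exp(- d / (be - t)) on ]al, be[. The parameter d is free
    so that, as d tends to 0, the bump tends to the indicator of ]al, be[ while staying between 0
    and 1. *)
Definition bump d al be t : R := flat d 1 (t - al) * flat d 1 (be - t).

Lemma smooth_bump d al be : 0 < d -> smooth (bump d al be).
Proof.
move=> d0; apply: smoothM.
  have := smooth_affine 1 (- al) (smooth_flat d0 1).
  by under eq_fun do rewrite mul1r.
have := smooth_affine (-1) be (smooth_flat d0 1).
by under eq_fun do rewrite mulN1r addrC.
Qed.

Lemma flat1_ge0 d t : 0 <= flat d 1 t.
Proof. by rewrite /flat hornerC mul1r; case: ifP => // _; exact: expR_ge0. Qed.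

Lemma flat1_le1 d t : 0 < d -> flat d 1 t <= 1.
Proof.
move=> d0; rewrite /flat hornerC mul1r; case: ifP => // t0.
by rewrite -expR0 ler_expR oppr_le0 divr_ge0// ltW.
Qed.

Lemma bump_ge0 d al be t : 0 <= bump d al be t.
Proof. by rewrite mulr_ge0// flat1_ge0. Qed.

Lemma bump_le1 d al be t : 0 < d -> bump d al be t <= 1.
Proof. by move=> d0; rewrite mulr_ile1 ?flat1_ge0 ?flat1_le1. Qed.

Lemma bump_out d al be t : ~~ (al < t < be) -> bump d al be t = 0.
Proof.
rewrite /bump /flat !subr_gt0 negb_and => /orP[] /negbTE ->.
  by rewrite mul0r.
by rewrite mulr0.
Qed.

Lemma cvg_bump al be t :
  (fun k : nat => bump k.+1%:R^-1 al be t) @ \oo --> ((al < t < be)%R%:R : R).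
Proof.
have cf (s : R) : (fun k : nat => flat k.+1%:R^-1 1 s) @ \oo --> ((0 < s)%R%:R : R).
  rewrite /flat; case: (ltP 0 s) => s0; last exact: cvg_cst.
  under eq_fun do rewrite hornerC mul1r.
  suff : (fun k : nat => expR (- (k.+1%:R^-1 / s))) @ \oo --> expR (- (0 / s)).
    by rewrite mul0r oppr0 expR0.
  apply: continuous_cvg; first exact: continuous_expR.
  apply: cvgN; apply: cvgM; [exact: cvg_harmonic|exact: cvg_cst].
have -> : ((al < t < be)%R%:R : R) = (0 < t - al)%R%:R * (0 < be - t)%R%:R.
  by rewrite !subr_gt0 -natrM mulnb.
by apply: cvgM; exact: cf.
Qed.

Lemma continuous_bump d al be : 0 < d -> continuous (bump d al be).
Proof. by move=> d0; apply: smooth_continuous; exact: smooth_bump. Qed.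

End bump.

(** * The fundamental lemma of the calculus of variations *)

Section fundamental_lemma.
Context {R : realType}.
Local Notation mu := (@lebesgue_measure R).
Implicit Types (w : R -> R) (al be : R).
Variables (th : R -> R -> R -> R -> R) (a b : R).
Hypothesis th_cont : forall d al be, 0 < d -> continuous (th d al be).
Hypothesis th01 : forall d al be t, 0 < d -> 0 <= th d al be t <= 1.
Hypothesis th_cvg : forall al be t, a < al -> al < t < be ->
  th k.+1%:R^-1 al be t @[k --> \oo] --> (1 : R).

Let itg_test_lim w al be : a < al -> int_itv w al be ->
  (forall d, 0 < d -> itg (fun t => th d al be t * w t) al be = 0) ->
  itg w al be = 0.
Proof.
move=> aal wi w0; have wi' : mu.-integrable `]al, be[ (EFin \o w) by apply/int_itv_oo.
have mw := integrable_measurableR wi'.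
rewrite -itg_oo//.
pose f k t := th k.+1%:R^-1 al be t * w t.
have k0 k : 0 < k.+1%:R^-1 :> R by rewrite invr_gt0.
have mf k : measurable_fun `]al, be[ (f k).
  apply: measurable_funM => //; apply: measurable_funTS.
  by apply: measurable_continuous; exact: th_cont.
have [|||||_ _ Icvg] := @dominated_convergence _ _ _ mu `]al, be[ (measurable_itv _)
  (fun k => EFin \o f k) (EFin \o w) (fun t => `|w t|%:E) _ _ _ _ _.
- by move=> k; apply/measurable_EFinP; exact: mf.
- by apply/measurable_EFinP; exact: mw.
- apply: aeW => t; rewrite /= in_itv/= => tab; apply: cvg_EFin; first exact: nearW.
  rewrite -[w t]mul1r; apply: cvgM; last exact: cvg_cst.
  exact: th_cvg.
- exact: (integrable_norm wi').
- apply: aeW => t k _ /=; rewrite lee_fin normrM -[leRHS]mul1r ler_wpM2r//.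
  by have /andP[? ?] := th01 al be t (k0 k); rewrite ger0_norm.
have E k : (\int[mu]_(t in `]al, be[) (f k t)%:E = 0)%E.
  have fi : mu.-integrable `]al, be[ (EFin \o f k).
    apply: (@integrableM_bounded _ _ _ mu _ (measurable_itv _) 1 w (th k.+1%:R^-1 al be) _ _ wi').
      apply: measurable_funTS; apply: measurable_continuous; exact: th_cont.
    by move=> t _; have /andP[? ?] := th01 al be t (k0 k); rewrite ger0_norm.
  rewrite -[LHS]fineK; last exact: (integrable_fin_num _ fi).
  by have := w0 _ (k0 k); rewrite -itg_oo; [rewrite /Rintegral => ->|exact: mf].
have : (\int[mu]_(t in `]al, be[) (f k t)%:E)%E @[k --> \oo] --> 0%:E.
  by under eq_fun do rewrite E; exact: cvg_cst.
by move=> I0; have := cvg_unique _ Icvg I0; rewrite /Rintegral /= => ->.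
Qed.

Let ae_zero_itv w al be : al < be -> int_itv w al be ->
  (forall x, al < x < be -> itg w al x = 0) ->
  {ae mu, forall t, al < t < be -> w t = 0}.
Proof.
move=> ab wi w0; pose f : R -> R := w \_ `[al, be].
have fi : mu.-integrable setT (EFin \o f).
  by rewrite -restrict_EFin; apply/(integrable_mkcond _ _).1.
have fi' y : mu.-integrable [set` Interval (BLeft al) (BRight y)] (EFin \o f).
  exact: integrableS fi.
have H := FTC1 (fun y => fi' y) (integrable_locally (measurable_itv _) wi).
move: H; cbv zeta; apply: (@filterS _ _ (ae_filter_ringOfSetsType mu)) => t Ht tab; have /andP[alt tbe] := tab.
have [|_ Ft] := Ht; first by rewrite lte_fin.
have -> : w t = f t by rewrite /f patchE mem_set//= in_itv/= !ltW.
rewrite -Ft.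
rewrite derive1E -(derive_cst (0 : R) t (1 : R)).
apply: near_eq_derive => //; near=> y.
have yab : al < y < be.
  by apply/andP; split; near: y; [exact: lt_nbhsr|exact: lt_nbhsl].
rewrite -(w0 y yab) /itg; apply: eq_Rintegral => z; rewrite inE/= in_itv/= => /andP[az zy].
rewrite /f patchE mem_set//= in_itv/= az (le_trans zy)//.
by case/andP: yab => _ /ltW.
Unshelve. all: by end_near. Qed.

(** The tests tend boundedly to 1 on ]al, be[, so w has integral 0 over each such interval, and the
    differentiation theorem gives w = 0 almost everywhere. The family [th] is abstract in order to
    serve bumps in t and bumps in t^2. *)
Lemma ae_eq0_test w :
  (forall al be, a < al -> al < be -> be < b -> int_itv w al be /\
     forall d, 0 < d -> itg (fun t => th d al be t * w t) al be = 0) ->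
  {ae mu, forall t, a < t < b -> w t = 0}.
Proof.
move=> H.
(* Countably many inner intervals exhaust ]a, b[; w need not be integrable up to its end points. *)
pose P (k : nat) t := a + k.+1%:R^-1 < t < b - k.+1%:R^-1 -> w t = 0.
have : forall k, {ae mu, forall t, P k t}.
  move=> k; have : 0 < k.+1%:R^-1 :> R by rewrite invr_gt0.
  rewrite /P; move: (k.+1%:R^-1 : R) => e e0.
  have [ab|ba] := ltP (a + e) (b - e); last first.
    by apply: aeW => t /andP[at1 tb]; have := lt_trans at1 tb; rewrite ltNge ba.
  apply: ae_zero_itv => //.
    by have [||//] := H (a + e) (b - e) _ ab _; lra.
  move=> x /andP[ax xb]; have [||wi w0] := H (a + e) x _ ax _; [lra|lra|].
  apply: (itg_test_lim _ wi w0); lra.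
move=> /ae_foralln; apply: filterS => t Pt /andP[at0 tb].
pose e := Num.min (t - a) (b - t).
have e0 : 0 < e by rewrite lt_min !subr_gt0 at0.
have [k _ /(_ k (leqnn k)) /= ke] := near_infty_natSinv_lt (PosNum e0).
have : e <= t - a /\ e <= b - t by rewrite /e; split; rewrite ge_min lexx ?orbT.
move: ke (Pt k); rewrite /P; move: (k.+1%:R^-1 : R) => e' ee' Pe' [? ?].
by apply: Pe'; apply/andP; split; lra.
Qed.

End fundamental_lemma.

Lemma ae_eq0_bump (R : realType) (w : R -> R) (a b : R) :
  (forall al be, a < al -> al < be -> be < b -> int_itv w al be /\
     forall d, 0 < d -> itg (fun t => bump d al be t * w t) al be = 0) ->
  {ae lebesgue_measure, forall t, a < t < b -> w t = 0}.
Proof.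
apply: ae_eq0_test.
- by move=> d al be d0; exact: continuous_bump.
- by move=> d al be t d0; rewrite bump_ge0 bump_le1.
- by move=> al be t _ tab; have H := @cvg_bump R al be t; rewrite tab in H.
Qed.

(* Bumps in the variable [t ^ 2], the profiles of smooth radial functions. *)
Lemma ae_eq0_bump_sqr (R : realType) (w : R -> R) (b : R) :
  (forall al be, 0 < al -> al < be -> be < b -> int_itv w al be /\
     forall d, 0 < d ->
       itg (fun t => bump d (al ^+ 2) (be ^+ 2) (t ^+ 2) * w t) al be = 0) ->
  {ae lebesgue_measure, forall t, 0 < t < b -> w t = 0}.
Proof.
apply: (ae_eq0_test (th := fun d al be t => bump d (al ^+ 2) (be ^+ 2) (t ^+ 2))).
- move=> d al be d0 t; apply: (@continuous_comp _ _ _ (fun t : R => t ^+ 2)).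
    exact: exprn_continuous.
  exact: continuous_bump.
- by move=> d al be t d0; rewrite bump_ge0 bump_le1.
- move=> al be t al0 /andP[alt tbe].
  have H := @cvg_bump R (al ^+ 2) (be ^+ 2) (t ^+ 2).
  have t0 : 0 < t by exact: lt_trans alt.
  by rewrite !ltr_pXn2r ?nnegrE ?ltW// ?alt ?tbe in H; last exact: lt_trans tbe.
Qed.


(** * Bumps as test functions on the interval and on the ball *)

Section test_functions.
Context {R : realType}.

(** Induction on k inside a class that is stable under every directional derivative; this passes
    from [smooth] to the test functions of the Sobolev space. *)
Lemma Ck_closed (V : normedModType R) (S : set (V -> R)) :
  (forall f, S f -> continuous f) ->
  (forall f v, S f -> exists2 g, S g &
     forall x, is_derive x v (f : V -> R^o) (g x)) ->
  forall k f, S f -> Ck k (f : V -> R^o).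
Proof.
move=> Sc Sd; elim=> [|k IH] f Sf; first by split=> //; exact: Sc.
split; first exact: Sc.
move=> v; have [g Sg df] := Sd f v Sf; split; first by move=> x; case: (df x).
rewrite (_ : 'D_v _ = g); first exact: IH.
by apply/funext => x; exact: derive_val.
Qed.

Lemma is_derive_dir (f : R -> R) x v d : is_derive x (1 : R) f d ->
  is_derive x v (f : R^o -> R^o) (v * d).
Proof.
move=> [fd fE]; have df : differentiable (f : R^o -> R^o) x by exact/derivable1_diffP.
apply: DeriveDef; first exact: diff_derivable.
rewrite -fE !deriveE//.
have -> : v = v *: (1 : R^o) by rewrite /GRing.scale/= mulr1.
by rewrite linearZ /GRing.scale/= mulr1.
Qed.

Lemma smooth_Ck (f : R -> R) k : smooth f -> Ck k (f : R^o -> R^o).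
Proof.
apply: (@Ck_closed R^o (@smooth R)) => {}f; first exact: smooth_continuous.
move=> v /smooth_derive[f' sf' df]; exists (fun x => v * f' x); first exact: smoothZ.
by move=> x; exact: is_derive_dir.
Qed.

Lemma bump_test_function (rho d al be : R) : 0 < d -> 0 < al -> be < rho ->
  test_function (`]0, rho[%classic : set R^o) (bump d al be : R^o -> R^o).
Proof.
move=> d0 al0 brho; have cab : closed (`[al, be]%classic : set R^o) by exact: itv_closed.
have sub : closure [set x : R^o | bump d al be x != 0] `<=` `[al, be].
  rewrite [X in _ `<=` X](closure_id _).1//; apply: closure_subset => x /= bx.
  apply: contraNT bx => xab; rewrite bump_out//; apply: contra xab => /andP[? ?].
  by rewrite in_itv/= !ltW.
split; first by move=> k; apply: smooth_Ck; exact: smooth_bump.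
  apply: (@subclosed_compact _ _ `[al, be]%classic) => //; first exact: closed_closure.
  exact: segment_compact.
by move=> x /sub; rewrite /= !in_itv/= => /andP[? ?]; apply/andP; split; lra.
Qed.

Section radial.
Variable n : nat.

(** Differentiating g(|x|^2) along v produces the factor [dot] x v; with sums and products of both
    kinds of functions the class becomes stable. *)
Inductive radial_class : ('rV[R]_n -> R) -> Prop :=
| rc_comp g : smooth g -> radial_class (fun x => g (sqn x))
| rc_dot v : radial_class (fun x => dot x v)
| rc_mul f g : radial_class f -> radial_class g -> radial_class (fun x => f x * g x)
| rc_add f g : radial_class f -> radial_class g -> radial_class (fun x => f x + g x).

Let rc_continuous f : radial_class f -> continuous f.
Proof.
elim=> {f}[g sg x|v|f g _ cf _ cg|f g _ cf _ cg].
- apply: continuous_comp; [exact: continuous_sqn|exact: smooth_continuous].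
- apply: continuous_sum_fun => i; apply: continuousM_fun; first exact: continuous_coord.
  exact: cst_continuous.
- exact: continuousM_fun.
- exact: continuousD_fun.
Qed.

Let rc_derive f v : radial_class f -> exists2 g, radial_class g &
  forall x, is_derive x v (f : _ -> R^o) (g x).
Proof.
elim=> {f}[g /smooth_derive[g' sg' dg]|w|f g rf [f' rf' df] rg [g' rg' dg]
  |f g _ [f' rf' df] _ [g' rg' dg]].
- exists (fun x => (fun s => 2 * g' s) (sqn x) * dot x v).
    apply: rc_mul; last exact: rc_dot.
    by apply: (@rc_comp (fun s => 2 * g' s)); exact: smoothZ.
  move=> x; rewrite (_ : _ * _ = g' (sqn x) * (2 * dot x v)); last by ring.
  exact: (is_derive_chain (is_derive_sqn x v) (dg _)).
- exists (fun=> dot v w); first exact: (@rc_comp (fun=> dot v w) (smooth_cst _)).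
  move=> x; apply: is_derive_sum_fun => i.
  rewrite -[v _ _ * _]addr0 -(mulr0 (x ord0 i)).
  by apply: is_derive_mul; exact: is_derive_coord.
- exists (fun x => f' x * g x + f x * g' x); first by apply: rc_add; exact: rc_mul.
  by move=> x; exact: is_derive_mul.
- exists (fun x => f' x + g' x); first exact: rc_add.
  by move=> x; exact: is_derive_add.
Qed.

Lemma radial_test_function (rho b : R) (ze : R -> R) : 0 < rho -> b < rho ^+ 2 ->
  smooth ze -> (forall s, b < s -> ze s = 0) ->
  test_function (@eball R n rho) (fun x => ze (sqn x)).
Proof.
move=> rho0 brho sz z0; pose K := [set x : 'rV[R]_n | sqn x <= b].
have cK : closed K.
  apply: (@closed_comp _ _ (sqn : 'rV[R]_n -> R) [set r | r <= b]).
    by move=> x _; exact: continuous_sqn.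
  exact: closed_le.
have sub : closure [set x : 'rV[R]_n | ze (sqn x) != 0] `<=` K.
  rewrite [X in _ `<=` X](closure_id _).1//; apply: closure_subset => x /= zx.
  by rewrite /K/= leNgt; apply: contra zx => bx; rewrite z0.
have cpK : compact K.
  apply: bounded_closed_compact => //; exists rho; split; first exact: num_real.
  move=> M rM x Kx; rewrite /Num.Def.normr/= mx_normrE; apply: bigmax_le.
    by rewrite ltW// (lt_trans rho0).
  move=> [i j] _ /=; rewrite ord1; apply: le_trans (ltW rM).
  rewrite -(ler_pXn2r (ltn0Sn 1)) ?nnegrE ?normr_ge0 ?(ltW rho0)// real_normK ?num_real//.
  apply: le_trans (ltW brho); apply: le_trans Kx.
  by rewrite /sqn (bigD1 j)//= lerDl sumr_ge0// => k _; exact: sqr_ge0.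
split.
- move=> k; apply: (@Ck_closed _ radial_class); [exact: rc_continuous|exact: (fun f v => @rc_derive f v)|].
  exact: rc_comp.
- by apply: (subclosed_compact _ cpK sub); exact: closed_closure.
- move=> x /sub Kx; rewrite /eball/= -(@ltr_pXn2r _ 2%N)// ?nnegrE ?enorm_ge0 ?(ltW rho0)//.
  by rewrite enorm_sqn (le_lt_trans Kx).
Qed.

End radial.
End test_functions.

(** * Radial Sobolev functions are primitives *)

Section primitive_of_radial.
Context {R : realType}.
Local Notation mu := (@lebesgue_measure R).

Lemma measurable_invr : measurable_fun setT (fun r : R => r^-1).
Proof.
have -> : (fun r : R => r^-1) = fun r => if r == 0 then 0 else r^-1.
  by apply/funext => r; case: eqVneq => // ->; rewrite invr0.
have m0 : measurable (`]-oo, 0[ `|` `]0, +oo[ : set R) by exact: measurableU.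
have -> : [set: R] = [set 0] `|` (`]-oo, 0[ `|` `]0, +oo[).
  apply/seteqP; split => // x _ /=; rewrite !in_itv/= andbT.
  by case: (ltgtP x 0) => [x0|x0|->]; [right; left|right; right|left].
apply/measurable_funU => //; split; first exact: measurable_fun_set1.
apply: (eq_measurable_fun (fun r : R => r^-1)).
  by move=> r _; case: eqVneq => // ->; rewrite invr0.
apply: open_continuous_measurable_fun.
  by apply: openU; [exact: interval_open|exact: interval_open].
move=> x; rewrite inE /= !in_itv/= andbT => x0; apply: inv_continuous.
by case: x0 => [/lt_eqF ->|/gt_eqF ->].
Qed.

Lemma aeS (P Q : R -> Prop) : (forall x, P x -> Q x) ->
  {ae mu, forall x, P x} -> {ae mu, forall x, Q x}.
Proof. exact: (@filterS _ _ (ae_filter_ringOfSetsType mu)). Qed.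

Lemma eq_integrableR (D : set R) (f g : R -> R) : measurable D ->
  (forall x, D x -> f x = g x) -> mu.-integrable D (EFin \o f) ->
  mu.-integrable D (EFin \o g).
Proof.
move=> mD fg; apply: eq_integrable => // x /set_mem Dx /=.
by rewrite fg.
Qed.

Lemma continuous_bounded_itv (f : R -> R) a b : continuous f ->
  exists M : R, forall x, a <= x <= b -> `|f x| <= M.
Proof.
move=> cf; have : compact (f @` `[a, b]).
  by apply: continuous_compact; [exact: continuous_subspaceT|exact: segment_compact].
move=> /compact_bounded /ex_strict_bound_gt0[M M0 HM]; exists M => x xab.
by apply/ltW/HM; exists x => //=; rewrite in_itv.
Qed.

Lemma int_itv_weight (f : R -> R) (k : nat) s b : 0 < s ->
  int_itv (fun r => f r * r ^+ k) s b -> int_itv f s b.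
Proof.
move=> s0 fi; have H r : s <= r -> 0 < r ^+ k by move=> /(lt_le_trans s0); exact: exprn_gt0.
apply: (@eq_integrableR _ (fun r => (r ^+ k)^-1 * (f r * r ^+ k))) => //.
  by move=> r /=; rewrite in_itv/= => /andP[/H r0 _]; rewrite mulrC mulfK// gt_eqF.
apply: (@integrableM_bounded _ _ _ mu _ (measurable_itv _) (s ^+ k)^-1 (fun r => f r * r ^+ k)) => //.
  apply: measurable_funTS; apply: (measurableT_comp (f := fun r : R => r^-1)).
    exact: measurable_invr.
  exact: exprn_measurable.
move=> r /=; rewrite in_itv/= => /andP[sr _].
rewrite normfV (ger0_norm (ltW (H r sr))) lef_pV2 ?posrE ?H//.
by rewrite lerXn2r ?nnegrE// ltW// (lt_le_trans s0).
Qed.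

Lemma itg_support (D : set R) (f : R -> R) al be : measurable D ->
  measurable_fun D f -> `]al, be[ `<=` D ->
  (forall x, D x -> ~~ (al < x < be) -> f x = 0) ->
  itg f al be = \int[mu]_(x in D) f x.
Proof.
move=> mD mf sub f0; rewrite -itg_oo; last exact: measurable_funS mf.
rewrite /Rintegral integral_mkcond [in RHS]integral_mkcond; congr fine.
apply: eq_integral => x _; rewrite !patchE.
have [xab|xab] := boolP (al < x < be).
  have xI : `]al, be[%classic x by rewrite /= in_itv.
  by rewrite !mem_set//; exact: sub.
rewrite memNset; last by rewrite /= in_itv; exact/negP.
by case: ifPn => // /set_mem Dx; rewrite f0.
Qed.

(** As g may fail to be integrable at 0, it is first restricted to [x/2, b]; the tail is then a
    constant minus a primitive. *)
Lemma itg_tail_continuous (g : R -> R) (b x : R) :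
  (forall s, 0 < s -> int_itv g s b) -> 0 < x < b ->
  {for x, continuous (fun s => itg g s b)}.
Proof.
move=> gi /andP[x0 xb]; pose h : R -> R := g \_ `[x / 2, b].
have x20 : 0 < x / 2 by rewrite divr_gt0.
have hi c : int_itv h (x / 2) c.
  apply: int_itvT; rewrite -restrict_EFin; apply/(integrable_mkcond _ _).1 => //.
  exact: gi.
have ch : {for x, continuous (fun s => itg g (x / 2) b - itg h (x / 2) s)}.
  apply: continuousB; first exact: cst_continuous.
  by apply: itg_continuous_at => //; lra.
have E : \forall s \near x, itg g (x / 2) b - itg h (x / 2) s = itg g s b.
  near=> s; have sx : x / 2 < s by near: s; apply: lt_nbhsr; lra.
  have sb : s < b by near: s; exact: lt_nbhsl.
  rewrite (@itg_split _ g (x / 2) s b) ?ltW//; last exact: gi.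
  suff -> : itg h (x / 2) s = itg g (x / 2) s by rewrite addrAC subrr add0r.
  apply: eq_itg => t /andP[t1 t2]; rewrite /h patchE mem_set//= in_itv/= t1/=.
  exact: le_trans t2 (ltW sb).
have Ex : itg g (x / 2) b - itg h (x / 2) x = itg g x b := nbhs_singleton E.
suff : itg g s b @[s --> x] --> itg g x b by [].
by rewrite -Ex; apply: cvg_trans ch; apply: near_eq_cvg; apply: filterS E => s ->.
Unshelve. all: by end_near. Qed.

Variables (n : nat) (rho : R).
Hypotheses (n0 : (0 < n)%N) (rho0 : 0 < rho).
Local Notation I := (`]0, rho[%classic : set R).
Local Notation leb := (@lebesgue_row R n).
Local Notation B := (@eball R n rho).

Section cutoff.
Variables d al be : R.
Hypotheses (d0 : 0 < d) (al0 : 0 < al).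
Let th := bump d al be.
Let X r := itg th 0 r.

Let thi a b : int_itv th a b.
Proof. by apply: int_itv_continuous => x _; exact: continuous_bump. Qed.

Lemma bump_primitive_eq0 r : r <= al -> X r = 0.
Proof.
move=> ral; rewrite /X (@eq_itg _ _ (fun=> 0)); last first.
  by move=> x /andP[_ xr]; rewrite /th bump_out// ltNge (le_trans xr).
have [r0|r0] := leP 0 r; first by rewrite itg_cst// mul0r.
by rewrite itg_lt.
Qed.

Lemma bump_primitive_derive (r : R) : 0 < r -> is_derive r (1 : R) X (th r).
Proof.
move=> r0; apply: (is_derive_itg (fun b => thi 0 b) r0); exact: continuous_bump.
Qed.

(* [kap (r ^ 2) = X r / r ^ n], so that the divergence of [kap (|x| ^ 2) x] is
   [th r / r ^ (n - 1)]. *)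
Definition kap s := X (Num.sqrt s) / Num.sqrt s ^+ n.
Definition kap' s :=
  (th (Num.sqrt s) - n%:R * X (Num.sqrt s) / Num.sqrt s) / (2 * Num.sqrt s ^+ n.+1).

Let near0 s : s < al ^+ 2 -> X (Num.sqrt s) = 0 /\ th (Num.sqrt s) = 0.
Proof.
move=> s0; have sal : Num.sqrt s <= al.
  by rewrite -[leRHS](ger0_norm (ltW al0)) -sqrtr_sqr ler_wsqrtr// ltW.
split; first exact: bump_primitive_eq0.
by rewrite /th bump_out// ltNge sal.
Qed.

Lemma is_derive_kap s : is_derive s (1 : R) kap (kap' s).
Proof.
have [s0|s0] := ltP s (al ^+ 2).
  have [X0 t0] := near0 s0; rewrite /kap' X0 t0 mulr0 mul0r subrr mul0r.
  apply: (@is_derive_local R (fun=> 0) kap s 0).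
  near=> t; rewrite /kap (near0 _).1 ?mul0r//.
  by near: t; exact: lt_nbhsl.
have {}s0 : 0 < s by rewrite (lt_le_trans _ s0)// exprn_gt0.
have r0 : 0 < Num.sqrt s by rewrite sqrtr_gt0.
set r := Num.sqrt s in r0.
have dr := is_derive1_sqrt s0.
have dX := bump_primitive_derive r0.
have dp : is_derive r (1 : R) (fun r => (r ^+ n)^-1) (- (r ^+ n) ^- 2 * (n%:R * r ^+ n.-1)).
  by apply: is_deriveV; [rewrite expf_neq0 ?gt_eqF|exact: is_derive_exprn].
have := is_derive_comp dr (is_deriveM_fun dX dp).
rewrite -/r /kap' -/r; congr is_derive.
have -> : r ^+ n.+1 = r ^+ n.-1 * r * r by rewrite -!exprSr prednK.
have -> : r ^+ n = r ^+ n.-1 * r by rewrite -exprSr prednK.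
have q0 : r ^+ n.-1 != 0 by rewrite expf_neq0 ?gt_eqF.
have rn0 : r != 0 by rewrite gt_eqF.
by field; rewrite q0 rn0.
Unshelve. all: by end_near. Qed.

Lemma continuous_kap' : continuous kap'.
Proof.
move=> s; have [s0|s0] := ltP s (al ^+ 2).
  have k0 t : t < al ^+ 2 -> kap' t = 0.
    by move=> /near0[X0 t0]; rewrite /kap' X0 t0 mulr0 mul0r subrr mul0r.
  rewrite /continuous_at k0//; apply: cvg_near_cst.
  by near=> t; apply: k0; near: t; exact: lt_nbhsl.
have {}s0 : 0 < s by rewrite (lt_le_trans _ s0)// exprn_gt0.
have r0 : 0 < Num.sqrt s by rewrite sqrtr_gt0.
apply: (@continuous_comp _ _ _ Num.sqrt
  (fun r => (th r - n%:R * X r / r) / (2 * r ^+ n.+1))); first exact: sqrt_continuous.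
have cV : {for Num.sqrt s, continuous (fun r : R => r^-1)}.
  by apply: inv_continuous; rewrite gt_eqF.
apply: continuousM.
  apply: continuousB; first exact: continuous_bump.
  apply: continuousM => //; apply: continuousM; first exact: cst_continuous.
  exact: is_derive_continuous (bump_primitive_derive r0).
apply: continuousV; first by rewrite mulf_neq0 ?expf_neq0 ?gt_eqF.
by apply: continuousM; [exact: cst_continuous|exact: exprn_continuous].
Unshelve. all: by end_near. Qed.

Lemma kap_sqr r : 0 < r -> kap (r ^+ 2) = X r / r ^+ n.
Proof. by move=> r0; rewrite /kap sqrtr_sqr gtr0_norm. Qed.

Lemma kap_divergence r : 0 < r ->
  (n%:R * kap (r ^+ 2) + 2 * r ^+ 2 * kap' (r ^+ 2)) * r ^+ n.-1 = th r.
Proof.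
move=> r0; rewrite /kap /kap' sqrtr_sqr gtr0_norm//.
have -> : r ^+ n.+1 = r ^+ n.-1 * r * r by rewrite -!exprSr prednK.
have -> : r ^+ n = r ^+ n.-1 * r by rewrite -exprSr prednK.
have q0 : r ^+ n.-1 != 0 by rewrite expf_neq0 ?gt_eqF.
have rn0 : r != 0 by rewrite gt_eqF.
by field; rewrite q0 rn0.
Qed.

End cutoff.

(** The function g is the radial derivative averaged over spheres. For a bump th with primitive X,
    the divergence identity for a field of divergence th / r^(n-1) reads int th u = - int g X.
    Fubini turns the right side into minus the integral of th against the tail of g, so u plus this
    tail is orthogonal to every bump. *)
Lemma H1_0rad_primitive u : H1_0rad n rho u -> exists2 g : R -> R,
  mu.-integrable I (EFin \o (fun r => g r * r ^+ n.-1)) &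
  {ae mu, forall r, 0 < r < rho -> u r = - itg g r rho}.
Proof.
move=> [G [LU LG _] approx].
have mB := @measurable_eball R n rho.
have [mU _] := LU; have Ui := L2_integrable rho0 LU.
have upi := (radial_integrable n0 mU).1 Ui.
have cgt0 := @ball_const_gt0 R n n0; set c := _ * _ in cgt0.
(* The radial component of the weak gradient. *)
pose F (x : 'rV[R]_n) := \sum_(i < n) (x ord0 i / enorm x) * G i x.
have Fi : leb.-integrable B (EFin \o F).
  apply: (Rintegral_sum_seq _ _ _).1 => // i.
  apply: (@integrableM_bounded _ _ _ _ _ mB 1); last exact: L2_integrable.
    apply: measurable_funTS; apply: measurable_funM; first exact: measurable_row_coor.
    by apply: (measurableT_comp (f := fun r : R => r^-1)); [exact: measurable_invr|exact: measurable_enorm].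
  move=> x _; have [->|x0] := eqVneq (enorm x) 0; first by rewrite invr0 mulr0 normr0.
  rewrite normrM normfV ler_pdivrMr ?normr_gt0// mul1r (ger0_norm (enorm_ge0 x)).
  exact: le_coor_enorm.
have [gp gpi Hgp] := radial_projection n0 Fi.
(* The mean of F over the sphere of radius r: the density of F dx along the radius, divided by the
   area of the sphere. *)
pose g := (fun r => gp r / (c * r ^+ n.-1)) \_ I.
have gE r : I r -> g r * r ^+ n.-1 = c^-1 * gp r.
  move=> Ir; rewrite /g patchE mem_set//; move: Ir; rewrite /= in_itv/= => /andP[r0 _].
  by field; rewrite expf_neq0 ?gt_eqF.
have gpi' : mu.-integrable I (EFin \o (fun r => g r * r ^+ n.-1)).
  apply: (@eq_integrableR _ (fun r => c^-1 * gp r)) => //.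
    by move=> r Ir /=; rewrite gE.
  exact: integrableZ_real.
have gi s b : 0 < s -> int_itv g s b.
  move=> s0; apply: (@int_itv_weight _ n.-1) => //; apply: int_itvT.
  rewrite (_ : (fun r => _) = (fun r => g r * r ^+ n.-1) \_ I); last first.
    by apply/funext => r; rewrite /g !patchE; case: ifPn => // _; rewrite mul0r.
  by rewrite -restrict_EFin; apply/(integrable_mkcond _ _).1.
exists g => //.
suff : {ae mu, forall t, 0 < t < rho -> u t + itg g t rho = 0}.
  by apply: aeS => t H /H /eqP; rewrite addr_eq0 => /eqP.
apply: ae_eq0_bump => al be al0 albe berho; split.
  apply: integrableD_real => //; last first.
    apply: int_itv_continuous => x /andP[x1 x2]; apply: itg_tail_continuous => //.
      by move=> s s0; exact: gi.
    by rewrite (lt_le_trans al0)//= (le_lt_trans x2).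
  apply: (@int_itv_weight _ n.-1) => //; apply: integrableS upi => // x /=.
  rewrite !in_itv/= => /andP[x1 x2].
  by rewrite (lt_le_trans al0)//= (le_lt_trans x2).
move=> d d0; pose th := bump d al be; pose k := kap d al be; pose k' := kap' d al be.
have dk s := @is_derive_kap d al be d0 al0 s.
have ck : continuous k by move=> s; exact: is_derive_continuous (dk s).
have ck' : continuous k' by exact: continuous_kap'.
have csq : continuous (fun r : R => r ^+ 2) by exact: exprn_continuous.
have := divergence_identity rho0 dk ck' LU LG approx.
pose Xi (r : R) := n%:R * k (r ^+ 2) + 2 * r ^+ 2 * k' (r ^+ 2).
have cc (q : R -> R) : continuous q -> continuous (fun r : R => q (r ^+ 2)).
  by move=> cq r; apply: (@continuous_comp _ _ _ (fun r : R => r ^+ 2)); [exact: csq|exact: cq].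
have cXi : continuous Xi.
  apply: continuousD_fun; apply: continuousM_fun; try exact: cc.
    exact: cst_continuous.
  by apply: continuousM_fun => //; exact: cst_continuous.
have crk : continuous (fun r : R => r * k (r ^+ 2)).
  by apply: continuousM_fun; [move=> r; exact: cvg_id|exact: cc].
have [M HM] := continuous_bounded_itv 0 rho cXi.
have [M' HM'] := continuous_bounded_itv 0 rho crk.
have Iin r : I r -> 0 <= r <= rho.
  by rewrite /= in_itv/= => /andP[? ?]; rewrite !ltW.
have Igt r : I r -> 0 < r by rewrite /= in_itv/= => /andP[].
have thE r : I r -> u r * Xi r * r ^+ n.-1 = th r * u r.
  by move=> Ir; rewrite -mulrA (kap_divergence d al be (Igt r Ir)) mulrC.
have fpi : mu.-integrable I (EFin \o (fun r => u r * Xi r * r ^+ n.-1)).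
  apply: (@eq_integrableR _ (fun r => Xi r * (u r * r ^+ n.-1))) => //.
    by move=> r _; ring.
  apply: (@integrableM_bounded _ _ _ mu _ (measurable_itv _) M) => //.
    by apply: measurable_funTS; exact: measurable_continuous.
  by move=> r /Iin; exact: HM.
have thui : mu.-integrable I (EFin \o (fun r => th r * u r)).
  exact: eq_integrableR fpi.
have mf : measurable_fun B (fun x => u (enorm x) * Xi (enorm x)).
  apply: measurable_funM => //; apply: measurable_funTS.
  by apply: measurableT_comp; [exact: measurable_continuous|exact: measurable_enorm].
under eq_Rintegral do rewrite -enorm_sqn -/(Xi (enorm _)).
rewrite (radial_Rintegral (f := fun r => u r * Xi r) n0 mf fpi) -/c.
rewrite (@eq_Rintegral _ _ _ mu I (fun r => th r * u r)); last first.
  by move=> r /set_mem Ir; exact: thE.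
(* The field k(|x|^2) x paired with the weak gradient is h(|x|) F(x), which [radial_projection] can
   integrate. *)
pose h := (fun r : R => r * k (r ^+ 2)) \_ I.
have hM r : `|h r| <= Num.max M' 0.
  rewrite /h patchE; case: ifPn => [/set_mem /Iin Ir|_].
    by rewrite le_max HM'.
  by rewrite normr0 le_max lexx orbT.
have mh : measurable_fun setT h.
  apply: (measurable_restrictT _ (measurable_itv _)).1.
  by apply: measurable_funTS; exact: measurable_continuous.
have h0 : h 0 = 0 by rewrite /h patchE memNset// /= in_itv/= ltxx.
have -> : \int[leb]_(x in B) (\sum_(i < n) G i x * x ord0 i * k (sqn x)) =
   \int[mu]_(r in I) (h r * gp r).
  rewrite -(Hgp h _ mh hM h0); apply: eq_Rintegral => x /set_mem Bx.
  rewrite mulr_sumr; apply: eq_bigr => i _; rewrite -enorm_sqn.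
  have [x0|x0] := eqVneq (enorm x) 0.
    rewrite x0 h0 mul0r; suff -> : x ord0 i = 0 by rewrite mulr0 mul0r.
    by apply/eqP; rewrite -normr_le0 -x0; exact: le_coor_enorm.
  rewrite /h patchE mem_set.
    by field.
  by rewrite /= in_itv/= lt_neqAle eq_sym x0 enorm_ge0.
pose X := itg th 0.
have thi a b : int_itv th a b.
  by apply: int_itv_continuous => x _; exact: continuous_bump.
have XE r : I r -> h r * gp r = c * (g r * X r).
  move=> Ir; have r0 := Igt r Ir; rewrite /h patchE mem_set// /k kap_sqr//.
  have := gE r Ir; rewrite -/X -/th => /(congr1 (fun t => c * t)).
  rewrite (mulrA c c^-1) mulfV ?gt_eqF// mul1r => <-.
  rewrite -[in r ^+ n](prednK n0) exprS.
  by field; rewrite expf_neq0 ?gt_eqF.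
rewrite (@eq_Rintegral _ _ _ mu I (fun r => c * (g r * X r)) (fun r => h r * gp r)); last first.
  by move=> r /set_mem Ir; rewrite XE.
have gXi : mu.-integrable I (EFin \o (fun r => g r * X r)).
  apply: (@eq_integrableR _ (fun r => r * k (r ^+ 2) * (g r * r ^+ n.-1))) => //.
    move=> r Ir; have r0 := Igt r Ir; rewrite /k kap_sqr// -/X -/th.
    rewrite -[in r ^+ n](prednK n0) exprS.
    by field; rewrite expf_neq0 ?gt_eqF.
  apply: (@integrableM_bounded _ _ _ mu _ (measurable_itv _) M') => //.
    by apply: measurable_funTS; exact: measurable_continuous.
  by move=> r /Iin; exact: HM'.
rewrite RintegralZl// -mulrN => /(mulfI (lt0r_neq0 cgt0)) key.
have mg : measurable_fun I g.
  apply: measurable_funTS; apply: (measurable_restrictT _ (measurable_itv _)).1.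
  apply: measurable_funM; first exact: integrable_measurableR gpi.
  apply: measurable_funTS; apply: (measurableT_comp (f := fun r : R => r^-1)).
    exact: measurable_invr.
  by apply: measurable_funM => //; exact: exprn_measurable.
have thn : (fun t => `|th t|) = th by apply/funext => t; rewrite ger0_norm// bump_ge0.
have thI : mu.-integrable I (EFin \o th) by apply/int_itv_oo.
have [||] := @fubini_triangle R rho g th mg thI.
- by rewrite thn.
- by move=> s s0; exact: gi.
move=> thgi E.
have sumi : mu.-integrable I (EFin \o (fun t => th t * (u t + itg g t rho))).
  apply: (@eq_integrableR _ (fun t => th t * u t + th t * itg g t rho)) => //.
    by move=> t _; rewrite mulrDr.
  exact: integrableD_real.
rewrite (@itg_support I _ _ _ (measurable_itv `]0, rho[)).
- rewrite (@eq_Rintegral _ _ _ mu I (fun t => th t * u t + th t * itg g t rho)).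
    by rewrite RintegralD// key E addNr.
  by move=> t _; rewrite mulrDr.
- exact: integrable_measurableR sumi.
- by move=> x /=; rewrite !in_itv/= => /andP[alx xbe]; rewrite (lt_trans al0 alx) (lt_trans xbe berho).
- by move=> x _ xab; rewrite bump_out// mul0r.
Qed.

End primitive_of_radial.

(** * The radial equation as a Volterra equation *)

Lemma cvg_dist_le (R : realType) (u : nat -> R) (l a M : R) (m : nat) :
  u k @[k --> \oo] --> l -> (forall k, (m <= k)%N -> `|u k - a| <= M) -> `|l - a| <= M.
Proof.
move=> ul uM; apply/ler_addgt0Pl => e e0.
have /cvgrPdist_lt /(_ e e0)[k _ Hk] := ul.
have -> : l - a = (l - u (maxn k m)) + (u (maxn k m) - a) by rewrite addrA subrK.
rewrite (le_trans (ler_normD _ _))// lerD ?uM ?leq_maxr//.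
by apply: ltW; apply: Hk => /=; exact: leq_maxl.
Qed.

Section volterra.
Context {R : realType}.
Local Notation mu := (@lebesgue_measure R).
Implicit Types (q f g : R -> R) (c C : R).

(** Potentials live on the whole line and vanish up to 0, so the primitives from 0 below are
    continuous everywhere and no end point of an interval needs care. *)
Definition potential q :=
  mu.-integrable setT (EFin \o q) /\ forall x, x <= 0 -> q x = 0.

Variable d : nat.

(* For a solution f of (r ^ d f')' + r ^ d q f = 0 which is regular at 0, the  *)
(* flux is - r ^ d f' and the slope is - f'.                                  *)
Definition flux q f s := itg (fun t => t ^+ d * q t * f t) 0 s.
Definition slope q f s := flux q f s / s ^+ d.
(** The regular solution with value 1 at 0 is the fixed point of y -> 1 - [volt] q y. *)
Definition volt q f r := itg (slope q f) 0 r.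

(** A weighted sup norm with exponential weight: a large rate c makes [volt] a contraction on the
    whole line at once, without cutting the line into short intervals. *)
Definition wt c t := expR (c * Num.max t 0).

Definition wball c C f := measurable_fun setT f /\ forall t, `|f t| <= C * wt c t.

Lemma wt_gt0 c t : 0 < wt c t. Proof. exact: expR_gt0. Qed.

Lemma le_wt c s t : 0 <= c -> s <= t -> wt c s <= wt c t.
Proof.
by move=> c0 st; rewrite /wt ler_expR ler_wpM2l// ge_max !le_max st lexx orbT.
Qed.

Lemma wball_ge0 c C f : wball c C f -> 0 <= C.
Proof.
move=> [_ /(_ 0)]; have := wt_gt0 c 0; move: (wt c 0) (normr_ge0 (f 0)) => w n0 w0 H.
by rewrite -(pmulr_lge0 _ w0); exact: le_trans n0 H.
Qed.

Section fixed_potential.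
Variable q : R -> R.
Hypothesis pq : potential q.
Let qi := pq.1.
Let q0 := pq.2.

Lemma potential_norm : potential (fun t => `|q t|).
Proof.
by split=> [|x /q0 ->]; [exact: (integrable_norm qi)|rewrite normr0].
Qed.

Let qni a b : int_itv (fun t => `|q t|) a b.
Proof. exact: int_itvT potential_norm.1. Qed.

Variables (c : R).
Hypothesis c0 : 0 <= c.

Lemma int_flux C f a b : wball c C f -> int_itv (fun t => t ^+ d * q t * f t) a b.
Proof.
move=> fW; have [mf fC] := fW.
have [M HM] := @continuous_bounded_itv R _ a b (@exprn_continuous R d).
apply: (@eq_integrableR _ _ (fun t => (t ^+ d * f t) * q t)) => //.
  by move=> t _; ring.
have mp : measurable_fun `[a, b] (fun t : R => t ^+ d * f t).
  by apply: measurable_funM; [exact: exprn_measurable|exact: measurable_funTS].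
apply: (@integrableM_bounded _ _ _ mu _ (measurable_itv _) (M * (C * wt c b)) q) => //.
  move=> t /=; rewrite in_itv/= => tab; rewrite normrM ler_pM//; first exact: HM.
  rewrite (le_trans (fC t))// ler_wpM2l ?(wball_ge0 fW)// le_wt//.
  by case/andP: tab.
exact: int_itvT.
Qed.

Lemma slope_le0 f s : s <= 0 -> slope q f s = 0.
Proof. by move=> s0; rewrite /slope /flux itg_pt// mul0r. Qed.

(** Since t^d <= s^d under the integral, the singular factor s^-d disappears. The bound tends to 0
    with s, which makes the slope continuous at the origin. *)
Lemma slope_bound C f s : wball c C f ->
  `|slope q f s| <= C * wt c s * itg (fun t => `|q t|) 0 s.
Proof.
move=> fW; have [mf fC] := fW; have C0 := wball_ge0 fW.
have [s0|s0] := leP s 0; first by rewrite slope_le0// normr0 itg_pt// mulr0.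
have p0 : 0 < s ^+ d by exact: exprn_gt0.
rewrite /slope normrM normfV (gtr0_norm p0) ler_pdivrMr//.
rewrite (le_trans (norm_itg (int_flux _ _ fW)))// mulrAC -itgZ//.
apply: le_itg => [||t /andP[t0 ts]].
- exact: int_itv_norm (int_flux _ _ fW).
- by apply: integrableZ_real => //; exact: qni.
- have H : t ^+ d * `|f t| <= s ^+ d * (C * wt c s).
    rewrite ler_pM ?exprn_ge0//; first by rewrite lerXn2r ?nnegrE// (le_trans t0).
    by rewrite (le_trans (fC t))// ler_wpM2l// le_wt.
  rewrite !normrM (ger0_norm (exprn_ge0 d t0)).
  rewrite (_ : t ^+ d * _ * _ = t ^+ d * `|f t| * `|q t|); last by ring.
  rewrite (_ : C * _ * _ * _ = s ^+ d * (C * wt c s) * `|q t|); last by ring.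
  by rewrite ler_wpM2r.
Qed.

Lemma flux_continuous C f : wball c C f -> continuous (flux q f).
Proof.
move=> fW; apply: itg_continuous; first by move=> a b; exact: int_flux fW.
by move=> x /q0 ->; rewrite mulr0 mul0r.
Qed.

Lemma slope_continuous C f : wball c C f -> continuous (slope q f).
Proof.
move=> fW x; have C0 := wball_ge0 fW.
have [x0|x0] := ltP 0 x.
  apply: continuousM; first exact: flux_continuous fW _.
  apply: continuousV; first by rewrite expf_neq0 ?gt_eqF.
  exact: exprn_continuous.
have cq : continuous (itg (fun t => `|q t|) 0).
  by apply: itg_continuous => //; exact: potential_norm.2.
have H : (C * wt c 1) * itg (fun t => `|q t|) 0 t @[t --> x] --> 0.
  have cqx : itg (fun t => `|q t|) 0 t @[t --> x] --> itg (fun t => `|q t|) 0 x := cq x.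
  rewrite (itg_pt _ x0) in cqx.
  rewrite -[X in _ --> X](mulr0 (C * wt c 1)).
  by apply: cvgM; [exact: cvg_cst|exact: cqx].
suff : slope q f t @[t --> x] --> slope q f x by [].
rewrite slope_le0//; apply/norm_cvg0P.
apply: (squeeze_cvgr _ (cvg_cst 0) H); near=> t.
rewrite normr_ge0/= (le_trans (slope_bound _ fW))// ler_wpM2r//.
  by apply: itg_ge0 => u _; exact: normr_ge0.
rewrite ler_wpM2l// le_wt//; near: t.
have x1 : x < 1 by rewrite (le_lt_trans x0).
by apply: filterS (lt_nbhsl x1) => u /ltW.
Unshelve. all: by end_near. Qed.

Lemma int_slope C f a b : wball c C f -> int_itv (slope q f) a b.
Proof. by move=> fW; apply: int_itv_continuous => x _; exact: slope_continuous fW x. Qed.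

Lemma is_derive_volt C f r : wball c C f -> is_derive r (1 : R) (volt q f) (slope q f r).
Proof.
move=> fW; pose a := Num.min r 0 - 1.
have [ar a0] : a < r /\ a < 0.
  by rewrite /a; case: (leP r 0) => H; split; lra.
have -> : volt q f = itg (slope q f) a.
  apply/funext => x; have [x0|x0] := leP 0 x.
    rewrite /volt (@itg_0l _ _ a)//; first exact: ltW.
      by move=> b; exact: int_slope fW.
    by move=> y; exact: slope_le0.
  rewrite /volt itg_lt// (@eq_itg _ _ (fun=> 0) a x).
    have [ax|xa] := leP a x; first by rewrite itg_cst ?mul0r.
    by rewrite itg_lt.
  by move=> y /andP[_ yx]; rewrite slope_le0// (le_trans yx)// ltW.
by apply: (is_derive_itg _ ar); [move=> b; exact: int_slope fW|exact: slope_continuous fW r].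
Qed.

Lemma volt_continuous C f : wball c C f -> continuous (volt q f).
Proof. by move=> fW x; exact: is_derive_continuous (is_derive_volt x fW). Qed.

Variable A : R.
Hypothesis qA : forall s, itg (fun t => `|q t|) 0 s <= A.

Lemma mass_ge0 : 0 <= A.
Proof. by rewrite (le_trans _ (qA 0))// itg_ge0// => x _; exact: normr_ge0. Qed.

Lemma slope_bound_mass C f s : wball c C f -> `|slope q f s| <= A * (C * wt c s).
Proof.
move=> fW; rewrite (le_trans (slope_bound s fW))// mulrC ler_wpM2r//.
by rewrite mulr_ge0 ?(wball_ge0 fW)// ltW// wt_gt0.
Qed.

(** Integrating exp(c t) gains the factor 1/c. *)
Lemma volt_wball_mass C f : 0 < c -> wball c C f -> wball c (A * C / c) (volt q f).
Proof.
move=> c1 fW; have C0 := wball_ge0 fW; split.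
  apply: measurable_continuous; exact: volt_continuous fW.
move=> r; have A0 := mass_ge0.
have [r0|r0] := ltP r 0.
  by rewrite /volt itg_lt// normr0 !mulr_ge0 ?invr_ge0// ltW// wt_gt0.
rewrite (le_trans (norm_itg (int_slope _ _ fW)))//.
have dE x : is_derive x (1 : R) (fun x => A * C / c * expR (c * x)) (A * C * expR (c * x)).
  have dc : is_derive x (1 : R) (fun x => c * x) c.
    by have := is_derive_cmul c (is_derive_id x (1 : R)); rewrite mulr1.
  have := is_derive_cmul (A * C / c) (is_derive_comp dc (is_derive_expR (c * x))).
  by congr is_derive; field; rewrite gt_eqF.
have cE : continuous (fun x : R => A * C * expR (c * x)).
  apply: continuousM_fun; first exact: cst_continuous.
  move=> x; apply: (@continuous_comp _ _ _ (fun x : R => c * x)); last exact: continuous_expR.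
  exact: mulrl_continuous.
have E := itg_derive r0 (fun x _ => cE x) (fun x _ => dE x).
apply: (@le_trans _ _ (itg (fun x => A * C * expR (c * x)) 0 r)).
  apply: le_itg.
  - exact: int_itv_norm (int_slope _ _ fW).
  - by apply: int_itv_continuous => x _; exact: cE.
  - move=> t /andP[t0 _]; rewrite (le_trans (slope_bound_mass t fW))//.
    by rewrite mulrA /wt max_l.
rewrite E mulr0 expR0 mulr1 /wt max_l//.
by rewrite lerBlDr lerDl !mulr_ge0// invr_ge0.
Qed.

Hypothesis Ac : 2 * A < c.

Lemma volt_wball C f : wball c C f -> wball c (C / 2) (volt q f).
Proof.
move=> fW; have c1 : 0 < c by rewrite (le_lt_trans _ Ac)// mulr_ge0// mass_ge0.
have [mv vC] := volt_wball_mass c1 fW; split=> // t.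
rewrite (le_trans (vC t))// ler_wpM2r ?(ltW (wt_gt0 _ _))// (mulrC A) -mulrA ler_wpM2l//.
  exact: wball_ge0 fW.
by rewrite ler_pdivrMr// mulrC -ler_pdivrMr ?invr_gt0// invrK mulrC ltW.
Qed.

Lemma voltB C C' f g : wball c C f -> wball c C' g ->
  volt q (fun t => f t - g t) = fun r => volt q f r - volt q g r.
Proof.
move=> fW gW; apply/funext => r; rewrite /volt -itgB; try exact: int_slope; last first.
- exact: int_slope gW.
- exact: int_slope fW.
apply: eq_itg => s _; rewrite /slope -mulrBl; congr (_ / _).
rewrite /flux -itgB; last exact: int_flux gW.
  by apply: eq_itg => t _; rewrite mulrBr.
exact: int_flux fW.
Qed.

Lemma wballB C C' f g : wball c C f -> wball c C' g ->
  wball c (C + C') (fun t => f t - g t).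
Proof.
move=> [mf fC] [mg gC]; split; first exact: measurable_funB.
by move=> t; rewrite (le_trans (ler_normB _ _))// mulrDl lerD.
Qed.

Lemma wball_weaken C C' f : C <= C' -> wball c C f -> wball c C' f.
Proof.
by move=> CC [mf fC]; split=> // t; rewrite (le_trans (fC t))// ler_wpM2r// ltW// wt_gt0.
Qed.

(* Gronwall's inequality, by iterating the contraction. *)
Lemma wball_contract E C f : wball c C f ->
  wball c E (fun r => f r + volt q f r) -> wball c (2 * E) f.
Proof.
move=> fW eW; have [mf _] := fW; have E0 := wball_ge0 eW.
have step C' : wball c C' f -> wball c (C' / 2 + E) f.
  move=> f'W; have [_ H] := volt_wball f'W; split=> // t.
  have -> : f t = (f t + volt q f t) - volt q f t by rewrite addrK.
  rewrite (le_trans (ler_normB _ _))// addrC mulrDl lerD//.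
  by case: eW => _; exact.
have it k : wball c (C / 2 ^+ k + 2 * E) f.
  elim: k => [|k IH].
    by rewrite expr0 divr1; apply: wball_weaken fW; rewrite lerDl mulr_ge0.
  by have := step _ IH; congr wball; rewrite exprS; field; rewrite expf_neq0.
split=> // t; apply/ler_addgt0Pl => e e0.
have w0 := wt_gt0 c t.
have C0 := wball_ge0 fW.
have := @cvg_geometric R (C * wt c t) (2^-1) _.
rewrite ger0_norm ?invr_ge0// => /(_ _).
have h1 : (2^-1 : R) < 1 by lra.
move=> /(_ h1) /cvgrPdist_lt /(_ e e0)[k _ /(_ k (leqnn k))] /=.
rewrite sub0r normrN ger0_norm ?mulr_ge0 ?exprn_ge0 ?invr_ge0// ?(ltW w0)// => ke.
have [_ /(_ t) H] := it k; apply: (le_trans H).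
by rewrite mulrDl lerD2r; apply: ltW; rewrite mulrAC -exprVn.
Qed.

Lemma volt_unique C f : wball c C f -> (forall r, f r + volt q f r = 0) -> forall r, f r = 0.
Proof.
move=> fW f0; have z : wball c 0 (fun r => f r + volt q f r).
  by split=> [|t]; rewrite ?f0 ?normr0 ?mul0r//; under eq_fun do rewrite f0; exact: measurable_cst.
have [_ H] := wball_contract fW z; move=> r; apply/eqP; rewrite -normr_le0.
by have := H r; rewrite mulr0 mul0r.
Qed.

(** Picard iterates started at 0; consecutive ones differ by at most 2^-m in the weighted norm. *)
Let S m : R -> R := iter m (fun f r => 1 - volt q f r) (fun=> 0).

Let one_wball : wball c 1 (fun=> 1).
Proof.
split=> [|t]; first exact: measurable_cst.
rewrite normr1 mul1r /wt -[leLHS]expR0 ler_expR mulr_ge0// le_max lexx orbT.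
by [].
Qed.

Let S_wball m : wball c 2 (S m).
Proof.
elim: m => [|m IH] /=.
  split=> [|t]; first exact: measurable_cst.
  by rewrite normr0 mulr_ge0// ltW// wt_gt0.
have := wballB one_wball (volt_wball IH).
by congr wball; lra.
Qed.

Let D_wball m : wball c (2^-1 ^+ m) (fun r => S m.+1 r - S m r).
Proof.
elim: m => [|m IH].
  rewrite expr0; suff -> : (fun r => S 1 r - S 0 r) = fun=> 1 by exact: one_wball.
  apply/funext => r; rewrite /S /= subr0 /volt (@eq_itg _ _ (fun=> 0) 0 r).
    have [r0|r0] := leP 0 r; last by rewrite itg_lt// subr0.
    by rewrite itg_cst// mul0r subr0.
  move=> x _; rewrite /slope /flux (@eq_itg _ _ (fun=> 0) 0 x).
    have [r0|r0] := leP 0 x; last by rewrite itg_lt// mul0r.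
    by rewrite itg_cst// !mul0r.
  by move=> t _; rewrite mulr0.
have := volt_wball IH; rewrite (voltB (S_wball _) (S_wball _)) exprSr => -[mv vC].
have E : (fun r => S m.+2 r - S m.+1 r) = fun r => - (volt q (S m.+1) r - volt q (S m) r).
  have gen (a b : R) : (1 - a) - (1 - b) = - (a - b) by ring.
  by apply/funext => r; exact: gen.
rewrite E; split; first exact: measurable_funN.
by move=> t; rewrite normrN.
Qed.

Let y r : R := limn (fun m => S m r).

Let S_cvg r : S m r @[m --> \oo] --> y r.
Proof.
have w0 := wt_gt0 c r.
have E m : S m r = series (fun k => S k.+1 r - S k r) m.
  rewrite /series/= telescope_sumr//= subr0.
  by [].
suff : cvgn (series (fun k => S k.+1 r - S k r)).
  have -> : series (fun k => S k.+1 r - S k r) = fun m => S m r by apply/funext.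
  by [].
apply: normed_cvg.
apply: (@series_le_cvg _ _ (geometric (wt c r) 2^-1)).
- by move=> k /=.
- by move=> k /=; rewrite mulr_ge0 ?exprn_ge0 ?invr_ge0// ltW.
- by move=> k /=; have [_ /(_ r)] := D_wball k; rewrite mulrC.
- by apply: is_cvg_geometric_series; rewrite ger0_norm ?invr_ge0//; lra.
Qed.

Let y_wball : wball c 2 y.
Proof.
split; first by apply: (measurable_fun_cvg (h := S)) => [m|t _]; [case: (S_wball m)|exact: S_cvg].
move=> t; rewrite -[y t]subr0; apply: (@cvg_dist_le _ _ _ _ _ 0 (@S_cvg t)) => m _.
by rewrite subr0; case: (S_wball m) => _; exact.
Qed.

Let yS_wball m : wball c (2 * 2^-1 ^+ m) (fun r => y r - S m r).
Proof.
split; first by apply: measurable_funB; [case: y_wball|case: (S_wball m)].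
move=> t.
(* Partial sums of the geometric series, telescoped from m to m + k; the limit in k gives the tail 2
   / 2^m. *)
have H k : `|S (m + k) t - S m t| <= (2 * 2^-1 ^+ m - 2 * 2^-1 ^+ (m + k)) * wt c t.
  elim: k => [|k IH]; first by rewrite addn0 !subrr normr0 mul0r.
  have [_ /(_ t) DD] := D_wball (m + k).
  rewrite addnS; have -> : S (m + k).+1 t - S m t =
     (S (m + k).+1 t - S (m + k) t) + (S (m + k) t - S m t) by ring.
  rewrite (le_trans (ler_normD _ _))// (le_trans (lerD DD IH))// -mulrDl ler_wpM2r//.
    by rewrite ltW// wt_gt0.
  by rewrite exprS; lra.
apply: (@cvg_dist_le _ _ _ _ _ m (@S_cvg t)) => k mk.
rewrite -(subnKC mk) (le_trans (H _))// ler_wpM2r//.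
  by rewrite ltW// wt_gt0.
by rewrite lerBlDr lerDl mulr_ge0// exprn_ge0// invr_ge0.
Qed.

Lemma volt_exists : exists y, wball c 2 y /\ forall r, y r + volt q y r = 1.
Proof.
exists y; split; first exact: y_wball.
move=> r; apply/eqP; rewrite -subr_eq0 -normr_le0; apply/ler_addgt0Pl => e e0.
have w0 := wt_gt0 c r.
have h1 : `|2^-1 : R| < 1 by rewrite ger0_norm ?invr_ge0//; lra.
have /cvgrPdist_lt /(_ e e0)[k _ /(_ k (leqnn k))] /= := cvg_geometric (2 * wt c r) h1.
rewrite sub0r normrN ger0_norm ?mulr_ge0 ?exprn_ge0 ?invr_ge0// ?(ltW w0)// => ke.
rewrite addr0; apply: le_trans (ltW ke).
have [_ /(_ r) H1] := yS_wball k.+1.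
have [_ /(_ r)] := volt_wball (yS_wball k); rewrite (voltB y_wball (S_wball k)) => H2.
have -> : y r + volt q y r - 1 = (y r - S k.+1 r) + (volt q y r - volt q (S k) r).
  have gen (a b v : R) : a + b - 1 = (a - (1 - v)) + (b - v) by ring.
  exact: gen.
rewrite (le_trans (ler_normD _ _))// (le_trans (lerD H1 H2))// -mulrDl.
by rewrite [leRHS]mulrAC ler_wpM2r ?(ltW w0)// exprS; lra.
Qed.

End fixed_potential.
End volterra.

(** * Integration by parts for primitives of integrable functions *)

Section parts.
Context {R : realType}.
Local Notation mu := (@lebesgue_measure R).
Implicit Types (f h F H : R -> R).

Lemma int_itvD f h a b : int_itv f a b -> int_itv h a b -> int_itv (fun x => f x + h x) a b.
Proof. exact: (@integrableD_real _ _ _ mu _ (measurable_itv _)). Qed.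

Lemma int_itvB f h a b : int_itv f a b -> int_itv h a b -> int_itv (fun x => f x - h x) a b.
Proof. exact: (@integrableB_real _ _ _ mu _ (measurable_itv _)). Qed.

Lemma int_itvZ (k : R) f a b : int_itv f a b -> int_itv (fun x => k * f x) a b.
Proof. exact: (@integrableZ_real _ _ _ mu _ (measurable_itv _)). Qed.

Lemma int_itv_measurable f a b : int_itv f a b -> measurable_fun `]a, b[ f.
Proof. by move=> /int_itv_oo; exact: integrable_measurableR. Qed.

Lemma potential_prim_continuous f : potential f -> continuous (itg f 0).
Proof. by move=> [fi f0]; apply: itg_continuous => // a b; exact: int_itvT. Qed.

Lemma potential_prim_int f h b : potential f -> potential h ->
  int_itv (fun r => f r * itg h 0 r) 0 b.
Proof.
move=> fp hp; have ch := potential_prim_continuous hp.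
have [M HM] := continuous_bounded_itv 0 b ch.
apply: (@eq_integrableR _ _ (fun r => itg h 0 r * f r)) => //.
  by move=> r _; rewrite mulrC.
apply: (@integrableM_bounded _ _ _ mu _ (measurable_itv _) M) => //.
- by apply: measurable_funTS; exact: measurable_continuous.
- exact: int_itvT fp.1.
Qed.

(** The square is cut along its diagonal, and [fubini_triangle] evaluates the integral over one
    triangle in the other order. *)
Lemma potential_parts f h b : 0 < b -> potential f -> potential h ->
  itg (fun r => f r * itg h 0 r) 0 b + itg (fun r => itg f 0 r * h r) 0 b =
  itg f 0 b * itg h 0 b.
Proof.
move=> b0 fp hp; have [fi f0] := fp; have [hi h0] := hp.
have fab x y : int_itv f x y by exact: int_itvT.
have hab x y : int_itv h x y by exact: int_itvT.
have i1 := potential_prim_int b fp hp.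
have i2 := potential_prim_int b hp fp.
have hnp := potential_norm hp.
have [||||_ E] := @fubini_triangle R b f h.
- exact: measurable_funS (integrable_measurableR fi).
- by apply/int_itv_oo.
- by apply/int_itv_oo; exact: potential_prim_int.
- by move=> s _.
have E0 s : 0 <= s <= b -> itg f 0 b * h s - h s * itg f 0 s = h s * itg f s b.
  by move=> /andP[s0 sb]; rewrite (itg_split s0 sb (fab 0 b)) mulrDl addrAC mulrC subrr add0r mulrC.
have fh := int_itvZ (itg f 0 b) (hab 0 b).
have E1 : itg (fun r => f r * itg h 0 r) 0 b = itg (fun s => h s * itg f s b) 0 b.
  rewrite -itg_oo; last exact: int_itv_measurable i1.
  rewrite E (@eq_Rintegral _ _ _ mu _ (fun s => itg f 0 b * h s - h s * itg f 0 s)).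
    rewrite itg_oo; last by apply: int_itv_measurable; exact: int_itvB.
    by apply: eq_itg => s /E0.
  by move=> s; rewrite inE/= in_itv/= => /andP[/ltW s0 /ltW sb]; rewrite E0// s0.
rewrite E1 (@eq_itg _ _ (fun s => itg f 0 b * h s - h s * itg f 0 s)); last first.
  by move=> s /E0.
rewrite (itgB fh i2) (itgZ _ (hab 0 b)) (@eq_itg _ (fun r => itg f 0 r * h r) (fun r => h r * itg f 0 r)).
  by rewrite subrK.
by move=> r _; rewrite mulrC.
Qed.

(** f and h are cut off to [al, be] to apply [potential_parts]. The vanishing condition bears only
    on x = al = 0 and makes the cut-off functions vanish up to 0, as a [potential] must. *)
Lemma itg_parts f h F H al be : 0 <= al -> al < be ->
  int_itv f al be -> int_itv h al be ->
  (forall x, al <= x <= 0 -> f x = 0 /\ h x = 0) ->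
  (forall r, al <= r <= be -> F r = F al + itg f al r) ->
  (forall r, al <= r <= be -> H r = H al + itg h al r) ->
  int_itv (fun r => f r * H r + F r * h r) al be /\
  itg (fun r => f r * H r + F r * h r) al be = F be * H be - F al * H al.
Proof.
move=> al0 albe fi hi fh0 FE HE; have be0 : 0 < be by exact: le_lt_trans albe.
pose pt (k : R -> R) : R -> R := k \_ `[al, be].
have ptp k : int_itv k al be -> (forall x, al <= x <= 0 -> k x = 0) -> potential (pt k).
  move=> ki k0; split.
    by rewrite -restrict_EFin; apply/(integrable_mkcond _ _).1.
  move=> x x0; rewrite /pt patchE; case: ifPn => // /set_mem /=.
  by rewrite in_itv/= => /andP[ax _]; apply: k0; rewrite ax.
have fp : potential (pt f) by apply: ptp => // x /fh0[].
have hp : potential (pt h) by apply: ptp => // x /fh0[].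
have ptE k r : al <= r <= be -> pt k r = k r.
  by move=> rab; rewrite /pt patchE mem_set//= in_itv.
have ptI k r : potential (pt k) -> al <= r <= be -> itg (pt k) 0 r = itg k al r.
  move=> kp /andP[ar rb]; rewrite (@itg_split _ _ 0 al r)//; last exact: int_itvT kp.1.
  rewrite -(@itg_oo _ _ 0 al); last exact: measurable_funS (integrable_measurableR kp.1).
  rewrite (@eq_Rintegral _ _ _ mu _ (fun=> 0)); last first.
    move=> x; rewrite inE/= in_itv/= => /andP[_ xal].
    by rewrite /pt patchE memNset//= in_itv/= => /andP[]; rewrite leNgt xal.
  rewrite {1}/Rintegral integral0 /= add0r; apply: eq_itg => x /andP[ax xr]; apply: ptE.
  by rewrite ax (le_trans xr).
have i1 : int_itv (fun r => f r * itg h al r) al be.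
  apply: (@eq_integrableR _ _ (fun r => pt f r * itg (pt h) 0 r)) => //.
    by move=> r /=; rewrite in_itv/= => rab; rewrite ptE// ptI.
  by apply: int_itvS (potential_prim_int be fp hp).
have i2 : int_itv (fun r => itg f al r * h r) al be.
  apply: (@eq_integrableR _ _ (fun r => pt h r * itg (pt f) 0 r)) => //.
    by move=> r /=; rewrite in_itv/= => rab; rewrite ptE// ptI// mulrC.
  by apply: int_itvS (potential_prim_int be hp fp).
have EE r : al <= r <= be -> f r * H r + F r * h r =
    (H al * f r + f r * itg h al r) + (F al * h r + itg f al r * h r).
  by move=> rab; rewrite (FE r rab) (HE r rab); ring.
have j1 := int_itvD (int_itvZ (H al) fi) i1.
have j2 := int_itvD (int_itvZ (F al) hi) i2.
split.
  apply: eq_integrableR (int_itvD j1 j2) => //.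
  by move=> r /=; rewrite in_itv/= => rab; rewrite EE.
rewrite (eq_itg EE) itgD// itgD//; last exact: int_itvZ.
rewrite itgZ// itgD//; last exact: int_itvZ.
rewrite itgZ//.
have key : itg (fun r => f r * itg h al r) al be + itg (fun r => itg f al r * h r) al be =
  itg f al be * itg h al be.
  have bb : al <= be <= be by rewrite lexx ltW.
  have := potential_parts be0 fp hp; rewrite !ptI// => <-.
  apply: (@f_equal2 _ _ _ (fun x y : R => x + y)).
    rewrite -[LHS](ptI (fun r => f r * itg h al r) be)//; last by apply: ptp => // x /fh0[-> _]; rewrite mul0r.
    apply: eq_itg => r /andP[r0 rb]; rewrite /pt !patchE.
    case: ifPn => [/set_mem /=|]; last by rewrite mul0r.
    by rewrite in_itv/= => rab; rewrite -ptI.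
  rewrite -[LHS](ptI (fun r => itg f al r * h r) be)//; last by apply: ptp => // x /fh0[_ ->]; rewrite mulr0.
  apply: eq_itg => r /andP[r0 rb]; rewrite /pt !patchE.
  case: ifPn => [/set_mem /=|]; last by rewrite mulr0.
  by rewrite in_itv/= => rab; rewrite -ptI.
have bb : al <= be <= be by rewrite lexx ltW.
rewrite (FE be bb) (HE be bb).
move: key; set A := itg (fun r => f r * _) _ _; set B := itg (fun r => itg f _ _ * _) _ _ => key.
rewrite (_ : H al * _ + A + _ = H al * itg f al be + F al * itg h al be + (A + B)); last by ring.
by rewrite key; ring.
Qed.

End parts.

(** * Sign changes and first zeros *)

Section zeros.
Context {R : realType}.
Implicit Types (f : R -> R) (a b r : R).

Lemma ivt_sign f a b : a <= b -> (forall x, a <= x <= b -> {for x, continuous f}) ->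
  f a * f b < 0 -> exists2 c, a < c < b & f c = 0.
Proof.
move=> ab cf sgn.
have cw : {within `[a, b], continuous f}.
  by apply: continuous_in_subspaceT => x; rewrite inE/= in_itv/=; exact: cf.
have [fa0|fa0|fa0] := ltgtP (f a) 0; last by move: sgn; rewrite fa0 mul0r ltxx.
  have fb0 : 0 < f b by rewrite -(nmulr_rlt0 _ fa0).
  have [|c cab fc] := IVT ab cw (v := 0).
    by rewrite ge_min le_max (ltW fa0) (ltW fb0) orbT.
  exists c => //; move: cab; rewrite in_itv/= => /andP[ac cb].
  rewrite !lt_neqAle ac cb !andbT; apply/andP; split; apply/eqP => E.
    by move: fa0; rewrite E fc ltxx.
  by move: fb0; rewrite -E fc ltxx.
have fb0 : f b < 0 by rewrite -(pmulr_rlt0 _ fa0).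
have [|c cab fc] := IVT ab cw (v := 0).
  by rewrite ge_min le_max (ltW fa0) (ltW fb0) orbT.
exists c => //; move: cab; rewrite in_itv/= => /andP[ac cb].
rewrite !lt_neqAle ac cb !andbT; apply/andP; split; apply/eqP => E.
  by move: fa0; rewrite E fc ltxx.
by move: fb0; rewrite -E fc ltxx.
Qed.

Lemma first_zero f a b : a <= b -> (forall x, a <= x <= b -> {for x, continuous f}) ->
  f a != 0 -> f b = 0 ->
  exists r, [/\ a < r <= b, f r = 0 & forall x, a <= x < r -> 0 < f a * f x].
Proof.
move=> ab cf fa fb; pose S := [set x | a <= x <= b /\ f x = 0].
have S0 : S !=set0 by exists b; split=> //; rewrite ab lexx.
have Sa : lbound S a by move=> x [/andP[]].
have hS : has_inf S by split=> //; exists a.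
pose r := inf S.
have ar : a <= r by exact: lb_le_inf.
have rb : r <= b by apply: ge_inf; [exists a|split; rewrite ?ab ?lexx].
have fr : f r = 0.
  apply/eqP; apply/negP => /negP fr0.
  have cr : {for r, continuous f} by apply: cf; rewrite ar.
  have : \forall x \near r, f x != 0.
    have nfr : 0 < `|f r| by rewrite normr_gt0.
    have /cvgrPdist_lt /(_ _ nfr) := cr; apply: filterS => x fx.
    by apply/eqP => fx0; move: fx; rewrite fx0 subr0 ltxx.
  move=> /nbhs_ballP[e /= e0 He].
  have [x [xab fx] xr] := inf_adherent e0 hS.
  have rx : r <= x by apply: ge_inf; [exists a|split].
  have := He x; rewrite /ball/= fx eqxx => /(_ _) H; suff : false by []; apply: H.
  by rewrite distrC ger0_norm ?subr_ge0// ltrBlDl.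
exists r; split=> //.
  by rewrite rb andbT lt_neqAle ar andbT; apply: contraNneq fa => ->; rewrite fr.
move=> x /andP[ax xr]; rewrite ltNge; apply/negP => fax.
have nz t : a <= t < r -> f t != 0.
  move=> /andP[at1 tr]; apply/eqP => ft.
  have : r <= t by apply: ge_inf; [exists a|split=> //; rewrite at1 (le_trans (ltW tr))].
  by rewrite leNgt tr.
have fax' : f a * f x < 0.
  by rewrite lt_neqAle fax andbT mulf_neq0// nz// ax.
have [|t /andP[at1 tx] ft] := ivt_sign ax _ fax'.
  by move=> t /andP[at1 tx]; apply: cf; rewrite at1 (le_trans tx)// (le_trans (ltW xr)).
by have := nz t; rewrite (ltW at1) (lt_trans tx xr) ft eqxx => /(_ isT).
Qed.

End zeros.

(** * Regular solutions: dependence on the potential, simple zeros, Wronskian *)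

Section regular.
Context {R : realType}.
Local Notation mu := (@lebesgue_measure R).
Implicit Types (q y f : R -> R) (c C A r al be : R).

Definition mass q A := forall s, itg (fun t => `|q t|) 0 s <= A.

Lemma potential_mass q : potential q -> exists A, mass q A.
Proof.
move=> pq; have [ni _] := potential_norm pq.
exists (\int[mu]_(t in setT) `|q t|) => s.
rewrite /itg /Rintegral fine_le//.
- by apply: (integrable_fin_num _ (int_itvT 0 s ni)); exact: measurable_itv.
- exact: integrable_fin_num.
- apply: ge0_subset_integral => //.
  by case/integrableP: ni.
Qed.

Lemma potentialB q1 q2 : potential q1 -> potential q2 -> potential (fun t => q1 t - q2 t).
Proof.
move=> [i1 z1] [i2 z2]; split; first exact: (@integrableB_real _ _ _ mu _ measurableT).
by move=> x x0; rewrite z1// z2// subrr.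
Qed.

Lemma wball_rate c c' C f : c <= c' -> wball c C f -> wball c' C f.
Proof.
move=> cc fW; have C0 := wball_ge0 fW; case: fW => mf fC; split=> // t.
rewrite (le_trans (fC t))// ler_wpM2l// /wt ler_expR ler_wpM2r//.
by rewrite le_max lexx orbT.
Qed.

Lemma wballN c C f : wball c C f -> wball c C (fun t => - f t).
Proof. by move=> [mf fC]; split=> [|t]; [exact: measurable_funN|rewrite normrN]. Qed.

Lemma itg_le0_ae f al be : int_itv f al be ->
  {ae mu, forall t, al < t < be -> f t <= 0} -> itg f al be <= 0.
Proof.
move=> fi f0; have mf := int_itv_measurable fi.
rewrite -itg_oo//.
rewrite (@eq_ae_Rintegral _ _ _ mu `]al, be[ (measurable_itv _) f (fun t => Num.min (f t) 0)) //.
- rewrite -oppr_ge0 -RintegralN//.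
    by apply: Rintegral_ge0 => t _; rewrite oppr_ge0 ge_min lexx orbT.
  apply: (@le_integrableR _ _ _ mu _ (measurable_itv _) f) => //.
  + by apply: measurable_minr => //; exact: measurable_cst.
  + by move=> t _; rewrite minEle; case: ifP => //; rewrite normr0.
  + exact/int_itv_oo.
- by apply: measurable_minr => //; exact: measurable_cst.
- by apply: aeS f0 => t H; rewrite /= in_itv/= => /H ft; rewrite min_l.
Qed.

Variable d : nat.

(** The growth condition puts y in a class where the Volterra equation has one solution; the
    equation carries both the value 1 and the vanishing flux at 0. *)
Definition regsol q y := (exists c C, 0 <= c /\ wball c C y) /\
  forall r, y r + volt d q y r = 1.

Lemma regsol_exists q : potential q -> exists y, regsol q y.
Proof.
move=> pq; have [A qA] := potential_mass pq.
have A0 : 0 <= A := mass_ge0 qA.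
pose c := 2 * A + 1; have c0 : 0 <= c by rewrite addr_ge0// mulr_ge0.
have Ac : 2 * A < c by rewrite ltrDl.
have [y [yW yE]] := volt_exists d pq c0 qA Ac.
by exists y; split=> //; exists c, 2.
Qed.

Lemma regsol_unique q y1 y2 : potential q -> regsol q y1 -> regsol q y2 -> y1 = y2.
Proof.
move=> pq [[c1 [C1 [c10 W1]]] E1] [[c2 [C2 [c20 W2]]] E2].
have [A qA] := potential_mass pq; have A0 : 0 <= A := mass_ge0 qA.
pose c := 2 * A + 1 + c1 + c2.
have c0 : 0 <= c by rewrite !addr_ge0// mulr_ge0.
have Ac : 2 * A < c by rewrite /c -!addrA ltrDl ltr_wpDr// addr_ge0.
have V1 : wball c C1 y1 by apply: wball_rate W1; rewrite /c; move: c10 c20 A0; lra.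
have V2 : wball c C2 y2 by apply: wball_rate W2; rewrite /c; move: c10 c20 A0; lra.
apply/funext => r; apply/eqP; rewrite -subr_eq0; apply/eqP; move: r.
apply: (volt_unique (d := d) pq c0 qA Ac (wballB V1 V2)) => r.
by rewrite (voltB d pq c0 V1 V2) addrACA -opprD E1 E2 subrr.
Qed.

Lemma regsol_bound q y A c : potential q -> mass q A -> 2 * A < c -> 0 <= c ->
  regsol q y -> wball c 2 y.
Proof.
move=> pq qA Ac c0 yS; have [y' [yW yE]] := volt_exists d pq c0 qA Ac.
have y'S : regsol q y' by split=> //; exists c, 2.
by rewrite (regsol_unique pq yS y'S).
Qed.

Lemma slopeBq q1 q2 y c C : potential q1 -> potential q2 -> 0 <= c -> wball c C y ->
  slope d (fun t => q1 t - q2 t) y = fun s => slope d q1 y s - slope d q2 y s.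
Proof.
move=> p1 p2 c0 yW; apply/funext => s; rewrite /slope -mulrBl /flux -itgB.
- by congr (_ / _); apply: eq_itg => t _; ring.
- exact: (int_flux d p1 c0 0 s yW).
- exact: (int_flux d p2 c0 0 s yW).
Qed.

(** The difference f = y1 - y2 satisfies f + volt q1 f = - volt (q1 - q2) y2. The right side is
    bounded with constant 2 dl / c, which [wball_contract] doubles. *)
Lemma regsol_lipschitz q1 q2 y1 y2 A c dl : potential q1 -> potential q2 ->
  mass q1 A -> mass q2 A -> 2 * A < c -> 0 <= c ->
  mass (fun t => q1 t - q2 t) dl -> regsol q1 y1 -> regsol q2 y2 ->
  forall r, `|y1 r - y2 r| <= 4 / c * dl * wt c r /\
    `|slope d q1 y1 r - slope d q2 y2 r| <= (A * (4 / c) + 2) * dl * wt c r.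
Proof.
move=> p1 p2 m1 m2 Ac c0 mdl S1 S2.
have W1 := regsol_bound p1 m1 Ac c0 S1; have W2 := regsol_bound p2 m2 Ac c0 S2.
have p12 := potentialB p1 p2.
have A0 : 0 <= A := mass_ge0 m1.
have c1 : 0 < c by rewrite (le_lt_trans _ Ac)// mulr_ge0.
have vE : (fun r => (y1 r - y2 r) + volt d q1 (fun t => y1 t - y2 t) r) =
    fun r => - volt d (fun t => q1 t - q2 t) y2 r.
  apply/funext => r; rewrite (voltB d p1 c0 W1 W2).
  have -> : volt d (fun t => q1 t - q2 t) y2 r = volt d q1 y2 r - volt d q2 y2 r.
    rewrite /volt (slopeBq p1 p2 c0 W2) itgB//; exact: int_slope W2.
  have := S1.2 r; have := S2.2 r; move: (volt d q1 y1 r) (volt d q1 y2 r) (volt d q2 y2 r).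
  by move=> v1 v2 v3 E2 E1; lra.
have fW : wball c (2 * (dl * 2 / c)) (fun t => y1 t - y2 t).
  apply: (wball_contract (d := d) p1 c0 m1 Ac (wballB W1 W2)); rewrite vE.
  by apply: wballN; exact: (volt_wball_mass d p12 c0 mdl c1 W2).
have EE : 2 * (dl * 2 / c) = 4 / c * dl by field; rewrite gt_eqF.
move=> r; split; first by have [_ /(_ r)] := fW; rewrite EE.
have -> : slope d q1 y1 r - slope d q2 y2 r =
    slope d q1 (fun t => y1 t - y2 t) r + slope d (fun t => q1 t - q2 t) y2 r.
  have -> : slope d q1 (fun t => y1 t - y2 t) r = slope d q1 y1 r - slope d q1 y2 r.
    rewrite /slope -mulrBl /flux -itgB; first by congr (_ / _); apply: eq_itg => t _; ring.
      exact: (int_flux d p1 c0 0 r W1).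
    exact: (int_flux d p1 c0 0 r W2).
  by rewrite (slopeBq p1 p2 c0 W2) addrA subrK.
rewrite (le_trans (ler_normD _ _))//.
have H1 := slope_bound_mass d p1 c0 m1 r fW.
have H2 := slope_bound_mass d p12 c0 mdl r W2.
rewrite (le_trans (lerD H1 H2))// EE le_eqVlt; apply/orP; left; apply/eqP.
by field; rewrite gt_eqF.
Qed.

Section one_solution.
Variables q y : R -> R.
Hypotheses (pq : potential q) (yS : regsol q y).

Lemma regsol_int al be : int_itv (fun t => t ^+ d * q t * y t) al be.
Proof. by have [[c [C [c0 yW]]] _] := yS; exact: int_flux yW. Qed.

Lemma regsol_slope_continuous : continuous (slope d q y).
Proof. by have [[c [C [c0 yW]]] _] := yS; exact: slope_continuous yW. Qed.

Lemma regsol_slope_int al be : int_itv (slope d q y) al be.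
Proof. by apply: int_itv_continuous => x _; exact: regsol_slope_continuous. Qed.

Lemma regsol_derive r : is_derive r (1 : R) y (- slope d q y r).
Proof.
have [[c [C [c0 yW]]] yE] := yS.
have := is_deriveB_fun (@is_derive_cst R R^o R^o (1 : R) r (1 : R)) (is_derive_volt d pq c0 r yW).
rewrite sub0r (_ : (fun r => _) = y)//.
by apply/funext => t; rewrite /cst -(yE t) addrK.
Qed.

Lemma regsol_continuous : continuous y.
Proof. by move=> r; exact: is_derive_continuous (regsol_derive r). Qed.

Lemma regsol_slopeE r : slope d q y r * r ^+ d = flux d q y r.
Proof.
have [r0|r0] := ltP 0 r; first by rewrite /slope mulfVK// expf_neq0// gt_eqF.
by rewrite slope_le0// mul0r /flux itg_pt.
Qed.

Lemma regsol_at0 : y 0 = 1.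
Proof. by have := yS.2 0; rewrite /volt itg_pt// addr0. Qed.

Lemma regsol_itg al r : 0 <= al -> al <= r -> y r = y al + itg (fun t => - slope d q y t) al r.
Proof.
move=> al0 alr; rewrite itgN; last exact: regsol_slope_int.
have := yS.2 r; have := yS.2 al; rewrite /volt (@itg_split _ _ 0 al r)//.
  by move: (itg _ _ _) (itg _ _ _) => u v; lra.
exact: regsol_slope_int.
Qed.

Lemma flux_itg al r : 0 <= al -> al <= r ->
  flux d q y r = flux d q y al + itg (fun t => t ^+ d * q t * y t) al r.
Proof. by move=> al0 alr; rewrite /flux; apply: itg_split => //; exact: regsol_int. Qed.

(* Gronwall's inequality run backwards from [r0]. *)
Lemma regsol_simple r0 : 0 < r0 -> y r0 = 0 -> flux d q y r0 != 0.
Proof.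
move=> r00 y0; apply/eqP => z0; have [A qA] := potential_mass pq.
have A0 : 0 <= A := mass_ge0 qA.
have qni al be : int_itv (fun t => `|q t|) al be by exact: int_itvT (potential_norm pq).1.
(* If y vanished on ]0, r0], continuity would contradict y(0) = 1. Stopping at e > 0 keeps s^-d
   bounded in the backward iteration. *)
suff H e : 0 < e -> e <= r0 -> y e = 0.
  have cy : {for 0, continuous y} by exact: regsol_continuous.
  have := cy; rewrite /prop_for /continuous_at regsol_at0 => /cvgrPdist_lt /(_ _ ltr01).
  move=> /nbhs_ballP[e /= e0 He]; pose t := Num.min r0 (e / 2).
  have t0 : 0 < t by rewrite lt_min r00 divr_gt0.
  have := He t; rewrite /ball/= sub0r normrN gtr0_norm//.
  rewrite H ?subr0 ?normr1 ?ltxx//; last by rewrite ge_min lexx.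
  move=> /(_ _) HH; suff : false by []; apply: HH.
  by rewrite gt_min; apply/orP; right; move: e0; lra.
move=> e0 er0; have ed : 0 < e ^+ d by exact: exprn_gt0.
have [M0 HM0] := continuous_bounded_itv e r0 regsol_continuous.
have M00 : 0 <= M0 by apply: le_trans (HM0 e _); rewrite ?normr_ge0// lexx.
(* K bounds the slope on [e, r0] by the weighted norm of y, and a rate above 2 K makes each backward
   integration from r0 halve that norm. *)
pose K := r0 ^+ d * A / e ^+ d.
have K0 : 0 <= K by rewrite /K divr_ge0 ?(ltW ed)// mulr_ge0// exprn_ge0// ltW.
pose c := 2 * K + 1; have c0 : 0 < c by rewrite ltr_wpDl// mulr_ge0.
pose E t := expR (c * (r0 - t)).
have E1 t : t <= r0 -> 1 <= E t.
  by move=> tr; rewrite /E -[leLHS]expR0 ler_expR mulr_ge0 ?subr_ge0// ltW.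
have dE1 x : is_derive x (1 : R) E (E x * - c).
  have dc : is_derive x (1 : R) (fun x => c * (r0 - x)) (- c).
    have := is_derive_cmul c (is_deriveB_fun (@is_derive_cst R R^o R^o r0 x (1 : R)) (is_derive_id x (1 : R))).
    by rewrite sub0r mulrN1.
  exact: (is_derive_comp dc (is_derive_expR (c * (r0 - x)))).
have dE x (k : R) : is_derive x (1 : R) (fun x => - (k / c) * E x) (k * E x).
  by have := is_derive_cmul (- (k / c)) (dE1 x); congr is_derive; field; rewrite gt_eqF.
have cE (k : R) : continuous (fun x => k * E x).
  apply: continuousM_fun; first exact: cst_continuous.
  by move=> x; exact: is_derive_continuous (dE1 x).
have step D : 0 <= D -> (forall t, e <= t <= r0 -> `|y t| <= D * E t) ->
    forall t, e <= t <= r0 -> `|y t| <= D / 2 * E t.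
  move=> D0 HD.
  have sl s : e <= s <= r0 -> `|slope d q y s| <= K * D * E s.
    move=> /andP[es sr]; have s0 : 0 < s by exact: lt_le_trans es.
    have sd : 0 < s ^+ d by exact: exprn_gt0.
    have := flux_itg (ltW s0) sr; rewrite z0 => /esym/eqP; rewrite addr_eq0 => /eqP fE.
    rewrite /slope fE normrM normrN normfV (gtr0_norm sd).
    have H : `|itg (fun t => t ^+ d * q t * y t) s r0| <= r0 ^+ d * A * (D * E s).
      rewrite (le_trans (norm_itg (regsol_int _ _)))//.
      apply: (@le_trans _ _ (itg (fun t => (r0 ^+ d * (D * E s)) * `|q t|) s r0)).
        apply: le_itg => [||t /andP[st tr]].
        - exact: int_itv_norm (regsol_int _ _).
        - exact: int_itvZ.
        - rewrite !normrM [leLHS]mulrAC ler_wpM2r// ler_pM//.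
            have t0 : 0 <= t by exact: le_trans (ltW s0) st.
            by rewrite normrX ger0_norm// lerXn2r ?nnegrE// ltW.
          rewrite (le_trans (HD t _)) ?(le_trans es st)// ler_wpM2l//.
          by rewrite /E ler_expR ler_wpM2l ?(ltW c0)// lerB.
      rewrite itgZ// [leRHS]mulrAC ler_wpM2l//.
        by rewrite !mulr_ge0 ?exprn_ge0 ?expR_ge0// ltW.
      apply: le_trans (qA r0); apply: le_itg_sub => //; first exact: ltW.
    rewrite ler_pdivrMr// (le_trans H)//.
    rewrite /K; have -> : r0 ^+ d * A / e ^+ d * D * E s * s ^+ d =
      (r0 ^+ d * A * (D * E s)) * (s ^+ d / e ^+ d) by field; rewrite gt_eqF.
    rewrite ler_peMr ?mulr_ge0 ?exprn_ge0 ?expR_ge0// ?(ltW r00)//.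
    by rewrite ler_pdivlMr// mul1r lerXn2r ?nnegrE// ltW.
  move=> t /andP[et tr]; have t0 : 0 <= t by exact: ltW (lt_le_trans e0 et).
  have := regsol_itg t0 tr; rewrite y0 itgN; last exact: regsol_slope_int.
  move=> /esym/eqP; rewrite subr_eq0 => /eqP ->.
  rewrite (le_trans (norm_itg (regsol_slope_int _ _)))//.
  apply: (@le_trans _ _ (itg (fun x => K * D * E x) t r0)).
    apply: le_itg.
    - exact: int_itv_norm (regsol_slope_int _ _).
    - by apply: int_itv_continuous => x _; exact: cE.
    - by move=> x /andP[tx xr]; apply: sl; rewrite xr (le_trans et).
  rewrite (itg_derive tr (fun x _ => cE _ x) (fun x _ => dE x _)).
  have -> : E r0 = 1 by rewrite /E subrr mulr0 expR0.
  have KD : 0 <= K * D / c by rewrite divr_ge0 ?(ltW c0)// mulr_ge0.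
  apply: (@le_trans _ _ (K * D / c * E t)); first by move: (K * D / c) KD => kd; lra.
  rewrite ler_wpM2r ?expR_ge0// mulrAC mulrC ler_wpM2l//.
  by rewrite ler_pdivrMr// /c; move: K0; lra.
have it k : forall t, e <= t <= r0 -> `|y t| <= M0 / 2 ^+ k * E t.
  elim: k => [|k IH].
    move=> t tr; rewrite expr0 divr1 (le_trans (HM0 t tr))// ler_peMr// E1//.
    by case/andP: tr.
  have := step _ _ IH; rewrite exprS invfM [2^-1 * _]mulrC mulrA; apply.
  by rewrite divr_ge0// exprn_ge0.
apply/eqP; rewrite -normr_le0; apply/ler_addgt0Pl => eps eps0; rewrite addr0.
have h1 : `|2^-1 : R| < 1 by rewrite ger0_norm ?invr_ge0//; lra.
have /cvgrPdist_lt /(_ eps eps0)[k _ /(_ k (leqnn k))] /= := cvg_geometric (M0 * E e) h1.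
rewrite sub0r normrN ger0_norm ?mulr_ge0 ?exprn_ge0 ?invr_ge0 ?expR_ge0// => ke.
apply: le_trans (ltW ke); rewrite mulrAC exprVn; apply: it.
by rewrite lexx.
Qed.

(** Up to its first zero y is positive, so with q <= 0 the flux is nonpositive and y is
    nondecreasing from 1; it cannot reach 0. *)
Lemma regsol_pos : {ae mu, forall t, 0 < t -> q t <= 0} -> forall r, 0 <= r -> 0 < y r.
Proof.
move=> q_le0 r r0; rewrite ltNge; apply/negP => yr.
have cy x : {for x, continuous y} by exact: regsol_continuous.
have [b b0 yb] : exists2 b, 0 <= b & y b = 0.
  have [yr0|yr0] := eqVneq (y r) 0; first by exists r.
  have [|c /andP[c0 _] yc] := ivt_sign r0 (fun x _ => cy x).
    by rewrite regsol_at0 mul1r lt_neqAle yr0.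
  by exists c => //; exact: ltW.
have y0 : y 0 != 0 by rewrite regsol_at0 oner_neq0.
have [r1 [/andP[r10 _] yr1 pos]] := first_zero b0 (fun x _ => cy x) y0 yb.
have fl s : s <= r1 -> flux d q y s <= 0.
  move=> sr; apply: itg_le0_ae; first exact: regsol_int.
  apply: aeS q_le0 => t qt /andP[t0 ts].
  have yt : 0 < y t by have := pos t; rewrite regsol_at0 mul1r; apply; rewrite (ltW t0) (lt_le_trans ts).
  rewrite -mulrA mulr_ge0_le0 ?exprn_ge0 ?(ltW t0)// mulr_le0_ge0 ?qt// ltW//.
have := regsol_itg (lexx 0) (ltW r10); rewrite yr1 regsol_at0 => /eqP.
rewrite eq_sym addr_eq0 => /eqP E; have : 0 <= itg (fun t => - slope d q y t) 0 r1.
  apply: itg_ge0 => x /andP[x0 xr]; rewrite oppr_ge0 /slope mulr_le0_ge0 ?fl//.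
  by rewrite invr_ge0 exprn_ge0.
by move: E; move: (itg _ _ _) => I1; lra.
Qed.

End one_solution.

(** Two integrations by parts. The products of slope and flux cancel because both equal r^d times
    the product of the slopes. *)
Lemma wronskian q1 q2 y1 y2 al be : potential q1 -> potential q2 ->
  regsol q1 y1 -> regsol q2 y2 -> 0 <= al -> al < be ->
  (y1 be * flux d q2 y2 be - y2 be * flux d q1 y1 be) -
  (y1 al * flux d q2 y2 al - y2 al * flux d q1 y1 al) =
  itg (fun t => t ^+ d * (q2 t - q1 t) * y1 t * y2 t) al be.
Proof.
move=> p1 p2 S1 S2 al0 albe.
have P qa qb ya yb : potential qa -> potential qb -> regsol qa ya -> regsol qb yb ->
    int_itv (fun r => - slope d qa ya r * flux d qb yb r + ya r * (r ^+ d * qb r * yb r)) al be /\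
    itg (fun r => - slope d qa ya r * flux d qb yb r + ya r * (r ^+ d * qb r * yb r)) al be =
    ya be * flux d qb yb be - ya al * flux d qb yb al.
  move=> pa pb Sa Sb; apply: itg_parts => //.
  - have := int_itvZ (-1) (regsol_slope_int pa Sa al be).
    by apply: eq_integrableR => // x _; rewrite mulN1r.
  - exact: regsol_int.
  - by move=> x /andP[_ x0]; rewrite slope_le0// oppr0 pb.2// mulr0 mul0r.
  - by move=> r /andP[ar _]; exact: regsol_itg.
  - by move=> r /andP[ar _]; exact: flux_itg.
have [i1 E1] := P _ _ _ _ p1 p2 S1 S2; have [i2 E2] := P _ _ _ _ p2 p1 S2 S1.
transitivity ((y1 be * flux d q2 y2 be - y1 al * flux d q2 y2 al) -
  (y2 be * flux d q1 y1 be - y2 al * flux d q1 y1 al)); first by ring.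
rewrite -E1 -E2 -itgB//; apply: eq_itg => t _.
by rewrite -!regsol_slopeE; ring.
Qed.

End regular.

(** * Counting the zeros of the spectral family *)

Local Open Scope card_scope.

Section zero_count.
Context {R : realType}.
Variables (rho : R) (Y V : R -> R -> R).
Hypothesis rho0 : 0 < rho.
Hypothesis Y0 : forall lam, Y lam 0 = 1.
Hypothesis dY : forall (lam r : R), is_derive r (1 : R) (Y lam) (V lam r).
Hypothesis cV : forall lam, continuous (V lam).
Hypothesis simple : forall lam r, 0 < r -> Y lam r = 0 -> V lam r != 0.
Hypothesis lip : forall lam, exists K : R, 0 <= K /\ forall mu, `|mu - lam| <= 1 ->
  forall r, 0 <= r <= rho -> `|Y mu r - Y lam r| <= K * `|mu - lam| /\
    `|V mu r - V lam r| <= K * `|mu - lam|.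
Hypothesis sturm : forall lam mu al be, lam < mu -> 0 <= al -> al < be -> be <= rho ->
  al = 0 \/ Y lam al = 0 -> Y lam be = 0 -> exists2 c, al < c < be & Y mu c = 0.
Hypothesis pos : exists L, forall r, 0 <= r <= rho -> 0 < Y L r.
Implicit Types (s t : seq R) (lam mu x : R).

Let cY lam : continuous (Y lam).
Proof. by move=> r; exact: is_derive_continuous (dY lam r). Qed.

(** At least k interior zeros, witnessed by a list. This is monotone in k and does not require the
    zeros to be finite in number. *)
Let Z k lam := exists s, [/\ uniq s, size s = k &
  forall x, x \in s -> 0 < x < rho /\ Y lam x = 0].

Let Z_take k j lam : (j <= k)%N -> Z k lam -> Z j lam.
Proof.
move=> jk [s [us sk sZ]]; exists (take j s); split; first exact: take_uniq.
  by rewrite size_takel// sk.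
by move=> x /mem_take; exact: sZ.
Qed.

(** One new zero in each gap between consecutive zeros, the origin being the left end of the first
    gap. *)
Let sturm_path lam mu s al : lam < mu -> 0 <= al -> al = 0 \/ Y lam al = 0 ->
  path <%R al s -> (forall x, x \in s -> x <= rho /\ Y lam x = 0) ->
  exists t, [/\ path <%R al t, size t = size s &
    forall x, x \in t -> 0 < x < rho /\ Y mu x = 0].
Proof.
move=> lm; elim: s al => [|x s IH] al al0 Yal /=; first by exists [::].
move=> /andP[alx px] sZ; have [xr Yx] := sZ x (mem_head _ _).
have [c /andP[alc cx] Yc] := sturm lm al0 alx xr Yal Yx.
have x0 : 0 <= x by rewrite (le_trans al0)// ltW.
have [|t [pt st tZ]] := IH x x0 (or_intror Yx) px.
  by move=> z zs; apply: sZ; rewrite inE zs orbT.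
exists (c :: t); split=> /=; [|by rewrite st|].
  rewrite alc/=; case: t pt {st tZ} => //= z t /andP[xz ->].
  by rewrite (lt_trans cx xz).
move=> z; rewrite inE => /predU1P[->|]; last exact: tZ.
by split=> //; rewrite (le_lt_trans al0 alc) (lt_le_trans cx).
Qed.

(** The zeros for lam may include rho, while those obtained for mu are interior: this is why the
    number of interior zeros grows past an eigenvalue. *)
Let Z_sturm lam mu s : lam < mu -> uniq s ->
  (forall x, x \in s -> 0 < x <= rho /\ Y lam x = 0) -> Z (size s) mu.
Proof.
move=> lm us sZ; pose s' := sort <=%R s.
have [||t [pt st tZ]] := @sturm_path lam mu s' 0 lm (lexx 0) (or_introl erefl).
- have so : sorted <%R s' by rewrite lt_sorted_uniq_le sort_uniq us sort_le_sorted.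
  case E : s' so => [//|x s1] /= ->; rewrite andbT.
  have : x \in s by rewrite -(mem_sort <=%R) -/s' E mem_head.
  by move=> /sZ[/andP[]].
- by move=> x; rewrite mem_sort => /sZ[/andP[_ ?] ?].
exists t; split=> //; last by rewrite st size_sort.
by apply: lt_sorted_uniq; case: t pt {st tZ} => //= x t /andP[].
Qed.

Let Z_mono k lam mu : lam < mu -> Z k lam -> Z k mu.
Proof.
move=> lm [s [us <- sZ]]; apply: (Z_sturm lm us) => x /sZ[/andP[x0 xr] Yx].
by rewrite x0 ltW.
Qed.

Let near_all (F : set_system R) {FF : Filter F} s (P : R -> R -> Prop) :
  (forall x, x \in s -> \forall e \near F, P x e) ->
  \forall e \near F, forall x, x \in s -> P x e.
Proof.
elim: s => [|y s IH] H; first by apply: nearW.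
have Hy := H y (mem_head _ _).
have Hs := IH (fun x xs => H x (mem_behead (s := y :: s) xs)).
apply: filterS2 Hy Hs => e Pye Pse x; rewrite inE => /predU1P[->//|]; exact: Pse.
Qed.

Let Y_cont_lam lam r : 0 <= r <= rho -> {for lam, continuous (fun mu => Y mu r)}.
Proof.
move=> rr; have [K [K0 HK]] := lip lam.
apply/cvgrPdist_lt => e e0.
have K1 : 0 < K + 1 by rewrite ltr_wpDl.
have eK : 0 < e / (K + 1) by rewrite divr_gt0.
near=> mu.
have m1 : `|mu - lam| <= 1.
  near: mu; apply: filterS (nbhsx_ballx lam 1 ltr01) => x.
  by rewrite /ball/= distrC => /ltW.
have [H _] := HK mu m1 r rr; rewrite distrC (le_lt_trans H)//.
have m2 : `|mu - lam| < e / (K + 1).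
  near: mu; apply: filterS (nbhsx_ballx lam _ eK) => x.
  by rewrite /ball/= distrC.
rewrite (@le_lt_trans _ _ ((K + 1) * `|mu - lam|))//.
  by rewrite ler_wpM2r// lerDl.
by rewrite mulrC -ltr_pdivlMr.
Unshelve. all: by end_near. Qed.

Let sign_change lam x : 0 < x -> Y lam x = 0 ->
  \forall e \near 0^'+, Y lam (x - e) * Y lam (x + e) < 0.
Proof.
move=> x0 Yx; have v0 := simple x0 Yx; set v := V lam x in v0.
have [dv vE] := dY lam x.
have nv : 0 < `|v| by rewrite normr_gt0.
have : h^-1 *: ((Y lam \o shift x) (h *: (1 : R)) - Y lam x) @[h --> 0^'] --> 'D_1 (Y lam) x.
  exact: dv.
rewrite vE -/v => /cvgrPdist_lt /(_ _ nv) /nbhs_ballP[d /= d0 Hd].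
have q h : h != 0 -> `|h| < d -> 0 < v * (h^-1 * Y lam (x + h)).
  move=> h0 hd; have := Hd h; rewrite /ball/= sub0r normrN => /(_ hd h0).
  rewrite Yx subr0 /shift/= /GRing.scale/= mulr1 [h + x]addrC => H.
  set w := h^-1 * _ in H *; have [vp|vn] := ltP 0 v.
    rewrite pmulr_rgt0//; move: H; rewrite (gtr0_norm vp) ltr_norml => /andP[h1 h2]; lra.
  have {}vn : v < 0 by rewrite lt_neqAle v0.
  by rewrite nmulr_rgt0//; move: H; rewrite (ltr0_norm vn) ltr_norml => /andP[h1 h2]; lra.
exists d => //= e /=; rewrite sub0r normrN => ed e0.
rewrite gtr0_norm// in ed.
have qp : 0 < v * (e^-1 * Y lam (x + e)) by apply: q; rewrite ?gt_eqF// gtr0_norm.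
have qm : 0 < v * ((- e)^-1 * Y lam (x - e)).
  by apply: q; rewrite ?oppr_eq0 ?gt_eqF// normrN gtr0_norm.
have := mulr_gt0 qp qm; rewrite invrN.
have -> : v * (e^-1 * Y lam (x + e)) * (v * (- e^-1 * Y lam (x - e))) =
  (v / e) ^+ 2 * - (Y lam (x - e) * Y lam (x + e)) by ring.
rewrite pmulr_rgt0 ?oppr_gt0// exprn_even_gt0//= mulf_neq0// invr_neq0// gt_eqF//.
Qed.

(** Simple zeros are sign changes, and a sign change between two fixed points persists for nearby
    parameters. *)
Let Z_open k lam : Z k lam -> \forall mu \near lam, Z k mu.
Proof.
move=> [s [us sk sZ]].
(* One radius for all zeros: the intervals around them are disjoint, lie inside ]0, rho[, and show a
   change of sign between their ends. *)
have [e [e0 He]] : exists e, 0 < e /\ forall x, x \in s ->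
    [/\ 0 < x - e, x + e < rho, Y lam (x - e) * Y lam (x + e) < 0 &
      forall y, y \in s -> y != x -> 2 * e < `|x - y|].
  suff : \forall e \near 0^'+, 0 < e /\ forall x, x \in s ->
    [/\ 0 < x - e, x + e < rho, Y lam (x - e) * Y lam (x + e) < 0 &
      forall y, y \in s -> y != x -> 2 * e < `|x - y|].
    by move=> /filter_ex [e He]; exists e.
  have NA := @near_all (0^'+) _ s (fun x e => [/\ 0 < x - e, x + e < rho,
    Y lam (x - e) * Y lam (x + e) < 0 &
      forall y, y \in s -> y != x -> 2 * e < `|x - y|]).
  suff /NA H : forall x, x \in s -> \forall e \near 0^'+, [/\ 0 < x - e, x + e < rho,
    Y lam (x - e) * Y lam (x + e) < 0 &
      forall y, y \in s -> y != x -> 2 * e < `|x - y|].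
    by near=> e; split; near: e; [exact: nbhs_right_gt|exact: H].
  move=> x xs; have [/andP[x0 xr] Yx] := sZ x xs.
  have sep : \forall e \near 0^'+, forall y, y \in s -> y != x -> 2 * e < `|x - y|.
    apply: near_all => y ys; have [->|yx] := eqVneq y x; first by apply: nearW => e /eqP.
    near=> e => _; rewrite mulrC -ltr_pdivlMr//; near: e; apply: nbhs_right_lt.
    by rewrite divr_gt0// normr_gt0 subr_eq0 eq_sym.
  have sc := sign_change x0 Yx.
  near=> e; split.
  - by rewrite subr_gt0; near: e; exact: nbhs_right_lt.
  - by rewrite -ltrBrDl; near: e; apply: nbhs_right_lt; rewrite subr_gt0.
  - by near: e.
  - by near: e.
suff : \forall mu \near lam, forall x, x \in s -> Y mu (x - e) * Y mu (x + e) < 0.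
  apply: filterS => mu Hmu.
  have ex x : exists c, x \in s -> x - e < c < x + e /\ Y mu c = 0.
    have [xs|_] := boolP (x \in s); last by exists 0.
    have xe : x - e <= x + e by lra.
    have [c cx Yc] := ivt_sign xe (fun (z : R) _ => @cY mu z) (Hmu x xs).
    by exists c.
  have [c Hc] := choice ex.
  exists (map c s); split; last 2 first.
  - by rewrite size_map.
  - move=> _ /mapP[x xs ->]; have [/andP[c1 c2] Yc] := Hc x xs.
    by have [? ? _ _] := He x xs; split=> //; apply/andP; split; lra.
  rewrite map_inj_in_uniq// => x y xs ys cxy.
  apply/eqP; apply: contraT => xy; have [_ _ _ /(_ x xs xy)] := He y ys.
  have [/andP[a1 a2] _] := Hc x xs; have [/andP[b1 b2] _] := Hc y ys.
  rewrite cxy in a1 a2; suff : `|y - x| < 2 * e by move=> h1 h2; have := lt_trans h1 h2; rewrite ltxx.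
  by rewrite ltr_norml; apply/andP; split; lra.
apply: (@near_all (nbhs lam) _ s (fun x mu => Y mu (x - e) * Y mu (x + e) < 0)) => x xs.
have [xe0 xer sgn _] := He x xs.
have c1 : {for lam, continuous (fun mu => Y mu (x - e) * Y mu (x + e))}.
  by apply: continuousM; apply: Y_cont_lam; apply/andP; split; lra.
by apply: (cvgr_lt _ c1).
Unshelve. all: by end_near. Qed.

(** Stated for any Phi so as to serve both Y, for limits of zeros, and V, for limits of critical
    points. *)
Let limzero (Phi : R -> R -> R) m p (K : R) : 0 <= K ->
  {for p, continuous (Phi m)} ->
  (forall mu, `|mu - m| <= 1 -> forall r, 0 <= r <= rho ->
    `|Phi mu r - Phi m r| <= K * `|mu - m|) ->
  (forall e, 0 < e -> exists mu c, [/\ `|mu - m| < e, `|c - p| < e, 0 <= c <= rho & Phi mu c = 0]) ->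
  Phi m p = 0.
Proof.
move=> K0 cP L H; apply/eqP; rewrite -normr_le0; apply/ler_addgt0Pl => eps eps0; rewrite addr0.
have h0 : 0 < eps / 2 by rewrite divr_gt0.
have /cvgrPdist_lt /(_ _ h0) /nbhs_ballP[d /= d0 Hd] := cP.
have K1 : 0 < K + 1 by rewrite ltr_wpDl.
pose e := Num.min d (Num.min 1 (eps / 2 / (K + 1))).
have e0 : 0 < e by rewrite !lt_min d0 ltr01 !divr_gt0.
have [mu [c [mm cp cr Pc]]] := H e e0.
have [ed e1 eK] : [/\ e <= d, e <= 1 & e <= eps / 2 / (K + 1)].
  by rewrite /e; split; rewrite !ge_min lexx ?orbT.
have B1 : `|Phi m p - Phi m c| < eps / 2.
  by apply: Hd; rewrite /ball/= distrC (lt_le_trans cp).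
have B2 : `|Phi mu c - Phi m c| <= eps / 2.
  rewrite (le_trans (L mu _ c cr)) ?(le_trans (ltW mm))//.
  rewrite (@le_trans _ _ ((K + 1) * `|mu - m|))//; first by rewrite ler_wpM2r// lerDl.
  by rewrite mulrC -ler_pdivlMr// (le_trans (ltW mm)).
rewrite Pc sub0r normrN in B2.
have -> : Phi m p = (Phi m p - Phi m c) + Phi m c by rewrite subrK.
by rewrite (le_trans (ler_normD _ _))// [leRHS](splitr eps) lerD// ltW.
Qed.

(** Lists of k zeros, for parameters tending to m, have a cluster point by compactness. Its entries
    are zeros of Y m, not 0 because Y m 0 = 1, and two of them cannot coincide: by Rolle, V m would
    vanish there together with Y m. *)
Let Z_closed k m : (forall e, 0 < e -> exists2 mu, `|mu - m| < e & Z k mu) ->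
  exists s, [/\ uniq s, size s = k & forall x, x \in s -> 0 < x <= rho /\ Y m x = 0].
Proof.
move=> H.
have ex (j : nat) : exists ms : R * seq R, [/\ `|ms.1 - m| < j.+1%:R^-1, uniq ms.2, size ms.2 = k &
    forall x, x \in ms.2 -> 0 < x < rho /\ Y ms.1 x = 0].
  have [|mu mm [s [us sk sZ]]] := H j.+1%:R^-1; first by rewrite invr_gt0.
  by exists (mu, s).
have [g Hg] := choice ex.
pose x j : 'rV[R]_k := \row_i nth 0 (g j).2 i.
have xin j i : x j ord0 i \in (g j).2.
  by have [_ _ sk _] := Hg j; rewrite mxE mem_nth// sk.
have xi j i : 0 < x j ord0 i < rho /\ Y (g j).1 (x j ord0 i) = 0.
  by have [_ _ _] := Hg j; apply; exact: xin.
pose Kc := [set v : 'rV[R]_k | `|v| <= `|rho|].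
have cKc : compact Kc.
  apply: bounded_closed_compact.
    exists `|rho|; split; first exact: num_real.
    by move=> M rM v /= Kv; rewrite (le_trans Kv)// ltW.
  apply: (@closed_comp _ _ (fun v : 'rV[R]_k => `|v|) [set r | r <= `|rho|]).
    by move=> v _; exact: norm_continuous.
  exact: closed_le.
have xK j : Kc (x j).
  rewrite /Kc/= {1}/Num.Def.normr/= mx_normrE; apply: bigmax_le; first exact: normr_ge0.
  move=> [i i'] _ /=; rewrite ord1; have [/andP[h0 h1] _] := xi j i'.
  by rewrite !gtr0_norm// ?ltW// (lt_trans h0).
have [|p [_ clp]] := cKc (fmap x \oo) (fmap_proper_filter x eventually_filter).
  by exists 0%N => // j _; exact: xK.
have near_p e : 0 < e -> exists j, `|(g j).1 - m| < e /\ forall i, `|x j ord0 i - p ord0 i| < e.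
  move=> e0; have [J _ HJ] := near_infty_natSinv_lt (PosNum e0).
  have [||_ [[j jJ <-] xp]] := clp (x @` [set j | (J <= j)%N]) (ball p e).
  - by exists J => // j Jj; exists j.
  - exact: nbhsx_ballx.
  exists j; split.
    have [gm _ _ _] := Hg j; apply: lt_trans gm _; exact: HJ.
  move: xp; rewrite -ball_normE/= {1}/Num.Def.normr/= mx_normrE => xp i.
  apply: le_lt_trans xp; rewrite distrC.
  have := @le_bigmax _ _ _ 0 (fun ij => `|(p - x j) ij.1 ij.2|) (ord0, i).
  by rewrite /= !mxE.
have [K [K0 HK]] := lip m.
have p01 i : 0 <= p ord0 i <= rho.
  apply/andP; split; apply/ler_addgt0Pl => e e0; have [j [_ /(_ i)]] := near_p e e0;
    have [/andP[h0 h1] _] := xi j i; rewrite ltr_norml => /andP[h2 h3]; lra.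
have Yp i : Y m (p ord0 i) = 0.
  apply: (limzero K0 (@cY m _)); first by move=> mu mm r rr; have [] := HK mu mm r rr.
  move=> e e0; have [j [mj xj]] := near_p e e0; have [/andP[h0 h1] Yx] := xi j i.
  by exists (g j).1, (x j ord0 i); split=> //; rewrite !ltW.
have pp i : 0 < p ord0 i.
  have /andP[p0 _] := p01 i; rewrite lt_neqAle p0 andbT; apply/eqP => E.
  by have := Yp i; rewrite -E Y0 => /eqP; rewrite oner_eq0.
have pinj : injective (fun i => p ord0 i).
  move=> i i' pii; apply/eqP; apply: contraT => ii'.
  have := simple (pp i) (Yp i); suff -> : V m (p ord0 i) = 0 by rewrite eqxx.
  apply: (limzero K0 (@cV m _)); first by move=> mu mm r rr; have [] := HK mu mm r rr.
  move=> e e0; have [j [mj xj]] := near_p e e0.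
  have [_ us sk _] := Hg j.
  have xx : x j ord0 i != x j ord0 i' by rewrite !mxE nth_uniq ?sk.
  wlog lt : i i' pii ii' xx / x j ord0 i < x j ord0 i'.
    move=> W; have [lt|lt|E] := ltgtP (x j ord0 i) (x j ord0 i'); last by rewrite E eqxx in xx.
      exact: (W i i').
    have [|||mu [c Hc]] := W i' i _ _ _ lt; rewrite // 1?eq_sym//.
    by exists mu, c; rewrite pii.
  have [/andP[h0 h1] Yx] := xi j i; have [/andP[h0' h1'] Yx'] := xi j i'.
  have [c] := @Rolle R (Y (g j).1) _ _ lt (fun (z : R) _ => (@ex_derive _ _ _ _ _ _ _ (dY (g j).1 z)))
    (continuous_subspaceT (@cY (g j).1)) (etrans Yx (esym Yx')).
  rewrite in_itv/= => /andP[ic ci'] dc.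
  exists (g j).1, c; split => //.
  - have := xj i; have := xj i'; rewrite -pii !ltr_norml => /andP[? ?] /andP[? ?].
    by apply/andP; split; lra.
  - by apply/andP; split; lra.
  - by rewrite -(@derive_val _ _ _ _ _ _ _ (dY (g j).1 c)) (@derive_val _ _ _ _ _ _ _ dc).
exists [seq p ord0 i | i <- enum 'I_k]; split.
- by rewrite map_inj_uniq// enum_uniq.
- by rewrite size_map size_enum_ord.
- by move=> _ /mapP[i _ ->]; have /andP[_ ->] := p01 i; rewrite pp.
Qed.

Variable N : nat.
Hypothesis ZN : [set r : R | 0 < r < rho /\ Y 0 r = 0] #= `I_N.
Hypothesis Yrho : Y 0 rho != 0.

Let ZN0 : Z N 0.
Proof.
have /card_set_bijP[f bf] := ZN.
have ex (k : nat) : exists x, (k < N)%N -> [/\ 0 < x < rho, Y 0 x = 0 & f x = k].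
  have [kN|_] := ltnP k N; last by exists 0.
  by have [x [xr Yx] fx] := set_bij_surj bf kN; exists x.
have [x Hx] := choice ex.
exists (map x (iota 0 N)); split.
- rewrite map_inj_in_uniq ?iota_uniq// => i j; rewrite !mem_iota !add0n => /Hx[_ _ fi] /Hx[_ _ fj] E.
  by rewrite -fi -fj E.
- by rewrite size_map size_iota.
- by move=> _ /mapP[i + ->]; rewrite mem_iota add0n => /Hx[].
Qed.

Let ZN1 : ~ Z N.+1 0.
Proof.
move=> [s [us sk sZ]]; have /card_set_bijP[f bf] := ZN.
have fin x : x \in s -> (f x < N)%N.
  by move=> /sZ Hx; have := set_bij_sub bf; apply; exists x.
have uf : uniq (map f s).
  rewrite map_inj_in_uniq// => x y xs ys; apply: (set_bij_inj bf); rewrite inE; exact: sZ.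
have := @uniq_leq_size _ _ (iota 0 N) uf; rewrite size_map sk size_iota ltnn => /(_ _) W.
suff : false by []; apply: W => _ /mapP[x xs ->]; rewrite mem_iota add0n; exact: fin.
Qed.

(** m is the supremum of the parameters lam <= 0 without k + 1 interior zeros. By [Z_open] it has no
    k + 1 interior zeros itself; by [Z_closed] it has k + 1 zeros in ]0, rho]. So rho is one of
    them, and the other k are interior. *)
Let eig k : (k < N)%N -> exists m, [/\ m < 0, Y m rho = 0, Z k m & ~ Z k.+1 m].
Proof.
move=> kN; pose D := [set lam | lam <= 0 /\ ~ Z k.+1 lam].
have Zk0 : Z k.+1 0 by exact: Z_take ZN0.
have D0 : D !=set0.
  have [L HL] := pos; have nZ : ~ Z k.+1 L.
    move=> [s [_ sk sZ]]; have := sZ (nth 0 s 0) (mem_nth _ _); rewrite sk => /(_ isT)[/andP[x0 xr] Yx].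
    by have := HL (nth 0 s 0); rewrite Yx ltxx !ltW// => /(_ isT).
  exists L; split=> //; rewrite leNgt; apply/negP => L0; apply: nZ; exact: Z_mono Zk0.
have Dub : ubound D 0 by move=> x [].
have hD : has_sup D by split=> //; exists 0.
pose m := sup D.
have nZm : ~ Z k.+1 m.
  move=> /Z_open /nbhs_ballP[e /= e0 He].
  have [lam [lam0 nZ] ml] := sup_adherent e0 hD.
  have lm : lam <= m := ub_le_sup (ex_intro _ 0 Dub) (conj lam0 nZ).
  apply: nZ; apply: He; rewrite /ball/= ger0_norm ?subr_ge0; first by rewrite ltrBlDr addrC -ltrBlDr.
  exact: lm.
have Zgt lam : m < lam -> Z k.+1 lam.
  move=> ml; apply: contrapT => nZ; have [l0|l0] := leP lam 0.
    have : lam <= m := ub_le_sup (ex_intro _ 0 Dub) (conj l0 nZ).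
    by rewrite leNgt ml.
  by apply: nZ; exact: Z_mono Zk0.
have m0 : m < 0.
  have m0 : m <= 0 by exact: ge_sup.
  rewrite lt_neqAle m0 andbT; apply/eqP => E; exact: nZm (eq_ind_r _ Zk0 E).
have [|s [us sk sZ]] := @Z_closed k.+1 m.
  move=> e e0; exists (m + e / 2); last by apply: Zgt; lra.
  by rewrite addrAC subrr add0r gtr0_norm; lra.
have rs : rho \in s.
  apply: contraT => rs; exfalso; apply: nZm; exists s; split=> // x xs.
  have [/andP[x0 xr] Yx] := sZ x xs; split=> //; rewrite x0 lt_neqAle xr andbT.
  by apply: contraNneq rs => <-.
exists m; split=> //; first by have [] := sZ rho rs.
exists (rem rho s); split; first exact: rem_uniq.
  by rewrite size_rem// sk.
move=> x; rewrite mem_rem_uniq// !inE => /andP[xr xs].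
by have [/andP[-> xr'] Yx] := sZ x xs; rewrite lt_neqAle xr xr'.
Qed.

(** The roots given by [eig] differ because they have different numbers of interior zeros. A
    negative root with exactly j interior zeros has j < N and must be the one found for j, since the
    larger of two such roots would have j + 1 interior zeros. *)
Lemma eigenvalue_count : exists s, [/\ uniq s, size s = N &
  forall lam, lam \in s <-> lam < 0 /\ Y lam rho = 0].
Proof.
have ex (k : nat) : exists m, (k < N)%N -> [/\ m < 0, Y m rho = 0, Z k m & ~ Z k.+1 m].
  have [kN|_] := ltnP k N; last by exists 0.
  by have [m Hm] := eig kN; exists m.
have [m Hm] := choice ex.
have inj : {in iota 0 N &, injective m}.
  move=> i j; rewrite !mem_iota !add0n => /Hm[_ _ Zi nZi] /Hm[_ _ Zj nZj] E.
  have [ij|ji|//] := ltngtP i j.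
    by exfalso; apply: nZi; rewrite E; exact: Z_take Zj.
  by exfalso; apply: nZj; rewrite -E; exact: Z_take Zi.
exists (map m (iota 0 N)); split.
- by rewrite map_inj_in_uniq ?iota_uniq.
- by rewrite size_map size_iota.
move=> lam; split; first by move=> /mapP[k + ->]; rewrite mem_iota add0n => /Hm[].
move=> [l0 Yl].
have step k : ~ Z k lam -> exists j, [/\ (j < k)%N, Z j lam & ~ Z j.+1 lam].
  elim: k => [|k IH] nZ; first by exfalso; apply: nZ; exists [::].
  have [Zk|nZk] := pselect (Z k lam); first by exists k.
  by have [j [jk Zj nZj]] := IH nZk; exists j; split=> //; exact: ltnW.
have nZ1 : ~ Z N.+1 lam by move=> /(Z_mono l0); exact: ZN1.
have [j [jN Zj nZj]] := step _ nZ1.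
(* A zero at rho enters the interval when the parameter grows, adding one interior zero. *)
have up k mu nu : Z k mu -> Y mu rho = 0 -> mu < nu -> Z k.+1 nu.
  move=> [s [us sk sZ]] Yr mn; have rs : rho \notin s.
    by apply/negP => /sZ[/andP[_]]; rewrite ltxx.
  rewrite -sk; apply: (Z_sturm (s := rho :: s) mn); first by rewrite /= rs.
  move=> x; rewrite inE => /predU1P[->|/sZ[/andP[-> xr] Yx]]; first by rewrite rho0 lexx.
  by rewrite ltW.
have Zj0 := up _ _ _ Zj Yl l0.
have {}jN : (j < N)%N.
  by move: jN; rewrite ltnS leq_eqVlt => /predU1P[E|//]; exfalso; apply: ZN1; rewrite -E.
apply/mapP; exists j; first by rewrite mem_iota.
have [mj0 mYj mZj mnZj] := Hm j jN.
have [lt|lt|//] := ltgtP lam (m j).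
  by exfalso; apply: mnZj; exact: up Zj Yl lt.
by exfalso; apply: nZj; exact: up mZj mYj lt.
Qed.

End zero_count.

(** * Absolutely continuous solutions *)

Section derivative_bound.
Context {R : realType}.
Implicit Types (F : R -> R) (x l : R).

Lemma is_derive_bound F x l : is_derive x (1 : R) F l -> forall e, 0 < e ->
  exists2 g, 0 < g & forall y, `|y - x| < g -> `|F y - F x - l * (y - x)| <= e * `|y - x|.
Proof.
move=> [dF FE] e e0.
have : h^-1 *: ((F \o shift x) (h *: (1 : R)) - F x) @[h --> 0^'] --> 'D_1 F x by exact: dF.
rewrite FE => /cvgrPdist_lt /(_ _ e0) /nbhs_ballP[g /= g0 Hg]; exists g => // y yx.
have [->|yx0] := eqVneq y x; first by rewrite !subrr mulr0 subr0 normr0 mulr0.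
have h0 : y - x != 0 by rewrite subr_eq0.
have := Hg (y - x); rewrite /ball/= sub0r normrN => /(_ yx h0).
rewrite /shift/= /GRing.scale/= mulr1 subrK => H.
rewrite -[F y - F x](mulVKf h0) [l * _]mulrC -mulrBr normrM mulrC ler_wpM2r//.
by rewrite distrC ltW.
Qed.

Lemma bound_is_derive F x l : (forall e, 0 < e ->
  exists2 g, 0 < g & forall y, `|y - x| < g -> `|F y - F x - l * (y - x)| <= e * `|y - x|) ->
  is_derive x (1 : R) F l.
Proof.
move=> H.
have Hc : h^-1 *: ((F \o shift x) (h *: (1 : R)) - F x) @[h --> 0^'] --> l.
  apply/cvgrPdist_le => e e0; have [g g0 Hg] := H e e0.
  exists g => //= h /=; rewrite sub0r normrN => hg h0.
  rewrite /shift/= /GRing.scale/= mulr1.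
  have := Hg (h + x); rewrite addrK => /(_ hg) B.
  have nh : 0 < `|h| by rewrite normr_gt0.
  rewrite -(ler_pM2r nh) -normrM mulrBl mulrAC mulVf// mul1r distrC.
  exact: B.
apply: DeriveDef; first exact: cvgP Hc.
by apply: cvg_lim => //; exact: norm_hausdorff.
Qed.

End derivative_bound.

Section abs_cont.
Context {R : realType}.
Local Notation mu := (@lebesgue_measure R).

(* The points where the derivative may fail to vanish are covered by an open
   set of small measure, over which absolute continuity controls the increments;
   elsewhere the increments are at most [e] times the length. *)
Lemma abs_continuous_const (F1 g : R -> R) (b : R) : 0 < b ->
  abs_continuous 0 b F1 -> mu.-integrable setT (EFin \o g) ->
  {ae mu, forall r, 0 < r < b -> is_derive r (1 : R) (fun r => F1 r + itg g 0 r) 0} ->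
  F1 b + itg g 0 b = F1 0.
Proof.
move=> b0 ac gi [A [mA A0 HA]]; pose F r := F1 r + itg g 0 r.
have F0 : F 0 = F1 0 by rewrite /F itg_pt// addr0.
rewrite -F0 -/(F b); apply/eqP; rewrite -subr_eq0 -normr_le0; apply/ler_addgt0Pl => e0 e00.
(* The errors will be e b from the derivative off U, e from absolute continuity of F1 on U, and e
   from the integral of |g| over U. *)
pose e := e0 / (b + 2); have b2 : 0 < b + 2 by rewrite addr_gt0.
have e_gt0 : 0 < e by rewrite divr_gt0.
have [d1 d10 Hd1] := ac e e_gt0.
have [d2 [d20 Hd2]] := integral_normr_continuous gi e_gt0.
pose D := A `|` [set 0] `|` [set b].
have mD : measurable D by apply: measurableU => //; apply: measurableU.
have D0 : mu D = 0%E.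
  have n1 : mu.-negligible D.
    apply: negligibleU; last by apply/negligibleP => //; exact: lebesgue_measure_set1.
    apply: negligibleU; first exact/negligibleP.
    by apply/negligibleP => //; exact: lebesgue_measure_set1.
  exact/negligibleP.
have d0 : 0 < Num.min d1 d2 by rewrite lt_min d10.
have [|U [oU DU UD]] := lebesgue_regularity_outer mD _ d0.
  by apply: le_lt_trans (ltry 0); rewrite le_eqVlt; apply/orP; left; apply/eqP; exact: D0.
have mU : measurable U by exact: open_measurable.
have muU : (mu U < (Num.min d1 d2)%:E)%E.
  apply: le_lt_trans UD; rewrite -[U in leLHS](setDUK DU).
  have mUD : measurable (U `\` D) by exact: measurableD.
  have H := @measureU2 _ _ _ mu D (U `\` D) mD mUD.
  rewrite -[leRHS]add0e; apply: (le_trans H); apply: leeD => //.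
  by rewrite le_eqVlt; apply/orP; left; apply/eqP; exact: D0.
pose one (t : R) : R := \1_U t.
pose h t := one t * `|g t|.
have mone : measurable_fun setT one by exact: measurable_indic.
have onei s t : int_itv one s t.
  apply: (le_integrableR _ _ _ (int_itv_cst 1 s t)) => //; first exact: measurable_funTS.
  by move=> x _; rewrite /one indicE normr1; case: (_ \in _); rewrite ?normr1 ?normr0.
have gni : mu.-integrable setT (EFin \o (fun t => `|g t|)) by exact: integrable_norm gi.
have hT : mu.-integrable setT (EFin \o h).
  apply: (@integrableM_bounded _ _ _ mu _ measurableT 1 (fun t => `|g t|) one) => // x _.
  by rewrite /one indicE; case: (_ \in _); rewrite ?normr1 ?normr0.
have hi s t : int_itv h s t by exact: int_itvT.
have gii s t : int_itv g s t by exact: int_itvT.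
(* Property carried from 0 to b: J lists the steps made inside U, whose total length is at most the
   measure of U in [0, t]; every other step costs e times its length. *)
pose P t := 0 <= t <= b /\ exists J : seq (R * R),
  [/\ all (fun p : R * R => [&& 0 <= p.1, p.1 <= p.2 & p.2 <= t]) J,
      pairwise (fun p q : R * R => p.2 <= q.1) J,
      \sum_(p <- J) (p.2 - p.1) <= itg one 0 t &
      `|F t - F 0| <= e * t + \sum_(p <- J) `|F1 p.2 - F1 p.1| + itg h 0 t].
have P0 : P 0.
  split; first by rewrite lexx ltW.
  by exists [::]; rewrite !big_nil subrr normr0 mulr0 !itg_pt ?addr0.
have step x : 0 <= x <= b -> exists2 ga, 0 < ga & forall s t, s <= x -> x <= t -> t <= b ->
    `|s - x| < ga -> `|t - x| < ga -> P s -> P t.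
  move=> /andP[x0 xb]; have [Ux|nUx] := pselect (U x).
    have /nbhs_ballP[ga /= ga0 Hga] : nbhs x U by exact: open_nbhs_nbhs.
    exists ga => // s t sx xt tb sga tga [/andP[s0 sb] [J [aJ pJ lJ FJ]]].
    have st : s <= t by exact: le_trans xt.
    have inU u : s <= u <= t -> U u.
      move=> /andP[su ut]; apply: Hga; rewrite /ball/=.
      move: sga tga; rewrite !ltr_norml => /andP[? ?] /andP[? ?].
      by apply/andP; split; lra.
    have o1 u : s <= u <= t -> one u = 1 by move=> /inU uU; rewrite /one indicE mem_set.
    have it : itg one 0 t = itg one 0 s + (t - s).
      by rewrite (@itg_split _ one 0 s t)// (eq_itg o1) itg_cst// mul1r.
    have ht : itg h 0 t = itg h 0 s + itg (fun u => `|g u|) s t.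
      rewrite (@itg_split _ h 0 s t)//; congr (_ + _); apply: eq_itg => u /o1 E.
      by rewrite /h E mul1r.
    split; first by rewrite tb andbT (le_trans s0).
    exists (rcons J (s, t)); split.
    - rewrite all_rcons /= s0 st lexx/=; apply/allP => p /(allP aJ) /and3P[-> -> pt].
      exact: le_trans st.
    - rewrite pairwise_rcons pJ andbT; apply/allP => p /(allP aJ) /and3P[_ _].
      by [].
    - by rewrite -cats1 big_cat big_seq1 /= it lerD2r.
    rewrite -cats1 big_cat big_seq1 /= ht.
    have -> : F t - F 0 = (F s - F 0) + ((F1 t - F1 s) + itg g s t).
      by rewrite /F (@itg_split _ g 0 s t)//; ring.
    rewrite (le_trans (ler_normD _ _))// (le_trans (lerD FJ (ler_normD _ _)))//.
    have := norm_itg (gii s t).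
    have : e * s <= e * t by rewrite ler_wpM2l// ltW.
    move: (e * s) (e * t) `|itg g s t| (itg _ s t) (\sum_(p <- J) _) `|F1 t - F1 s| (itg h 0 s).
    by move=> v1 v2 v3 v4 v5 v6 v7; lra.
  have nDx : ~ D x by move=> /DU.
  have xx : 0 < x < b.
    apply/andP; split; rewrite lt_neqAle ?x0 ?xb andbT; apply/eqP => E; apply: nDx.
      by left; right.
    by right.
  have dx : is_derive x (1 : R) F 0.
    apply: contrapT => ndx; apply: nDx; left; left; apply: HA => /(_ xx) //.
  have [ga ga0 Hga] := is_derive_bound dx e_gt0.
  exists ga => // s t sx xt tb sga tga [/andP[s0 sb] [J [aJ pJ lJ FJ]]].
  have st : s <= t by exact: le_trans xt.
  split; first by rewrite tb andbT (le_trans s0).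
  exists J; split=> //.
  - by apply/allP => p /(allP aJ) /and3P[-> -> pt]; exact: le_trans st.
  - apply: le_trans lJ _; apply: le_itg_sub => // u _; rewrite /one indicE; exact: ler0n.
  have h2 : itg h 0 s <= itg h 0 t.
    apply: le_itg_sub => // u _; rewrite /h mulr_ge0// /one indicE; exact: ler0n.
  have -> : F t - F 0 = (F s - F 0) + ((F t - F x) - (F s - F x)) by ring.
  rewrite (le_trans (ler_normD _ _))// (le_trans (lerD FJ (ler_normB _ _)))//.
  have := Hga s sga; have := Hga t tga; rewrite !mul0r !subr0.
  rewrite (ger0_norm (_ : 0 <= t - x)) ?subr_ge0// (ler0_norm (_ : s - x <= 0)) ?subr_le0//.
  rewrite opprB !mulrBr.
  move: (e * s) (e * t) (e * x) `|F t - F x| `|F s - F x| (\sum_(p <- J) _) (itg h 0 s) (itg h 0 t) h2.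
  by move=> v1 v2 v3 v4 v5 v6 v7 v8 h2; lra.
(* The supremum of the points with P is itself crossed by a local step, so it is b. *)
have Pb : P b.
  pose S := [set t | P t].
  have S0 : S !=set0 by exists 0.
  have Sb : ubound S b by move=> t [/andP[]].
  have hS : has_sup S by split=> //; exists b.
  have ub t : P t -> t <= sup S by move=> Pt; exact: (ub_le_sup (ex_intro _ b Sb) Pt).
  have m0 : 0 <= sup S by exact: ub.
  have mb : sup S <= b by exact: ge_sup.
  have [ga ga0 Hga] := step (sup S) (introT andP (conj m0 mb)).
  have [s Ps sm] := sup_adherent ga0 hS.
  have sS := ub s Ps.
  have Hs : `|s - sup S| < ga by rewrite ler0_norm ?subr_le0// opprB ltrBlDr addrC -ltrBlDr.
  have [E|lt] := eqVneq (sup S) b.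
    by apply: (Hga s b) => //; rewrite ?E// subrr normr0.
  have {}lt : sup S < b by rewrite lt_neqAle lt.
  pose t := Num.min b (sup S + ga / 2).
  have mt : sup S < t by rewrite lt_min lt ltrDl divr_gt0.
  have Pt : P t.
    apply: (Hga s t) => //; [exact: ltW|by rewrite ge_min lexx|].
    rewrite ger0_norm ?subr_ge0 ?(ltW mt)// ltrBlDl.
    have : t <= sup S + ga / 2 by rewrite ge_min lexx orbT.
    by move: ga0; lra.
  by have := ub t Pt; rewrite leNgt mt.
have [_ [J [aJ pJ lJ FJ]]] := Pb.
have I1 : itg one 0 b < d1.
  rewrite -lte_fin; apply: lt_le_trans (_ : (Num.min d1 d2)%:E <= _)%E; last first.
    by rewrite lee_fin ge_min lexx.
  apply: le_lt_trans muU; rewrite /itg /Rintegral fineK; last first.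
    by apply: (integrable_fin_num _ (onei 0 b)); exact: measurable_itv.
  by rewrite integral_indic//; apply: le_measure; rewrite ?inE//; exact: measurableI.
have I2 : itg h 0 b <= e.
  apply: ltW; apply: le_lt_trans (Hd2 U mU _); last first.
    by apply: (lt_le_trans muU); rewrite lee_fin ge_min lexx orbT.
  have -> : \int[mu]_(x in U) `|g x| = \int[mu]_(x in setT) h x.
    rewrite /Rintegral integral_mkcond; congr fine; apply: eq_integral => x _.
    by rewrite patchE /h /one indicE; case: (x \in U); rewrite ?mul1r ?mul0r.
  rewrite /itg /Rintegral fine_le//.
  - by apply: (integrable_fin_num _ (hi 0 b)); exact: measurable_itv.
  - exact: integrable_fin_num.
  - apply: ge0_subset_integral => //; first by case/integrableP: hT.
    by move=> x _; rewrite lee_fin /h mulr_ge0// /one indicE ler0n.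
have := Hd1 J aJ pJ (le_lt_trans lJ I1) => S1.
rewrite addr0 (le_trans FJ)//.
have : e * b + e + e = e0 by rewrite /e; field; rewrite gt_eqF.
by move: (e * b) S1 I2; move: (\sum_(p <- J) `|_|) (itg h 0 b) => v1 v2 v3; lra.
Qed.

End abs_cont.

(** * The given solution solves the Volterra equation *)

Section identification.
Context {R : realType}.
Local Notation mu := (@lebesgue_measure R).
Variables (n : nat) (rho : R) (a y0 : R -> R).
Hypothesis rho0 : 0 < rho.
Local Notation I := (`]0, rho[%classic : set R).
Local Notation d := n.-1.

Definition pot lam : R -> R := (fun t => a t + lam) \_ I.

Hypothesis ai : mu.-integrable I (EFin \o a).

Lemma potE lam t : 0 < t < rho -> pot lam t = a t + lam.
Proof. by move=> tI; rewrite /pot patchE mem_set//= in_itv. Qed.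

Lemma pot_out lam t : ~~ (0 < t < rho) -> pot lam t = 0.
Proof. by move=> tI; rewrite /pot patchE memNset//= in_itv/=; exact/negP. Qed.

Lemma potential_pot lam : potential (pot lam).
Proof.
split; last by move=> x x0; rewrite pot_out// ltNge x0.
rewrite -restrict_EFin; apply/(integrable_mkcond _ _).1 => //.
by apply: integrableD_real => //; apply/int_itv_oo; exact: int_itv_cst.
Qed.

Hypothesis sol : regular_solution n rho a y0.
Hypothesis y00 : y0 0 = 1.

(** Retraction onto [0, rho]: y0 is controlled only there, and its composite with the retraction is
    continuous on the whole line. *)
Let clamp t := Num.max 0 (Num.min t rho).

Let clamp_in t : 0 <= clamp t <= rho.
Proof. by rewrite /clamp le_max lexx /= ge_max (ltW rho0) ge_min lexx orbT. Qed.

Let clamp_id t : 0 <= t <= rho -> clamp t = t.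
Proof. by move=> /andP[t0 tr]; rewrite /clamp min_l// max_r. Qed.

Let clamp_lip s t : `|clamp s - clamp t| <= `|s - t|.
Proof.
wlog st : s t / t <= s.
  by move=> W; have [/W//|/ltW/W] := leP t s; rewrite distrC [leRHS]distrC.
rewrite [leRHS]ger0_norm ?subr_ge0// ler_norml /clamp; move: rho0.
by case: (leP s rho) => ?; case: (leP t rho) => ?; case: (leP 0 s) => ?; case: (leP 0 t) => ?;
  case: (leP 0 rho) => ? ?; apply/andP; split; lra.
Qed.

(** [abs_continuous_const] turns the almost everywhere equation into r^d y' + flux = 0 on [0, rho].
    Hence y0 and 1 - volt have the same derivative inside, and they agree at 0. *)
Lemma regular_solution_regsol : exists2 y, regsol d (pot 0) y &
  forall r, 0 <= r <= rho -> y r = y0 r.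
Proof.
have [y' [[cy' Dy'] y'0 acy' dy']] := sol.
have Hq r : 0 <= r <= rho -> forall e, 0 < e -> exists2 g, 0 < g &
    forall x, 0 <= x <= rho -> `|x - r| < g -> `|y0 x - y0 r - y' r * (x - r)| <= e * `|x - r|.
  move=> rr e e0; have /cvgrPdist_lt /(_ _ e0) := Dy' r rr.
  move=> /nbhs_ballP[g /= g0 Hg]; exists g => // x xr xg.
  have [->|xnr] := eqVneq x r; first by rewrite !subrr mulr0 subr0 normr0 mulr0.
  have h0 : x - r != 0 by rewrite subr_eq0.
  have := Hg x; rewrite /ball/= distrC => /(_ xg); rewrite in_itv/= => /(_ xnr xr) H.
  rewrite -[y0 x - y0 r](mulfVK h0) -mulrBl normrM ler_wpM2r//.
  by rewrite distrC ltW.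
pose f t := y0 (clamp t).
have fE t : 0 <= t <= rho -> f t = y0 t by move=> tr; rewrite /f clamp_id.
have cf : continuous f.
  move=> t; apply/cvgrPdist_lt => e e0; have rr := clamp_in t.
  have [g g0 Hg] := Hq _ rr 1 ltr01; pose K := `|y' (clamp t)| + 1.
  have K0 : 0 < K by rewrite ltr_wpDl.
  have m0 : 0 < Num.min g (e / K) by rewrite lt_min g0 divr_gt0.
  apply: filterS (nbhsx_ballx t _ m0) => s; rewrite /ball/= lt_min distrC => /andP[sg sK].
  have cl := clamp_lip s t; rewrite distrC /f.
  have B := Hg (clamp s) (clamp_in s) (le_lt_trans cl sg).
  have -> : y0 (clamp s) - y0 (clamp t) = (y0 (clamp s) - y0 (clamp t) - y' (clamp t) * (clamp s - clamp t))
    + y' (clamp t) * (clamp s - clamp t) by rewrite subrK.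
  rewrite (le_lt_trans (ler_normD _ _))//.
  apply: (@le_lt_trans _ _ (K * `|clamp s - clamp t|)).
    by rewrite /K mulrDl addrC lerD// normrM.
  by rewrite -ltr_pdivlMl// mulrC (le_lt_trans cl).
have [C HC] := continuous_bounded_itv 0 rho cf.
have fW : wball 1 C f.
  split; first exact: measurable_continuous.
  move=> t; have B : `|f t| <= C.
    by have := HC _ (clamp_in t); rewrite /f (clamp_id (clamp_in t)).
  rewrite (le_trans B)// ler_peMr ?(le_trans _ B)// /wt -[leLHS]expR0 ler_expR mul1r.
  by rewrite le_max lexx orbT.
have pq := potential_pot 0; set q := pot 0 in pq.
have fin s t := int_flux d pq ler01 s t fW.
have flE r : 0 <= r <= rho -> r ^+ d * y' r + flux d q f r = 0.
  move=> /andP[]; rewrite le_eqVlt => /predU1P[<- _|r0 rr].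
    by rewrite y'0 mulr0 /flux itg_pt// addr0.
  pose g t := t ^+ d * q t * f t.
  have gT : mu.-integrable setT (EFin \o g).
    have := integrable_patch_oo (fin 0 rho); apply: eq_integrableR => // x _.
    rewrite patchE; case: ifPn => // xI; rewrite /g /q pot_out ?mulr0 ?mul0r//.
    by apply: contra xI => xI; rewrite inE/= in_itv.
  have acr : abs_continuous 0 r (fun s => s ^+ d * y' s).
    move=> e e0; have [dd dd0 H] := acy' e e0; exists dd => // J aJ; apply: H.
    by apply/allP => p /(allP aJ) /and3P[-> -> pr]; exact: le_trans rr.
  rewrite (@abs_continuous_const _ _ g r r0 acr gT) ?y'0 ?mulr0//.
  have gl : locally_integrable setT g.
    by apply: open_integrable_locally; [exact: openT|exact: gT].
  have FT := FTC1 (a := BLeft 0) (fun y => int_itvT 0 y gT) gl.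
  cbv zeta in FT.
  have H2 := @filterI _ _ (ae_filter_ringOfSetsType mu) _ _ FT dy'.
  apply: (@filterS _ _ (ae_filter_ringOfSetsType mu) _ _ _ H2) => x [Fx Dx] /andP[x0 xr].
  have xI : 0 < x < rho by rewrite x0 (lt_le_trans xr).
  have [|DF FE] := Fx; first by rewrite lte_fin.
  have D1 : is_derive x (1 : R) (itg g 0) (g x).
    by apply: DeriveDef; [exact: DF|rewrite -derive1E; exact: FE].
  have D2 := Dx xI.
  have := is_deriveD_fun D2 D1; rewrite (_ : - _ + _ = 0)//.
  have xx : 0 <= x <= rho by move: xI => /andP[/ltW -> /ltW].
  by rewrite /g /q potE// (fE _ xx) addr0 addNr.
(* This extends y0 beyond [0, rho]. As q vanishes outside ]0, rho[, replacing f by yh does not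
   change the Volterra term, so the equation holds on the whole line. *)
pose yh r := 1 - volt d q f r.
have dyh r : is_derive r (1 : R) yh (- slope d q f r).
  have := is_deriveB_fun (@is_derive_cst R R^o R^o (1 : R) r (1 : R)) (is_derive_volt d pq ler01 r fW).
  by rewrite sub0r.
have yhE r : 0 <= r <= rho -> yh r = y0 r.
  move=> /andP[r0 rr]; pose G t := f t - yh t.
  have cG : continuous G.
    move=> t; apply: continuousB; [exact: cf|exact: is_derive_continuous (dyh t)].
  have dG x : x \in `]0, r[ -> is_derive x (1 : R) G 0.
    rewrite in_itv/= => /andP[x0 xr]; have xr' : x < rho by exact: lt_le_trans xr rr.
    have xx : 0 <= x <= rho by rewrite !ltW.
    have df : is_derive x (1 : R) f (y' x).
      apply: bound_is_derive => e e0; have [g g0 Hg] := Hq x xx e e0.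
      have m0 : 0 < Num.min g (Num.min x (rho - x)) by rewrite !lt_min g0 x0 subr_gt0.
      exists (Num.min g (Num.min x (rho - x))) => // t.
      rewrite !lt_min => /and3P[tg tx tr].
      have tt : 0 <= t <= rho by move: tx tr; rewrite !ltr_norml => /andP[? ?] /andP[? ?]; apply/andP; split; lra.
      by rewrite (fE t tt) (fE x xx); exact: Hg.
    have := is_deriveB_fun df (dyh x); rewrite opprK (_ : y' x + _ = 0)//.
    have := flE x xx; rewrite /slope; have xd : x ^+ d != 0 by rewrite expf_neq0// gt_eqF.
    move=> E; apply: (mulfI xd); rewrite mulr0 -E mulrDr; congr (_ + _).
    by rewrite mulrC mulfVK.
  have [c _] := MVT_segment r0 dG (continuous_subspaceT cG).
  rewrite mul0r => /eqP; rewrite subr_eq0 => /eqP E.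
  have G0 : G 0 = 0 by rewrite /G fE ?lexx ?(ltW rho0)// y00 /yh /volt itg_pt// subr0 subrr.
  by move: E; rewrite G0 /G fE ?r0// => /eqP; rewrite subr_eq0 => /eqP ->.
exists yh => //; split.
  exists 1, (1 + itg (fun t => `|q t|) 0 rho * C / 1); split=> //.
  apply: wballB; last first.
    apply: (volt_wball_mass d pq ler01 _ ltr01 fW) => s.
    have qn u v : int_itv (fun t => `|q t|) u v by exact: int_itvT (potential_norm pq).1.
    have [sr|rs] := leP s rho; first by apply: le_itg_sub.
    rewrite (@itg_split _ _ 0 rho s (ltW rho0) (ltW rs) (qn _ _)) (@eq_itg _ _ (fun=> 0) rho s); last first.
      by move=> t /andP[rt _]; rewrite /q pot_out ?normr0// negb_and -!leNgt rt orbT.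
    by rewrite (itg_cst _ (ltW rs)) mul0r addr0.
  split=> [|t]; first exact: measurable_cst.
  by rewrite normr1 mul1r /wt mul1r -[leLHS]expR0 ler_expR le_max lexx orbT.
move=> r; suff vE : volt d q yh r = volt d q f r by rewrite vE /yh subrK.
apply: eq_itg => s _; rewrite /slope; congr (_ / _).
apply: eq_itg => t _; have [tI|tI] := boolP (0 < t < rho).
  have tt : 0 <= t <= rho by move: tI => /andP[/ltW -> /ltW].
  by rewrite fE// yhE.
by rewrite /q pot_out// mulr0 !mul0r.
Qed.

End identification.

(** * Weak solutions *)

Section weak_derivative.
Context {R : realType}.
Local Notation mu := (@lebesgue_measure R).
Variables (d : nat) (rho : R).
Hypothesis rho0 : 0 < rho.
Local Notation I := (`]0, rho[%classic : set R).
Implicit Types (u g : R -> R).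

Lemma compact_away0 (K : set R) : compact K -> K `<=` I ->
  exists2 al, 0 < al & forall x, K x -> al <= x.
Proof.
move=> cK KI; have : compact ((fun r : R => r^-1) @` K).
  apply: continuous_compact => //; apply: continuous_in_subspaceT => x; rewrite inE => /KI.
  by rewrite /= in_itv/= => /andP[x0 _]; apply: inv_continuous; rewrite gt_eqF.
move=> /compact_bounded /ex_strict_bound_gt0[M M0 HM]; exists M^-1; first by rewrite invr_gt0.
move=> x Kx; have : I x by exact: KI.
rewrite /= in_itv/= => /andP[x0 _].
rewrite -[x]invrK lef_pV2 ?posrE ?invr_gt0//.
have : `|x^-1| < M := HM _ (imageP _ Kx).
by rewrite gtr0_norm ?invr_gt0// => /ltW.
Qed.

Lemma int_I_weight g : mu.-integrable I (EFin \o (fun r => g r * r ^+ d)) ->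
  forall s, 0 < s -> int_itv g s rho.
Proof.
move=> gi s s0; apply: (@int_itv_weight _ _ d) => //.
apply/int_itv_oo; apply: integrableS gi => // x /=; rewrite !in_itv/= => /andP[sx ->].
by rewrite (lt_trans s0).
Qed.

Lemma measurable_weight g : mu.-integrable I (EFin \o (fun r => g r * r ^+ d)) ->
  measurable_fun I g.
Proof.
move=> gi; have mg := integrable_measurableR gi.
apply: (eq_measurable_fun (fun r => (g r * r ^+ d) * (r ^+ d)^-1)).
  move=> r /set_mem; rewrite /= in_itv/= => /andP[r0 _].
  by rewrite mulfK// expf_neq0// gt_eqF.
apply: measurable_funM => //; apply: measurable_funTS.
apply: (measurableT_comp (f := fun r : R => r^-1)); first exact: measurable_invr.
exact: exprn_measurable.
Qed.

Lemma int_weight_bounded (g h : R -> R) (C : R) : mu.-integrable I (EFin \o (fun r => g r * r ^+ d)) ->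
  measurable_fun I h -> (forall r, 0 < r < rho -> `|h r| <= C * r ^+ d) ->
  mu.-integrable I (EFin \o (fun r => h r * g r)).
Proof.
move=> gi mh hC.
apply: (@eq_integrableR _ _ (fun r => (h r / r ^+ d) * (g r * r ^+ d))) => //.
  move=> r; rewrite /= in_itv/= => /andP[r0 _]; field.
  by rewrite expf_neq0// gt_eqF.
apply: (@integrableM_bounded _ _ _ mu _ (measurable_itv _) C) => //.
  apply: measurable_funM => //; apply: measurable_funTS.
  apply: (measurableT_comp (f := fun r : R => r^-1)); first exact: measurable_invr.
  exact: exprn_measurable.
move=> r; rewrite /= in_itv/= => rI; have /andP[r0 _] := rI.
rewrite normrM normfV (ger0_norm (exprn_ge0 d (ltW r0))) ler_pdivrMr ?exprn_gt0//.
exact: hC.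
Qed.

Lemma locally_integrable_itv g al be : locally_integrable I g -> 0 < al -> be < rho ->
  int_itv g al be.
Proof.
move=> [mg _ gK] al0 ber; have sub : `[al, be] `<=` I.
  by move=> x /=; rewrite !in_itv/= => /andP[? ?]; apply/andP; split; lra.
apply/integrableP; split; first by apply/measurable_EFinP; exact: measurable_funS mg.
by apply: (gK `[al, be]%classic sub); exact: segment_compact.
Qed.

Lemma weak_deriv_unique u g1 g2 : is_weak_deriv rho u g1 -> is_weak_deriv rho u g2 ->
  {ae mu, forall r, I r -> g1 r = g2 r}.
Proof.
move=> [l1 w1] [l2 w2].
suff : {ae mu, forall r, 0 < r < rho -> g1 r - g2 r = 0}.
  by apply: aeS => r H; rewrite /= in_itv/= => /H /eqP; rewrite subr_eq0 => /eqP.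
have m1 : measurable_fun I g1 by case: l1.
have m2 : measurable_fun I g2 by case: l2.
apply: ae_eq0_bump => al be al0 albe ber.
have i1 := locally_integrable_itv l1 al0 ber.
have i2 := locally_integrable_itv l2 al0 ber.
split; first exact: int_itvB.
move=> dl dl0; pose th := bump dl al be.
have tt := bump_test_function dl0 al0 ber.
have cth : continuous th by exact: continuous_bump.
have bi g : int_itv g al be -> int_itv (fun t => th t * g t) al be.
  move=> gi; apply: (@integrableM_bounded _ _ _ mu _ (measurable_itv _) 1 g th) => //.
    by apply: measurable_funTS; exact: measurable_continuous.
  by move=> x _; rewrite ger0_norm ?bump_ge0// bump_le1.
have E g : measurable_fun I g -> \int[mu]_(r in I) (g r * th r) = itg (fun t => th t * g t) al be.
  move=> mg; rewrite (@itg_support _ I)//.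
  - by apply: eq_Rintegral => r _; rewrite mulrC.
  - by apply: measurable_funM => //; apply: measurable_funTS; exact: measurable_continuous.
  - by move=> x /=; rewrite !in_itv/= => /andP[alx xbe]; rewrite (lt_trans al0 alx) (lt_trans xbe ber).
  - by move=> x _ xab; rewrite /th bump_out// mul0r.
rewrite (@eq_itg _ _ (fun t => th t * g1 t - th t * g2 t)); last by move=> t _; rewrite mulrBr.
rewrite itgB ?bi// -!E//.
by have := w1 _ tt; rewrite (w2 _ tt) => /oppr_inj ->; rewrite subrr.
Qed.

(** psi is the primitive of its derivative, so [fubini_triangle] is the integration by parts. Near 0
    only r^d g is integrable, which is enough because psi vanishes there. *)
Lemma tail_is_weak_deriv u g : mu.-integrable I (EFin \o (fun r => g r * r ^+ d)) ->
  measurable_fun I u -> {ae mu, forall r, 0 < r < rho -> u r = - itg g r rho} ->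
  is_weak_deriv rho u g.
Proof.
move=> gi mu_ uE; have mg := measurable_weight gi; have gir := int_I_weight gi.
split.
  split=> //.
  move=> K KI cK; have [al al0 Kal] := compact_away0 cK KI.
  have /integrableP[_ fin] := gir al al0.
  have {}fin : (\int[mu]_(x in `[al, rho]) `|g x|%:E < +oo)%E := fin.
  apply: le_lt_trans fin; apply: ge0_subset_integral => //.
  - exact: compact_measurable.
  - apply/measurable_EFinP; apply: measurableT_comp => //.
    by apply/measurable_EFinP; case/integrableP: (gir al al0).
  - by move=> x Kx /=; rewrite in_itv/= Kal//=; have := KI x Kx; rewrite /= in_itv/= => /andP[_ /ltW].
move=> psi [Cpsi Ksupp KI]; have [al al0 Kal] := compact_away0 Ksupp KI.
have [cpsi /(_ 1)[dpsi [cdpsi _]]] := Cpsi 1%N.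
pose dp : R -> R := 'D_1 psi.
have dE r : is_derive r (1 : R) (psi : R -> R) (dp r) by apply: DeriveDef.
have nsupp x : ~ closure [set x | psi x != 0] x -> psi x = 0.
  by move=> nx; apply/eqP; apply: contrapT => /negP px; apply: nx; exact: subset_closure.
have psi0 x : x < al -> psi x = 0.
  by move=> xal; apply: nsupp => /Kal; rewrite leNgt xal.
have dp0 x : x < al -> dp x = 0.
  move=> xal; rewrite /dp -(derive_cst (0 : R) x (1 : R)); apply: near_eq_derive => //.
  by near=> y; apply: psi0; near: y; exact: lt_nbhsl.
have cdp : continuous (dp : R -> R) by exact: cdpsi.
have dpi a b : int_itv dp a b by apply: int_itv_continuous => x _; exact: cdp.
have psiE r : 0 <= r -> psi r = itg dp 0 r.
  move=> r0; rewrite (itg_derive r0 (fun x _ => cdp x) (fun x _ => dE x)).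
  by rewrite (psi0 0 al0) subr0.
have d1E : derive1 psi = dp by apply/funext => r; rewrite derive1E.
rewrite d1E.
have ndpi a b : int_itv (fun t => `|dp t|) a b by exact: int_itv_norm.
have [M HM] : exists M : R, forall r, 0 <= r <= rho -> `|itg (fun t => `|dp t|) 0 r| <= M.
  exists (itg (fun t => `|dp t|) 0 rho) => r /andP[r0 rr].
  rewrite ger0_norm; last by apply: itg_ge0 => x _; exact: normr_ge0.
  by apply: le_itg_sub.
have M0 : 0 <= M by apply: le_trans (HM 0 _); rewrite ?normr_ge0// lexx ltW.
have itg0 r : r < al -> itg (fun t => `|dp t|) 0 r = 0.
  move=> ral; rewrite (@eq_itg _ _ (fun=> 0)); last first.
    by move=> x /andP[_ xr]; rewrite dp0 ?normr0// (le_lt_trans xr).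
  by have [r0|r0] := leP 0 r; [rewrite itg_cst// mul0r|rewrite itg_lt].
have citg : continuous (itg (fun t => `|dp t|) 0).
  apply: itg_continuous => // x x0; rewrite dp0 ?normr0//.
  exact: le_lt_trans al0.
have [|||Ei E] := @fubini_triangle R rho g dp mg.
- by apply/int_itv_oo.
- have := @int_weight_bounded g (itg (fun t => `|dp t|) 0) (M / al ^+ d) gi _ _.
  move=> H; apply: eq_integrableR (H _ _) => //; first by move=> r _; rewrite mulrC.
    by apply: measurable_funTS; exact: measurable_continuous.
  move=> r /andP[r0 rr]; have [ral|alr] := ltP r al.
    by rewrite itg0// normr0 mulr_ge0 ?exprn_ge0 ?(ltW r0)// divr_ge0// exprn_ge0// ltW.
  apply: (@le_trans _ _ M); first by apply: HM; rewrite !ltW.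
  rewrite mulrAC ler_pdivlMr ?exprn_gt0// ler_wpM2l//.
  by rewrite lerXn2r ?nnegrE// ltW.
- exact: gir.
rewrite (@eq_Rintegral _ _ _ mu I (fun r => g r * itg dp 0 r) (fun r => g r * psi r)); last first.
  by move=> r /set_mem; rewrite /= in_itv/= => /andP[r0 _]; rewrite psiE// ltW.
rewrite E -RintegralN//.
have mdp : measurable_fun I dp by apply: measurable_funTS; exact: measurable_continuous.
have mtail : measurable_fun I (fun r => itg g r rho).
  apply: open_continuous_measurable_fun; first exact: interval_open.
  by move=> x /set_mem; rewrite /= in_itv/= => xI; exact: itg_tail_continuous.
apply: eq_ae_Rintegral.
- exact: measurable_itv.
- exact: measurable_funM.
- by apply: measurableT_comp => //; exact: measurable_funM.
- apply: aeS uE => r H rI; rewrite H; last by move: rI; rewrite /= in_itv.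
  by rewrite mulNr mulrC.
Unshelve. all: by end_near. Qed.

(** [weak_deriv] is a choice among all weak derivatives; since g is one, uniqueness identifies the
    choice with g almost everywhere. *)
Lemma weak_derivE u g : mu.-integrable I (EFin \o (fun r => g r * r ^+ d)) ->
  measurable_fun I u -> {ae mu, forall r, 0 < r < rho -> u r = - itg g r rho} ->
  measurable_fun I (weak_deriv rho u) /\
  {ae mu, forall r, I r -> weak_deriv rho u r = g r}.
Proof.
move=> gi mu_ uE; have W := tail_is_weak_deriv gi mu_ uE.
have W' : is_weak_deriv rho u (weak_deriv rho u) by exact: (@xgetPex _ (cst 0) [set g | is_weak_deriv rho u g] (ex_intro _ g W)).
by split; [case: W' => -[]|exact: weak_deriv_unique W' W].
Qed.

End weak_derivative.

(** * Radial test functions with prescribed derivative *)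

Section radial_test.
Context {R : realType}.
Local Notation mu := (@lebesgue_measure R).

(** The additive constant is fixed so that the primitive vanishes beyond be; near 0 it is constant
    because k vanishes there. *)
Lemma cutoff_primitive (k : R -> R) (al be b : R) : smooth k -> 0 < al ->
  (forall s, s <= al -> k s = 0) -> (forall s, be <= s -> k s = 0) -> be <= b ->
  let ze s := itg k 0 s - itg k 0 b in
  [/\ forall s, is_derive s (1 : R) ze (k s), smooth ze & forall s, be < s -> ze s = 0].
Proof.
move=> sk al0 k0 k1 beb ze; have ck := smooth_continuous sk.
have ki s t : int_itv k s t by apply: int_itv_continuous => x _; exact: ck.
have i0 s : s <= al -> itg k 0 s = 0.
  move=> sal; rewrite (@eq_itg _ _ (fun=> 0)); last by move=> x /andP[_ xs]; rewrite k0// (le_trans xs).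
  by have [s0|s0] := leP 0 s; [rewrite itg_cst// mul0r|rewrite itg_lt].
have i1 s t : be <= s -> s <= t -> itg k s t = 0.
  move=> bes st; rewrite (@eq_itg _ _ (fun=> 0)) ?itg_cst ?mul0r//.
  by move=> x /andP[sx _]; rewrite k1// (le_trans bes).
have dze s : is_derive s (1 : R) ze (k s).
  have [s0|s0] := ltP 0 s.
    have := is_deriveB_fun (is_derive_itg (fun b => ki 0 b) s0 (ck s)) (@is_derive_cst R R^o R^o (itg k 0 b) s (1 : R)).
    by rewrite subr0.
  rewrite k0; last by rewrite (le_trans s0)// ltW.
  apply: (@is_derive_local R (fun=> - itg k 0 b) ze s 0).
  near=> t; rewrite /ze (i0 t) ?sub0r//; near: t.
  by apply: filterS (lt_nbhsl (le_lt_trans s0 al0)) => t /ltW.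
split=> //; first exact: smooth_primitive sk dze.
move=> s bes; rewrite /ze.
have [be0|be0] := leP 0 be; last first.
  have z t : itg k 0 t = 0.
    have [t0|t0] := leP 0 t; last by rewrite itg_lt.
    by apply: i1 => //; exact: ltW.
  by rewrite !z subrr.
rewrite (@itg_split _ k 0 be s) ?(ltW bes)// (@itg_split _ k 0 be b)//.
by rewrite (i1 be s)// ?(ltW bes)// (i1 be b)// subrr.
Unshelve. all: by end_near. Qed.

Variables (n : nat) (rho : R).
Hypotheses (n0 : (0 < n)%N) (rho0 : 0 < rho).
Local Notation leb := (@lebesgue_row R n).
Local Notation B := (@eball R n rho).

Lemma test_H1_0 (phi : 'rV[R]_n -> R) : test_function B phi -> H1_0 B phi.
Proof.
move=> tphi; have [K [Kc KB K0 cphi Dphi]] := test_function_facts tphi.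
have mB := @measurable_eball R n rho.
have sq0 (f : 'rV[R]_n -> R) : (forall x, ~ K x -> f x = 0) -> continuous f -> L2 B f.
  move=> f0 cf; split; first by apply: measurable_funTS; exact: measurable_continuous_row.
  rewrite (_ : (fun x => _) = EFin \o (fun x => f x * f x)); last first.
    by apply/funext => x; rewrite /= expr2.
  apply: (compact_support_integrable Kc KB) => [x /f0 ->|]; first by rewrite mulr0.
  exact: continuousM_fun.
exists (fun i => partial i phi).
  split; first exact: sq0.
    move=> i; apply: sq0; first by move=> x nK; exact: (partial_eq0 i Kc K0).
    by have [] := Dphi (delta_mx ord0 i).
  move=> psi tpsi i; have [_ [_ _ _ cpsi Dpsi]] := test_function_facts tpsi.
  have [] := test_function_ibp (i := i) tphi (psi := psi) => //.
  by have [d1 d2] := Dpsi (delta_mx ord0 i); split.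
move=> e e0; exists phi => //.
rewrite (eq_integral (cst 0%E)) ?integral_cst// ?mul0e ?lte_fin//.
move=> x _ /=; rewrite subrr expr0n/= add0r big1// => i _.
by rewrite subrr expr0n.
Qed.

Variables (k : R -> R) (al be : R).
Hypotheses (sk : smooth k) (al0 : 0 < al) (ber : be < rho ^+ 2).
Hypotheses (k0 : forall s, s <= al -> k s = 0) (k1 : forall s, be <= s -> k s = 0).
Let ze s := itg k 0 s - itg k 0 (rho ^+ 2).

Let zeP : [/\ forall s, is_derive s (1 : R) ze (k s), smooth ze & forall s, be < s -> ze s = 0].
Proof. exact: (cutoff_primitive sk al0 k0 k1 (ltW ber)). Qed.

(** The derivative 2 r k(r^2) of this profile is what gets prescribed, through the choice of k. *)
Definition radial_profile r := ze (r ^+ 2).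
Definition radial_profile' r := 2 * r * k (r ^+ 2).

Lemma radial_profile_test : test_function B (fun x => radial_profile (enorm x)).
Proof.
have [dze sze z0] := zeP.
have := @radial_test_function R n rho be ze rho0 ber sze z0.
by congr test_function; apply/funext => x; rewrite /radial_profile enorm_sqn.
Qed.

Lemma radial_profile_H1_0 : H1_0rad n rho radial_profile.
Proof. exact: test_H1_0 radial_profile_test. Qed.

Lemma radial_profile_derive r : is_derive r (1 : R) radial_profile (radial_profile' r).
Proof.
have [dze _ _] := zeP.
have := is_derive_comp (is_derive_exprn 2 r) (dze (r ^+ 2)).
by rewrite /radial_profile' expr1 mulrC.
Qed.

Lemma radial_profile'_continuous : continuous radial_profile'.
Proof.
apply: continuousM_fun; first exact: mulrl_continuous.
move=> r; apply: (@continuous_comp _ _ _ (fun r : R => r ^+ 2)); first exact: exprn_continuous.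
exact: smooth_continuous.
Qed.

Lemma radial_profile_tail r : r <= rho -> radial_profile r = - itg radial_profile' r rho.
Proof.
move=> rr; have [_ _ z0] := zeP.
rewrite (itg_derive rr (fun x _ => radial_profile'_continuous (x := x)) (fun x _ => radial_profile_derive x)).
by rewrite /radial_profile (z0 (rho ^+ 2) ber) sub0r opprK.
Qed.

End radial_test.

(** * From the weak form to the flux equation *)

Section weak_solution.
Context {R : realType}.
Local Notation mu := (@lebesgue_measure R).
Variables (n : nat) (rho lam : R) (a g : R -> R).
Hypotheses (n0 : (0 < n)%N) (rho0 : 0 < rho).
Local Notation I := (`]0, rho[%classic : set R).
Local Notation d := n.-1.
Hypothesis ai : mu.-integrable I (EFin \o a).
Hypothesis gi : mu.-integrable I (EFin \o (fun r => g r * r ^+ d)).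

(** The continuous representative of a radial Sobolev function. It may be unbounded at 0, but r^d
    times it is bounded ([tail_bound]). *)
Definition tail r := - itg g r rho.
Local Notation q := (pot rho a lam).
Local Notation U := tail.
Local Notation B := (itg (fun t => `|g t * t ^+ d|) 0 rho).

Let pq : potential q := potential_pot ai lam.
Let gir := int_I_weight gi.

Lemma tail_bound r : 0 < r < rho -> `|r ^+ d * U r| <= B.
Proof.
move=> /andP[r0 rr]; rewrite normrM normrN (ger0_norm (exprn_ge0 _ (ltW r0))).
have gn : int_itv (fun t => `|g t * t ^+ d|) 0 rho by apply: int_itv_norm; apply/int_itv_oo.
have gr := int_itv_norm (gir r0).
apply: (@le_trans _ _ (itg (fun t => r ^+ d * `|g t|) r rho)).
  by rewrite itgZ// ler_wpM2l ?exprn_ge0 ?(ltW r0)// norm_itg// gir.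
apply: (@le_trans _ _ (itg (fun t => `|g t * t ^+ d|) r rho)).
  apply: le_itg; first exact: int_itvZ.
    by apply: int_itvS gn => //; exact: ltW.
  move=> t /andP[rt tr]; have t0 : 0 < t by exact: lt_le_trans rt.
  rewrite normrM mulrC ler_wpM2l// ger0_norm ?exprn_ge0 ?(ltW t0)//.
  by rewrite lerXn2r ?nnegrE// ltW.
by apply: le_itg_sub => //; exact: ltW.
Qed.

Lemma tail_continuous r : 0 < r < rho -> {for r, continuous U}.
Proof.
by move=> rI; apply: continuousN; apply: itg_tail_continuous => // s s0; exact: gir.
Qed.

Lemma measurable_tail : measurable_fun I U.
Proof.
apply: open_continuous_measurable_fun; first exact: interval_open.
by move=> x /set_mem; rewrite /= in_itv/=; exact: tail_continuous.
Qed.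

Lemma measurable_tail_weight : measurable_fun I (fun r => r ^+ d * U r).
Proof. by apply: measurable_funM; [exact: measurable_funTS (exprn_measurable _)|exact: measurable_tail]. Qed.

Lemma tail_weight_integrable h : mu.-integrable I (EFin \o h) ->
  mu.-integrable I (EFin \o (fun r => r ^+ d * U r * h r)).
Proof.
move=> hi; apply: (@integrableM_bounded _ _ _ mu _ (measurable_itv _) B) => //.
  exact: measurable_tail_weight.
by move=> r; rewrite /= in_itv/=; exact: tail_bound.
Qed.

Lemma tail_source_potential : potential (fun t => t ^+ d * q t * U t).
Proof.
split; last by move=> x x0; rewrite pot_out ?mulr0 ?mul0r// ltNge x0.
have qi : mu.-integrable I (EFin \o q) by exact: integrableS pq.1.
have HT : mu.-integrable setT (EFin \o ((fun r => r ^+ d * U r * q r) \_ I)).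
  rewrite -restrict_EFin; apply/(integrable_mkcond _ _).1 => //.
  exact: tail_weight_integrable qi.
apply: eq_integrableR HT => // x _; rewrite patchE.
case: ifPn => [_|xI]; first by ring.
rewrite pot_out ?mulr0 ?mul0r//; apply: contra xI => xI.
by rewrite inE/= in_itv.
Qed.

(** The form is tested with a profile v whose derivative is 2 r times a bump in r^2. This gives int
    v' r^d g = int r^d q U v, and Fubini, with v = - int_r^rho v', turns the right side into - int
    v' A, where A is the flux. So 2 r (r^d g + A) is orthogonal to all these bumps. *)
Lemma weak_form_flux u : measurable_fun I u -> {ae mu, forall r, 0 < r < rho -> u r = U r} ->
  (forall v, H1_0rad n rho v ->
    Defs.form n rho a u v = \int[mu]_(r in I) (lam * u r * v r * r ^+ d)) ->
  {ae mu, forall r, 0 < r < rho -> g r * r ^+ d = - flux d q U r}.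
Proof.
move=> mu_ uE weak; have Hp := tail_source_potential.
pose H t := t ^+ d * q t * U t; pose A := itg H 0.
have cA : continuous A by exact: potential_prim_continuous.
suff : {ae mu, forall r, 0 < r < rho -> 2 * r * (g r * r ^+ d + A r) = 0}.
  apply: aeS => r Hr rI; have /eqP := Hr rI; have /andP[r0 _] := rI.
  rewrite mulf_eq0 mulf_eq0 pnatr_eq0/= gt_eqF//= addr_eq0 => /eqP ->.
  by [].
apply: ae_eq0_bump_sqr => al be al0 albe ber.
have sub : `[al, be] `<=` I.
  by move=> x /=; rewrite !in_itv/= => /andP[? ?]; apply/andP; split; lra.
have c2 : continuous (fun r : R => 2 * r) by exact: mulrl_continuous.
have bi f : int_itv f al be -> int_itv (fun r => 2 * r * f r) al be.
  move=> fi; have [M HM] := continuous_bounded_itv al be c2.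
  apply: (@integrableM_bounded _ _ _ mu _ (measurable_itv _) M f (fun r => 2 * r)) => //.
  by apply: measurable_funTS; exact: measurable_continuous.
split.
  apply: bi; apply: int_itvD; first exact: integrableS gi.
  by apply: int_itv_continuous => x _; exact: cA.
move=> dl dl0; pose k := bump dl (al ^+ 2) (be ^+ 2).
have be0 : 0 < be by exact: lt_trans albe.
have al2 : 0 < al ^+ 2 by rewrite exprn_gt0.
have be2 : be ^+ 2 < rho ^+ 2 by rewrite ltr_pXn2r ?nnegrE// ltW.
have sk : smooth k by exact: smooth_bump.
have k0 s : s <= al ^+ 2 -> k s = 0 by move=> sal; rewrite /k bump_out// ltNge sal.
have k1 s : be ^+ 2 <= s -> k s = 0 by move=> sbe; rewrite /k bump_out// negb_and -!leNgt sbe orbT.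
pose v := radial_profile rho k; pose v' := radial_profile' k.
have vH : H1_0rad n rho v := radial_profile_H1_0 n rho0 sk al2 be2 k0 k1.
have cv' : continuous v' := radial_profile'_continuous sk.
have dv r : is_derive r (1 : R) v (v' r) := radial_profile_derive sk al2 be2 k0 k1 r.
have cv : continuous v by move=> r; exact: is_derive_continuous (dv r).
have vT r : r <= rho -> v r = - itg v' r rho := radial_profile_tail sk al2 be2 k0 k1 (r := r).
have v'i s t : int_itv v' s t by apply: int_itv_continuous => x _; exact: cv'.
have Iin r : I r -> 0 <= r <= rho by rewrite /= in_itv/= => /andP[? ?]; rewrite !ltW.
have mc (f : R -> R) : continuous f -> measurable_fun I f.
  by move=> cf; apply: measurable_funTS; exact: measurable_continuous.
have bI (f h : R -> R) : continuous f -> mu.-integrable I (EFin \o h) -> mu.-integrable I (EFin \o (fun r => f r * h r)).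
  move=> cf hi; have [M HM] := continuous_bounded_itv 0 rho cf.
  apply: (@integrableM_bounded _ _ _ mu _ (measurable_itv _) M) => //; first exact: mc.
  by move=> r /Iin; exact: HM.
have v'pi : mu.-integrable I (EFin \o (fun r => v' r * r ^+ d)).
  apply: bI => //; apply/int_itv_oo; apply: int_itv_continuous => x _; exact: exprn_continuous.
have [mwu wuE] := weak_derivE rho0 gi mu_ uE.
have vTI (r : R) : 0 < r < rho -> v r = - itg v' r rho by move=> /andP[_ /ltW]; exact: vT.
have vTae : {ae mu, forall r, 0 < r < rho -> v r = - itg v' r rho} by exact: aeW.
have [mwv wvE] := weak_derivE rho0 v'pi (mc _ cv) vTae.
have ma : measurable_fun I a by exact: integrable_measurableR ai.
have mg : measurable_fun I g by exact: measurable_weight gi.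
have mU := measurable_tail.
have mp : measurable_fun I (fun r : R => r ^+ d) by exact: measurable_funTS (exprn_measurable _).
have mv := mc _ cv; have mv' := mc _ cv'.
have E1 : Defs.form n rho a u v = \int[mu]_(r in I) ((g r * v' r - a r * U r * v r) * r ^+ d).
  apply: eq_ae_Rintegral => //.
  - apply: measurable_funM => //; apply: measurable_funB; first exact: measurable_funM.
    by apply: measurable_funM => //; exact: measurable_funM.
  - apply: measurable_funM => //; apply: measurable_funB; first exact: measurable_funM.
    by apply: measurable_funM => //; exact: measurable_funM.
  have HH := @filterI _ _ (ae_filter_ringOfSetsType mu) _ _ wuE (@filterI _ _ (ae_filter_ringOfSetsType mu) _ _ wvE uE).
  apply: (@filterS _ _ (ae_filter_ringOfSetsType mu) _ _ _ HH) => r [h1 [h2 h3]] rI.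
  by rewrite h1// h2// h3//; move: rI; rewrite /= in_itv.
have E2 : \int[mu]_(r in I) (lam * u r * v r * r ^+ d) = \int[mu]_(r in I) (lam * U r * v r * r ^+ d).
  apply: eq_ae_Rintegral => //.
  - by apply: measurable_funM => //; apply: measurable_funM => //; apply: measurable_funM.
  - by apply: measurable_funM => //; apply: measurable_funM => //; apply: measurable_funM.
  by apply: aeS uE => r h3 rI; rewrite h3//; move: rI; rewrite /= in_itv.
have J1 : mu.-integrable I (EFin \o (fun r => v' r * (g r * r ^+ d))) by exact: bI.
have J2 : mu.-integrable I (EFin \o (fun r => v r * (r ^+ d * U r * a r))).
  by apply: bI => //; exact: tail_weight_integrable.
have J3 : mu.-integrable I (EFin \o (fun r => v r * (r ^+ d * U r * lam))).
  by apply: bI => //; apply: tail_weight_integrable; apply/int_itv_oo; exact: int_itv_cst.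
have HI : mu.-integrable I (EFin \o H) by exact: integrableS Hp.1.
have key : \int[mu]_(r in I) (v' r * (g r * r ^+ d)) = \int[mu]_(r in I) (H r * v r).
  have := weak v vH; rewrite E1 E2.
  rewrite (@eq_Rintegral _ _ _ mu I (fun r => v' r * (g r * r ^+ d) - v r * (r ^+ d * U r * a r))); last first.
    by move=> r _; ring.
  rewrite (@eq_Rintegral _ _ _ mu I (fun r => v r * (r ^+ d * U r * lam)) (fun r => lam * U r * v r * r ^+ d)); last first.
    by move=> r _; ring.
  rewrite RintegralB// => /eqP; rewrite subr_eq -RintegralD// => /eqP ->.
  apply: eq_Rintegral => r /set_mem; rewrite /= in_itv/= => rI.
  by rewrite /H potE//; ring.
have nA : continuous (itg (fun t => `|H t|) 0).
  exact: potential_prim_continuous (potential_norm Hp).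
have [||i1 E3] := @fubini_triangle R rho v' H mv' HI.
- by apply: bI => //; apply/int_itv_oo; apply: int_itv_continuous => x _; exact: nA.
- by move=> s _; exact: v'i.
have J4 : mu.-integrable I (EFin \o (fun r => v' r * A r)).
  by apply: bI => //; apply/int_itv_oo; apply: int_itv_continuous => x _; exact: cA.
have key2 : \int[mu]_(r in I) (H r * v r) = - \int[mu]_(r in I) (v' r * A r).
  rewrite E3 -RintegralN//; apply: eq_Rintegral => r /set_mem; rewrite /= in_itv/= => /andP[_ rr].
  by rewrite vT ?mulrN// ltW.
rewrite (@itg_support _ I _ _ _ (measurable_itv `]0, rho[)); last 1 first.
- move=> r; rewrite /= in_itv/= => /andP[r0 rr] rab.
  rewrite bump_out ?mul0r//; apply: contra rab => /andP[h1 h2].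
  by rewrite !ltr_pXn2r ?nnegrE ?(ltW r0) ?(ltW al0) ?(ltW be0)// in h1 h2; rewrite h1.
- rewrite (@eq_Rintegral _ _ _ mu I (fun r => v' r * (g r * r ^+ d) + v' r * A r)); last first.
    by move=> r _; rewrite /v' /radial_profile' -/k; ring.
  by rewrite RintegralD// key key2 addNr.
- apply: measurable_funM.
    apply: mc => r; apply: (@continuous_comp _ _ _ (fun t : R => t ^+ 2)); first exact: exprn_continuous.
    exact: continuous_bump.
  apply: measurable_funM; first exact: mc.
  by apply: measurable_funD; [exact: measurable_funM|exact: mc].
- by move=> x xab; apply: sub; exact: subset_itv_oo_cc xab.
Qed.

End weak_solution.

(** * A weak solution is a multiple of the regular one *)

Section weak_solution_regular.
Context {R : realType}.
Local Notation mu := (@lebesgue_measure R).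
Variables (n : nat) (rho lam : R) (a g Y : R -> R).
Hypotheses (rho0 : 0 < rho).
Local Notation I := (`]0, rho[%classic : set R).
Local Notation d := n.-1.
Hypothesis ai : mu.-integrable I (EFin \o a).
Hypothesis gi : mu.-integrable I (EFin \o (fun r => g r * r ^+ d)).
Local Notation q := (pot rho a lam).
Local Notation U := (tail rho g).
Hypothesis gE : {ae mu, forall r, 0 < r < rho -> g r * r ^+ d = - flux d q U r}.
Hypothesis YS : regsol d q Y.

Let pq : potential q := potential_pot ai lam.
Let gir := int_I_weight gi.
Let A := flux d q U.
Let z := flux d q Y.
Let Hp : potential (fun t => t ^+ d * q t * U t) := tail_source_potential lam ai gi.

Let cA : continuous A.
Proof. exact: potential_prim_continuous Hp. Qed.

Let slopeU_continuous x : 0 < x -> {for x, continuous (slope d q U)}.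
Proof.
move=> x0; apply: continuousM; first exact: cA.
by apply: continuousV; [rewrite expf_neq0// gt_eqF|exact: exprn_continuous].
Qed.

Let slopeU_int al be : 0 < al -> int_itv (slope d q U) al be.
Proof.
move=> al0; apply: int_itv_continuous => x /andP[ax _]; apply: slopeU_continuous.
exact: lt_le_trans ax.
Qed.

Let U_itg al r : 0 < al -> al <= r -> r <= rho ->
  U r = U al + itg (fun t => - slope d q U t) al r.
Proof.
move=> al0 alr rr; rewrite /tail (@itg_split _ g al r rho)//; last exact: gir.
suff -> : itg (fun t => - slope d q U t) al r = itg g al r by ring.
have i1 : int_itv (fun t => - slope d q U t) al r.
  by apply: eq_integrableR (int_itvZ (-1) (slopeU_int r al0)) => // x _; rewrite mulN1r.
have i2 : int_itv g al r by apply: int_itvS (gir al0).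
rewrite -[LHS]itg_oo; last exact: int_itv_measurable i1.
rewrite -[RHS]itg_oo; last exact: int_itv_measurable i2.
apply: eq_ae_Rintegral => //.
- exact: int_itv_measurable i1.
- exact: int_itv_measurable i2.
apply: aeS gE => x Hx; rewrite /= in_itv/= => /andP[ax xr].
have x0 : 0 < x by exact: lt_trans ax.
have := Hx; rewrite x0 (lt_le_trans xr rr) => /(_ isT) E.
have xd : x ^+ d != 0 by rewrite expf_neq0// gt_eqF.
by apply: (mulIf xd); rewrite E mulNr /slope mulfVK.
Qed.

Let A_itg al r : 0 <= al -> al <= r -> A r = A al + itg (fun t => t ^+ d * q t * U t) al r.
Proof. by move=> al0 alr; rewrite /A /flux; apply: itg_split => //; exact: int_itvT Hp.1. Qed.

Let slopeUE r : 0 < r -> slope d q U r * r ^+ d = A r.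
Proof. by move=> r0; rewrite /slope mulfVK// expf_neq0// gt_eqF. Qed.

Let W r := U r * z r - Y r * A r.

Let W_const al be : 0 < al -> al < be -> be < rho -> W be = W al.
Proof.
move=> al0 albe ber.
have sUi : int_itv (fun t => - slope d q U t) al be.
  by apply: eq_integrableR (int_itvZ (-1) (slopeU_int be al0)) => // x _; rewrite mulN1r.
have sYi : int_itv (fun t => - slope d q Y t) al be.
  by apply: eq_integrableR (int_itvZ (-1) (regsol_slope_int pq YS al be)) => // x _; rewrite mulN1r.
have Hi : int_itv (fun t => t ^+ d * q t * U t) al be by exact: int_itvT Hp.1.
have zi := regsol_int pq YS al be.
have no x : al <= x <= 0 -> False.
  by move=> /andP[ax x0]; have := lt_le_trans al0 (le_trans ax x0); rewrite ltxx.
have [i1 E1] : int_itv (fun r => - slope d q U r * z r + U r * (r ^+ d * q r * Y r)) al be /\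
    itg (fun r => - slope d q U r * z r + U r * (r ^+ d * q r * Y r)) al be = U be * z be - U al * z al.
  apply: itg_parts => //; first exact: ltW.
  - by move=> x /no.
  - by move=> r /andP[ar rb]; apply: U_itg => //; exact: le_trans rb (ltW ber).
  - by move=> r /andP[ar _]; apply: (flux_itg pq YS) => //; exact: ltW.
have [i2 E2] : int_itv (fun r => - slope d q Y r * A r + Y r * (r ^+ d * q r * U r)) al be /\
    itg (fun r => - slope d q Y r * A r + Y r * (r ^+ d * q r * U r)) al be = Y be * A be - Y al * A al.
  apply: itg_parts => //; first exact: ltW.
  - by move=> x /no.
  - by move=> r /andP[ar _]; apply: (regsol_itg pq YS) => //; exact: ltW.
  - by move=> r /andP[ar _]; apply: A_itg => //; exact: ltW.
apply/eqP; rewrite -subr_eq0 /W; apply/eqP.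
transitivity ((U be * z be - U al * z al) - (Y be * A be - Y al * A al)); first by ring.
rewrite -E1 -E2 -itgB//.
rewrite (@eq_itg _ _ (fun=> 0)) ?itg_cst ?mul0r ?(ltW albe)//.
move=> t /andP[at0 tb]; have t0 : 0 < t by exact: lt_le_trans at0.
by rewrite -(slopeUE t0) /z -(regsol_slopeE d q Y); ring.
Qed.

(** The Wronskian W is constant and bounded by K times the primitive m of |q|, which tends to 0 at
    the origin: one product pairs the bounded r^d U with the slope of Y, the other the bounded Y
    with the flux of U. *)
Let W0 r : 0 < r < rho -> W r = 0.
Proof.
move=> /andP[r0 rr]; have [[c [C [c0 YW]]] _] := YS; have C0 := wball_ge0 YW.
pose B := itg (fun t => `|g t * t ^+ d|) 0 rho.
have B0 : 0 <= B by apply: itg_ge0 => x _; exact: normr_ge0.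
pose m := itg (fun t => `|q t|) 0.
have cm : continuous m by exact: potential_prim_continuous (potential_norm pq).
have m0 : m 0 = 0 by rewrite /m itg_pt.
pose K := B * (C * wt c rho) + C * wt c rho * B + 1.
have w0 := wt_gt0 c rho.
have K0 : 0 < K by rewrite ltr_wpDl// addr_ge0// !mulr_ge0// ltW.
have bound s : 0 < s -> s < rho -> `|W s| <= K * m s.
  move=> s0 sr; have ms : 0 <= m s by apply: itg_ge0 => x _; exact: normr_ge0.
  have sI : 0 < s < rho by rewrite s0.
  have wsr : wt c s <= wt c rho by rewrite le_wt// ltW.
  have T1 : `|U s * z s| <= B * (C * wt c rho) * m s.
    have -> : U s * z s = s ^+ d * U s * slope d q Y s.
      by rewrite /z -(regsol_slopeE d q Y); ring.
    rewrite normrM -mulrA; apply: ler_pM; [by []|by []|exact: (tail_bound gi sI)|].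
    by rewrite (le_trans (slope_bound d pq c0 s YW))// ler_wpM2r// ler_wpM2l.
  have T2 : `|A s| <= B * m s.
    rewrite (le_trans (norm_itg (int_itvT 0 s Hp.1)))// -itgZ; last exact: int_itvT (potential_norm pq).1.
    apply: le_itg.
    - by apply: int_itv_norm; exact: int_itvT Hp.1.
    - by apply: int_itvZ; exact: int_itvT (potential_norm pq).1.
    move=> t /andP[t0 ts]; have [tI|tI] := boolP (0 < t < rho).
      rewrite mulrAC normrM ler_wpM2r//; exact: (tail_bound gi tI).
    by rewrite pot_out// mulr0 mul0r normr0 mulr0.
  have T3 : `|Y s| <= C * wt c rho.
    by have [_ /(_ s) H] := YW; rewrite (le_trans H)// ler_wpM2l.
  rewrite /W (le_trans (ler_normB _ _))// (le_trans (lerD T1 (_ : _ <= C * wt c rho * (B * m s))))//.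
    by rewrite normrM ler_pM.
  by rewrite /K !mulrDl mul1r !mulrA lerDl.
apply/eqP; rewrite -normr_le0; apply/ler_addgt0Pl => e e0; rewrite addr0.
have eK : 0 < e / K by rewrite divr_gt0.
have cm0 : {for 0, continuous m} by exact: cm.
have /cvgrPdist_lt /(_ _ eK) /nbhs_ballP[dl /= dl0 Hdl] := cm0.
pose s := Num.min (r / 2) (dl / 2).
have s0 : 0 < s by rewrite lt_min !divr_gt0.
have [sr sdl] : s <= r / 2 /\ s <= dl / 2 by rewrite /s !ge_min !lexx orbT.
have sr' : s < r by move: r0; lra.
rewrite (W_const s0 sr' rr) (le_trans (bound s s0 (lt_trans sr' rr)))//.
have := Hdl s; rewrite /ball/= sub0r normrN gtr0_norm// m0 sub0r normrN => H.
rewrite mulrC -ler_pdivlMr// ltW// (le_lt_trans (ler_norm _))// H//.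
by move: dl0; lra.
Qed.

(* The Wronskian of the two functions is constant; it vanishes because both   *)
(* fluxes tend to 0 at the origin while r ^ d U stays bounded.                *)
Lemma weak_solution_multiple : exists c, forall r, 0 < r <= rho -> U r = c * Y r.
Proof.
have cY := regsol_continuous pq YS.
have [r1 [r10 r1r Ypos]] : exists r1, [/\ 0 < r1, r1 < rho & forall r, 0 <= r <= r1 -> 0 < Y r].
  have c0 : {for 0, continuous Y} by exact: cY.
  have := c0; rewrite /prop_for /continuous_at (regsol_at0 YS) => /cvgrPdist_lt /(_ _ ltr01).
  move=> /nbhs_ballP[e /= e0 He]; exists (Num.min (rho / 2) (e / 2)).
  have [h1 h2] : Num.min (rho / 2) (e / 2) <= rho / 2 /\ Num.min (rho / 2) (e / 2) <= e / 2.
    by rewrite !ge_min !lexx orbT.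
  split; [by rewrite lt_min !divr_gt0|by move: rho0; lra|].
  move=> r /andP[r0 rr]; have := He r; rewrite /ball/= sub0r normrN ger0_norm// => H.
  have : `|1 - Y r| < 1 by apply: H; move: e0; lra.
  by rewrite ltr_norml => /andP[_]; lra.
have r1I : 0 < r1 <= r1 by rewrite r10 lexx.
have Y1 : 0 < Y r1 by apply: Ypos; rewrite lexx ltW.
pose c := U r1 / Y r1; exists c.
(* Near the origin Y is positive, and the derivative of U / Y is proportional to the Wronskian,
   hence 0. *)
have near1 r : 0 < r <= r1 -> U r = c * Y r.
  move=> /andP[r0 rr1].
  have dU x : 0 < x < rho -> is_derive x (1 : R) U (- slope d q U x).
    move=> /andP[x0 xr]; have x2 : 0 < x / 2 by rewrite divr_gt0.
    have x2x : x / 2 < x by lra.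
    have dJ : is_derive x (1 : R) (itg (slope d q U) (x / 2)) (slope d q U x).
      by apply: (is_derive_itg (fun b => slopeU_int b x2) x2x); exact: slopeU_continuous.
    have dI : is_derive x (1 : R) (fun s : R => U (x / 2) - itg (slope d q U) (x / 2) s)
        (0 - slope d q U x).
      exact: (is_deriveB_fun (@is_derive_cst R R^o R^o (U (x / 2)) x (1 : R)) dJ).
    rewrite sub0r in dI; apply: is_derive_local dI; near=> s.
    have s1 : x / 2 < s by near: s; exact: lt_nbhsr.
    have s2 : s < rho by near: s; exact: lt_nbhsl.
    rewrite (U_itg x2 (ltW s1) (ltW s2)) itgN//; exact: slopeU_int.
  pose Q x := U x * (Y x)^-1.
  have dQ x : 0 < x < rho -> Y x != 0 -> is_derive x (1 : R) Q 0.
    move=> xI Yx; have /andP[x0 _] := xI.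
    have := is_deriveM_fun (dU x xI) (is_deriveV Yx (regsol_derive pq YS x)).
    congr is_derive; rewrite /GRing.scale/=.
    have E : U x * slope d q Y x - Y x * slope d q U x = 0.
      have xd : x ^+ d != 0 by rewrite expf_neq0// gt_eqF.
      apply: (mulIf xd); rewrite mul0r -[RHS](W0 xI) /W -(slopeUE x0) /z -(regsol_slopeE d q Y).
      by rewrite mulrBl !mulrA.
    transitivity ((U x * slope d q Y x - Y x * slope d q U x) / Y x ^+ 2).
      by move: (slope d q Y x) (slope d q U x) => s1 s2; field.
    by rewrite E mul0r.
  have YI x : r <= x <= r1 -> Y x != 0.
    by move=> /andP[rx xr]; rewrite gt_eqF// Ypos// xr andbT (le_trans (ltW r0)).
  have xin x : r <= x <= r1 -> 0 < x < rho.
    by move=> /andP[rx xr]; rewrite (lt_le_trans r0 rx) (le_lt_trans xr).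
  have [||x _] := @MVT_segment R Q (fun=> 0) r r1 rr1.
  - move=> x; rewrite in_itv/= => /andP[/ltW rx /ltW xr].
    by apply: dQ; [apply: xin|apply: YI]; rewrite rx.
  - apply: continuous_in_subspaceT => x; rewrite inE/= in_itv/= => xr.
    exact: is_derive_continuous (dQ x (xin x xr) (YI x xr)).
  rewrite mul0r => /eqP; rewrite subr_eq0 => /eqP E.
  rewrite /c -/(Q r1) E /Q mulfVK//; apply: YI; rewrite lexx//.
(* Past r1 the quotient is useless at the zeros of Y. The difference, which vanishes up to r1 and so
   has no singularity at 0, solves the homogeneous Volterra equation instead. *)
pose D0 : R -> R := (fun r => U r - c * Y r) \_ I.
have D0E r : 0 < r < rho -> D0 r = U r - c * Y r.
  by move=> rI; rewrite /D0 patchE mem_set//= in_itv.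
have D00 r : r <= r1 -> D0 r = 0.
  move=> rr; rewrite /D0 patchE; case: ifPn => // /set_mem; rewrite /= in_itv/= => /andP[r0 _].
  by rewrite near1 ?subrr// r0.
have mD0 : measurable_fun setT D0.
  apply: (measurable_restrictT _ (measurable_itv _)).1; apply: measurable_funB.
    exact: (measurable_tail gi).
  by apply: measurable_funM => //; apply: measurable_funTS; exact: measurable_continuous.
have [M HM] := continuous_bounded_itv 0 rho cY.
have gr := gir r10.
pose Cb := itg (fun t => `|g t|) r1 rho + `|c| * M.
have M0 : 0 <= M by apply: le_trans (HM 0 _); rewrite ?normr_ge0// lexx ltW.
have Cb0 : 0 <= Cb.
  by rewrite addr_ge0 ?mulr_ge0//; apply: itg_ge0 => x _; exact: normr_ge0.
have D0b r : `|D0 r| <= Cb.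
  have [rr|rr] := leP r r1; first by rewrite D00// normr0.
  have [rrho|rrho] := ltP r rho; last first.
    by rewrite /D0 patchE memNset ?normr0//= in_itv/= => /andP[_]; rewrite ltNge rrho.
  have r0 : 0 < r by exact: lt_trans rr.
  rewrite D0E ?r0// (le_trans (ler_normB _ _))// lerD//.
    rewrite normrN (le_trans (norm_itg (gir r0)))//.
    by apply: le_itg_sub => //; [exact: ltW|exact: int_itv_norm].
  by rewrite normrM ler_wpM2l// HM// !ltW.
have [A0 qA] := potential_mass pq; have A00 : 0 <= A0 := mass_ge0 qA.
pose k := 2 * A0 + 1; have k0 : 0 <= k by rewrite addr_ge0// mulr_ge0.
have Ak : 2 * A0 < k by rewrite ltrDl.
have W0' : wball k Cb D0.
  split=> // r; rewrite (le_trans (D0b r))// ler_peMr// /wt -[leLHS]expR0 ler_expR mulr_ge0//.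
  by rewrite le_max lexx orbT.
(* Equal to U - c Y on ]0, rho], end point included, and defined on the whole line, where it solves
   the homogeneous equation exactly. *)
pose D1 r := - volt d q D0 r.
have flE s : flux d q D0 s = A s - c * z s.
  rewrite /A /z /flux -itgZ; last exact: (regsol_int pq YS).
  rewrite -itgB; [|exact: int_itvT Hp.1|by apply: int_itvZ; exact: (regsol_int pq YS)].
  apply: eq_itg => t _; have [tI|tI] := boolP (0 < t < rho).
    by rewrite D0E//; ring.
  by rewrite pot_out// !mulr0 !mul0r mulr0 subrr.
have sl0 s : s <= r1 -> slope d q D0 s = 0.
  move=> sr; rewrite /slope /flux (@eq_itg _ _ (fun=> 0)); last first.
    by move=> t /andP[_ ts]; rewrite D00 ?mulr0// (le_trans ts).
  by have [s0|s0] := leP 0 s; [rewrite itg_cst// !mul0r|rewrite itg_lt// mul0r].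
have D1E r : 0 < r <= rho -> D1 r = U r - c * Y r.
  move=> /andP[r0 rr]; rewrite /D1 /volt; have [rr1|r1r'] := leP r r1.
    rewrite near1 ?r0// subrr (@eq_itg _ _ (fun=> 0)) ?itg_cst ?mul0r ?oppr0 ?(ltW r0)//.
    by move=> x /andP[_ xr]; rewrite sl0// (le_trans xr).
  rewrite (@itg_split _ _ 0 r1 r) ?(ltW r10) ?(ltW r1r')//; last exact: (int_slope d pq k0 0 r W0').
  rewrite (@eq_itg _ (slope d q D0) (fun=> 0) 0 r1) ?itg_cst ?mul0r ?add0r ?(ltW r10)//; last first.
    by move=> x /andP[_ xr]; exact: sl0.
  rewrite (@eq_itg _ _ (fun t => slope d q U t - c * slope d q Y t)); last first.
    by move=> t _; rewrite /slope flE -/A -/z; ring.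
  have Yi := regsol_slope_int pq YS r1 r.
  rewrite itgB; [|exact: slopeU_int|exact: int_itvZ].
  rewrite itgZ//.
  have := U_itg r10 (ltW r1r') rr; have := regsol_itg pq YS (ltW r10) (ltW r1r').
  rewrite !itgN//; last exact: slopeU_int.
  move=> -> ->; rewrite (near1 r1 r1I).
  by move: (itg _ _ _) (itg _ _ _) (Y r1) => e1 e2 e3; ring.
have vE r : volt d q D1 r = volt d q D0 r.
  apply: eq_itg => s _; rewrite /slope; congr (_ / _); apply: eq_itg => t _.
  have [tI|tI] := boolP (0 < t < rho); last by rewrite pot_out// mulr0 !mul0r.
  by rewrite D0E// D1E//; have /andP[-> /ltW ->] := tI.
have D1W : wball k (Cb / 2) D1 by apply: wballN; exact: (volt_wball d pq k0 qA Ak W0').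
have D10 := volt_unique (d := d) pq k0 qA Ak D1W.
move=> r rI; apply/eqP; rewrite -subr_eq0 -D1E//; apply/eqP; apply: D10 => t.
by rewrite vE /D1 addNr.
Unshelve. all: by end_near. Qed.

End weak_solution_regular.

(** * Smooth approximation on the interval *)

Section continuous_induction.
Context {R : realType}.

(** The supremum of the points of [a, b] where P holds is crossed by a local step, so P reaches b.
    The step size may depend on the point, so no uniform partition has to be chosen. *)
Lemma continuous_induction (P : R -> Prop) (a b : R) : a <= b -> P a ->
  (forall t, a <= t <= b -> exists2 e, 0 < e &
     forall s s', a <= s -> t - e < s -> s <= t -> t <= s' -> s' < t + e -> s' <= b ->
       P s -> P s') ->
  P b.
Proof.
move=> ab Pa step; pose S := [set t | a <= t <= b /\ P t].
have Sa : S a by split=> //; rewrite lexx.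
have Sb : ubound S b by move=> t [/andP[]].
have hS : has_sup S by split; [exists a|exists b].
pose T := sup S.
have aT : a <= T by apply: ub_le_sup => //; exists b.
have Tb : T <= b by apply: ge_sup => //; exists a.
have [|e e0 He] := step T; first by rewrite aT.
have [s [/andP[as_ sb] Ps] Ts] := sup_adherent e0 hS.
have sT : s <= T by apply: ub_le_sup; [exists b|split; rewrite ?as_].
pose s' := Num.min (T + e / 2) b.
have Ts' : T <= s' by rewrite le_min Tb andbT lerDl divr_ge0// ltW.
have s'b : s' <= b by rewrite ge_min lexx orbT.
have s'e : s' < T + e by rewrite gt_min ltrD2l ltr_pdivrMr// ltr_pMr// ltr1n.
have Ps' : P s' by exact: He Ps.
have : s' <= T by apply: ub_le_sup; [exists b|split; rewrite ?(le_trans aT)].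
rewrite /s' ge_min => /orP[|bT].
  by rewrite leNgt ltrDl divr_gt0.
by have -> : b = s' by apply/eqP; rewrite eq_le s'b (le_trans bT Ts').
Qed.

End continuous_induction.

Lemma continuousB_fun {R : realType} {T : topologicalType} (f g : T -> R) :
  continuous f -> continuous g -> continuous (fun x => f x - g x).
Proof. by move=> cf cg x; exact: (continuousB (cf x) (cg x)). Qed.

Lemma continuous_comp_fun {S T U : topologicalType} (g : T -> U) (f : S -> T) :
  continuous f -> continuous g -> continuous (fun x => g (f x)).
Proof. by move=> cf cg x; exact: (continuous_comp (cf x) (cg (f x))). Qed.

Section smooth_approximation.
Context {R : realType}.
Local Notation mu := (@lebesgue_measure R).

Lemma bump_deficit (al be e : R) : 0 <= al -> al < be -> 0 < e ->
  exists2 d, 0 < d & itg (fun r => 1 - bump d (al ^+ 2) (be ^+ 2) (r ^+ 2)) al be <= e.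
Proof.
move=> al0 albe e0; pose f k r := 1 - bump k.+1%:R^-1 (al ^+ 2) (be ^+ 2) (r ^+ 2) : R.
have k0 k : 0 < k.+1%:R^-1 :> R by rewrite invr_gt0.
have cf k : continuous (f k).
  apply: continuousB_fun; first exact: cst_continuous.
  apply: (@continuous_comp_fun R R R _ (fun t : R => t ^+ 2)); first exact: exprn_continuous.
  exact: continuous_bump.
have fi k : mu.-integrable `]al, be[ (EFin \o f k).
  by apply/int_itv_oo; apply: int_itv_continuous => x _; exact: cf.
have f01 k r : 0 <= f k r <= 1.
  by rewrite /f subr_ge0 bump_le1//= gerBl bump_ge0.
have [|||||_ _ Icvg] := @dominated_convergence _ _ _ mu `]al, be[ (measurable_itv _)
  (fun k => EFin \o f k) (fun=> 0%:E) (fun=> 1%:E) _ _ _ _ _.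
- by move=> k; exact: measurable_int (fi k).
- exact: measurable_cst.
- apply: aeW => r; rewrite /= in_itv/= => /andP[ar rb]; apply: cvg_EFin; first exact: nearW.
  rewrite -[X in _ --> X](subrr (1 : R)); apply: cvgB; first exact: cvg_cst.
  have H := @cvg_bump R (al ^+ 2) (be ^+ 2) (r ^+ 2).
  have r0 : 0 < r by exact: le_lt_trans ar.
  have b0 : 0 < be by exact: lt_trans rb.
  by rewrite !ltr_pXn2r ?nnegrE ?(ltW r0) ?(ltW b0) ?ar ?rb in H.
- by apply/int_itv_oo; exact: int_itv_cst.
- apply: aeW => r k _ /=; rewrite lee_fin.
  by have /andP[? ?] := f01 k r; rewrite ger0_norm.
have := Icvg; rewrite integral0 => /fine_cvgP[_] /cvgrPdist_le /(_ _ e0)[k _ /(_ k (leqnn k))].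
rewrite /= sub0r normrN => H; exists (k.+1%:R^-1) => //.
rewrite -itg_oo; last exact: integrable_measurableR (fi k).
exact: le_trans (ler_norm _) H.
Qed.

Variable w : R -> R.
Hypothesis cw : continuous w.

Let err (k : R -> R) r := (radial_profile' k r - w r) ^+ 2.

Let continuous_err (k : R -> R) : continuous k -> continuous (err k).
Proof.
move=> ck; apply: (@continuous_comp_fun R R R (fun t => t ^+ 2)); last exact: exprn_continuous.
apply: continuousB_fun => //; apply: continuousM_fun.
  by apply: continuousM_fun => //; [exact: cst_continuous|move=> x; exact: cvg_id].
by apply: (@continuous_comp_fun R R R _ (fun t : R => t ^+ 2)) => //; exact: exprn_continuous.
Qed.

Let int_err (k : R -> R) a b : continuous k -> int_itv (err k) a b.
Proof. by move=> ck; apply: int_itv_continuous => x _; exact: continuous_err. Qed.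

Let step_bound (f b h C X : R) : X = 2 * f * b - (2 * f - h) -> 0 <= b <= 1 -> (2 * f) ^+ 2 <= C ->
  X ^+ 2 <= 2 * h ^+ 2 + 2 * C * (1 - b).
Proof.
move=> -> /andP[b0 b1] fC; set F := 2 * f in fC *.
have -> : F * b - (F - h) = h - F * (1 - b) by ring.
set v := 1 - b; have v0 : 0 <= v by rewrite subr_ge0.
have v1 : v <= 1 by rewrite gerBl.
have H1 : (h - F * v) ^+ 2 <= 2 * h ^+ 2 + 2 * (F ^+ 2 * v ^+ 2).
  rewrite -subr_ge0.
  have -> : 2 * h ^+ 2 + 2 * (F ^+ 2 * v ^+ 2) - (h - F * v) ^+ 2 = (h + F * v) ^+ 2 by ring.
  exact: sqr_ge0.
rewrite (le_trans H1)// lerD2l -mulrA ler_pM2l//.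
apply: ler_pM; [exact: sqr_ge0|exact: sqr_ge0|exact: fC|].
by rewrite expr2 ler_piMr.
Qed.

(** Continuous induction on be. An approximation valid up to s is continued on [s, s'] by a constant
    times a bump; both ends lie near a point t, where the constant is exact and w varies little. *)
Lemma smooth_approx_inside al be e : 0 < al -> al <= be -> 0 < e ->
  exists k, [/\ smooth k, forall s, s <= al ^+ 2 -> k s = 0,
    forall s, be ^+ 2 <= s -> k s = 0 & itg (err k) al be <= e * (be - al)].
Proof.
move=> al0 albe e0; pattern be; apply: (continuous_induction albe).
  exists (fun=> 0); split=> //; first exact: smooth_cst.
  by rewrite itg_pt// subrr mulr0.
move=> t /andP[alt tbe]; have t0 : 0 < t by exact: lt_le_trans alt.
(* The constant value of k for which 2 r k(r^2) equals w at r = t. *)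
pose f := w t / (2 * t).
pose h r := 2 * r * f - w r.
have ht : h t = 0 by rewrite /h /f mulrC divfK ?subrr// mulf_neq0// gt_eqF.
have ch : continuous h.
  apply: continuousB_fun => //; apply: continuousM_fun; last exact: cst_continuous.
  by apply: continuousM_fun; [exact: cst_continuous|move=> x; exact: cvg_id].
have ch2 : {for t, continuous (fun r => h r ^+ 2)}.
  by apply: (@continuous_comp_fun R R R (fun r : R => r ^+ 2) h) => //; exact: exprn_continuous.
have e4 : 0 < e / 4 by rewrite divr_gt0.
have /cvgrPdist_le /(_ _ e4) /nbhs_ballP[g /= g0 Hg] := ch2.
exists g => // s s' als ts st ts' s'g s'be [k [sk k0 k1 ke]].
have [s's|ss'] := leP s' s.
  have -> : s' = s by apply/eqP; rewrite eq_le s's (le_trans st).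
  by exists k.
have s0 : 0 < s by exact: lt_le_trans als.
have s'0 : 0 < s' by exact: lt_trans ss'.
pose C := (2 * (s' * f)) ^+ 2 + 1.
have C0 : 0 < C by rewrite ltr_wpDl// sqr_ge0.
(* Half of the allowed error e (s' - s) pays for the gap between the bump and 1, the other half for
   the variation of w. *)
have de0 : 0 < e / 2 * (s' - s) / (2 * C) by rewrite divr_gt0// mulr_gt0 ?subr_gt0 ?divr_gt0.
have [dl dl0 Hdl] := bump_deficit (ltW s0) ss' de0.
pose b := bump dl (s ^+ 2) (s' ^+ 2).
have sb : smooth b by exact: smooth_bump.
pose k2 r := k r + f * b r.
have sk2 : smooth k2 by apply: smoothD => //; exact: smoothZ.
have ck2 := smooth_continuous sk2.
exists k2; split=> //.
- move=> r ral; rewrite /k2 k0// add0r /b bump_out ?mulr0//.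
  rewrite negb_and -leNgt (le_trans ral)//.
  by rewrite ler_pXn2r ?nnegrE ?(ltW s0) ?(ltW al0).
- move=> r sr; rewrite /k2 k1 ?add0r.
    by rewrite /b bump_out ?mulr0// negb_and orbC -leNgt sr.
  by rewrite (le_trans _ sr)// ler_pXn2r ?nnegrE ?ltW.
rewrite (@itg_split _ _ al s s') ?(ltW ss')//; last exact: int_err.
have -> : e * (s' - al) = e * (s - al) + e * (s' - s) by ring.
apply: lerD.
  rewrite (@eq_itg _ _ (err k))// => r /andP[ar rs].
  rewrite /err /radial_profile' /k2 /b bump_out ?mulr0 ?addr0//.
  rewrite negb_and -leNgt ler_pXn2r ?nnegrE ?rs//; last exact: ltW.
  by rewrite (le_trans (ltW al0)).
have cb : continuous (fun r : R => 1 - b (r ^+ 2)).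
  apply: continuousB_fun; first exact: cst_continuous.
  apply: (@continuous_comp_fun R R R _ (fun t : R => t ^+ 2)); first exact: exprn_continuous.
  exact: continuous_bump.
have bi : int_itv (fun r => 1 - b (r ^+ 2)) s s' by apply: int_itv_continuous => x _; exact: cb.
apply: (@le_trans _ _ (itg (fun r => e / 2 + 2 * C * (1 - b (r ^+ 2))) s s')).
  apply: le_itg.
  - exact: int_err.
  - by apply: int_itvD; [exact: int_itv_cst|exact: int_itvZ].
  move=> r /andP[sr rs']; have r0 : 0 < r by exact: lt_le_trans sr.
  apply: le_trans (_ : 2 * h r ^+ 2 + 2 * C * (1 - b (r ^+ 2)) <= _).
    apply: (@step_bound (r * f)).
    - rewrite /radial_profile' /k2 (k1 (r ^+ 2)) ?ler_pXn2r ?nnegrE ?(ltW r0) ?(ltW s0)//.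
      by rewrite /h; ring.
    - by rewrite /b bump_ge0 bump_le1.
    - rewrite /C (@le_trans _ _ ((2 * (s' * f)) ^+ 2))// ?lerDl//.
      have r2 : r ^+ 2 <= s' ^+ 2 by rewrite ler_pXn2r ?nnegrE ?(ltW r0) ?(ltW s'0).
      rewrite (exprMn 2 2 (r * f)) (exprMn 2 2 (s' * f)) (exprMn 2 r f) (exprMn 2 s' f).
      by apply: ler_wpM2l; [exact: sqr_ge0|apply: ler_wpM2r; [exact: sqr_ge0|]].
  rewrite lerD2r.
  have := Hg r; rewrite /ball/= ht expr0n/= sub0r normrN (ger0_norm (sqr_ge0 (h r))) => H.
  have : h r ^+ 2 <= e / 4.
    by apply: H; rewrite ltr_norml; apply/andP; split; move: ts st ts' s'g sr rs'; lra.
  by lra.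
rewrite itgD; [|exact: int_itv_cst|exact: int_itvZ].
rewrite itg_cst ?(ltW ss')// itgZ//.
have : 2 * C * itg (fun r => 1 - b (r ^+ 2)) s s' <= e / 2 * (s' - s).
  by rewrite mulrC -ler_pdivlMr ?mulr_gt0.
by lra.
Qed.

(** Margins of width al at 0 and at rho are left with k = 0; each costs at most M^2 al <= e / 4, and
    the inside costs e / 2. *)
Lemma smooth_approx_L2 rho e : 0 < rho -> 0 < e ->
  exists k al be, [/\ smooth k, 0 < al, be < rho ^+ 2,
    (forall s, s <= al -> k s = 0) /\ (forall s, be <= s -> k s = 0) &
    itg (err k) 0 rho <= e].
Proof.
move=> rho0 e0; have [M HM] := continuous_bounded_itv 0 rho cw.
have M0 : 0 <= M by apply: le_trans (HM 0 _); rewrite ?normr_ge0// lexx ltW.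
pose D := 4 * (M ^+ 2 + 1); have D0 : 0 < D by rewrite mulr_gt0// ltr_wpDl// sqr_ge0.
pose al := Num.min (rho / 4) (e / D).
have al0 : 0 < al by rewrite lt_min !divr_gt0.
have [al1 al2] : al <= rho / 4 /\ al <= e / D by rewrite !ge_min !lexx orbT.
pose be := rho - al.
have albe : al <= be by rewrite /be; move: rho0; lra.
have ber : be < rho by rewrite /be; lra.
have be0 : 0 < be by exact: lt_le_trans albe.
have er : 0 < e / (2 * rho) by rewrite divr_gt0// mulr_gt0.
have [k [sk k0 k1 ke]] := smooth_approx_inside al0 albe er.
exists k, (al ^+ 2), (be ^+ 2); split=> //; first exact: exprn_gt0.
  by rewrite ltr_pXn2r ?nnegrE ?ltW.
have ck := smooth_continuous sk.
have small x y : 0 <= x -> x <= y -> y <= rho -> y - x <= al ->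
    (forall r, x <= r <= y -> k (r ^+ 2) = 0) -> itg (err k) x y <= e / 4.
  move=> x0 xy yr yx kz; apply: (@le_trans _ _ (M ^+ 2 * (y - x))).
    rewrite -itg_cst//; apply: le_itg; [exact: int_err|exact: int_itv_cst|].
    move=> r /andP[xr ry]; rewrite /err /radial_profile' kz ?xr// mulr0 sub0r sqrrN.
    rewrite -[leLHS]real_normK ?num_real// ler_pXn2r ?nnegrE ?normr_ge0// HM//.
    by rewrite (le_trans x0)// (le_trans ry).
  rewrite (@le_trans _ _ ((M ^+ 2 + 1) * (e / D)))//.
    apply: ler_pM; [exact: sqr_ge0|by rewrite subr_ge0|by rewrite lerDl|exact: le_trans al2].
  rewrite /D; have : M ^+ 2 + 1 != 0 by rewrite gt_eqF// ltr_wpDl// sqr_ge0.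
  by move: (M ^+ 2 + 1) => m m0; rewrite le_eqVlt; apply/orP; left; apply/eqP; field.
have i2 := int_err (al) (rho) ck.
rewrite (@itg_split _ _ 0 al rho) ?(ltW al0)//; last 2 first.
- by rewrite (le_trans albe)// ltW.
- exact: int_err.
rewrite (@itg_split _ _ al be rho) ?(ltW ber)//.
have h1 : itg (err k) 0 al <= e / 4.
  apply: small => //; rewrite ?(ltW al0) ?subr0//; first by rewrite (le_trans albe)// ltW.
  by move=> r /andP[r0 ral]; apply: k0; rewrite ler_pXn2r ?nnegrE// ltW.
have h2 : itg (err k) be rho <= e / 4.
  apply: small => //; rewrite ?(ltW be0) ?(ltW ber)//; first by rewrite /be; lra.
  move=> r /andP[ber' _]; apply: k1; rewrite ler_pXn2r ?nnegrE ?(ltW be0)//.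
  by rewrite (le_trans (ltW be0)).
have h3 : itg (err k) al be <= e / 2.
  rewrite (le_trans ke)// (@le_trans _ _ (e / (2 * rho) * rho))//.
    by rewrite ler_pM2l// /be; move: al0; lra.
  by rewrite le_eqVlt; apply/orP; left; apply/eqP; field; rewrite gt_eqF.
by lra.
Qed.

End smooth_approximation.

(** * Radial C^1 functions in the Sobolev space *)

Section radial_C1.
Context {R : realType}.
Local Notation mu := (@lebesgue_measure R).
Variable n : nat.

Lemma enorm_delta (i : 'I_n) : enorm (delta_mx ord0 i : 'rV[R]_n) = 1.
Proof.
rewrite /enorm (bigD1 i)//= mxE !eqxx expr1n big1 ?addr0 ?sqrtr1// => j ji.
by rewrite mxE (negbTE ji) andbF expr0n.
Qed.

Lemma continuous_enorm : continuous (@enorm R n).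
Proof. by apply: (continuous_comp_fun (@continuous_sqn R n)); exact: sqrt_continuous. Qed.

Lemma enorm_eq0 (x : 'rV[R]_n) : enorm x = 0 -> x = 0.
Proof.
move=> x0; apply/rowP => i; rewrite mxE; apply/eqP; rewrite -normr_le0 -x0.
exact: le_coor_enorm.
Qed.

Lemma norm_radial_coor (h : R) (x : 'rV[R]_n) i : `|h / enorm x * x ord0 i| <= `|h|.
Proof.
have [x0|x0] := eqVneq (enorm x) 0; first by rewrite x0 invr0 mulr0 mul0r normr0 normr_ge0.
have x1 : 0 < enorm x by rewrite lt_neqAle eq_sym x0 enorm_ge0.
rewrite -mulrA normrM ler_piMr// mulrC normrM normfV (gtr0_norm x1).
by rewrite ler_pdivrMr// mul1r le_coor_enorm.
Qed.

Variables Y w : R -> R.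
Hypotheses (cw : continuous w) (w0 : w 0 = 0).
Hypothesis dY : forall r : R, is_derive r (1 : R) Y (w r).

Let cY : continuous Y.
Proof. by move=> r; exact: is_derive_continuous (dY r). Qed.

(** At the origin the norm is not differentiable, but w 0 = 0 makes the derivative of Y(|s|) exist
    and vanish; the formula also gives 0 there, since the inverse of 0 is 0. *)
Lemma radial_is_derive (i : 'I_n) (x : 'rV[R]_n) :
  is_derive x (delta_mx ord0 i) ((fun y => Y (enorm y)) : 'rV[R]_n -> R^o)
    (w (enorm x) / enorm x * x ord0 i).
Proof.
have [x0|x0] := eqVneq (enorm x) 0.
  rewrite x0 invr0 mulr0 mul0r; apply: line_derivable.
  rewrite (enorm_eq0 x0) (_ : (fun s : R => _) = fun s : R => Y `|s|); last first.
    by apply/funext => s; rewrite add0r enormZ enorm_delta mulr1.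
  apply: bound_is_derive => e e0; have [g g0 Hg] := is_derive_bound (dY 0) e0.
  exists g => // y; rewrite subr0 normr0 mul0r subr0 => yg.
  by have := Hg `|y|; rewrite w0 !subr0 mul0r subr0 normr_id; exact.
have s0 : 0 < sqn x by rewrite -enorm_sqn exprn_gt0// lt_neqAle eq_sym x0 enorm_ge0.
have de : is_derive x (delta_mx ord0 i) (@enorm R n : 'rV[R]_n -> R^o)
    ((2 * enorm x)^-1 * (2 * x ord0 i)).
  rewrite -(dot_delta x i); apply: (is_derive_chain (k := Num.sqrt) (is_derive_sqn x _)).
  exact: is_derive1_sqrt.
have := is_derive_chain de (dY (enorm x)).
congr is_derive; field.
by rewrite x0.
Qed.

Lemma radial_partial (i : 'I_n) (x : 'rV[R]_n) :
  partial i (fun y => Y (enorm y)) x = w (enorm x) / enorm x * x ord0 i.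
Proof. by have [_] := radial_is_derive i x. Qed.

Lemma radial_C1_dir (i : 'I_n) : C1_dir i (fun x : 'rV[R]_n => Y (enorm x)).
Proof.
split; first exact: continuous_comp_fun continuous_enorm cY.
  by move=> x; have [] := radial_is_derive i x.
rewrite (_ : partial i _ = fun x : 'rV[R]_n => w (enorm x) / enorm x * x ord0 i); last first.
  by apply/funext => x; exact: radial_partial.
have cwe : continuous (fun x : 'rV[R]_n => w (enorm x)).
  exact: continuous_comp_fun continuous_enorm cw.
move=> x; have [x0|x0] := eqVneq (enorm x) 0; last first.
  have cV : {for x, continuous (fun x : 'rV[R]_n => (enorm x)^-1)}.
    by apply: continuousV => //; exact: continuous_enorm.
  exact: (continuousM (continuousM (cwe x) cV) (@continuous_coord R n i x)).
have x00 := enorm_eq0 x0.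
rewrite /continuous_at x0 invr0 mulr0 mul0r; apply/(@cvgrPdist_lt R R^o _ (nbhs x) (nbhs_filter x)) => e e0.
have := cwe x; rewrite /continuous_at x0 w0 => /(@cvgrPdist_lt R R^o _ (nbhs x) (nbhs_filter x)) /(_ _ e0).
apply: (@filterS _ _ (nbhs_filter x)) => y; rewrite !sub0r !normrN => H; apply: le_lt_trans H.
exact: norm_radial_coor.
Qed.

Lemma radial_partial_sqr (x : 'rV[R]_n) (v : R -> R) : v 0 = 0 ->
  \sum_(i < n) (w (enorm x) / enorm x * x ord0 i - v (enorm x) / enorm x * x ord0 i) ^+ 2
  = (w (enorm x) - v (enorm x)) ^+ 2.
Proof.
move=> v0; have [x0|x0] := eqVneq (enorm x) 0.
  rewrite x0 w0 v0 subrr expr0n/= big1// => i _.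
  by rewrite !mul0r subrr expr0n.
rewrite (eq_bigr (fun i => ((w (enorm x) - v (enorm x)) / enorm x) ^+ 2 * x ord0 i ^+ 2)); last first.
  by move=> i _; rewrite -exprMn !mulrBl.
by rewrite -mulr_sumr -sqr_enorm -exprMn divfK.
Qed.

End radial_C1.

Section radial_C1_H1_0.
Context {R : realType}.
Local Notation mu := (@lebesgue_measure R).
Variables (n : nat) (rho : R) (Y w : R -> R).
Hypotheses (n0 : (0 < n)%N) (rho0 : 0 < rho).
Hypotheses (cw : continuous w) (w0 : w 0 = 0).
Hypothesis dY : forall r : R, is_derive r (1 : R) Y (w r).
Hypothesis Yrho : Y rho = 0.
Let cY : continuous Y.
Proof. by move=> r; exact: is_derive_continuous (dY r). Qed.

Local Notation leb := (@lebesgue_row R n).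
Local Notation B := (@eball R n rho).
Local Notation I := (`]0, rho[%classic : set R).
Local Notation c := (@ball_volume R n * n%:R).

Let continuous_ball_integrable (f : R -> R) : continuous f ->
  leb.-integrable B (EFin \o (fun x => f (enorm x))).
Proof.
move=> cf; have [M HM] := continuous_bounded_itv 0 rho cf.
apply: (@integrable_ball_bounded _ _ _ rho0 (fun x => f (enorm x)) M).
  by apply: measurable_funTS; apply: measurable_continuous_row; exact: continuous_comp_fun (@continuous_enorm R n) cf.
by move=> x /ltW Bx; apply: HM; rewrite enorm_ge0.
Qed.

Let L2_radial (f : 'rV[R]_n -> R) (h : R -> R) : continuous f -> continuous h ->
  (forall x, `|f x| <= `|h (enorm x)|) -> L2 B f.
Proof.
move=> cf ch fh; have [M HM] := continuous_bounded_itv 0 rho ch.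
have mf := @measurable_funTS _ _ _ _ B _ (measurable_continuous_row cf).
split => //; apply: (@integrable_ball_bounded _ _ _ rho0 (fun x => f x ^+ 2) (M ^+ 2)).
  exact: measurable_funX.
move=> x /ltW Bx; rewrite ger0_norm ?sqr_ge0// -[leLHS]real_normK ?num_real//.
have fM : `|f x| <= M by rewrite (le_trans (fh x))// HM// enorm_ge0.
by rewrite ler_pXn2r ?nnegrE// (le_trans _ fM).
Qed.

(** Y and the profile both vanish at rho, so their difference is a primitive of the difference of
    derivatives. By [le_norm_amgm] the L^2 error dl^2 on derivatives gives a uniform error dl (rho +
    1) on the functions. *)
Let approx_small (k : R -> R) al be dl : smooth k -> 0 < al -> be < rho ^+ 2 ->
  (forall s, s <= al -> k s = 0) -> (forall s, be <= s -> k s = 0) -> 0 < dl ->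
  itg (fun r => (radial_profile' k r - w r) ^+ 2) 0 rho <= dl ^+ 2 ->
  let F r := (Y r - radial_profile rho k r) ^+ 2 + (w r - radial_profile' k r) ^+ 2 in
  continuous F /\ itg (fun r => F r * r ^+ n.-1) 0 rho <= ((rho + 1) ^+ 2 * rho + 1) * rho ^+ n.-1 * dl ^+ 2.
Proof.
move=> sk al0 ber k0 k1 dl0 kd F.
have dphi r : is_derive r (1 : R) (radial_profile rho k) (radial_profile' k r).
  exact: radial_profile_derive sk al0 ber k0 k1 r.
have cphi : continuous (radial_profile rho k) by move=> r; exact: is_derive_continuous (dphi r).
have cphi' : continuous (radial_profile' k) := radial_profile'_continuous sk.
have csq (f : R -> R) : continuous f -> continuous (fun r => f r ^+ 2).
  by move=> cf; apply: (@continuous_comp_fun R R R (fun r : R => r ^+ 2) f) => //; exact: exprn_continuous.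
have cD : continuous (fun r => w r - radial_profile' k r) by exact: continuousB_fun.
have cF : continuous F.
  by apply: continuousD_fun; [apply: csq; exact: continuousB_fun|exact: csq].
have ic (f : R -> R) s t : continuous f -> int_itv f s t.
  by move=> cf; apply: int_itv_continuous => x _; exact: cf.
have kd' : itg (fun r => (w r - radial_profile' k r) ^+ 2) 0 rho <= dl ^+ 2.
  by apply: le_trans kd; apply: le_itg; [exact/ic/csq|apply/ic/csq; exact: continuousB_fun|];
    move=> r _; rewrite -sqrrN opprB.
have nD : continuous (fun r => `|w r - radial_profile' k r|).
  by apply: (@continuous_comp_fun R R R (fun r : R => `|r|)) => // r; exact: norm_continuous.
have B1 : itg (fun r => `|w r - radial_profile' k r|) 0 rho <= dl * (rho + 1).
  apply: (@le_trans _ _ (itg (fun r => dl + dl^-1 * (w r - radial_profile' k r) ^+ 2) 0 rho)).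
    apply: le_itg; [exact: ic|apply: ic; apply: continuousD_fun; [exact: cst_continuous|]|].
      by apply: continuousM_fun; [exact: cst_continuous|exact: csq].
    by move=> r _; rewrite mulrC; exact: le_norm_amgm.
  rewrite itgD; [|exact: int_itv_cst|by apply: int_itvZ; exact/ic/csq].
  rewrite itg_cst ?(ltW rho0)// itgZ; last exact/ic/csq.
  rewrite subr0 mulrDr mulr1 lerD2l mulrC ler_pdivrMr//.
have B2 r : 0 <= r <= rho -> (Y r - radial_profile rho k r) ^+ 2 <= (dl * (rho + 1)) ^+ 2.
  move=> /andP[r0 rr].
  have E : Y r - radial_profile rho k r = - itg (fun r => w r - radial_profile' k r) r rho.
    have dB x : is_derive x (1 : R) (fun r => Y r - radial_profile rho k r) (w x - radial_profile' k x).
      exact: is_deriveB_fun.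
    rewrite (itg_derive rr (fun x _ => cD x) (fun x _ => dB x)) Yrho.
    by rewrite (radial_profile_tail sk al0 ber k0 k1 (lexx rho)) itg_pt// oppr0 subrr sub0r opprK.
  rewrite -[leLHS]real_normK ?num_real// E normrN ler_pXn2r ?nnegrE ?mulr_ge0 ?addr_ge0 ?(ltW dl0) ?(ltW rho0)//.
  rewrite (le_trans (norm_itg (ic _ _ _ cD)))// (le_trans _ B1)//.
  by apply: le_itg_sub => //; exact: ic.
split=> //.
have cF2 : continuous (fun r => F r * r ^+ n.-1) by apply: continuousM_fun => //; exact: exprn_continuous.
have rd : 0 <= rho ^+ n.-1 by rewrite exprn_ge0// ltW.
apply: (@le_trans _ _ (itg (fun r => rho ^+ n.-1 * ((dl * (rho + 1)) ^+ 2 + (w r - radial_profile' k r) ^+ 2)) 0 rho)).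
  apply: le_itg; first exact: ic.
    by apply: int_itvZ; apply: int_itvD; [exact: int_itv_cst|exact/ic/csq].
  move=> r /andP[r0 rr]; rewrite mulrC; apply: ler_pM.
  - by rewrite exprn_ge0.
  - by rewrite addr_ge0// sqr_ge0.
  - by apply: lerXn2r; rewrite ?nnegrE// (ltW rho0).
  - by rewrite lerD2r B2// r0.
rewrite itgZ; last by apply: int_itvD; [exact: int_itv_cst|exact/ic/csq].
rewrite [leRHS]mulrAC [leRHS]mulrC ler_wpM2l//.
rewrite itgD; [|exact: int_itv_cst|exact/ic/csq].
rewrite itg_cst ?(ltW rho0)// subr0 exprMn.
move: kd'; move: (itg _ _ _) => T; lra.
Qed.

Lemma C1_H1_0rad : H1_0rad n rho Y.
Proof.
have cU : continuous (fun x : 'rV[R]_n => Y (enorm x)) by exact: continuous_comp_fun (@continuous_enorm R n) cY.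
exists (fun i x => w (enorm x) / enorm x * x ord0 i).
  split.
  - by apply: (L2_radial cU cY).
  - move=> i; apply: (L2_radial (h := w)) => //.
      have [_ _] := radial_C1_dir cw w0 dY i.
      by rewrite (_ : partial i _ = fun x : 'rV[R]_n => w (enorm x) / enorm x * x ord0 i)//; apply/funext => x; exact: (radial_partial w0 dY).
    by move=> x; exact: norm_radial_coor.
  - move=> phi tphi i; have [_ _ E] := test_function_ibp tphi (radial_C1_dir cw w0 dY i).
    transitivity (\int[leb]_(x in B) (partial i phi x * Y (enorm x))).
      by apply: eq_Rintegral => x _; rewrite mulrC.
    rewrite -[LHS]opprK -E; congr (- _); apply: eq_Rintegral => x _.
    by rewrite (radial_partial w0 dY) mulrC.
move=> e e0.
have c0 : 0 < c by exact: ball_const_gt0.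
(* The constant of [approx_small] times the area of the unit sphere: the squared H^1 error on the
   ball is at most K dl^2. With dl <= 1 it is at most K dl <= e / 2. *)
pose K := c * (((rho + 1) ^+ 2 * rho + 1) * rho ^+ n.-1).
have K0 : 0 < K.
  by rewrite mulr_gt0// mulr_gt0 ?exprn_gt0// ltr_wpDl// mulr_ge0 ?sqr_ge0// ltW.
pose dl := Num.min 1 (e / (2 * K)).
have dl0 : 0 < dl by rewrite lt_min ltr01 divr_gt0// mulr_gt0.
have [dl1 dl2] : dl <= 1 /\ dl <= e / (2 * K) by rewrite !ge_min !lexx orbT.
have [k [al [be [sk al0 ber [k0 k1] kd]]]] := smooth_approx_L2 cw rho0 (exprn_gt0 2 dl0).
exists (fun x => radial_profile rho k (enorm x)); first exact: (radial_profile_test n rho0 sk al0 ber k0 k1).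
have [] := approx_small sk al0 ber k0 k1 dl0 kd.
set F := fun r : R => _ => cF FE.
have dphi r : is_derive r (1 : R) (radial_profile rho k) (radial_profile' k r).
  exact: radial_profile_derive sk al0 ber k0 k1 r.
have E (x : 'rV[R]_n) : (Y (enorm x) - radial_profile rho k (enorm x)) ^+ 2 +
   \sum_(i < n) (w (enorm x) / enorm x * x ord0 i - partial i (fun x => radial_profile rho k (enorm x)) x) ^+ 2 = F (enorm x).
  have phi0 : radial_profile' k 0 = 0 by rewrite /radial_profile' mulr0 mul0r.
  under eq_bigr do rewrite (radial_partial phi0 dphi).
  by rewrite radial_partial_sqr.
under eq_integral do rewrite E.
have Fi := continuous_ball_integrable cF.
have mF : measurable_fun B (fun x => F (enorm x)) by exact: integrable_measurableR Fi.
have FI := (radial_integrable n0 mF).1 Fi.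
have := radial_Rintegral n0 mF FI; rewrite itg_oo; last exact: integrable_measurableR FI.
rewrite /Rintegral => IE; rewrite -[X in (X < _)%E]fineK; last exact: (integrable_fin_num (@measurable_eball R n rho) Fi).
rewrite IE lte_fin (@le_lt_trans _ _ (K * dl ^+ 2))//.
  by rewrite /K -[leRHS]mulrA ler_pM2l.
apply: (@le_lt_trans _ _ (K * (e / (2 * K)))).
  by rewrite ler_pM2l// (le_trans _ dl2)// expr2 ler_piMr// ltW.
have -> : K * (e / (2 * K)) = e / 2 by field; rewrite gt_eqF.
by lra.
Qed.

End radial_C1_H1_0.

(** * Eigenspaces are spanned by the regular solutions *)

Section eigenfunction.
Context {R : realType}.
Local Notation mu := (@lebesgue_measure R).
Variables (n : nat) (rho lam : R) (a Y : R -> R).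
Hypotheses (n0 : (0 < n)%N) (rho0 : 0 < rho).
Local Notation I := (`]0, rho[%classic : set R).
Local Notation d := n.-1.
Hypothesis ai : mu.-integrable I (EFin \o a).
Local Notation q := (pot rho a lam).
Hypothesis YS : regsol d q Y.

Let pq : potential q := potential_pot ai lam.
Let cY : continuous Y := regsol_continuous pq YS.
Let S := slope d q Y.
Let cS : continuous S := regsol_slope_continuous pq YS.

Lemma regsol_not_ae0 (c : R) : ae_eq mu I (fun r => c * Y r) (cst 0) -> c = 0.
Proof.
move=> E; have c0 : {for 0, continuous Y} by exact: cY.
have := c0; rewrite /prop_for /continuous_at (regsol_at0 YS) => /cvgrPdist_lt.
move=> /(_ (1 / 2)) []; first by rewrite divr_gt0.
move=> e /= e0 He; pose b := Num.min (rho / 2) (e / 2).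
have [h1 h2] : b <= rho / 2 /\ b <= e / 2 by rewrite !ge_min !lexx orbT.
have b0 : 0 < b by rewrite lt_min !divr_gt0.
have Yb r : 0 <= r <= b -> 1 / 2 <= Y r.
  move=> /andP[r0 rr]; have := He r; rewrite /ball/= sub0r normrN ger0_norm// => H.
  have : `|1 - Y r| < 1 / 2 by apply: H; move: e0; lra.
  by rewrite ltr_norml => /andP[_]; lra.
have Yi : int_itv Y 0 b by apply: int_itv_continuous => x _; exact: cY.
have : itg (fun r => c * Y r) 0 b = 0.
  rewrite -[RHS](mul0r (b - 0)) -(itg_cst 0 (ltW b0)).
  rewrite -[LHS]itg_oo; last by apply: int_itv_measurable; exact: int_itvZ.
  rewrite -[RHS]itg_oo; last exact: measurable_cst.
  apply: eq_ae_Rintegral => //; first by apply: int_itv_measurable; exact: int_itvZ.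
  apply: aeS E => x Hx; rewrite /= in_itv/= => /andP[x0 xb]; apply: Hx.
  by rewrite /= in_itv/= x0 (lt_trans xb)//; move: rho0; lra.
rewrite itgZ// => /eqP; rewrite mulf_eq0 => /orP[/eqP//|/eqP Y0].
have := le_itg (int_itv_cst (1 / 2) 0 b) Yi Yb; rewrite itg_cst ?(ltW b0)// Y0 subr0.
by rewrite leNgt mulr_gt0// divr_gt0.
Qed.

(** For v in the form domain, written as the tail V of g, the gradient term is minus the integral of
    g times the flux of Y. Fubini turns it into the integral of r^d q Y V, which cancels the term in
    a and leaves the one in lam. It converges because r^d g is integrable and the flux is O(r^d). *)
Lemma eigenspace_regsol : Y rho = 0 -> Defs.eigenspace n rho a lam Y.
Proof.
move=> Yrho; have dY r : is_derive r (1 : R) Y (- S r) := regsol_derive pq YS r.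
have cN : continuous (fun r => - S r) by move=> x; apply: cvgN; exact: cS.
have S0 : - S 0 = 0 by rewrite /S /slope /flux itg_pt// mul0r oppr0.
have mc (f : R -> R) : continuous f -> measurable_fun I f.
  by move=> cf; apply: measurable_funTS; exact: measurable_continuous.
have ic (f : R -> R) : continuous f -> mu.-integrable I (EFin \o f).
  by move=> cf; apply/int_itv_oo; apply: int_itv_continuous => x _; exact: cf.
have bI (f h : R -> R) : continuous f -> mu.-integrable I (EFin \o h) -> mu.-integrable I (EFin \o (fun r => f r * h r)).
  move=> cf hi; have [M HM] := continuous_bounded_itv 0 rho cf.
  apply: (@integrableM_bounded _ _ _ mu _ (measurable_itv _) M) => //; first exact: mc.
  by move=> r; rewrite /= in_itv/= => /andP[r0 rr]; apply: HM; rewrite !ltW.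
have cX (k : nat) : continuous (fun r : R => r ^+ k) by exact: exprn_continuous.
have cl : continuous (fun r => lam * Y r) by apply: continuousM_fun => //; exact: cst_continuous.
have YT r : 0 <= r <= rho -> Y r = - itg (fun r => - S r) r rho.
  by move=> /andP[r0 rr]; have := regsol_itg pq YS r0 rr; rewrite Yrho => /esym/eqP; rewrite addr_eq0 => /eqP.
split; first exact: C1_H1_0rad n0 rho0 cN S0 dY Yrho.
  split; first exact: mc.
  apply: ic; apply: continuousM_fun; last exact: cX.
  exact: (@continuous_comp_fun R R R (fun r : R => r ^+ 2)).
move=> v vH; have [g gi vE] := H1_0rad_primitive n0 rho0 vH.
have mv : measurable_fun I v by have [G [[mv _] _ _] _] := vH; exact: (measurable_profile n0 mv).
have [mwv wvE] := weak_derivE rho0 gi mv vE.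
have Sd : mu.-integrable I (EFin \o (fun r => - S r * r ^+ d)).
  by apply: ic; exact: continuousM_fun.
have YTae : {ae mu, forall r, 0 < r < rho -> Y r = - itg (fun r => - S r) r rho}.
  by apply: aeW => r /andP[r0 rr]; rewrite -YT// !ltW.
have [mwY wYE] := weak_derivE rho0 Sd (mc _ cY) YTae.
have ma : measurable_fun I a by exact: integrable_measurableR ai.
have mg : measurable_fun I g by exact: measurable_weight gi.
pose V := tail rho g; have mV : measurable_fun I V by exact: measurable_tail gi.
have mY := mc _ cY; have mS := mc _ cN; have mp := mc _ (cX d).
have HH := @filterI _ _ (ae_filter_ringOfSetsType mu) _ _ wvE (@filterI _ _ (ae_filter_ringOfSetsType mu) _ _ wYE vE).
have E1 : Defs.form n rho a Y v =
    \int[mu]_(r in I) ((- S r * g r - a r * Y r * V r) * r ^+ d).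
  apply: eq_ae_Rintegral => //.
  - apply: measurable_funM => //; apply: measurable_funB; first exact: measurable_funM.
    by apply: measurable_funM => //; exact: measurable_funM.
  - apply: measurable_funM => //; apply: measurable_funB; first exact: measurable_funM.
    by apply: measurable_funM => //; exact: measurable_funM.
  apply: (@filterS _ _ (ae_filter_ringOfSetsType mu) _ _ _ HH) => r [h1 [h2 h3]] rI.
  by rewrite h1// h2// h3//; move: rI; rewrite /= in_itv.
have E2 : \int[mu]_(r in I) (lam * Y r * v r * r ^+ d) = \int[mu]_(r in I) (lam * Y r * V r * r ^+ d).
  apply: eq_ae_Rintegral => //.
  - by apply: measurable_funM => //; apply: measurable_funM => //; exact: mc.
  - by apply: measurable_funM => //; apply: measurable_funM => //; exact: mc.
  by apply: aeS vE => r h3 rI; rewrite h3//; move: rI; rewrite /= in_itv.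
rewrite E1 E2.
pose H t := t ^+ d * q t * Y t.
have Hint s t : int_itv H s t by exact: (regsol_int pq YS).
have HI : mu.-integrable I (EFin \o H) by apply/int_itv_oo; exact: Hint.
have [A qA] := potential_mass pq; have A0 : 0 <= A := mass_ge0 qA.
have [M HM] := continuous_bounded_itv 0 rho cY.
have M0 : 0 <= M by apply: le_trans (HM 0 _); rewrite ?normr_ge0// lexx ltW.
have nH : continuous (fun r => itg (fun t => `|q t|) 0 r).
  exact: potential_prim_continuous (potential_norm pq).
have Hb r : 0 < r < rho -> `|itg (fun t => `|H t|) 0 r| <= M * A * r ^+ d.
  move=> /andP[r0 rr]; rewrite ger0_norm; last by apply: itg_ge0 => x _; exact: normr_ge0.
  apply: (@le_trans _ _ (itg (fun t => r ^+ d * M * `|q t|) 0 r)).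
    apply: le_itg; [exact: int_itv_norm|by apply: int_itvZ; exact: int_itvT (potential_norm pq).1|].
    move=> t /andP[t0 tr]; rewrite /H mulrAC normrM ler_wpM2r// normrM.
    apply: ler_pM => //; first by rewrite ger0_norm ?exprn_ge0// lerXn2r ?nnegrE// ltW.
    by rewrite HM// t0 (le_trans tr)// ltW.
  rewrite itgZ; last exact: int_itvT (potential_norm pq).1.
  by rewrite [leRHS]mulrC mulrA ler_wpM2l ?qA// mulr_ge0// exprn_ge0// ltW.
have mH : measurable_fun I (fun r => itg (fun t => `|H t|) 0 r).
  apply: mc; apply: itg_continuous => [s t|x x0]; first exact: int_itv_norm.
  by rewrite /H pq.2// mulr0 mul0r normr0.
have FGi : mu.-integrable I (EFin \o (fun r => g r * itg (fun t => `|H t|) 0 r)).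
  apply: (@le_integrableR _ _ _ mu _ (measurable_itv `]0, rho[)
    (fun r : R => M * A * (g r * r ^+ d)) (fun r : R => g r * itg (fun t => `|H t|) 0 r)).
  - exact: measurable_funM.
  - move=> r; rewrite /= in_itv/= => rI; rewrite normrM [leRHS]normrM.
    rewrite (ger0_norm (mulr_ge0 M0 A0)) normrM.
    rewrite mulrCA ler_wpM2l// [X in _ * X]ger0_norm ?Hb//.
    by rewrite exprn_ge0//; case/andP: rI => /ltW.
  - exact: integrableZ_real.
have gis s : 0 < s -> int_itv g s rho := int_I_weight gi (s := s).
have [i1 E3] := fubini_triangle mg HI FGi gis.
have i2 := fubini_triangle_integrable mg HI FGi.
have J1 : mu.-integrable I (EFin \o (fun r => r ^+ d * V r * (Y r * a r))).
  by apply: tail_weight_integrable => //; exact: bI.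
have J2 : mu.-integrable I (EFin \o (fun r => r ^+ d * V r * (lam * Y r))).
  by apply: tail_weight_integrable => //; exact: ic.
have E4 : \int[mu]_(r in I) (g r * itg H 0 r) =
    - \int[mu]_(r in I) (r ^+ d * V r * (Y r * a r) + r ^+ d * V r * (lam * Y r)).
  rewrite E3 -RintegralN//; last exact: integrableD_real.
  apply: eq_Rintegral => r /set_mem; rewrite /= in_itv/= => rI.
  by rewrite /H potE// /V /tail; ring.
rewrite (@eq_Rintegral _ _ _ mu I (fun r => - (g r * itg H 0 r) - r ^+ d * V r * (Y r * a r))); last first.
  move=> r _; have := regsol_slopeE d q Y r; rewrite /flux -/(S r) -/H => <-.
  by ring.
rewrite RintegralB//; last exact: integrableN_real.
rewrite RintegralN// E4 opprK RintegralD// addrC addKr.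
by apply: eq_Rintegral => r _; ring.
Qed.

(** The tail representing u is 0 at rho, hence c Y(rho) = 0: either rho is a zero of Y or the
    eigenspace is trivial. *)
Lemma eigenspace_multiple u : Defs.eigenspace n rho a lam u ->
  exists c, c * Y rho = 0 /\ ae_eq mu I u (fun r => c * Y r).
Proof.
move=> [uH _ weak]; have [g gi uE] := H1_0rad_primitive n0 rho0 uH.
have mu_ : measurable_fun I u by have [G [[m _] _ _] _] := uH; exact: (measurable_profile n0 m).
have gE := weak_form_flux rho0 ai gi mu_ uE weak.
have [c cE] := weak_solution_multiple rho0 ai gi gE YS.
exists c; split; first by rewrite -cE ?rho0 ?lexx// /tail itg_pt// oppr0.
by apply: aeS uE => r Hr; rewrite /= in_itv/= => rI; rewrite Hr// -cE//; case/andP: rI => -> /ltW.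
Qed.

End eigenfunction.

(** * Sturm comparison *)

Section sign_change.
Context {R : realType}.
Implicit Types f : R -> R.

Lemma is_derive_same_sign f (x D : R) : is_derive x (1 : R) f D -> f x = 0 -> D != 0 ->
  exists2 g, 0 < g & forall y, 0 < `|y - x| -> `|y - x| < g -> 0 < D * (y - x) * f y.
Proof.
move=> df f0 D0; have aD : 0 < `|D| by rewrite normr_gt0.
have e0 : 0 < `|D| / 2 by rewrite divr_gt0.
have [g g0 Hg] := is_derive_bound df e0; exists g => // y y0 /Hg; rewrite f0 subr0 => H.
set h := y - x in y0 H *; have DDh : 0 < (D * h) ^+ 2 by rewrite exprn_even_gt0//= mulf_neq0// -normr_gt0.
have B : `|D * h * (f y - D * h)| <= (D * h) ^+ 2 / 2.
  rewrite -(real_normK (num_real (D * h))) normrM (expr2 `|D * h|) -mulrA ler_wpM2l//.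
  by rewrite (le_trans H)// normrM mulrAC.
have -> : D * h * f y = (D * h) ^+ 2 + D * h * (f y - D * h) by ring.
move: B; rewrite ler_norml => /andP[B _].
by move: B DDh; lra.
Qed.

Lemma itg_gt0 f al be : al < be -> continuous f -> (forall x, al <= x <= be -> 0 <= f x) ->
  (forall x, al < x < be -> 0 < f x) -> 0 < itg f al be.
Proof.
move=> albe cf f0 f1; pose h := (be - al) / 3.
have h0 : 0 < h by rewrite divr_gt0// subr_gt0.
have hE : be = al + 3 * h by rewrite /h; field.
have lt1 : al + h < be - h by rewrite hE; lra.
have [c cI Hc] := EVT_min (ltW lt1) (continuous_subspaceT (A := `[al + h, be - h]%classic) cf).
have fi s t : int_itv f s t by apply: int_itv_continuous => x _; exact: cf.
move: cI; rewrite in_itv/= => /andP[c1 c2].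
have fc : 0 < f c by apply: f1; apply/andP; split; [move: c1|move: c2]; lra.
apply: (@lt_le_trans _ _ (itg f (al + h) (be - h))); last by apply: le_itg_sub => //; lra.
apply: (@lt_le_trans _ _ (itg (fun=> f c) (al + h) (be - h))).
  by rewrite itg_cst ?ltW// mulr_gt0// subr_gt0.
apply: le_itg => //; exact: int_itv_cst.
Qed.

End sign_change.

Section sturm_comparison.
Context {R : realType}.
Local Notation mu := (@lebesgue_measure R).
Variables (d : nat) (rho : R) (a : R -> R).
Local Notation I := (`]0, rho[%classic : set R).
Hypothesis ai : mu.-integrable I (EFin \o a).
Variables (l1 l2 : R) (y1 y2 : R -> R).
Local Notation q1 := (pot rho a l1).
Local Notation q2 := (pot rho a l2).
Hypotheses (S1 : regsol d q1 y1) (S2 : regsol d q2 y2) (l12 : l1 < l2).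
Let p1 : potential q1 := potential_pot ai l1.
Let p2 : potential q2 := potential_pot ai l2.
Let c1 : continuous y1 := regsol_continuous p1 S1.
Let c2 : continuous y2 := regsol_continuous p2 S2.

(** The multiplier s only carries the sign of y1 between al and its next zero r. When y1 vanishes at
    al, simplicity of that zero keeps the following ones away from al. *)
Let next_zero al be : 0 <= al -> al < be -> al = 0 \/ y1 al = 0 -> y1 be = 0 ->
  exists r s, [/\ al < r <= be, y1 r = 0 & forall x, al < x < r -> 0 < s * y1 x].
Proof.
move=> al0 albe hal ybe; have cc b x : b <= x <= be -> {for x, continuous y1} by move=> _; exact: c1.
have [y0|y0] := eqVneq (y1 al) 0; last first.
  have [r [rI yr H]] := first_zero (ltW albe) (cc al) y0 ybe.
  by exists r, (y1 al); split => // x /andP[/ltW ax xr]; apply: H; rewrite ax.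
have al1 : 0 < al.
  rewrite lt_neqAle al0 andbT; apply/eqP => E; move: y0; rewrite -E (regsol_at0 S1).
  by move/eqP; rewrite oner_eq0.
have dal := regsol_derive p1 S1 al.
have D0 : - slope d q1 y1 al != 0.
  rewrite oppr_eq0; have := regsol_simple p1 S1 al1 y0.
  by rewrite -(regsol_slopeE d q1 y1); apply: contraNneq => ->; rewrite mul0r.
have [g g0 Hg] := is_derive_same_sign dal y0 D0; set D := - _ in D0 Hg.
have near x : al < x -> x < al + g -> 0 < D * y1 x.
  move=> ax xg; have xa : 0 < x - al by rewrite subr_gt0.
  have := Hg x; rewrite gtr0_norm// => /(_ xa); rewrite ltrBlDl => /(_ xg).
  by rewrite mulrAC pmulr_lgt0.
pose x0 := al + Num.min (g / 2) ((be - al) / 2).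
have [h1 h2] : Num.min (g / 2) ((be - al) / 2) <= g / 2 /\ Num.min (g / 2) ((be - al) / 2) <= (be - al) / 2.
  by rewrite !ge_min !lexx orbT.
have m0 : 0 < Num.min (g / 2) ((be - al) / 2) by rewrite lt_min !divr_gt0// subr_gt0.
have [ax0 x0b x0g] : [/\ al < x0, x0 < be & x0 < al + g].
  by rewrite /x0; split; move: m0 h1 h2 g0 albe; lra.
have n0 := near x0 ax0 x0g.
have yx0 : y1 x0 != 0 by apply: contraTneq n0 => ->; rewrite mulr0 ltxx.
have [r [/andP[x0r rb] yr H]] := first_zero (ltW x0b) (cc x0) yx0 ybe.
exists r, (y1 x0); split => //; first by rewrite rb (lt_trans ax0).
move=> x /andP[ax xr]; have [x0x|xx0] := leP x0 x; first by apply: H; rewrite x0x.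
have nx := near x ax (lt_trans xx0 x0g).
have : 0 < (D * y1 x0) * (D * y1 x) by rewrite mulr_gt0.
have -> : D * y1 x0 * (D * y1 x) = D ^+ 2 * (y1 x0 * y1 x) by ring.
by rewrite pmulr_rgt0// exprn_even_gt0.
Qed.

Let sign_limit (f : R -> R) (s x : R) (al be : R) : continuous f -> al < be ->
  (forall t, al < t < be -> 0 < s * f t) -> al <= x <= be -> 0 <= s * f x.
Proof.
move=> cf albe H /andP[ax xb]; rewrite leNgt; apply/negP => sx.
have cs : continuous (fun t => s * f t) by apply: continuousM_fun => //; exact: cst_continuous.
have /cvgrPdist_lt /(_ (- (s * f x))) [] := cs x; first by rewrite oppr_gt0.
move=> e /= e0 He; pose m := (al + be) / 2.
have [m1 m2] : al < m /\ m < be by rewrite /m; split; move: albe; lra.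
pose h := Num.min (1 : R) (e / (2 * (`|m - x| + 1))).
have n1 : 0 < `|m - x| + 1 by rewrite ltr_wpDl.
have [h1 h2] : h <= 1 /\ h <= e / (2 * (`|m - x| + 1)) by rewrite !ge_min !lexx orbT.
have h0 : 0 < h by rewrite lt_min ltr01 divr_gt0// mulr_gt0.
pose t := x + h * (m - x).
have tI : al < t < be.
  apply/andP; split.
    have -> : t = al + (h * (m - al) + (1 - h) * (x - al)) by rewrite /t; ring.
    by rewrite ltrDl ltr_pwDl ?mulr_gt0 ?mulr_ge0 ?subr_gt0 ?subr_ge0.
  have -> : t = be - (h * (be - m) + (1 - h) * (be - x)) by rewrite /t; ring.
  by rewrite gtrBl ltr_pwDl ?mulr_gt0 ?mulr_ge0 ?subr_gt0 ?subr_ge0.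
have := He t; rewrite /ball/= /t opprD addNKr normrN normrM gtr0_norm// => /(_ _) Ht.
have : `|s * f x - s * f t| < - (s * f x).
  apply: Ht; apply: (@le_lt_trans _ _ (h * (`|m - x| + 1))); first by rewrite ler_pM2l// lerDl.
  rewrite (@le_lt_trans _ _ (e / (2 * (`|m - x| + 1)) * (`|m - x| + 1)))//; first by rewrite ler_pM2r.
  have -> : e / (2 * (`|m - x| + 1)) * (`|m - x| + 1) = e / 2 by field; rewrite gt_eqF.
  by move: e0; lra.
rewrite ltr_norml => /andP[+ _]; have := H t tI; lra.
Qed.

(** Otherwise y1 and y2 would keep their signs up to the next zero r of y1. After multiplication by
    these signs, the integral in the Wronskian identity is positive because l1 < l2. The boundary
    terms are nonpositive: y1 leaves 0 at al, or both fluxes vanish there if al = 0, and y1 returns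
    to 0 at r. *)
Lemma sturm_comparison al be : 0 <= al -> al < be -> be <= rho ->
  al = 0 \/ y1 al = 0 -> y1 be = 0 -> exists2 c, al < c < be & y2 c = 0.
Proof.
move=> al0 albe ber hal ybe; have [r [s [/andP[ar rb] yr sH]]] := next_zero al0 albe hal ybe.
have r0 : 0 < r by exact: le_lt_trans ar.
have rr : r <= rho by exact: le_trans ber.
apply: contrapT => nz.
have nzr c : al < c < r -> y2 c != 0.
  by move=> /andP[ac cr]; apply/eqP => y0; apply: nz; exists c => //; rewrite ac (lt_le_trans cr).
pose m := (al + r) / 2.
have [m1 m2] : al < m /\ m < r by rewrite /m; split; move: ar; lra.
have s2H x : al < x < r -> 0 < y2 m * y2 x.
  move=> /andP[ax xr]; rewrite ltNge le_eqVlt negb_or mulf_neq0 ?nzr ?m1 ?ax//=.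
  apply/negP => neg; have [mx|xm] := leP m x.
    have [c /andP[c1' c2'] yc] := ivt_sign mx (fun t _ => c2 (x := t)) neg.
    by have := nzr c; rewrite yc eqxx (lt_trans m1 c1') (lt_trans c2' xr) => /(_ isT).
  rewrite mulrC in neg.
  have [c /andP[c1' c2'] yc] := ivt_sign (ltW xm) (fun t _ => c2 (x := t)) neg.
  by have := nzr c; rewrite yc eqxx (lt_trans ax c1') (lt_trans c2' m2) => /(_ isT).
set s2 := y2 m in s2H.
have W := wronskian p1 p2 S1 S2 al0 ar.
have y2r : 0 <= s2 * y2 r by apply: (sign_limit c2 ar s2H); rewrite lexx ltW.
have y2al : 0 <= s2 * y2 al by apply: (sign_limit c2 ar s2H); rewrite lexx ltW.
have fr : 0 <= s * flux d q1 y1 r.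
  have dr := regsol_derive p1 S1 r.
  rewrite -(regsol_slopeE d q1 y1) mulrA mulr_ge0 ?exprn_ge0 ?(ltW r0)//.
  have [->|D0] := eqVneq (slope d q1 y1 r) 0; first by rewrite mulr0.
  have D0' : - slope d q1 y1 r != 0 by rewrite oppr_eq0.
  have [g g0 Hg] := is_derive_same_sign dr yr D0'.
  pose x := r - Num.min (g / 2) ((r - al) / 2).
  have [h1 h2] : Num.min (g / 2) ((r - al) / 2) <= g / 2 /\ Num.min (g / 2) ((r - al) / 2) <= (r - al) / 2.
    by rewrite !ge_min !lexx orbT.
  have h0 : 0 < Num.min (g / 2) ((r - al) / 2) by rewrite lt_min !divr_gt0// subr_gt0.
  have xr : x - r = - Num.min (g / 2) ((r - al) / 2) by rewrite /x addrC addKr.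
  have sx : 0 < s * y1 x by apply: sH; apply/andP; split; rewrite /x; move: h0 h1 h2 ar; lra.
  have := Hg x; rewrite xr normrN gtr0_norm// => /(_ h0); rewrite mulrNN => H.
  have {}H : 0 < slope d q1 y1 r * Num.min (g / 2) ((r - al) / 2) * y1 x by apply: H; move: h1 g0; lra.
  have : 0 < (s * slope d q1 y1 r) * (y1 x ^+ 2 * Num.min (g / 2) ((r - al) / 2)).
    move: H sx (mulr_gt0 H sx).
    move: (slope _ _ _ _) (Num.min _ _) (y1 x) => D t y _ _.
    by congr (0 < _); ring.
  rewrite pmulr_lgt0; first exact: ltW.
  by rewrite mulr_gt0// exprn_even_gt0//=; apply: contraTneq sx => ->; rewrite mulr0 ltxx.
have fal : s * flux d q1 y1 al <= 0.
  have [->|al1] := eqVneq al 0; first by rewrite /flux itg_pt// mulr0.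
  have {al1}al1 : 0 < al by rewrite lt_neqAle eq_sym al1.
  have yal : y1 al = 0 by case: hal => // E; rewrite E ltxx in al1.
  have dr := regsol_derive p1 S1 al.
  rewrite -(regsol_slopeE d q1 y1) mulrA mulr_le0_ge0 ?exprn_ge0 ?(ltW al1)//.
  have [->|D0] := eqVneq (slope d q1 y1 al) 0; first by rewrite mulr0.
  have D0' : - slope d q1 y1 al != 0 by rewrite oppr_eq0.
  have [g g0 Hg] := is_derive_same_sign dr yal D0'.
  pose x := al + Num.min (g / 2) ((r - al) / 2).
  have [h1 h2] : Num.min (g / 2) ((r - al) / 2) <= g / 2 /\ Num.min (g / 2) ((r - al) / 2) <= (r - al) / 2.
    by rewrite !ge_min !lexx orbT.
  have h0 : 0 < Num.min (g / 2) ((r - al) / 2) by rewrite lt_min !divr_gt0// subr_gt0.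
  have xr : x - al = Num.min (g / 2) ((r - al) / 2) by rewrite /x addrC addKr.
  have sx : 0 < s * y1 x by apply: sH; apply/andP; split; rewrite /x; move: h0 h1 h2 ar; lra.
  have := Hg x; rewrite xr gtr0_norm// => /(_ h0) H.
  have {}H : 0 < - slope d q1 y1 al * Num.min (g / 2) ((r - al) / 2) * y1 x by apply: H; move: h1 g0; lra.
  have : 0 < - (s * slope d q1 y1 al) * (y1 x ^+ 2 * Num.min (g / 2) ((r - al) / 2)).
    move: H sx (mulr_gt0 H sx).
    move: (slope _ _ _ _) (Num.min _ _) (y1 x) => D t y _ _.
    by congr (0 < _); ring.
  rewrite pmulr_lgt0; first by rewrite oppr_gt0 => /ltW.
  by rewrite mulr_gt0// exprn_even_gt0//=; apply: contraTneq sx => ->; rewrite mulr0 ltxx.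
pose f t := (l2 - l1) * t ^+ d * (s * y1 t) * (s2 * y2 t).
have cf : continuous f.
  apply: continuousM_fun; last by apply: continuousM_fun => //; exact: cst_continuous.
  apply: continuousM_fun; last by apply: continuousM_fun => //; exact: cst_continuous.
  by apply: continuousM_fun; [exact: cst_continuous|exact: exprn_continuous].
have l0 : 0 < l2 - l1 by rewrite subr_gt0.
have fpos : 0 < itg f al r.
  apply: itg_gt0 => // x /[dup] xI /andP[ax xr].
    have y1x : 0 <= s * y1 x by apply: (sign_limit c1 ar sH).
    have y2x : 0 <= s2 * y2 x by apply: (sign_limit c2 ar s2H).
    have xd : 0 <= x ^+ d by rewrite exprn_ge0// (le_trans al0).
    by rewrite /f mulr_ge0// mulr_ge0// mulr_ge0// ltW.
  have xd : 0 < x ^+ d by rewrite exprn_gt0// (le_lt_trans al0).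
  by rewrite /f mulr_gt0 ?s2H// mulr_gt0 ?sH// mulr_gt0.
have Wi : int_itv (fun t => t ^+ d * (q2 t - q1 t) * y1 t * y2 t) al r.
  apply: (@eq_integrableR _ _ (fun t => y2 t * (t ^+ d * q2 t * y1 t) - y2 t * (t ^+ d * q1 t * y1 t))) => //.
    by move=> t _; ring.
  have [[k [C [k0 yW]]] _] := S1; have [M HM] := continuous_bounded_itv al r c2.
  have yi q (pq : potential q) : int_itv (fun t => y2 t * (t ^+ d * q t * y1 t)) al r.
    apply: (@integrableM_bounded _ _ _ mu _ (measurable_itv _) M).
    - by apply: measurable_funTS; exact: measurable_continuous.
    - by move=> x; rewrite /= in_itv/=; exact: HM.
    - exact: (int_flux d pq k0 al r yW).
  exact: (int_itvB (yi _ p2) (yi _ p1)).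
have fE : itg f al r = s * s2 * itg (fun t => t ^+ d * (q2 t - q1 t) * y1 t * y2 t) al r.
  rewrite -itgZ// -[LHS]itg_oo; last by apply: measurable_funTS; exact: measurable_continuous.
  rewrite -[RHS]itg_oo; last by apply: int_itv_measurable; exact: int_itvZ.
  apply: eq_Rintegral => t /set_mem; rewrite /= in_itv/= => /andP[at1 tr].
  have tI : 0 < t < rho by rewrite (le_lt_trans al0 at1) (lt_le_trans tr).
  by rewrite /f !potE//; ring.
have E0 : y1 al * flux d q2 y2 al = 0.
  by case: hal => [->|->]; [rewrite /flux itg_pt// mulr0|rewrite mul0r].
move: fpos; rewrite fE -W yr E0 mul0r !sub0r opprK.
have -> : s * s2 * (- (y2 r * flux d q1 y1 r) + y2 al * flux d q1 y1 al) =
  - ((s2 * y2 r) * (s * flux d q1 y1 r)) + (s2 * y2 al) * (s * flux d q1 y1 al) by ring.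
have A1 := mulr_ge0 y2r fr; have A2 := mulr_ge0_le0 y2al fal.
by move: A1 A2; lra.
Qed.

End sturm_comparison.

(** * The family of regular solutions indexed by lam *)

Section spectral_family.
Context {R : realType}.
Local Notation mu := (@lebesgue_measure R).
Variables (d : nat) (rho : R) (a : R -> R).
Hypothesis rho0 : 0 < rho.
Local Notation I := (`]0, rho[%classic : set R).
Hypothesis ai : mu.-integrable I (EFin \o a).

Lemma mass_pot_cst (k : R) : mass (pot rho (fun=> 0) k) (`|k| * rho).
Proof.
move=> s; have kr : 0 <= `|k| * rho by rewrite mulr_ge0// ltW.
have [s0|s0] := ltP s 0; first by rewrite itg_lt.
have pi : int_itv (fun t => `|pot rho (fun=> 0) k t|) 0 (Num.max s rho).
  apply: int_itv_norm; apply: int_itvT; apply: (potential_pot _ k).1.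
  by apply/int_itv_oo; exact: int_itv_cst.
apply: (@le_trans _ _ (itg (fun t => `|pot rho (fun=> 0) k t|) 0 (Num.max s rho))).
  by apply: le_itg_sub => //; rewrite le_max lexx.
rewrite (@itg_split _ _ 0 rho) ?le_max ?lexx ?orbT ?(ltW rho0)//.
rewrite [X in _ + X](@eq_itg _ _ (fun=> 0)); last first.
  move=> t /andP[rt _]; rewrite pot_out ?normr0// negb_and orbC -leNgt rt//.
rewrite itg_cst ?le_max ?lexx ?orbT// mul0r addr0.
rewrite -[leRHS](_ : itg (fun=> `|k|) 0 rho = _); last by rewrite itg_cst ?(ltW rho0)// subr0.
apply: le_itg; [|exact: int_itv_cst|].
  by apply: int_itvS pi => //; rewrite le_max lexx orbT.
move=> t _; have [tI|tI] := boolP (0 < t < rho); first by rewrite potE// add0r.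
by rewrite pot_out// normr0.
Qed.

Let pot_shift l l' t : pot rho a l' t = pot rho a l t + pot rho (fun=> 0) (l' - l) t.
Proof.
have [tI|tI] := boolP (0 < t < rho); last by rewrite !pot_out// addr0.
by rewrite !potE//; ring.
Qed.

Lemma mass_pot_shift (l l' A : R) : mass (pot rho a l) A ->
  mass (pot rho a l') (A + `|l' - l| * rho).
Proof.
move=> qA s; have [s0|s0] := ltP s 0.
  by rewrite itg_lt// addr_ge0 ?(mass_ge0 qA)// mulr_ge0// ltW.
have pi (b : R -> R) k : mu.-integrable I (EFin \o b) -> int_itv (fun t => `|pot rho b k t|) 0 s.
  by move=> bi; apply: int_itv_norm; apply: int_itvT; exact: (potential_pot bi k).1.
have i0 : mu.-integrable I (EFin \o (fun=> 0 : R)) by apply/int_itv_oo; exact: int_itv_cst.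
apply: (@le_trans _ _ (itg (fun t => `|pot rho a l t| + `|pot rho (fun=> 0) (l' - l) t|) 0 s)).
  apply: le_itg; [exact: pi|by apply: int_itvD; exact: pi|].
  by move=> t _; rewrite (pot_shift l l'); exact: ler_normD.
by rewrite itgD; [rewrite lerD ?qA ?mass_pot_cst|exact: pi|exact: pi].
Qed.

Variable Y : R -> R -> R.
Hypothesis YS : forall l, regsol d (pot rho a l) (Y l).

Let pq l : potential (pot rho a l) := potential_pot ai l.

Lemma regsol_locally_lipschitz lam : exists K, 0 <= K /\
  forall l, `|l - lam| <= 1 -> forall r, 0 <= r <= rho ->
    `|Y l r - Y lam r| <= K * `|l - lam| /\
    `|- slope d (pot rho a l) (Y l) r - - slope d (pot rho a lam) (Y lam) r| <= K * `|l - lam|.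
Proof.
have [A0 qA0] := potential_mass (pq lam); have A00 := mass_ge0 qA0.
(* A bounds the mass of every potential with parameter within distance 1 of lam, so one rate c
   serves them all. *)
pose A := A0 + rho; pose c := 2 * A + 1.
have Ac : 2 * A < c by rewrite ltrDl.
have A_ge0 : 0 <= A by rewrite addr_ge0// ltW.
have c0 : 0 < c by rewrite (le_lt_trans _ Ac)// mulr_ge0.
have w0 := wt_gt0 c rho.
pose K := (4 / c + (A * (4 / c) + 2)) * rho * wt c rho.
have c4 : 0 <= 4 / c by rewrite divr_ge0// ltW.
have Ac4 : 0 <= A * (4 / c) + 2 by rewrite addr_ge0// mulr_ge0.
exists K; split; first by apply: mulr_ge0; [apply: mulr_ge0; [exact: addr_ge0|exact: ltW]|exact: ltW].
move=> l l1 r /andP[r0 rr].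
have m1 : mass (pot rho a lam) A by move=> s; rewrite (le_trans (qA0 s))// lerDl ltW.
have m2 : mass (pot rho a l) A.
  move=> s; rewrite (le_trans (mass_pot_shift l qA0 s))// lerD2l.
  by rewrite -[leRHS]mul1r ler_wpM2r// ltW.
have md : mass (fun t => pot rho a l t - pot rho a lam t) (`|l - lam| * rho).
  move=> s; have := mass_pot_cst (l - lam) s; congr (_ <= _); apply: eq_itg => t _.
  by rewrite (pot_shift lam l) addrAC subrr add0r.
have [L1 L2] := regsol_lipschitz (pq l) (pq lam) m2 m1 Ac (ltW c0) md (YS l) (YS lam) r.
have wr : wt c r <= wt c rho by rewrite le_wt// ltW.
have bound B : 0 <= B -> B <= 4 / c + (A * (4 / c) + 2) ->
    B * (`|l - lam| * rho) * wt c r <= K * `|l - lam|.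
  move=> B0 BK; have -> : K * `|l - lam| =
    (4 / c + (A * (4 / c) + 2)) * (`|l - lam| * rho) * wt c rho by rewrite /K; ring.
  have lr : 0 <= `|l - lam| * rho by rewrite mulr_ge0// ltW.
  apply: ler_pM => //; [exact: mulr_ge0|exact: ltW (wt_gt0 c r)|exact: ler_wpM2r].
split; first by rewrite (le_trans L1)// bound// lerDl.
by rewrite -opprD normrN (le_trans L2)// bound// lerDr.
Qed.

Lemma regsol_eigenvalue_count (M : R) (N : nat) :
  {ae mu, forall r, 0 < r < rho -> a r <= M} ->
  [set r : R | 0 < r < rho /\ Y 0 r = 0] #= `I_N ->
  exists s, [/\ uniq s, size s = N & forall lam, lam \in s <-> lam < 0 /\ Y lam rho = 0].
Proof.
move=> aM ZN.
apply: (@eigenvalue_count R rho Y (fun l r => - slope d (pot rho a l) (Y l) r)) => //.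
- by move=> l; exact: regsol_at0 (YS l).
- by move=> l r; exact: regsol_derive (pq l) (YS l) r.
- by move=> l r; apply: cvgN; exact: (regsol_slope_continuous (pq l) (YS l)).
- move=> l r r0 Yr; rewrite oppr_eq0; have := regsol_simple (pq l) (YS l) r0 Yr.
  by rewrite -(regsol_slopeE d _ (Y l)); apply: contraNneq => ->; rewrite mul0r.
- exact: regsol_locally_lipschitz.
- by move=> l l' al be ll' al0 albe ber hal Ybe; exact: (sturm_comparison ai (YS l) (YS l') ll' al0 albe ber).
(* At lam = - M the potential a - M is nonpositive, so its solution has no zero. *)
exists (- M) => r /andP[r0 _]; apply: (regsol_pos (pq _) (YS _)) => //.
apply: aeS aM => t Ht _; have [tI|tI] := boolP (0 < t < rho); last by rewrite pot_out.
by rewrite potE// subr_le0 Ht.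
Qed.

End spectral_family.

Theorem lemma5p2 (R : realType) (n : nat) (rho : R) (a ap am : R -> R)
    (ps : seq R) (y0 : R -> R) (N : nat) :
  (2 <= n)%N -> 0 < rho ->
  admissible_potential rho a ap am ps ->
  regular_solution n rho a y0 -> y0 0 = 1 ->
  y0 rho != 0 ->
  [set r : R | 0 < r < rho /\ y0 r = 0] #= `I_N ->
  negative_eigenvalue_count n rho a N /\ trivial_kernel n rho a.
Proof.
move=> n2 rho0 [ai aE [_ [M apM]] [_ am0] _] y0S y00 y0rho ZN.
have n0 : (0 < n)%N by exact: ltn_trans n2.
have pq l : potential (pot rho a l) := potential_pot ai l.
pose Y l := projT1 (cid (regsol_exists n.-1 (pq l))).
have YS l : regsol n.-1 (pot rho a l) (Y l) := projT2 (cid (regsol_exists n.-1 (pq l))).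
have [y yS yE] := regular_solution_regsol rho0 ai y0S y00.
have YE r : 0 <= r <= rho -> Y 0 r = y0 r.
  by move=> rI; rewrite -yE//; rewrite (regsol_unique (pq 0) (YS 0) yS).
have aM : {ae lebesgue_measure, forall r, 0 < r < rho -> a r <= M}.
  have := @filterI _ _ (ae_filter_ringOfSetsType lebesgue_measure) _ _ aE
    (@filterI _ _ (ae_filter_ringOfSetsType lebesgue_measure) _ _ apM am0).
  apply: aeS => r [h1 [h2 h3]] rI.
  have Ir : `]0, rho[%classic r by rewrite /= in_itv.
  rewrite h1// (le_trans _ (h2 Ir))// (le_trans _ (ler_norm _))// gerBl; exact: h3.
have ZN' : [set r : R | 0 < r < rho /\ Y 0 r = 0] #= `I_N.
  have -> : [set r : R | 0 < r < rho /\ Y 0 r = 0] = [set r : R | 0 < r < rho /\ y0 r = 0].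
    by apply/seteqP; split => r [rI] /=; have /andP[? ?] := rI; rewrite YE ?ltW.
  exact: ZN.
have [s [us sN sE]] := regsol_eigenvalue_count rho0 ai YS aM ZN'.
have eigY l : Y l rho = 0 -> Defs.eigenspace n rho a l (Y l) := eigenspace_regsol n0 rho0 ai (YS l).
have not0 l (c : R) := regsol_not_ae0 rho0 ai (YS l) (c := c).
split; last first.
  (* The kernel is the eigenspace at 0, whose elements are c y_0 with c y0(rho) = 0. *)
  move=> u uH; have u0 : Defs.eigenspace n rho a 0 u.
    have [? ? ?] := uH; rewrite /Defs.eigenspace/=.
    by have -> : (fun r => 0 * u r) = cst 0 by apply/funext => r; rewrite mul0r.
  have [c [/eqP cY uE]] := eigenspace_multiple n0 rho0 ai (YS 0) u0.
  move: cY; rewrite mulf_eq0 YE ?lexx ?(ltW rho0)// (negbTE y0rho) orbF => /eqP c0.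
  by apply: aeS uE => r Hr /Hr ->; rewrite c0 mul0r.
(* Each eigenspace is the line spanned by Y l, so all multiplicities are 1 and their sum is the
   length of s. *)
exists s, (fun=> 1%N); split=> //.
- move=> l; split.
    move=> /sE[l0 Yl]; split=> //; exists (Y l); first exact: eigY.
    move=> Y0; suff : 1 = 0 :> R by move/eqP; rewrite oner_eq0.
    apply: (not0 l).
    by apply: aeS Y0 => r Hr /Hr ->; rewrite mulr0.
  move=> [l0 [u uE u0]]; apply/sE; split=> //.
  have [c [/eqP cY ucY]] := eigenspace_multiple n0 rho0 ai (YS l) uE.
  move: cY; rewrite mulf_eq0 => /orP[/eqP c0|/eqP//]; exfalso; apply: u0.
  by apply: aeS ucY => r Hr /Hr ->; rewrite c0 mul0r.
- move=> l /sE[l0 Yl]; exists (fun=> Y l); split.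
  + by move=> _; exact: eigY.
  + move=> c H i; rewrite (ord1 i); apply: (not0 l).
    by apply: aeS H => r Hr /Hr; rewrite big_ord1.
  + move=> u uE; have [c [_ ucY]] := eigenspace_multiple n0 rho0 ai (YS l) uE.
    by exists (fun=> c); apply: aeS ucY => r Hr /Hr ->; rewrite big_ord1.
- by rewrite sum1_size.
Qed.
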